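(* Let $\Gamma=(V,E)$ be a graph with countably many edges, with intervals $(a(e),b(e))$, $e\in E$, and edge sets $E_\ell,E_r$, let $\mathcal{H}=(\mathcal{H}_e)_{e\in E}$ be a Hamiltonian on $\Gamma$, let $P_1,P_0\in\mathbb{C}^{d\times d}$ with $P_1^{\star}=P_1$ invertible and $P_0^{\star}=-P_0$, and let $A$, $\mathcal{G}_1$, $\mathcal{G}_2$, $\Omega$, $\omega$ and $S$ be as specified in the context. Assume that $\inf_{e\in E}\operatorname{diam}(a(e),b(e))>0$ and that $\mathcal{H}$ is uniformly strictly positive and uniformly bounded. Define, for $x\in D(A^{\star})$, $$F(x,A^{\star}x)=\biggl(\begin{bmatrix}(\operatorname{pr}_+(S\mathcal{H}_ex_e)(a(e)))_{e\in E_\ell}\\(\operatorname{pr}_-(S\mathcal{H}_ex_e)(b(e)))_{e\in E_r}\end{bmatrix},\begin{bmatrix}(\operatorname{pr}_-(S\mathcal{H}_ex_e)(a(e)))_{e\in E_\ell}\\(\operatorname{pr}_+(S\mathcal{H}_ex_e)(b(e)))_{e\in E_r}\end{bmatrix}\biggr).$$ Then $(\Omega,\mathcal{G}_1,\mathcal{G}_2,F,\omega)$ is a boundary system for $A$. (In particular $F$ is a well-defined map $\operatorname{Graph}(A^{\star})\to\mathcal{G}_1\oplus\mathcal{G}_2$.)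
   Context: $\Gamma=(V,E)$ has at most countably many vertices and edges. $a,b\colon E\to\mathbb{R}\cup\{\pm\infty\}$ satisfy $a(e)<b(e)$; $E_\ell=\{e\in E:a(e)>-\infty\}$, $E_r=\{e\in E:b(e)<+\infty\}$. The $\mathcal{H}_e\colon(a(e),b(e))\to\mathbb{C}^{d\times d}$ are measurable and Hermitian almost everywhere; ''uniformly strictly positive and uniformly bounded'' means that there are $0<m\leqslant M$ with $m|\zeta|^2\leqslant\zeta^{\star}\mathcal{H}_e(\xi)\zeta\leqslant M|\zeta|^2$ for all $\zeta\in\mathbb{C}^d$, $e\in E$ and a.e. $\xi\in(a(e),b(e))$. $X=L^2_{\mathcal{H}}(\Gamma)=\bigoplus_{e\in E}L^2_{\mathcal{H}_e}(a(e),b(e))$ (Hilbert space direct sum of spaces of $\mathbb{C}^d$-valued functions with scalar products $\int x^{\star}\mathcal{H}_ey$). The operator $A$ in $X$ is $Ax=(P_1(\mathcal{H}_ex_e)'+P_0\mathcal{H}_ex_e)_{e\in E}$ with $D(A)=\{x\in X:(P_1(\mathcal{H}_ex_e)'+P_0\mathcal{H}_ex_e)_{e\in E}\in X,\ \mathcal{H}_ex_e|_{\partial(a(e),b(e))}=0\ \forall e\}$ (distributional derivatives; $\partial(a(e),b(e))$ is the set of finite endpoints). It is densely defined, closed, skew-symmetric, and $A^{\star}x=-(P_1(\mathcal{H}_ex_e)'+P_0\mathcal{H}_ex_e)_{e\in E}$ with $D(A^{\star})=\{x\in X:(P_1(\mathcal{H}_ex_e)'+P_0\mathcal{H}_ex_e)_{e\in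 E}\in X\}$. $S\in\mathbb{C}^{d\times d}$ is unitary with $P_1=S^{\star}\operatorname{diag}(\Lambda,-\Theta)S$, $\Lambda=\operatorname{diag}(\lambda_1,\dots,\lambda_{n_+})$, $\Theta=\operatorname{diag}(\theta_1,\dots,\theta_{n_-})$, $\lambda_k,\theta_j>0$; $\operatorname{pr}_\pm$ are the projections of $\mathbb{C}^d$ onto the first $n_+$, resp. last $n_-$, coordinates. $\mathcal{G}_1=\bigoplus_{e\in E_\ell}\mathbb{C}^{n_+}\oplus\bigoplus_{e\in E_r}\mathbb{C}^{n_-}$ and $\mathcal{G}_2=\bigoplus_{e\in E_\ell}\mathbb{C}^{n_-}\oplus\bigoplus_{e\in E_r}\mathbb{C}^{n_+}$ (Hilbert space direct sums), each $\mathbb{C}^{n_+}$ with scalar product $\langle\cdot,\Lambda\,\cdot\rangle$, each $\mathbb{C}^{n_-}$ with $\langle\cdot,\Theta\,\cdot\rangle$, $\mathbb{C}^0=\{0\}$. $\Omega((x,y),(u,v))=\langle x,v\rangle_X+\langle y,u\rangle_X$ on $X\oplus X$ and $\omega((x,y),(u,v))=\langle x,u\rangle_{\mathcal{G}_1}-\langle y,v\rangle_{\mathcal{G}_2}$ on $\mathcal{G}_1\oplus\mathcal{G}_2$. A boundary system for a densely defined, closed, skew-symmetric operator $A$ is a quintuple $(\Omega,\mathcal{G}_1,\mathcal{G}_2,F,\omega)$ of Hilbert spaces $\mathcal{G}_1,\mathcal{G}_2$, sesquilinear forms $\Omega$ on $X\oplus X$ and $\omega$ on $\mathcal{G}_1\oplus\mathcal{G}_2$,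 and a linear surjection $F\colon\operatorname{Graph}(A^{\star})\to\mathcal{G}_1\oplus\mathcal{G}_2$ with $\Omega((x,A^{\star}x),(y,A^{\star}y))=\omega(F(x,A^{\star}x),F(y,A^{\star}y))$ for all $x,y\in D(A^{\star})$. *)

(* Defs.v *)
From HB Require Import structures.
From mathcomp Require Import all_boot all_order all_algebra.
From mathcomp Require Import generic_quotient ring_quotient sesquilinear spectral.
From mathcomp Require Import complex ring.
From mathcomp Require Import all_classical all_reals all_analysis.
From mathcomp Require Import measurable_realfun.
Import Order.TTheory GRing.Theory Num.Theory.
Import numFieldNormedType.Exports.

Set Implicit Arguments.
Unset Strict Implicit.
Unset Printing Implicit Defensive.

Local Open Scope classical_set_scope.
Local Open Scope ring_scope.
Local Open Scope complex_scope.
Local Open Scope sesquilinear_scope.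

Local Notation mu := (@lebesgue_measure _).

(* Hilbert space notions.  As in the source, scalar products are conjugate
   linear in the first and linear in the second argument. *)

Section InnerProduct.
Context {R : realType}.
Local Notation C := R[i].

Definition sesqui (U : lmodType C) (f : U -> U -> C) : Prop :=
  (forall c x y z, f (c *: x + y) z = Num.conj c * f x z + f y z) /\
  (forall c x y z, f z (c *: x + y) = c * f z x + f z y).

Definition inner_product (U : lmodType C) (ip : U -> U -> C) : Prop :=
  [/\ sesqui ip, forall x y, ip y x = Num.conj (ip x y) &
      forall x, x != 0 -> 0 < ip x x].

Definition hnorm (U : lmodType C) (ip : U -> U -> C) (x : U) : R :=
  Num.sqrt (complex.Re (ip x x)).

Definition hcvg (U : lmodType C) (ip : U -> U -> C) (u : nat -> U) (l : U) :=
  (fun n => hnorm ip (u n - l)) @ \oo --> (0 : R).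

Definition hcauchy (U : lmodType C) (ip : U -> U -> C) (u : nat -> U) :=
  forall eps : R, 0 < eps -> exists N : nat, forall m n : nat,
    (N <= m)%N -> (N <= n)%N -> hnorm ip (u m - u n) < eps.

Definition hilbert (U : lmodType C) (ip : U -> U -> C) : Prop :=
  inner_product ip /\
  forall u, hcauchy ip u -> exists l, hcvg ip u l.

(* scalar product of a direct sum of two spaces *)
Definition ip_sum (U W : lmodType C) (ipU : U -> U -> C) (ipW : W -> W -> C)
  (p q : U * W) : C := ipU p.1 q.1 + ipW p.2 q.2.

(* Operators are represented by their graphs. *)
Definition linear_operator (U : lmodType C) (A : set (U * U)) : Prop :=
  [/\ A 0, forall c p q, A p -> A q -> A (c *: p + q) &
      forall x y z, A (x, y) -> A (x, z) -> y = z].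

Definition densely_defined (U : lmodType C) (ip : U -> U -> C)
    (A : set (U * U)) : Prop :=
  forall x (eps : R), 0 < eps -> exists2 p, A p & hnorm ip (p.1 - x) < eps.

Definition closed_operator (U : lmodType C) (ip : U -> U -> C)
    (A : set (U * U)) : Prop :=
  forall u v x y, (forall n, A (u n, v n)) -> hcvg ip u x -> hcvg ip v y ->
    A (x, y).

(* graph of the adjoint *)
Definition adjoint (U : lmodType C) (ip : U -> U -> C) (A : set (U * U)) :
    set (U * U) :=
  [set q | forall p, A p -> ip p.2 q.1 = ip p.1 q.2].

Definition skew_symmetric (U : lmodType C) (ip : U -> U -> C)
    (A : set (U * U)) : Prop :=
  forall x y, A (x, y) -> adjoint ip A (x, - y).

(* [F] is a map on the graph of the adjoint; its values elsewhere are
   irrelevant. *)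
Definition boundary_system (U : lmodType C) (ip : U -> U -> C)
    (A : set (U * U)) (Omega : U * U -> U * U -> C)
    (G1 G2 : lmodType C) (ip1 : G1 -> G1 -> C) (ip2 : G2 -> G2 -> C)
    (F : U * U -> G1 * G2) (omega : G1 * G2 -> G1 * G2 -> C) : Prop :=
  [/\ linear_operator A, densely_defined ip A, closed_operator ip A &
      skew_symmetric ip A] /\
  [/\ hilbert ip1, hilbert ip2, sesqui Omega & sesqui omega] /\
  [/\ forall c p q, adjoint ip A p -> adjoint ip A q ->
        F (c *: p + q) = c *: F p + F q,
      set_surj (adjoint ip A) setT F &
      forall p q, adjoint ip A p -> adjoint ip A q ->
        Omega p q = omega (F p) (F q)].

Definition Omega_form (U : lmodType C) (ip : U -> U -> C) (p q : U * U) : C :=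
  ip p.1 q.2 + ip p.2 q.1.

Definition omega_form (G1 G2 : lmodType C) (ip1 : G1 -> G1 -> C)
    (ip2 : G2 -> G2 -> C) (p q : G1 * G2) : C :=
  ip1 p.1 q.1 - ip2 p.2 q.2.

End InnerProduct.

Section Vectors.
Context {R : realType}.
Local Notation C := R[i].

(* u^* M v *)
Definition hform d (M : 'M[C]_d) (u v : 'cV[C]_d) : C := (u^t* *m M *m v) 0 0.

Lemma hformDr d (M : 'M[C]_d) u v w : hform M u (v + w) = hform M u v + hform M u w.
Proof. by rewrite /hform mulmxDr mxE. Qed.

Lemma hformDl d (M : 'M[C]_d) u v w : hform M (v + w) u = hform M v u + hform M w u.
Proof. by rewrite /hform linearD map_mxD !mulmxDl mxE. Qed.

Lemma hformZr d (M : 'M[C]_d) c u v : hform M u (c *: v) = c * hform M u v.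
Proof. by rewrite /hform -scalemxAr mxE. Qed.

Lemma hformZl d (M : 'M[C]_d) c u v : hform M (c *: u) v = Num.conj c * hform M u v.
Proof. by rewrite /hform linearZ map_mxZ -!scalemxAl mxE. Qed.

Lemma hform_le d (M : 'M[C]_d) c u v : (forall w, 0 <= hform M w w) ->
  hform M (c *: u + v) (c *: u + v) <=
    2 * `|c| ^+ 2 * hform M u u + 2 * hform M v v.
Proof.
move=> M0; rewrite -subr_ge0; apply: le_trans (M0 (c *: u + (- 1) *: v)) _.
rewrite !(hformDl, hformDr, hformZl, hformZr) normCK rmorphN1.
rewrite le_eqVlt; apply/orP; left; apply/eqP; ring.
Qed.

(* the diagonal matrix with (positive) diagonal w *)
Definition posdiag n (w : 'I_n -> {posnum R}) : 'M[C]_n :=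
  diag_mx (\row_k ((w k)%:num)%:C).

Definition rsum (I : choiceType) (f : I -> R) : R :=
  fine (\esum_(i in [set: I]) (Num.max (f i) 0)%:E) -
  fine (\esum_(i in [set: I]) (Num.max (- f i) 0)%:E).

Definition csum (I : choiceType) (f : I -> C) : C :=
  rsum (fun i => complex.Re (f i)) +i* rsum (fun i => complex.Im (f i)).

Definition cintegral (D : set R) (f : R -> C) : C :=
  (\int[mu]_(t in D) complex.Re (f t)) +i* (\int[mu]_(t in D) complex.Im (f t)).

Definition vintegral d (D : set R) (f : R -> 'cV[C]_d) : 'cV[C]_d :=
  \col_k cintegral D (fun t => f t k 0).

Definition cmeasurable (D : set R) (f : R -> C) : Prop :=
  measurable_fun D (fun t => complex.Re (f t)) /\
  measurable_fun D (fun t => complex.Im (f t)).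

Definition mxmeasurable m n (D : set R) (f : R -> 'M[C]_(m, n)) : Prop :=
  forall i j, cmeasurable D (fun t => f t i j).

Definition cvg_cV d (F : set_system R) (f : R -> 'cV[C]_d) (v : 'cV[C]_d) :
    Prop :=
  forall k, (complex.Re (f t k 0) @[t --> F] --> complex.Re (v k 0)) /\
            (complex.Im (f t k 0) @[t --> F] --> complex.Im (v k 0)).

(* v is the limit along F of the continuous representative of the class of f
   on the open set D *)
Definition boundary_value d (D : set R) (F : set_system R)
    (f : R -> 'cV[C]_d) (v : 'cV[C]_d) : Prop :=
  exists h : R -> 'cV[C]_d,
    [/\ {ae mu, forall t, D t -> h t = f t},
        forall t, D t -> cvg_cV (nbhs t) h (h t) &
        cvg_cV F h v].

(* real-valued C_c^oo functions on the open set D, extended by 0 to R *)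
Definition test_fun (D : set R) (phi : R -> R) : Prop :=
  (forall n t, derivable (derive1n n phi) t 1) /\
  exists K : set R, [/\ compact K, K `<=` D & forall t, ~ K t -> phi t = 0].

(* y is the distribution  P1 f' + P0 f  on D *)
Definition is_distr d (P1 P0 : 'M[C]_d) (D : set R) (f y : R -> 'cV[C]_d) :
    Prop :=
  forall phi, test_fun D phi ->
    vintegral D (fun t => (phi t)%:C *: y t) =
    - vintegral D (fun t => (derive1 phi t)%:C *: (P1 *m f t)) +
    vintegral D (fun t => (phi t)%:C *: (P0 *m f t)).

Definition diam (D : set R) : \bar R :=
  ereal_sup [set `|x - y|%:E | x in D & y in D].

End Vectors.

(* [vertex] and the incidence structure play no role: only the edge intervals
   enter.  [countType] means at most countable. *)
Record metric_graph (R : realType) := MetricGraph {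
  vertex : countType;
  edge : countType;
  left_end : edge -> \bar R;
  right_end : edge -> \bar R;
  left_lt_right : forall e, (left_end e < right_end e)%E }.

Section MetricGraph.
Context {R : realType} (G : metric_graph R).

Definition edge_int (e : edge G) : set R :=
  [set t | (left_end e < t%:E < right_end e)%E].

Definition edgeL := {e : edge G | (-oo < left_end e)%E}.
Definition edgeR := {e : edge G | (right_end e < +oo)%E}.
HB.instance Definition _ := Countable.on edgeL.
HB.instance Definition _ := Countable.on edgeR.

(* filters of the limits at a finite left, resp. right, endpoint *)
Definition at_left_end (e : edge G) : set_system R := (fine (left_end e))^'+.
Definition at_right_end (e : edge G) : set_system R := (fine (right_end e))^'-.

End MetricGraph.

Lemma measurable_edge_int {R : realType} (G : metric_graph R) (e : edge G) :
  measurable (edge_int e).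
Proof.
rewrite (_ : edge_int e = EFin @^-1` `](left_end e), (right_end e)[%classic);
  last by apply/seteqP; split => t /=; rewrite in_itv.
rewrite -[X in measurable X]setTI; apply: EFin_measurable => //.
exact: emeasurable_itv.
Qed.

Section Measurability.
Context {R : realType}.
Local Notation C := R[i].
Implicit Types (D : set R) (f g : R -> C).

Lemma cmeasurableD D f g : cmeasurable D f -> cmeasurable D g ->
  cmeasurable D (fun t => f t + g t).
Proof.
move=> [f1 f2] [g1 g2]; split.
- rewrite (_ : (fun t => _) =
    (fun t => complex.Re (f t)) \+ (fun t => complex.Re (g t))).
    exact: measurable_funD.
  by apply/funext => t /=; case: (f t) (g t) => [? ?] [].
- rewrite (_ : (fun t => _) =
    (fun t => complex.Im (f t)) \+ (fun t => complex.Im (g t))).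
    exact: measurable_funD.
  by apply/funext => t /=; case: (f t) (g t) => [? ?] [].
Qed.

Lemma cmeasurableM D f g : cmeasurable D f -> cmeasurable D g ->
  cmeasurable D (fun t => f t * g t).
Proof.
move=> [f1 f2] [g1 g2]; split.
- rewrite (_ : (fun t => _) =
    (fun t => complex.Re (f t)) \* (fun t => complex.Re (g t)) \-
    (fun t => complex.Im (f t)) \* (fun t => complex.Im (g t))).
    by apply: measurable_funB; exact: measurable_funM.
  by apply/funext => t /=; case: (f t) (g t) => [? ?] [].
- rewrite (_ : (fun t => _) =
    (fun t => complex.Re (f t)) \* (fun t => complex.Im (g t)) \+
    (fun t => complex.Im (f t)) \* (fun t => complex.Re (g t))).
    by apply: measurable_funD; exact: measurable_funM.
  by apply/funext => t /=; case: (f t) (g t) => [? ?] [].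
Qed.

Lemma cmeasurable_cst D (c : C) : cmeasurable D (fun=> c).
Proof. by split; exact: measurable_cst. Qed.

Lemma cmeasurable_conj D f : cmeasurable D f ->
  cmeasurable D (fun t => Num.conj (f t)).
Proof.
move=> [f1 f2]; split.
- rewrite (_ : (fun t => _) = (fun t => complex.Re (f t)))//.
  by apply/funext => t /=; case: (f t).
- rewrite (_ : (fun t => _) = \- (fun t => complex.Im (f t))).
    exact: measurable_funN.
  by apply/funext => t /=; case: (f t).
Qed.

Lemma cmeasurable_sum D (I : Type) (s : seq I) (F : I -> R -> C) :
  (forall i, cmeasurable D (F i)) ->
  cmeasurable D (fun t => \sum_(i <- s) F i t).
Proof.
move=> mF; elim: s => [|i s IH].
  by under eq_fun do rewrite big_nil; exact: cmeasurable_cst.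
by under eq_fun do rewrite big_cons; exact: cmeasurableD.
Qed.

Lemma mxmeasurable_mul m n p D (A : R -> 'M[C]_(m, n)) (B : R -> 'M[C]_(n, p)) :
  mxmeasurable D A -> mxmeasurable D B -> mxmeasurable D (fun t => A t *m B t).
Proof.
move=> mA mB i j; under eq_fun do rewrite mxE.
by apply: cmeasurable_sum => k; exact: cmeasurableM.
Qed.

Lemma mxmeasurable_adj m n D (A : R -> 'M[C]_(m, n)) :
  mxmeasurable D A -> mxmeasurable D (fun t => (A t)^t*).
Proof.
by move=> mA i j; under eq_fun do rewrite !mxE; exact: cmeasurable_conj.
Qed.

Lemma mxmeasurable_lin m n D (c : C) (A B : R -> 'M[C]_(m, n)) :
  mxmeasurable D A -> mxmeasurable D B ->
  mxmeasurable D (fun t => c *: A t + B t).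
Proof.
move=> mA mB i j; under eq_fun do rewrite !mxE.
by apply: cmeasurableD => //; apply: cmeasurableM => //; exact: cmeasurable_cst.
Qed.

Lemma measurable_hform d D (M : R -> 'M[C]_d) (x : R -> 'cV[C]_d) :
  mxmeasurable D M -> mxmeasurable D x ->
  measurable_fun D (fun t => (complex.Re (hform (M t) (x t) (x t)))%:E).
Proof.
move=> mM mx; apply/measurable_EFinP.
apply: (proj1 (@mxmeasurable_mul _ _ _ D _ _ _ mx 0 0)).
by apply: mxmeasurable_mul => //; exact: mxmeasurable_adj.
Qed.

Lemma esumZ_lty (I : choiceType) (f : I -> \bar R) (k : R) :
  0 <= k -> (forall i, 0 <= f i)%E ->
  (\esum_(i in [set: I]) f i < +oo)%E ->
  (\esum_(i in [set: I]) (k%:E * f i) < +oo)%E.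
Proof.
move=> k0 f0 foo; apply: (@le_lt_trans _ _ (k%:E * \esum_(i in [set: I]) f i)%E).
  apply: ge_ereal_sup => _ [X [Xfin _] <-].
  rewrite -ge0_mule_fsumr//; apply: lee_wpmul2l; first by rewrite lee_fin.
  by apply: ereal_sup_ubound; exists X.
by rewrite lte_mul_pinfty// lee_fin.
Qed.

Lemma Re_hform_le d (M : 'M[C]_d) c u v : (forall w, 0 <= hform M w w) ->
  complex.Re (hform M (c *: u + v) (c *: u + v)) <=
    complex.Re (2 * `|c| ^+ 2) * complex.Re (hform M u u) +
    2 * complex.Re (hform M v v).
Proof.
move=> M0; have := hform_le c u v M0; rewrite lecE => /andP[_].
have : complex.Im (hform M u u) = 0.
  by have := M0 u; rewrite lecE => /andP[/eqP].
rewrite (mulr_natl (hform M v v)) (mulr_natl (complex.Re _)) !mulr2n.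
case: (hform M u u) (hform M v v) (2 * _) => [a b] [p q] [r s] /= ->.
by rewrite mulr0 subr0.
Qed.

Lemma Re_hform_ge0 d (M : 'M[C]_d) u : (forall w, 0 <= hform M w w) ->
  0 <= complex.Re (hform M u u).
Proof. by move=> /(_ u); rewrite lecE => /andP[]. Qed.

End Measurability.

Record hamiltonian (R : realType) (G : metric_graph R) (d : nat) :=
  Hamiltonian {
    ham :> edge G -> R -> 'M[R[i]]_d;
    ham_measurable : forall e, mxmeasurable (edge_int e) (ham e);
    ham_hermitian : forall e,
      {ae mu, forall t, edge_int e t -> (ham e t)^t* = ham e t} }.

Lemma ae_imp {R : realType} (P Q : R -> Prop) : (forall t, P t -> Q t) ->
  {ae mu, forall t, P t} -> {ae mu, forall t, Q t}.
Proof. exact: (@filterS _ _ (ae_filter_ringOfSetsType mu)). Qed.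

Lemma ae_imp2 {R : realType} (P Q S : R -> Prop) :
  (forall t, P t -> Q t -> S t) -> {ae mu, forall t, P t} ->
  {ae mu, forall t, Q t} -> {ae mu, forall t, S t}.
Proof. exact: (@filterS2 _ _ (ae_filter_ringOfSetsType mu)). Qed.

Section L2H.
Context {R : realType} {G : metric_graph R} {d : nat}.
Local Notation C := R[i].

(* One exceptional null set serves all z.  On C, [<=] compares numbers with equal imaginary parts. *)
Definition uniformly_pos_bounded (H : hamiltonian G d) : Prop :=
  exists m M : R, [/\ 0 < m, m <= M &
    forall e, {ae mu, forall t, edge_int e t -> forall z : 'cV[C]_d,
      m%:C * (z^t* *m z) 0 0 <= hform (H e t) z z <= M%:C * (z^t* *m z) 0 0}].

Lemma hform_ge0 (H : hamiltonian G d) : uniformly_pos_bounded H ->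
  forall e, {ae mu, forall t, edge_int e t -> forall z, 0 <= hform (H e t) z z}.
Proof.
move=> [m [M [m0 _ +]]] e => /(_ e); apply: ae_imp => t + It z.
move=> /(_ It z) /andP[+ _]; apply: le_trans.
apply: mulr_ge0; first by rewrite ler0c ltW.
rewrite mxE; apply: sumr_ge0 => k _.
by rewrite !mxE mulrC mul_conjC_ge0.
Qed.

Variables (H : hamiltonian G d) (hH : uniformly_pos_bounded H).

(* square of the norm of x *)
Definition energy (x : edge G -> R -> 'cV[C]_d) : \bar R :=
  (\esum_(e in [set: edge G])
    \int[mu]_(t in edge_int e) (complex.Re (hform (H e t) (x e t) (x e t)))%:E)%E.

Definition sq_integrable of uniformly_pos_bounded H :
    {pred edge G -> R -> 'cV[C]_d} :=
  fun x => `[< (forall e, mxmeasurable (edge_int e) (x e)) /\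
               (energy x < +oo)%E >].

Lemma sq_integrable_submod : submod_closed (sq_integrable hH).
Proof.
have hform0r e t : hform (H e t) 0 0 = 0 by rewrite /hform mulmx0 mxE.
split.
  apply/asboolP; split=> [e i j|].
    by under eq_fun do rewrite mxE; exact: cmeasurable_cst.
  rewrite /energy esum1// => e _; apply: integral0_eq => t _.
  by rewrite hform0r.
move=> c x y /asboolP[mx ex] /asboolP[my ey]; apply/asboolP; split=> [e|].
  exact: mxmeasurable_lin.
pose q (z : edge G -> R -> 'cV[C]_d) e t := complex.Re (hform (H e t) (z e t) (z e t)).
pose k := complex.Re (2 * `|c| ^+ 2 : C).
have k0 : 0 <= k.
  have : 0 <= (2 * `|c| ^+ 2 : C) by rewrite mulr_ge0// exprn_ge0.
  by rewrite lecE => /andP[].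
have mI (e : edge G) : measurable (edge_int e) by exact: measurable_edge_int.
have mq z e : (forall e, mxmeasurable (edge_int e) (z e)) ->
    measurable_fun (edge_int e) (fun t => (q z e t)%:E).
  by move=> mz; apply: measurable_hform => //; exact: ham_measurable.
have mabs z e : (forall e, mxmeasurable (edge_int e) (z e)) ->
    measurable_fun (edge_int e) (fun t => `|q z e t|%:E).
  by move=> mz; rewrite (_ : (fun _ => _) = (abse \o (fun t => (q z e t)%:E)));
    [apply: measurableT_comp => //; exact: mq | by apply/funext].
have qabs z e : (forall e, mxmeasurable (edge_int e) (z e)) ->
    (\int[mu]_(t in edge_int e) (q z e t)%:E =
     \int[mu]_(t in edge_int e) `|q z e t|%:E)%E.
  move=> mz; apply: ae_eq_integral; [exact: mI | exact: mq | exact: mabs |].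
  apply: ae_imp (hform_ge0 hH e) => t + It => /(_ It) Ht.
  by rewrite ger0_norm// Re_hform_ge0.
pose w := c *: x + y.
have mw e : mxmeasurable (edge_int e) (w e) by exact: mxmeasurable_lin.
have le_w e : (\int[mu]_(t in edge_int e) (q w e t)%:E <=
    k%:E * \int[mu]_(t in edge_int e) (q x e t)%:E +
    2%:E * \int[mu]_(t in edge_int e) (q y e t)%:E)%E.
  rewrite !qabs//.
  have Zq (a : R) z : 0 <= a -> (forall e, mxmeasurable (edge_int e) (z e)) ->
      (a%:E * \int[mu]_(t in edge_int e) `|q z e t|%:E =
       \int[mu]_(t in edge_int e) (a%:E * `|q z e t|%:E))%E.
    move=> a0 mz; apply/esym/ge0_integralZl_EFin => //;
      [exact: mI | exact: mabs].
  have Mq (a : R) z : (forall e, mxmeasurable (edge_int e) (z e)) ->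
      measurable_fun (edge_int e) (fun t => a%:E * `|q z e t|%:E)%E.
    by move=> mz; apply: measurable_funeM; exact: mabs.
  rewrite (Zq k x k0 mx) (Zq 2 y _ my)//.
  have pos (a b : R) : 0 <= a -> (0 <= a%:E * `|b|%:E)%E.
    by move=> a0; rewrite mule_ge0.
  have := ge0_integralD mu (mI e) (fun t _ => pos k (q x e t) k0) (Mq k x mx)
    (fun t _ => pos 2 (q y e t) (ler0n _ _)) (Mq 2 y my).
  move=> <-; apply: ae_ge0_le_integral.
  - exact: mI.
  - by move=> t _; rewrite lee_fin.
  - exact: mabs.
  - by move=> t _; rewrite adde_ge0 ?pos.
  - by apply: emeasurable_funD; exact: Mq.
  apply: ae_imp (hform_ge0 hH e) => t + It => /(_ It) Ht.
  rewrite -!EFinM -EFinD lee_fin !ger0_norm ?Re_hform_ge0//.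
  exact: Re_hform_le.
have q0 z e : (forall e, mxmeasurable (edge_int e) (z e)) ->
    (0 <= \int[mu]_(t in edge_int e) (q z e t)%:E)%E.
  by move=> mz; rewrite qabs// integral_ge0.
apply: (@le_lt_trans _ _ (\esum_(e in [set: edge G])
  (k%:E * \int[mu]_(t in edge_int e) (q x e t)%:E +
   2%:E * \int[mu]_(t in edge_int e) (q y e t)%:E)%E)).
  by apply: le_esum => e _; exact: le_w.
rewrite esumD//; last 2 first.
- by move=> e _; rewrite mule_ge0// q0.
- by move=> e _; rewrite mule_ge0// q0.
by rewrite lte_add_pinfty// esumZ_lty// => e; exact: q0.
Qed.

HB.instance Definition _ :=
  GRing.isSubmodClosed.Build C _ (sq_integrable hH) sq_integrable_submod.

Definition sq_fun := {x : edge G -> R -> 'cV[C]_d | x \in sq_integrable hH}.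
HB.instance Definition _ := SubType.on sq_fun.
HB.instance Definition _ := [Choice of sq_fun by <:].
HB.instance Definition _ := [SubChoice_isSubLmodule of sq_fun by <:].

Definition ae_null : {pred sq_fun} := fun x =>
  `[< forall e, {ae mu, forall t, edge_int e t -> val x e t = 0} >].

Lemma ae_null_submod : submod_closed ae_null.
Proof.
split=> [|c x y /asboolP x0 /asboolP y0].
  by apply/asboolP => e; apply/nearW => t _; rewrite raddf0.
apply/asboolP => e; apply: ae_imp2 (x0 e) (y0 e) => t xt yt It.
have -> : val (c *: x + y) e t = c *: val x e t + val y e t by rewrite linearP.
by rewrite xt// yt// scaler0 addr0.
Qed.

HB.instance Definition _ :=
  GRing.isSubmodClosed.Build C _ ae_null ae_null_submod.

(* the space L^2_H: classes modulo equality almost everywhere *)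
Definition L2H := Quotient.quot ae_null.
HB.instance Definition _ := GRing.Zmodule.on L2H.
HB.instance Definition _ := EqQuotient.on L2H.

Local Open Scope quotient_scope.

Definition L2H_scale (c : C) (x : L2H) : L2H := \pi_L2H (c *: repr x).

Lemma pi_scale c (x : sq_fun) : L2H_scale c (\pi_L2H x) = \pi_L2H (c *: x).
Proof.
apply/eqP; rewrite -Quotient.idealrBE -scalerBr rpredZ//.
by rewrite Quotient.idealrBE reprK.
Qed.

Lemma L2H_addE (x y : sq_fun) : \pi_L2H x + \pi_L2H y = \pi_L2H (x + y).
Proof. by rewrite (Quotient.pi_add _ x y). Qed.

Lemma L2H_scaleA a b x : L2H_scale a (L2H_scale b x) = L2H_scale (a * b) x.
Proof.
by elim/quotW: x => x;
  rewrite (pi_scale b x) (pi_scale a (b *: x)) (pi_scale (a * b) x) scalerA.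
Qed.

Lemma L2H_scale1 : left_id 1 L2H_scale.
Proof. by elim/quotW => x; rewrite pi_scale scale1r. Qed.

Lemma L2H_scaleDr : right_distributive L2H_scale +%R.
Proof.
move=> a x y; elim/quotW: x => x; elim/quotW: y => y.
rewrite L2H_addE (pi_scale a (x + y)) (pi_scale a x) (pi_scale a y).
by rewrite L2H_addE scalerDr.
Qed.

Lemma L2H_scaleDl x : {morph L2H_scale^~ x : a b / a + b}.
Proof.
move=> a b; elim/quotW: x => x.
by rewrite (pi_scale (a + b) x) (pi_scale a x) (pi_scale b x) L2H_addE scalerDl.
Qed.

HB.instance Definition _ := GRing.Zmodule_isLmodule.Build C L2H
  L2H_scaleA L2H_scale1 L2H_scaleDr L2H_scaleDl.

(* a representative of the class x *)
Definition rep (x : L2H) : edge G -> R -> 'cV[C]_d := val (repr x).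

Definition ip_L2H (x y : L2H) : C :=
  csum (fun e => cintegral (edge_int e)
    (fun t => hform (H e t) (rep x e t) (rep y e t))).

Definition Hrep (x : L2H) (e : edge G) (t : R) : 'cV[C]_d := H e t *m rep x e t.

(* graph of  x |-> P1 (H x)' + P0 H x  with zero boundary values *)
Definition port_ham_op (P1 P0 : 'M[C]_d) : set (L2H * L2H) :=
  [set p | [/\
    forall e, is_distr P1 P0 (edge_int e) (Hrep p.1 e) (rep p.2 e),
    forall e, (-oo < left_end e)%E ->
      boundary_value (edge_int e) (at_left_end e) (Hrep p.1 e) 0 &
    forall e, (right_end e < +oo)%E ->
      boundary_value (edge_int e) (at_right_end e) (Hrep p.1 e) 0]].

End L2H.

(* Hilbert space direct sum over I of copies of C^n with the scalar product
   <u, v> = u^* diag(w) v *)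
Section DirectSum.
Context {R : realType} (I : countType) {n : nat}.
Local Notation C := R[i].
Variable w : 'I_n -> {posnum R}.

Lemma hform_posdiag_ge0 (v : 'cV[C]_n) : 0 <= hform (posdiag w) v v.
Proof.
rewrite /hform /posdiag mul_mx_diag mxE; apply: sumr_ge0 => k _; rewrite !mxE.
by rewrite mulrAC [_^* * _]mulrC mulr_ge0 ?mul_conjC_ge0// ler0c.
Qed.

Definition sq_summable : {pred I -> 'cV[C]_n} := fun f =>
  `[< (\esum_(i in [set: I])
        (complex.Re (hform (posdiag w) (f i) (f i)))%:E < +oo)%E >].

Lemma sq_summable_submod : submod_closed sq_summable.
Proof.
split.
  by apply/asboolP; rewrite esum1// => i _; rewrite /hform mulmx0 mxE.
move=> c f g /asboolP ff /asboolP fg; apply/asboolP.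
pose q (h : I -> 'cV[C]_n) i := complex.Re (hform (posdiag w) (h i) (h i)).
have q0 h i : (0 <= (q h i)%:E)%E.
  by rewrite lee_fin Re_hform_ge0//; exact: hform_posdiag_ge0.
pose k := complex.Re (2 * `|c| ^+ 2 : C).
have k0 : 0 <= k.
  have : 0 <= (2 * `|c| ^+ 2 : C) by rewrite mulr_ge0// exprn_ge0.
  by rewrite lecE => /andP[].
apply: (@le_lt_trans _ _ (\esum_(i in [set: I])
    (k%:E * (q f i)%:E + 2%:E * (q g i)%:E)%E)).
  apply: le_esum => i _; rewrite -!EFinM -EFinD lee_fin.
  by apply: Re_hform_le => v; exact: hform_posdiag_ge0.
rewrite esumD//; last 2 first.
- by move=> i _; rewrite mule_ge0.
- by move=> i _; rewrite mule_ge0.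
by rewrite lte_add_pinfty// esumZ_lty.
Qed.

HB.instance Definition _ :=
  GRing.isSubmodClosed.Build C _ sq_summable sq_summable_submod.

Definition l2 := {f : I -> 'cV[C]_n | f \in sq_summable}.
HB.instance Definition _ := SubType.on l2.
HB.instance Definition _ := [Choice of l2 by <:].
HB.instance Definition _ := [SubChoice_isSubLmodule of l2 by <:].

Definition ip_l2 (f g : l2) : C :=
  csum (fun i => hform (posdiag w) (val f i) (val g i)).

End DirectSum.

Section BoundaryMap.
Context {R : realType} {G : metric_graph R} {np nm : nat}.
Local Notation C := R[i].
Variables (lam : 'I_np -> {posnum R}) (theta : 'I_nm -> {posnum R}).

Definition G1 : lmodType C := (l2 (edgeL G) lam * l2 (edgeR G) theta)%type.
Definition G2 : lmodType C := (l2 (edgeL G) theta * l2 (edgeR G) lam)%type.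

Definition ip_G1 : G1 -> G1 -> C := ip_sum (@ip_l2 _ _ _ lam) (@ip_l2 _ _ _ theta).
Definition ip_G2 : G2 -> G2 -> C := ip_sum (@ip_l2 _ _ _ theta) (@ip_l2 _ _ _ lam).

(* g is the vector of boundary values of S H x; in particular these values
   exist and are square summable *)
Definition boundary_values (H : hamiltonian G (np + nm))
    (hH : uniformly_pos_bounded H) (S : 'M[C]_(np + nm)) (x : L2H hH)
    (g : G1 * G2) : Prop :=
  (forall e : edgeL G, exists v : 'cV[C]_(np + nm),
    [/\ boundary_value (edge_int (val e)) (at_left_end (val e))
          (fun t => S *m Hrep x (val e) t) v,
        val g.1.1 e = usubmx v & val g.2.1 e = dsubmx v]) /\
  (forall e : edgeR G, exists v : 'cV[C]_(np + nm),
    [/\ boundary_value (edge_int (val e)) (at_right_end (val e))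
          (fun t => S *m Hrep x (val e) t) v,
        val g.1.2 e = dsubmx v & val g.2.2 e = usubmx v]).

End BoundaryMap.

Arguments G1 {R} G {np nm}.
Arguments G2 {R} G {np nm}.
Arguments ip_G1 {R} G {np nm}.
Arguments ip_G2 {R} G {np nm}.

(* Main.v *)
(* Let the maximal operator map [x] to [P1 (H x)' + P0 H x], without boundary
   conditions.  Since [P1] is invertible, the du Bois-Reymond lemma shows that
   [x] is in its domain iff on every edge [H x] has an absolutely continuous
   representative which is square integrable together with its derivative.
   Such a function has limits at the ends of the edge, which are 0 at infinite
   ends, and integration by parts gives Green's identity; diagonalising [P1]
   turns its sum over the edges into the identity between [Omega] and [omega].
   The lower bound on the lengths of the edges enters twice: it makes the trace
   estimate uniform in the edge, so that the boundary values are square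
   summable, and it yields cutoff functions with uniformly bounded norms, so
   that all square summable boundary values occur.  Testing with smooth
   functions on a single edge identifies the adjoint of [A] with minus the
   maximal operator, while [A] itself is the restriction of the maximal operator
   to vanishing boundary values; the remaining properties of [A] follow from
   this, except for the density of its domain, which is obtained by
   approximating on finitely many edges by compactly supported Steklov
   averages. *)

Require Import Defs.
From mathcomp Require Import all_boot all_order all_algebra.
From mathcomp Require Import sesquilinear spectral complex.
From mathcomp Require Import generic_quotient ring_quotient.
From mathcomp Require Import ring lra.
From mathcomp Require Import all_classical all_reals all_analysis.
From mathcomp Require Import measurable_realfun.
Import Order.TTheory GRing.Theory Num.Theory.
Import numFieldNormedType.Exports.
Import Defs.

Set Implicit Arguments.
Unset Strict Implicit.
Unset Printing Implicit Defensive.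

Local Open Scope classical_set_scope.
Local Open Scope ring_scope.
Local Open Scope complex_scope.
Local Open Scope sesquilinear_scope.

Local Notation mu := (@lebesgue_measure _).
Local Notation integr D f := (mu.-integrable D (EFin \o f)).

(** * Integration by parts *)

Section RealIntegrable.
Context {R : realType}.
Implicit Types (f g : R -> R) (D : set R).

(** Absolute continuity is used only in the integrated form [F t - F s = \int f], so the product
    rule has to come from Fubini's theorem, and boundary values are limits of integrals. Since [H]
    is merely measurable, regularity belongs to [H x] rather than to [x]: approximations, cutoffs
    and test elements are constructed as functions [F] in the role of [H x], and [x] is recovered by
    applying the inverse of [H], with bounds independent of the edge. The points of [L2H] are
    classes, so relations between representatives hold only almost everywhere; evaluation at an
    endpoint makes sense because two continuous representatives agree everywhere on the edge. The
    adjoint is minus the maximal operator, which is why a pair [p] of the adjoint reappears as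
    [(p.1, - p.2)] and why Green's identity for the maximal operator carries the sign opposite to
    [omega]. Closedness of [A] is not drawn from continuity of the traces: only scalar products with
    fixed elements pass to the limit, and surjectivity of the boundary map removes the remaining
    boundary values. *)

Lemma integrD D f g : measurable D -> integr D f -> integr D g ->
  integr D (fun x => f x + g x).
Proof. by move=> mD iff ig; have := integrableD _ iff ig => /(_ mD); exact: eq_integrable. Qed.

Lemma integrB D f g : measurable D -> integr D f -> integr D g ->
  integr D (fun x => f x - g x).
Proof. by move=> mD iff ig; have := integrableB _ iff ig => /(_ mD); exact: eq_integrable. Qed.

Lemma integrZl D c f : measurable D -> integr D f -> integr D (fun x => c * f x).
Proof. by move=> mD iff; have := integrableZl _ c iff => /(_ mD); exact: eq_integrable. Qed.

Lemma integrZr D c f : measurable D -> integr D f -> integr D (fun x => f x * c).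
Proof. by move=> mD iff; have := integrableZr _ c iff => /(_ mD); exact: eq_integrable. Qed.

Lemma integrS D (E : set R) f : measurable D -> measurable E -> E `<=` D ->
  integr D f -> integr E f.
Proof. by move=> mD mE ED; exact: integrableS. Qed.

Lemma eq_integr D f g : measurable D -> (forall x, D x -> f x = g x) ->
  integr D f -> integr D g.
Proof.
move=> mD fg; apply: eq_integrable => // x; rewrite inE => /fg/= ->//.
Qed.

Lemma integr_meas D f : integr D f -> measurable_fun D f.
Proof. by move=> iff; apply/measurable_EFinP; exact: (measurable_int mu). Qed.

Lemma le_integr D f g : measurable D -> measurable_fun D f ->
  (forall x, D x -> `|f x| <= g x) -> integr D g -> integr D f.
Proof.
move=> mD mf fg; apply: le_integrable => //; first exact/measurable_EFinP.
by move=> x Dx /=; rewrite lee_fin (le_trans (fg _ Dx))// ler_norm.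
Qed.

Lemma integr_norm D f : integr D f -> integr D (fun x => `|f x|).
Proof. by move=> /integrable_norm; apply. Qed.

End RealIntegrable.

Section IntegrationByParts.
Context {R : realType}.
Implicit Types (u v f g F G : R -> R) (D : set R).

(* The left-hand side integrates [u x * v y] over the plane, split along the
   diagonal [x = y]. *)
Let fubini_triangle1 u v :
  mu.-integrable setT (EFin \o u) -> mu.-integrable setT (EFin \o v) ->
  let U t := \int[mu]_(s in `]-oo, t]) u s in
  let V t := \int[mu]_(s in `]-oo, t]) v s in
  mu.-integrable setT (EFin \o (fun t => u t * V t)) /\
  (mu.-integrable setT (EFin \o (fun t => v t * U t)) ->
  \int[mu]_t (u t * V t) + \int[mu]_t (v t * U t) =
  (\int[mu]_t u t) * (\int[mu]_t v t)).
Proof.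
move=> iu iv U V.
have mu_ : measurable_fun setT u by apply/measurable_EFinP; exact: (measurable_int mu).
have mv_ : measurable_fun setT v by apply/measurable_EFinP; exact: (measurable_int mu).
pose T (z : R * R) : set (R * R) := [set z | z.2 <= z.1].
pose k (z : R * R) : R := u z.1 * (v z.2 * (\1_[set z : R * R | z.2 <= z.1] z)).
have mT : measurable [set z : R * R | z.2 <= z.1].
  rewrite -[X in measurable X]setTI.
  have -> : [set: R * R] `&` [set z | z.2 <= z.1] =
    [set: R * R] `&` (fun z : R * R => z.2 <= z.1) @^-1` [set true].
    by rewrite !setTI; apply/seteqP; split=> z /= ->.
  apply: (measurable_fun_ler (f := snd) (g := fst)) => //.
have mk : measurable_fun setT k.
  apply: measurable_funM; first exact: measurableT_comp.
  apply: measurable_funM; first exact: measurableT_comp.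
  exact: measurable_indic.
have ind x y : (\1_[set z : R * R | z.2 <= z.1] (x, y) : R) = \1_(`]-oo, x]%classic) y.
  by rewrite !indicE; congr (nat_of_bool _)%:R; apply/idP/idP;
    rewrite !inE /= in_itv.
have ind' x y : (\1_[set z : R * R | z.2 <= z.1] (x, y) : R) = \1_(`[y, +oo[%classic) x.
  by rewrite !indicE; congr (nat_of_bool _)%:R; apply/idP/idP;
    rewrite !inE /= in_itv /= andbT.
(* Tonelli: the absolute value is at most [|u x| * |v y|], whose iterated integral is a product of
   two finite integrals. *)
have ik : (mu \x mu)%E.-integrable setT (EFin \o k).
  apply/integrable12ltyP; first exact/measurable_EFinP.
  have le1 x : (\int[mu]_y `|(EFin \o k) (x, y)| <= `|u x|%:E * \int[mu]_y `|v y|%:E)%E.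
    rewrite -ge0_integralZl//; last exact/measurable_EFinP/measurableT_comp.
    apply: ge0_le_integral => //.
    - apply/measurable_EFinP/measurableT_comp => //.
      exact: (measurableT_comp mk (pair1_measurable x)).
    - apply: measurable_funeM; exact/measurable_EFinP/measurableT_comp.
    - move=> y _; rewrite /= /k !normrM -EFinM lee_fin ler_wpM2l//.
      by rewrite indicE ler_piMr// normr_nat lern1 leq_b1.
  have fv : (\int[mu]_y `|v y|%:E < +oo)%E by case/integrableP: iv.
  have fu : (\int[mu]_y `|u y|%:E < +oo)%E by case/integrableP: iu.
  apply: (@le_lt_trans _ _ (\int[mu]_x (`|u x|%:E * \int[mu]_y `|v y|%:E)%E)%E).
    apply: ge0_le_integral => //.
    - by move=> x _; exact: integral_ge0.
    - apply: (measurable_fun_fubini_tonelli_F (m2 := mu) (abse \o (EFin \o k))) => //.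
        by apply: measurableT_comp => //; exact/measurable_EFinP.
      by move=> z; rewrite /= lee_fin.
    - under eq_fun do rewrite muleC.
      by apply: measurable_funeM; exact/measurable_EFinP/measurableT_comp.
  rewrite ge0_integralZr//; last 2 first.
  - exact/measurable_EFinP/measurableT_comp.
  - exact: integral_ge0.
  by rewrite lte_mul_pinfty// ?integral_ge0// ge0_fin_numE// integral_ge0.
have iT (h : R -> R) (A : set R) : measurable A -> mu.-integrable setT (EFin \o h) ->
    mu.-integrable A (EFin \o h).
  by move=> mA; apply: integrableS.
have restr (h : R -> R) (A : set R) : (fun y => h y * \1_A y) = h \_ A.
  apply/funext => y; rewrite patchE indicE.
  by case: (y \in A); rewrite ?mulr1 ?mulr0.
have restrI (h : R -> R) (A : set R) : measurable A -> mu.-integrable setT (EFin \o h) ->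
    mu.-integrable setT (EFin \o (h \_ A)).
  move=> mA ih; rewrite -restrict_EFin.
  by rewrite -integrable_mkcond//; exact: iT.
have E1 x : fubini_F mu (EFin \o k) x = (u x * V x)%:E.
  rewrite /fubini_F /= /k/=.
  under eq_integral => y _ do rewrite ind -[v y * _]/((fun y => v y * \1_(`]-oo, x]%classic) y) y) restr.
  under eq_integral => y _ do rewrite EFinM.
  rewrite integralZl//; last exact: restrI.
  rewrite EFinM; congr (_ * _)%E.
  rewrite /V /Rintegral fineK; last first.
    by apply: integrable_fin_num => //; exact: iT.
  rewrite [RHS]integral_mkcond/=; apply: eq_integral => y _.
  by rewrite restrict_EFin.
(* With [y] fixed, [x] runs over [[y, +oo[], and the integral of [u] over this half-line is its
   total integral minus [U y]. *)
have E2 y : fubini_G mu (EFin \o k) y = (v y * (\int[mu]_t u t - U y))%:E.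
  rewrite /fubini_G /= /k/=.
  under eq_integral => x _ do rewrite ind' mulrCA -[u x * _]/((fun x => u x * \1_(`[y, +oo[%classic) x) x) restr.
  under eq_integral => x _ do rewrite EFinM.
  rewrite integralZl//; last exact: restrI.
  rewrite EFinM; congr (_ * _)%E.
  have -> : \int[mu]_t u t - U y = \int[mu]_(t in `[y, +oo[) u t.
    have := @Rintegral_itvB _ u -oo%O +oo%O y; rewrite set_itvNyy => -> //.
    by rewrite Rintegral_itv_obnd_cbnd//; exact: iT.
  rewrite /Rintegral fineK; last first.
    by apply: integrable_fin_num => //; exact: iT.
  rewrite [RHS]integral_mkcond/=; apply: eq_integral => x _.
  by rewrite restrict_EFin.
have I1 : mu.-integrable setT (EFin \o (fun t => u t * V t)).
  have := integrable_fubini_F ik.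
  by apply: eq_integrable => // x _; exact: E1.
split => // I4.
have I3 : mu.-integrable setT (EFin \o (fun t => v t * \int[mu]_s u s)).
  exact: integrZr.
have -> : \int[mu]_t (u t * V t) = \int[mu]_t (v t * (\int[mu]_t u t - U t)).
  rewrite /Rintegral; congr fine.
  under eq_integral do rewrite -E1; under [RHS]eq_integral do rewrite -E2.
  by rewrite integral12_prod_meas1// integral21_prod_meas1.
under eq_Rintegral do rewrite mulrBr.
rewrite RintegralB//= subrK RintegralZr//; ring.
Qed.

(** The integrability of [v * U], a premise in the second half of [fubini_triangle1], is the first
    half of that lemma with [u] and [v] exchanged. *)
Lemma fubini_triangle u v :
  mu.-integrable setT (EFin \o u) -> mu.-integrable setT (EFin \o v) ->
  let U t := \int[mu]_(s in `]-oo, t]) u s in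
  let V t := \int[mu]_(s in `]-oo, t]) v s in
  [/\ mu.-integrable setT (EFin \o (fun t => u t * V t)),
      mu.-integrable setT (EFin \o (fun t => v t * U t)) &
  \int[mu]_t (u t * V t) + \int[mu]_t (v t * U t) =
  (\int[mu]_t u t) * (\int[mu]_t v t)].
Proof.
move=> iu iv U V; have [uV H] := fubini_triangle1 iu iv.
by have [vU _] := fubini_triangle1 iv iu; split => //; exact: H.
Qed.

(* On an interval: [F] is absolutely continuous with derivative [f]. *)
Definition primitive D F f :=
  forall s t, D s -> D t -> s <= t ->
    mu.-integrable `[s, t] (EFin \o f) /\ F t - F s = \int[mu]_(x in `[s, t]) f x.

(** Cut [f] and [g] off outside [[s, t]]. On this interval their integrals from [-oo] are [F - F s]
    and [G - G s], so the identity of [fubini_triangle] turns into the product rule. *)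
Lemma primitiveM D F f G g : is_interval D -> primitive D F f -> primitive D G g ->
  primitive D (fun t => F t * G t) (fun t => f t * G t + F t * g t).
Proof.
move=> iD pF pG s t Ds Dt st.
have [intf eF] := pF _ _ Ds Dt st; have [intg eG] := pG _ _ Ds Dt st.
pose u := f \_ `[s, t]; pose v := g \_ `[s, t].
have iu : mu.-integrable setT (EFin \o u).
  by rewrite -restrict_EFin -integrable_mkcond.
have iv : mu.-integrable setT (EFin \o v).
  by rewrite -restrict_EFin -integrable_mkcond.
have [uV vU E] := fubini_triangle iu iv.
pose U t := \int[mu]_(s in `]-oo, t]) u s.
pose V t := \int[mu]_(s in `]-oo, t]) v s.
have prE (h H : R -> R) x : primitive D H h -> x \in `[s, t] ->
    \int[mu]_(y in `]-oo, x]) (h \_ `[s, t]) y = H x - H s.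
  move=> pH; rewrite in_itv/= => /andP[sx xt].
  have Dx : D x by apply: (iD s t) => //; rewrite sx xt.
  rewrite (pH s x Ds Dx sx).2 -Rintegral_mkcondr.
  congr (Rintegral mu _ _); apply/seteqP; split => y /=; rewrite !in_itv/=.
    by move=> [-> /andP[->]].
  by move=> /andP[-> yx]; rewrite yx (le_trans yx xt).
have eUV (h H : R -> R) (p P : R -> R) : primitive D H h -> primitive D P p ->
    mu.-integrable setT (EFin \o (fun x => (p \_ `[s, t]) x * \int[mu]_(y in `]-oo, x]) (h \_ `[s, t]) y)) ->
    mu.-integrable `[s,t] (EFin \o (fun x => p x * H x)) /\
    \int[mu]_x ((p \_ `[s, t]) x * \int[mu]_(y in `]-oo, x]) (h \_ `[s, t]) y) =
    \int[mu]_(x in `[s, t]) (p x * H x) - H s * (P t - P s).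
  move=> pH pP iI.
  have eq1 : (fun x => (p \_ `[s, t]) x * \int[mu]_(y in `]-oo, x]) (h \_ `[s, t]) y) =
    (fun x => p x * (H x - H s)) \_ `[s,t].
    apply/funext => x; rewrite !patchE; case: ifPn => [|_]; last by rewrite mul0r.
    by rewrite inE /= => xst; rewrite (prE _ _ _ pH).
  have i1 : mu.-integrable `[s,t] (EFin \o (fun x => p x * (H x - H s))).
    by rewrite integrable_mkcond// restrict_EFin -eq1.
  have i2 : mu.-integrable `[s,t] (EFin \o (fun x => p x * H s)).
    by apply: integrZr => //; exact: (pP _ _ Ds Dt st).1.
  have i3 : mu.-integrable `[s,t] (EFin \o (fun x => p x * H x)).
    by apply: eq_integr (integrD _ i1 i2) => // x _; ring.
  split => //.
  rewrite eq1 -Rintegral_mkcond.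
  under eq_Rintegral do rewrite mulrBr.
  rewrite RintegralB// RintegralZr//; last exact: (pP _ _ Ds Dt st).1.
  by rewrite -(pP _ _ Ds Dt st).2 [H s * _]mulrC.
have [i1 e1] := eUV _ _ _ _ pG pF uV; have [i2 e2] := eUV _ _ _ _ pF pG vU.
split.
  by apply: eq_integr (integrD _ i1 i2) => // x _; ring.
move: E; rewrite e1 e2 -!Rintegral_mkcond -eF -eG.
under [in X in _ -> _ = X]eq_Rintegral do rewrite [F _ * _]mulrC.
rewrite RintegralD//=.
move=> H; have {H} -> : \int[mu]_(x in `[s, t]) (f x * G x) =
  (F t - F s) * (G t - G s) + G s * (F t - F s) + F s * (G t - G s)
    - \int[mu]_(x in `[s, t]) (g x * F x) by rewrite -H; ring.
by ring.
Qed.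

End IntegrationByParts.

(** * Limits of primitives at the ends of an interval *)

Section Ends.
Context {R : realType}.
Implicit Types (f g k K : R -> R) (D : set R) (a b : \bar R).

Lemma Rintegral_dct D (f_ : nat -> R -> R) f g : measurable D ->
  (forall n, measurable_fun D (f_ n)) -> measurable_fun D f ->
  {ae mu, forall x, D x -> f_ n x @[n --> \oo] --> f x} ->
  integr D g -> (forall n x, D x -> `|f_ n x| <= g x) ->
  \int[mu]_(x in D) f_ n x @[n --> \oo] --> \int[mu]_(x in D) f x.
Proof.
move=> mD mf_ mf cf ig fg.
have [] := @dominated_convergence _ _ R mu D mD (fun n => EFin \o f_ n) (EFin \o f)
  (EFin \o g).
- by move=> n; apply/measurable_EFinP; exact: mf_.
- by apply/measurable_EFinP.
- apply: ae_imp cf => x /= cf Dx; apply: cvg_EFin (cf Dx).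
  exact: nearW.
- exact: ig.
- by apply: nearW => x n Dx /=; rewrite lee_fin fg.
move=> iff _ cI; rewrite /Rintegral.
apply: fine_cvg; rewrite fineK//.
exact: integrable_fin_num.
Qed.

(* [edge_int e] is convertible to [eitv (left_end e) (right_end e)]. *)
Definition eitv a b : set R := [set t | (a < t%:E < b)%E].

Lemma measurable_eitv a b : measurable (eitv a b).
Proof.
rewrite (_ : eitv a b = EFin @^-1` `]a, b[%classic);
  last by apply/seteqP; split => t /=; rewrite in_itv.
rewrite -[X in measurable X]setTI; apply: EFin_measurable => //.
exact: emeasurable_itv.
Qed.

Lemma eitv_itv a b s t : eitv a b s -> eitv a b t -> `[s, t] `<=` eitv a b.
Proof.
rewrite /eitv /= => /andP[sa _] /andP[_ tb] x /=; rewrite in_itv/= => /andP[sx xt].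
rewrite (lt_le_trans sa) ?lee_fin//=.
by rewrite (le_lt_trans _ tb) ?lee_fin.
Qed.

Lemma is_interval_eitv a b : is_interval (eitv a b).
Proof. by move=> s t Ds Dt x xst; apply: (eitv_itv Ds Dt); rewrite /= in_itv. Qed.

Lemma open_eitv a b : open (eitv a b).
Proof.
have -> : eitv a b = [set t | (a < t%:E)%E] `&` [set t | (t%:E < b)%E].
  by rewrite /eitv; apply/seteqP; split => t /= => [/andP[]|[-> ->]].
apply: openI.
  case: a => [r| |]; first by under eq_set do rewrite lte_fin; exact: open_gt.
    rewrite (_ : [set _ | _] = set0); first exact: open0.
    by apply/seteqP; split => t //=; rewrite ltNge leey.
  rewrite (_ : [set _ | _] = setT); first exact: openT.
  by apply/seteqP; split => t //= _; rewrite ltNyr.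
case: b => [r| |]; first by under eq_set do rewrite lte_fin; exact: open_lt.
  rewrite (_ : [set _ | _] = setT); first exact: openT.
  by apply/seteqP; split => t //= _; rewrite ltry.
rewrite (_ : [set _ | _] = set0); first exact: open0.
by apply/seteqP; split => t //=; rewrite ltNge leNye.
Qed.

(** Dominated convergence with majorant [|k|]: at each point the restrictions of [k] are eventually
    constant in [n]. *)
Lemma Rintegral_sets D (A_ : nat -> set R) (A : set R) k : measurable D ->
  (forall n, measurable (A_ n)) -> measurable A -> integr D k ->
  (forall x, D x -> \forall n \near \oo, A_ n x <-> A x) ->
  \int[mu]_(x in D `&` A_ n) k x @[n --> \oo] --> \int[mu]_(x in D `&` A) k x.
Proof.
move=> mD mA_ mA ik nA.
rewrite Rintegral_mkcondr; under eq_fun do rewrite Rintegral_mkcondr.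
have mk : measurable_fun D k by exact: integr_meas.
have mr (B : set R) : measurable B -> measurable_fun D (k \_ B).
  move=> mB; apply/(measurable_restrict _ mB mD).
  by apply: measurable_funS mk => //; exact: subIsetl.
apply: (@Rintegral_dct D (fun n => k \_ (A_ n)) _ (fun x => `|k x|)) => //.
- by move=> n; exact: mr.
- exact: mr.
- apply: nearW => x Dx; apply: (@cvg_near_cst _ R).
  apply: filterS (nA x Dx) => n An; rewrite !patchE.
  by congr (if _ then _ else _); apply/idP/idP; rewrite !inE An.
- exact: integr_norm.
- by move=> n x Dx; rewrite patchE; case: ifPn => // _; rewrite normr0.
Qed.

(** The filters chosen for [b = -oo] here and for [a = +oo] in [end_left] are placeholders: the
    interval is empty in these cases. *)
Definition end_right b : set_system R :=
  if b is r%:E then r^'- else +oo%R.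
Definition end_left a : set_system R :=
  if a is r%:E then r^'+ else -oo%R.

(** The limit is tested along sequences that are eventually in the interval and eventually beyond
    each of its points. There [K (u n)] is [K s] plus the integral of [k] over [[s, u n]], and
    [Rintegral_sets] applies. Finite and infinite right ends differ only in how such sequences are
    recognised. *)
Lemma primitive_cvg_right a b K k s : eitv a b s -> primitive (eitv a b) K k ->
  integr (eitv a b) k ->
  K x @[x --> end_right b] --> K s + \int[mu]_(x in eitv a b `&` `[s, +oo[) k x.
Proof.
move=> Ds pK ik.
have mD := measurable_eitv a b.
have suff_ (u : nat -> R) :
    (\forall n \near \oo, u n \in eitv a b) ->
    (forall x, eitv a b x -> \forall n \near \oo, x <= u n) ->
    K (u n) @[n --> \oo] --> K s + \int[mu]_(x in eitv a b `&` `[s, +oo[) k x.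
  move=> uD ux.
  apply: (@cvg_trans _ (K s + \int[mu]_(x in eitv a b `&` `[s, u n]) k x @[n --> \oo])).
    apply: near_eq_cvg.
    near=> n.
    have sun : s <= u n by near: n; exact: ux.
    have Dun : eitv a b (u n) by apply/set_mem; near: n.
    rewrite setIidr; last exact: eitv_itv.
    by rewrite -(pK _ _ Ds Dun sun).2 addrC subrK.
  apply: cvgD; first exact: cvg_cst.
  apply: Rintegral_sets => // x Dx.
  apply: filterS (ux _ Dx) => n xn /=; rewrite !in_itv/= andbT xn andbT//.
move: a b {mD} Ds pK ik suff_ => a [r| |] Ds pK ik suff_ /=.
- apply/cvg_at_leftP => u [ur cu]; apply: suff_.
    case/andP: (Ds) => a_s; rewrite lte_fin -subr_gt0 => sr.
    move/cvgrPdist_lt: cu => /(_ _ sr); apply: filterS => n.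
    rewrite inE /eitv/= lte_fin ur andbT => un.
    rewrite (lt_trans a_s)// lte_fin; move: un.
    rewrite ger0_norm; last by rewrite subr_ge0 ltW.
    lra.
  move=> x /andP[_]; rewrite lte_fin -subr_gt0 => xr.
  move/cvgrPdist_lt: cu => /(_ _ xr); apply: filterS => n.
  rewrite ger0_norm; last by rewrite subr_ge0 ltW.
  lra.
- apply/cvg_pinftyP => u cu; apply: suff_.
    case/andP: Ds => a_s sr; move/cvgryPge : cu => /(_ s); apply: filterS => n un.
    by rewrite inE /eitv/= ltry andbT (lt_le_trans a_s)// lee_fin.
  by move=> x _; move/cvgryPge: cu; apply.
- by case/andP: Ds => _; rewrite ltNge leNye.
Unshelve. all: by end_near. Qed.

Lemma primitive_cvg_left a b K k s : eitv a b s -> primitive (eitv a b) K k ->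
  integr (eitv a b) k ->
  K x @[x --> end_left a] --> K s - \int[mu]_(x in eitv a b `&` `]-oo, s]) k x.
Proof.
move=> Ds pK ik.
have mD := measurable_eitv a b.
have suff_ (u : nat -> R) :
    (\forall n \near \oo, u n \in eitv a b) ->
    (forall x, eitv a b x -> \forall n \near \oo, u n <= x) ->
    K (u n) @[n --> \oo] --> K s - \int[mu]_(x in eitv a b `&` `]-oo, s]) k x.
  move=> uD ux.
  apply: (@cvg_trans _ (K s - \int[mu]_(x in eitv a b `&` `[u n, s]) k x @[n --> \oo])).
    apply: near_eq_cvg.
    near=> n.
    have sun : u n <= s by near: n; exact: ux.
    have Dun : eitv a b (u n) by apply/set_mem; near: n.
    rewrite setIidr; last exact: eitv_itv.
    by rewrite -(pK _ _ Dun Ds sun).2 opprB addrC subrK.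
  apply: cvgB; first exact: cvg_cst.
  apply: Rintegral_sets => // x Dx.
  by apply: filterS (ux _ Dx) => n xn /=; rewrite !in_itv/= xn.
move: a b {mD} Ds pK ik suff_ => [r| |] b Ds pK ik suff_ /=.
- apply/cvg_at_rightP => u [ur cu]; apply: suff_.
    case/andP: (Ds) => + a_s; rewrite lte_fin -subr_gt0 => sr.
    move/cvgrPdist_lt: cu => /(_ _ sr); apply: filterS => n.
    rewrite inE /eitv/= lte_fin ur /= => un.
    rewrite (lt_trans _ a_s)// lte_fin; move: un.
    rewrite distrC ger0_norm; last by rewrite subr_ge0 ltW.
    lra.
  move=> x /andP[+ _]; rewrite lte_fin -subr_gt0 => xr.
  move/cvgrPdist_lt: cu => /(_ _ xr); apply: filterS => n.
  rewrite distrC ger0_norm; last by rewrite subr_ge0 ltW.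
  lra.
- by case/andP: Ds; rewrite ltNge leey.
- apply/cvg_ninftyP => u cu; apply: suff_.
    case/andP: Ds => sr a_s; move/cvgrNyPle : cu => /(_ s); apply: filterS => n un.
    by rewrite inE /eitv/= ltNyr/= (le_lt_trans _ a_s)// lee_fin.
  by move=> x _; move/cvgrNyPle: cu; apply.
Unshelve. all: by end_near. Qed.

Global Instance end_right_proper b : ProperFilter (end_right b).
Proof. by case: b => [r| |] /=; typeclasses eauto. Qed.

Global Instance end_left_proper a : ProperFilter (end_left a).
Proof. by case: a => [r| |] /=; typeclasses eauto. Qed.

Lemma near_end_right a b s : eitv a b s -> \forall x \near end_right b, eitv a b x /\ s < x.
Proof.
case: b => [r| |] /andP[a_s sb] /=.
- near=> x; have sx : s < x by near: x; apply: nbhs_left_gt; rewrite -lte_fin.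
  have xr : x < r by near: x; exact: nbhs_left_lt.
  by split => //; rewrite /eitv/= lte_fin xr andbT (lt_trans a_s)// lte_fin.
- near=> x; have sx : s < x by near: x; apply: nbhs_pinfty_gt; rewrite num_real.
  by split => //; rewrite /eitv/= ltry andbT (lt_trans a_s)// lte_fin.
- by move: sb; rewrite ltNge leNye.
Unshelve. all: by end_near. Qed.

Lemma near_end_left a b s : eitv a b s -> \forall x \near end_left a, eitv a b x /\ x < s.
Proof.
case: a => [r| |] /andP[a_s sb] /=.
- near=> x; have sx : x < s by near: x; apply: nbhs_right_lt; rewrite -lte_fin.
  have xr : r < x by near: x; exact: nbhs_right_gt.
  by split => //; rewrite /eitv/= lte_fin xr (lt_trans _ sb)// lte_fin.
- by move: a_s; rewrite ltNge leey.
- near=> x; have sx : x < s by near: x; apply: nbhs_ninfty_lt; rewrite num_real.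
  by split => //; rewrite /eitv/= ltNyr/= (lt_trans _ sb)// lte_fin.
Unshelve. all: by end_near. Qed.

Lemma Rintegral_eitv_split a b k s : eitv a b s -> integr (eitv a b) k ->
  \int[mu]_(x in eitv a b `&` `]-oo, s]) k x + \int[mu]_(x in eitv a b `&` `[s, +oo[) k x
  = \int[mu]_(x in eitv a b) k x.
Proof.
move=> Ds ik; have mD := measurable_eitv a b.
rewrite !Rintegral_mkcondl [RHS]Rintegral_mkcond.
have ikT : integr setT (k \_ (eitv a b)).
  by rewrite -restrict_EFin -integrable_mkcond.
have := @Rintegral_itvB _ (k \_ (eitv a b)) -oo%O +oo%O s; rewrite set_itvNyy.
move=> /(_ ikT) /(_ isT isT) => /(canRL (subrK _)) ->; rewrite addrC; congr (_ + _).
rewrite Rintegral_itv_obnd_cbnd//.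
by apply: integrableS ikT.
Qed.

Lemma primitive_total a b K k l r : eitv a b !=set0 -> primitive (eitv a b) K k ->
  integr (eitv a b) k ->
  K x @[x --> end_left a] --> l -> K x @[x --> end_right b] --> r ->
  \int[mu]_(x in eitv a b) k x = r - l.
Proof.
move=> [s Ds] pK ik cl cr.
rewrite -(cvg_unique (@Rhausdorff R) (primitive_cvg_left Ds pK ik) cl).
rewrite -(cvg_unique (@Rhausdorff R) (primitive_cvg_right Ds pK ik) cr).
rewrite -(Rintegral_eitv_split Ds ik); ring.
Qed.

Lemma not_integr_infinite D K c : measurable D -> 0 < c -> mu D = +oo%E ->
  (forall x, D x -> c <= `|K x|) -> ~ integr D K.
Proof.
move=> mD c0 muD cK iK.
have /integrableP[mK] := iK; apply/negP; rewrite -leNgt.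
have -> : +oo%E = (\int[mu]_(x in D) c%:E)%E.
  rewrite integral_cst//= (_ : lebesgue_measure D = +oo%E)// gt0_muley// lte_fin.
apply: ge0_le_integral => //.
- by move=> x _; rewrite lee_fin ltW.
- by apply: measurableT_comp => //.
Qed.

(** A nonzero limit [l] would keep [|K|] above [|l| / 2] on a half-line, which has infinite
    measure. *)
Lemma integr_cvg_right_eq0 a K l : (a < +oo)%E -> integr (eitv a +oo) K ->
  K x @[x --> end_right +oo] --> l -> l = 0.
Proof.
move=> aoo iK cK; apply/eqP/negPn/negP => l0.
have nl : 0 < `|l| / 2 by rewrite divr_gt0// normr_gt0.
have [M [_ HM]] : \forall x \near +oo, `|l| / 2 <= `|K x|.
  move/cvgr_dist_lt: cK => /(_ _ nl); apply: filterS => x.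
  have := lerB_dist l (K x); have := ler_norm (K x); lra.
have [N HN] : exists N : R, (a <= N%:E)%E.
  by case: a aoo {iK} => [r| |] //= _; [exists r|exists 0; rewrite leNye].
pose s := Num.max M N.
apply: (@not_integr_infinite `]s, +oo[ K (`|l| / 2)) => //.
- by rewrite lebesgue_measure_itv/= ltry.
- move=> x; rewrite /= in_itv/= andbT => sx; apply: HM.
  by rewrite (le_lt_trans _ sx)// le_max lexx.
- apply: integrableS iK => //; first exact: measurable_eitv.
  move=> x; rewrite /= in_itv/= andbT => sx; rewrite /eitv/= ltry andbT.
  by rewrite (le_lt_trans HN)// lte_fin (le_lt_trans _ sx)// le_max lexx orbT.
Qed.

Lemma integr_cvg_left_eq0 b K l : (-oo < b)%E -> integr (eitv -oo b) K ->
  K x @[x --> end_left -oo] --> l -> l = 0.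
Proof.
move=> aoo iK cK; apply/eqP/negPn/negP => l0.
have nl : 0 < `|l| / 2 by rewrite divr_gt0// normr_gt0.
have [M [_ HM]] : \forall x \near -oo, `|l| / 2 <= `|K x|.
  move/cvgr_dist_lt: cK => /(_ _ nl); apply: filterS => x.
  have := lerB_dist l (K x); have := ler_norm (K x); lra.
have [N HN] : exists N : R, (N%:E <= b)%E.
  by case: b aoo {iK} => [r| |] //= _; [exists r|exists 0; rewrite leey].
pose s := Num.min M N.
apply: (@not_integr_infinite `]-oo, s[ K (`|l| / 2)) => //.
- by rewrite lebesgue_measure_itv/= ltNyr.
- move=> x; rewrite /= in_itv/= => sx; apply: HM.
  by rewrite (lt_le_trans sx)// ge_min lexx.
- apply: integrableS iK => //; first exact: measurable_eitv.
  move=> x; rewrite /= in_itv/= => sx; rewrite /eitv/= ltNyr/=.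
  by rewrite (lt_le_trans _ HN)// lte_fin (lt_le_trans sx)// ge_min lexx orbT.
Qed.

(** For every [t] the value [|K s|] exceeds [|K t|] by at most the integral of [|k|]. Averaging this
    over a subinterval whose length is controlled by [d] gives a bound that does not involve the
    interval itself; this is the source of the trace estimate. *)
Lemma primitive_bound a b K k x y d s : primitive (eitv a b) K k ->
  integr (eitv a b) K -> integr (eitv a b) k ->
  0 < d -> eitv a b x -> eitv a b y -> d <= y - x -> eitv a b s ->
  `|K s| <= 2 / d * \int[mu]_(t in eitv a b) `|K t| + \int[mu]_(t in eitv a b) `|k t|.
Proof.
move=> pK iK ik d0 Dx Dy dxy Ds.
have mD := measurable_eitv a b.
have le1 p q : eitv a b p -> eitv a b q -> p <= q -> forall f, integr (eitv a b) f ->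
    \int[mu]_(t in `[p, q]) `|f t| <= \int[mu]_(t in eitv a b) `|f t|.
  move=> Dp Dq pq f If; rewrite /Rintegral; apply: fine_le.
  - apply: integrable_fin_num => //; apply: integrableS (integr_norm If) => //.
    exact: eitv_itv.
  - by apply: integrable_fin_num => //; exact: integr_norm.
  - apply: ge0_subset_integral => //; last exact: eitv_itv.
    by apply/measurable_EFinP/measurableT_comp => //; exact: integr_meas.
have le2 t : eitv a b t -> `|K s| <= `|K t| + \int[mu]_(t in eitv a b) `|k t|.
  move=> Dt; wlog [p [q [Dp Dq pq e]]] : / exists p q, [/\ eitv a b p, eitv a b q, p <= q &
      `|K s| <= `|K t| + `|K q - K p|].
    apply; have [st|/ltW ts] := leP s t.
      exists s, t; split => //; have := lerB_dist (K s) (K t); rewrite distrC; lra.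
    by exists t, s; split => //; have := lerB_dist (K s) (K t); lra.
  apply: (le_trans e); rewrite lerD2l (pK p q Dp Dq pq).2.
  apply: le_trans (le1 _ _ Dp Dq pq _ ik).
  by apply: le_normr_Rintegral => //; exact: (pK p q Dp Dq pq).1.
(* Of the two intervals from [x] to [s] and from [s] to [y], one has length at least [d / 2],
   according to the side of the midpoint on which [s] lies. Hence the factor [2 / d]. *)
wlog [p [q [Dp Dq pq]]] : / exists p q, [/\ eitv a b p, eitv a b q & d / 2 <= q - p].
  apply; have [sx|/ltW xs] := leP s ((x + y) / 2).
    by exists s, y; split => //; lra.
  by exists x, s; split => //; lra.
have pq' : p <= q by lra.
pose C := \int[mu]_(t in eitv a b) `|k t|.
have iKpq : integr `[p, q] (fun t => `|K t|).
  by apply: integrableS (integr_norm iK) => //; exact: eitv_itv.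
have icst (c : R) : integr `[p, q] (fun _ => c).
  apply: measurable_bounded_integrable => //.
    by rewrite /= lebesgue_measure_itv/=; case: ifP => //= _; rewrite ltry.
  by exists `|c|; split; [exact: num_real|move=> z cz t _ /=; exact: ltW].
have : \int[mu]_(t in `[p, q]) (`|K s| - C) <= \int[mu]_(t in `[p, q]) `|K t|.
  apply: le_Rintegral => // t /(eitv_itv Dp Dq) Dt.
  by rewrite lerBlDr le2.
rewrite Rintegral_cst//= lebesgue_measure_itv/= lte_fin (_ : fine _ = q - p); last first.
  case: ltP => //=.
  by move=> qp; apply/eqP; rewrite eq_sym subr_eq0 eq_le pq' qp.
move=> /le_trans /(_ (le1 _ _ Dp Dq pq' _ iK)) H.
rewrite -/C; set I := \int[mu]_(t in eitv a b) `|K t| in H *.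
have I0 : 0 <= I by apply: Rintegral_ge0.
have [|sC] := leP (`|K s| - C) 0.
  move=> h; have : 0 <= 2 / d * I by rewrite mulr_ge0// divr_ge0// ltW.
  lra.
have : (`|K s| - C) * (d / 2) <= I by apply: le_trans H; rewrite ler_wpM2l// ltW.
rewrite -lerBlDr (_ : 2 / d * I = I / (d / 2)); last first.
  by field; rewrite gt_eqF.
by rewrite ler_pdivlMr// divr_gt0.
Qed.

End Ends.

(** * Test functions and the du Bois-Reymond lemma *)

Section Smooth.
Context {R : realType}.
Implicit Types (f g : R -> R).

(** The derivative is an explicit witness at each level, so that sums, products and affine
    substitutions are handled by induction without computing iterated derivatives. *)
Fixpoint derivable_upto (n : nat) f : Prop :=
  if n is m.+1 then
    exists g, (forall t : R, is_derive t 1 f (g t)) /\ derivable_upto m g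
  else True.

Definition smooth f := forall n, derivable_upto n f.

Lemma derivable_uptoW n f : derivable_upto n.+1 f -> derivable_upto n f.
Proof.
elim: n f => [//|n IH] f [g [fg gn]]; exists g; split => //; exact: IH.
Qed.

Lemma derivable_uptoD n f g : derivable_upto n f -> derivable_upto n g ->
  derivable_upto n (fun t => f t + g t).
Proof.
elim: n f g => [//|n IH] f g [f' [ff' f'n]] [g' [gg' g'n]].
by exists (fun t => f' t + g' t); split; [move=> t; exact: is_deriveD|exact: IH].
Qed.

Lemma derivable_uptoM n f g : derivable_upto n f -> derivable_upto n g ->
  derivable_upto n (fun t => f t * g t).
Proof.
elim: n f g => [//|n IH] f g fn gn.
have f1 := derivable_uptoW fn; have g1 := derivable_uptoW gn.
case: fn gn => [f' [ff' f'n]] [g' [gg' g'n]].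
exists (fun t => f t * g' t + g t * f' t); split.
  by move=> t; apply: is_deriveM.
by apply: derivable_uptoD; exact: IH.
Qed.

Lemma derivable_upto_cst n (c : R) : derivable_upto n (fun=> c).
Proof.
elim: n c => [//|n IH] c; exists (fun=> 0); split => // t; exact: is_derive_cst.
Qed.

Lemma derivable_upto_affine n f (c d : R) : derivable_upto n f ->
  derivable_upto n (fun t => f (c * t + d)).
Proof.
elim: n f => [//|n IH] f [f' [ff' f'n]].
exists (fun t => f' (c * t + d) * c); split.
  move=> t; apply: (@is_derive1_comp _ f (fun t => c * t + d)).
  apply: is_derive_eq.
  by rewrite addr0; exact: mulr1.
by apply: derivable_uptoM; [exact: IH|exact: derivable_upto_cst].
Qed.

Lemma smooth_derivable1n f : smooth f ->
  forall n t, derivable (derive1n n f) t 1.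
Proof.
move=> sf n; move: (sf n.+1) => {sf}; elim: n f => [|n IH] f [g [fg gn]] t.
  by rewrite derive1n0; case: (fg t).
rewrite derive1Sn (_ : derive1 f = g); first exact: IH.
by apply/funext => x; rewrite derive1E; case: (fg x).
Qed.

(** The classical function [exp (- 1 / x)] extended by 0, times a power of [1 / x]. The powers are
    included because they make the family stable under differentiation: the derivative of [flat k]
    combines [flat k.+2] and [flat k.+1]. *)
Definition flat (k : nat) (x : R) : R :=
  if x <= 0 then 0 else x^-1 ^+ k * expR (- x^-1).

Lemma flatE k (x : R) : 0 < x -> flat k x = x^-1 ^+ k * expR (- x^-1).
Proof. by rewrite /flat ltNge => /negbTE ->. Qed.

(** The exponential of [u = 1 / x] dominates the single term of degree [k + 1] of its power
    series. *)
Lemma flat_le k (x : R) : 0 < x -> flat k x <= k.+1`!%:R * x.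
Proof.
move=> x0; rewrite flatE// expRN ler_pdivrMr ?expR_gt0//.
have u0 : 0 <= x^-1 by rewrite invr_ge0 ltW.
have := expR_ge1Dxn k u0.
set F := k.+1`!%:R; have F0 : 0 < F :> R by rewrite ltr0n fact_gt0.
move=> H; have {H} : x^-1 ^+ k.+1 / F <= expR x^-1 by lra.
rewrite ler_pdivrMr// exprS => H.
rewrite -(ler_pM2l (x := x^-1)) ?invr_gt0//; apply: (le_trans H).
by rewrite mulrC mulrA mulrCA mulVf ?mulr1// gt_eqF.
Qed.

Lemma flat_ge0 k (x : R) : 0 <= flat k x.
Proof.
rewrite /flat; case: (leP x 0) => // x0.
by rewrite mulr_ge0// ?expR_ge0// exprn_ge0// invr_ge0 ltW.
Qed.

(** Meant for functions defined by cases, at the gluing point 0: the quadratic bound makes the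
    difference quotient there at most [C * |h|]. *)
Lemma is_derive0_sqr_bound f (C : R) : (forall h, `|f h - f 0| <= C * h ^+ 2) ->
  is_derive (0 : R) (1 : R) f 0.
Proof.
move=> fC.
have cq : h^-1 *: (f (h *: 1 + 0) - f 0) @[h --> (0 : R)^'] --> (0 : R).
  apply/cvgr0Pnorm_le => e e0.
  near=> h.
  have h0 : h != 0 by near: h; exact: nbhs_dnbhs_neq.
  rewrite [h *: 1]mulr1 addr0 normrZ normfV ler_pdivrMl ?normr_gt0//.
  apply: (le_trans (fC h)); rewrite -real_normK ?num_real// expr2 mulrCA.
  apply: ler_wpM2l => //.
  apply: (@le_trans _ _ (`|C| * `|h|)); first by rewrite ler_wpM2r// ler_norm.
  have C1 : 0 < `|C| + 1 by rewrite ltr_wpDl.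
  apply: (@le_trans _ _ ((`|C| + 1) * `|h|)); first by rewrite ler_wpM2r// lerDl.
  rewrite -ler_pdivlMl//; near: h; apply: dnbhs0_le.
  by rewrite mulr_gt0// invr_gt0.
split; first by apply/cvg_ex; exists 0.
exact: (cvg_lim (@Rhausdorff R) cq).
Unshelve. all: by end_near. Qed.

Lemma is_derive_invX k (x : R) : x != 0 ->
  is_derive x 1 (fun y : R => y^-1 ^+ k) (- (k%:R * x^-1 ^+ k.+1)).
Proof.
move=> x0; elim: k => [|k IH].
  by under eq_fun do rewrite expr0; apply: is_derive_eq; rewrite mul0r oppr0.
have dV : is_derive x 1 (fun y : R => y^-1) (- x ^- 2 *: 1) by exact: is_deriveV.
under eq_fun do rewrite exprS.
have := is_deriveM dV IH => d; apply: is_derive_eq.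
rewrite /GRing.scale/= -exprVn -natr1 !exprS; ring.
Qed.

Lemma is_derive_flat k (x : R) :
  is_derive x 1 (flat k) (flat k.+2 x - k%:R * flat k.+1 x).
Proof.
have [x0|x0|->] := ltgtP x 0.
- rewrite (_ : _ - _ = 0); last first.
    by rewrite /flat (ltW x0) mulr0 subrr.
  apply: (near_eq_is_derive (f := cst 0)).
  near=> y; rewrite /flat ifT//.
  by apply: ltW; near: y; exact: lt_nbhsl.
- have x1 : x != 0 by rewrite gt_eqF.
  have dX := is_derive_invX k x1.
  have dN : is_derive x 1 (fun y : R => - y^-1) (x^-1 ^+ 2).
    have := is_derive_invX 1 x1; under [X in is_derive _ _ X]eq_fun do rewrite expr1.
    by move=> d; apply: is_derive_eq; rewrite mul1r opprK.
  have dE := @is_derive1_comp _ expR _ x _ _ (is_derive_expR (- x^-1)) dN.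
  have d : is_derive x 1 (fun x => x^-1 ^+ k * expR (- x^-1))
      (flat k.+2 x - k%:R * flat k.+1 x).
    apply: (@is_derive_eq _ _ _ _ _ _ _ _ (is_deriveM dX dE)).
    rewrite !flatE// /GRing.scale/= !exprS; ring.
  apply: near_eq_is_derive d.
  near=> y; rewrite flatE//.
  by near: y; exact: lt_nbhsr.
- rewrite (_ : _ - _ = 0); last by rewrite /flat lexx mulr0 subrr.
  (* For positive [h], one factor [h] comes from [flat k h = h * flat k.+1 h] and a second one from
     [flat_le] at [k + 1], which brings in the factorial of [k + 2]. *)
  apply: (@is_derive0_sqr_bound _ k.+2`!%:R) => h.
  rewrite [flat k 0]/flat lexx subr0 ger0_norm ?flat_ge0//.
  have [h0|h0] := leP h 0.
    by rewrite /flat h0 mulr_ge0// sqr_ge0.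
  have -> : flat k h = h * flat k.+1 h.
    by rewrite !flatE// exprS mulrA mulrA mulfV ?mul1r// gt_eqF.
  by rewrite expr2 mulrCA ler_pM2l// flat_le.
Unshelve. all: by end_near. Qed.

Lemma smooth_flat k : smooth (flat k).
Proof.
move=> n; elim: n k => [//|n IH] k; exists (fun x => flat k.+2 x - k%:R * flat k.+1 x).
split; first by move=> t; exact: is_derive_flat.
rewrite (_ : (fun x => _) = (fun x => flat k.+2 x + (fun x => (- k%:R) * flat k.+1 x) x)).
  apply: derivable_uptoD => //; apply: derivable_uptoM => //.
  exact: derivable_upto_cst.
by apply/funext => x; rewrite mulNr.
Qed.

Lemma smooth_continuous f : smooth f -> continuous f.
Proof.
move=> /(_ 1%N)[g [fg _]] x.
by apply: differentiable_continuous; apply/derivable1_diffP; case: (fg x).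
Qed.

(** The index [n] only sharpens the flanks: the function vanishes off []p, q[] for every [n], stays
    between 0 and 1, and tends to the indicator of []p, q[]. This is how smooth functions are made
    to see intervals. *)
Definition bump (n : nat) (p q x : R) : R :=
  flat 0 (n.+1%:R * (x - p)) * flat 0 (n.+1%:R * (q - x)).

Lemma smooth_bump n p q : smooth (bump n p q).
Proof.
move=> m; rewrite /bump.
rewrite (_ : (fun x => _) = (fun x => flat 0 (n.+1%:R * x + - (n.+1%:R * p)) *
    flat 0 (- n.+1%:R * x + n.+1%:R * q))).
  by apply: derivable_uptoM; apply: derivable_upto_affine; exact: smooth_flat.
apply/funext => x; congr (flat 0 _ * flat 0 _); ring.
Qed.

Lemma flat0_le1 (x : R) : flat 0 x <= 1.
Proof.
rewrite /flat; case: (leP x 0) => // x0.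
by rewrite expr0 mul1r -expR0 ler_expR oppr_le0 invr_ge0 ltW.
Qed.

Lemma bump_ge0 n p q x : 0 <= bump n p q x.
Proof. by rewrite mulr_ge0// flat_ge0. Qed.

Lemma bump_le1 n p q x : bump n p q x <= 1.
Proof. by rewrite mulr_ile1// ?flat_ge0// flat0_le1. Qed.

Lemma bump_out n p q x : x \notin `]p, q[ -> bump n p q x = 0.
Proof.
rewrite in_itv/= negb_and -!leNgt => /orP[xp|xq]; rewrite /bump /flat.
  by rewrite ifT ?mul0r// pmulr_rle0// subr_le0.
by rewrite [in X in _ * X]ifT ?mulr0// pmulr_rle0// subr_le0.
Qed.

Lemma flat0_gt0 (x : R) : 0 < x -> 0 < flat 0 x.
Proof. by move=> x0; rewrite flatE// mul1r expR_gt0. Qed.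

Lemma bump_gt0 n p q x : p < x < q -> 0 < bump n p q x.
Proof.
by move=> /andP[px xq]; rewrite mulr_gt0// flat0_gt0// mulr_gt0// subr_gt0.
Qed.

Lemma cvg_flat0 (x : R) : 0 < x -> flat 0 (n.+1%:R * x) @[n --> \oo] --> (1 : R).
Proof.
move=> x0; rewrite -[X in _ --> X]expR0.
rewrite (_ : (fun n => _) = (fun n => expR (- (n.+1%:R^-1 * x^-1)))); last first.
  by apply/funext => n; rewrite flatE ?mulr_gt0//= expr0 mul1r invfM.
have c0 : - (n.+1%:R^-1 * x^-1) @[n --> \oo] --> (0 : R).
  rewrite -[0 in X in _ --> X]oppr0 -[0 in X in _ --> X](mul0r x^-1).
  by apply: cvgN; apply: cvgM; [exact: cvg_harmonic|exact: cvg_cst].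
exact: (cvg_comp _ _ c0 (@continuous_expR R 0)).
Qed.

Lemma cvg_bump p q x : p < x < q -> bump n p q x @[n --> \oo] --> (1 : R).
Proof.
move=> /andP[px xq]; rewrite -[1 in X in _ --> X](mulr1 1).
by apply: cvgM; apply: cvg_flat0; rewrite subr_gt0.
Qed.

End Smooth.

(** * Regularity of primitives and integration against test functions *)

Section Primitives.
Context {R : realType}.
Implicit Types (f g F G y : R -> R) (a b : \bar R).

Lemma continuous_integr f (p q : R) : continuous f -> integr `[p, q] f.
Proof.
move=> cf; apply: continuous_compact_integrable; first exact: segment_compact.
exact: continuous_subspaceT.
Qed.

Lemma continuous_primitive F f (D : set R) :
  (forall t : R, is_derive t 1 F (f t)) -> continuous f -> primitive D F f.
Proof.
move=> Ff cf s t _ _; rewrite le_eqVlt => /predU1P[<-|st].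
  split; first exact: continuous_integr.
  by rewrite subrr set_itv1 Rintegral_set1.
split; first exact: continuous_integr.
have cF : continuous F.
  by move=> x; apply: differentiable_continuous; apply/derivable1_diffP; case: (Ff x).
rewrite /Rintegral (@continuous_FTC2 _ f F)//.
- exact: continuous_subspaceT.
- split.
  + by move=> x _; case: (Ff x).
  + by apply: cvg_at_right_filter; exact: cF.
  + by apply: cvg_at_left_filter; exact: cF.
- by move=> x _; rewrite derive1E; case: (Ff x).
Qed.

Lemma eitv_ex a b x : eitv a b x -> exists p q, [/\ eitv a b p, eitv a b q & p < x < q].
Proof.
move=> Dx; have : nbhs x (eitv a b) by apply: open_nbhs_nbhs; split => //; exact: open_eitv.
move=> /nbhs_ballP[e /= e0 be].
have e2 : 0 < e / 2 by rewrite divr_gt0.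
exists (x - e / 2), (x + e / 2); split.
- by apply: be; rewrite /ball/= opprB addrC subrK gtr0_norm//; lra.
- by apply: be; rewrite /ball/= opprD addNKr normrN gtr0_norm//; lra.
- by apply/andP; split; lra.
Qed.

Lemma primitive_continuous a b F f x : primitive (eitv a b) F f -> eitv a b x ->
  {for x, continuous F}.
Proof.
move=> pF Dx; have [p [q [Dp Dq /andP[px xq]]]] := eitv_ex Dx.
have pq : p <= q by rewrite (le_trans (ltW px) (ltW xq)).
have iff := (pF p q Dp Dq pq).1.
have := parameterized_integral_continuous pq iff.
move=> /within_continuous_continuous => /(_ x).
have xpq : x \in `]p, q[ by rewrite in_itv/= px.
move=> /(_ (lt_trans px xq) xpq) c.
have {}c : {for x, continuous (fun t => F p + \int[mu]_(u in `[p, t]) f u)}.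
  by apply: cvgD; [exact: cvg_cst|exact: c].
have E t : p < t < q -> F p + \int[mu]_(u in `[p, t]) f u = F t.
  move=> /andP[/ltW pt /ltW tq]; rewrite -(pF p t Dp _ pt).2; first by rewrite addrC subrK.
  by apply: (eitv_itv Dp Dq); rewrite /= in_itv/= pt.
rewrite /prop_for /continuous_at -(E x) ?px//; apply: cvg_trans c.
apply: near_eq_cvg; near=> t; apply: E.
by apply/andP; split; near: t; [exact: lt_nbhsr|exact: lt_nbhsl].
Unshelve. all: by end_near. Qed.

(** An open set on which [P] fails throughout would lie in a null set, while every ball has positive
    measure. *)
Lemma negligible_open_nonempty (P : R -> Prop) (U : set R) : open U ->
  {ae mu, forall x, P x} -> U !=set0 -> exists2 x, U x & P x.
Proof.
move=> oU [N [mN N0 PN]] [x Ux]; apply: contrapT => H.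
have UN : U `<=` N.
  by move=> z Uz; apply: PN => /= Pz; apply: H; exists z.
have : nbhs x U by exact: open_nbhs_nbhs.
move=> /nbhs_ballP[e /= e0 be].
have : (mu (ball x e) <= mu N)%E.
  by apply: le_measure; rewrite ?inE//; [exact: measurable_ball|exact: subset_trans UN].
rewrite N0 lebesgue_measure_ball; last exact: ltW.
by rewrite lee_fin leNgt mulrn_wgt0.
Qed.

Lemma continuous_ae_eq (U : set R) f g : open U ->
  (forall x, U x -> {for x, continuous f}) -> (forall x, U x -> {for x, continuous g}) ->
  {ae mu, forall x, U x -> f x = g x} -> forall x, U x -> f x = g x.
Proof.
move=> oU cf cg fg x Ux; apply/eqP/negPn/negP => fgx.
have c : {for x, continuous (fun t => f t - g t)}.
  by apply: cvgB; [exact: cf|exact: cg].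
have : nbhs x (U `&` [set t | f t - g t != 0]).
  apply: filterI; first exact: open_nbhs_nbhs.
  have : nbhs (f x - g x) [set z : R | z != 0].
    apply: open_nbhs_nbhs; split; first exact: open_neq.
    by rewrite /= subr_eq0.
  exact: c.
rewrite nbhsE => -[V [oV Vx] VU].
have [z Vz /= Hz] := negligible_open_nonempty oV fg (ex_intro _ x Vx).
by have [Uz] := VU _ Vz; rewrite /= subr_eq0 Hz ?eqxx.
Qed.

(** On each compact subinterval the primitive of [g] is constant, so Lebesgue's differentiation
    theorem gives [g = 0] almost everywhere there. Countably many subintervals with rational ends
    exhaust the interval. *)
Lemma ae_eq0_of_Rintegral a b g :
  (forall s t, eitv a b s -> eitv a b t -> s <= t ->
    integr `[s, t] g /\ \int[mu]_(x in `[s, t]) g x = 0) ->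
  {ae mu, forall x, eitv a b x -> g x = 0}.
Proof.
move=> H.
have H1 p q : eitv a b p -> eitv a b q -> p <= q ->
    {ae mu, forall x, x \in `]p, q[ -> g x = 0}.
  move=> Dp Dq pq; have [ig _] := H p q Dp Dq pq.
  pose G := g \_ `[p, q].
  have iG : integr setT G by rewrite -restrict_EFin -integrable_mkcond.
  have lG : locally_integrable setT G by apply: open_integrable_locally => //; exact: openT.
  have iGy (y : R) : integr `]-oo, y] G by apply: integrableS iG.
  have := FTC1Ny iGy lG; apply: ae_imp => x [_ dF] xpq.
  have : G x = g x by rewrite /G patchE ifT// inE; exact: subset_itv_oo_cc.
  move=> <-; rewrite -dF derive1E.
  rewrite (@near_eq_derive _ _ _ _ (cst 0)); first exact: derive_cst.
  move: xpq; rewrite in_itv/= => /andP[px xq].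
  near=> y.
  have /andP[py yq] : p <= y <= q.
    by apply/andP; split; apply: ltW; near: y; [exact: lt_nbhsr|exact: lt_nbhsl].
  rewrite /G -Rintegral_mkcondr (_ : _ `&` _ = `[p, y]%classic).
    apply: (H p y Dp _ py).2; apply: (eitv_itv Dp Dq).
    by rewrite /= in_itv/= py.
  apply/seteqP; split => z /=; rewrite !in_itv/=.
    by move=> [-> /andP[->]].
  by move=> /andP[-> zy]; rewrite zy (le_trans zy).
(* The pairs of rational ends are enumerated by [unpickle], so that the exceptional sets form a
   sequence; pairs that do not give a subinterval satisfy the claim vacuously. *)
have H2 n : {ae mu, forall x, forall r : rat * rat, unpickle n = Some r ->
    ratr r.1 < x < ratr r.2 -> eitv a b (ratr r.1) -> eitv a b (ratr r.2) -> g x = 0}.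
  case E : (unpickle n) => [[p q]|]; last by apply: nearW.
  have [[Dp Dq]|nD] := pselect (eitv a b (ratr p) /\ eitv a b (ratr q)); last first.
    by apply: nearW => x r [<-] /= _ ? ?; exfalso; apply: nD.
  have [pq|qp] := leP (ratr p : R) (ratr q); last first.
    apply: nearW => x r [<-] /= /andP[px xq]; exfalso.
    by move: (lt_trans px xq); rewrite ltNge (ltW qp).
  by apply: ae_imp (H1 _ _ Dp Dq pq) => x Hx r [<-] /= pxq _ _; apply: Hx; rewrite in_itv.
have := ae_foralln H2; apply: ae_imp => x Hx Dx.
have [p [q [Dp Dq /andP[px xq]]]] := eitv_ex Dx.
have [r1 r1i] := rat_in_itvoo px; have [r2 r2i] := rat_in_itvoo xq.
move: r1i r2i; rewrite !in_itv/= => /andP[pr1 r1x] /andP[xr2 r2q].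
apply: (Hx (pickle (r1, r2)) (r1, r2)); rewrite ?pickleK//=; first by rewrite r1x.
- by apply: (eitv_itv Dp Dx); rewrite /= in_itv/= !ltW.
- by apply: (eitv_itv Dx Dq); rewrite /= in_itv/= !ltW.
Unshelve. all: by end_near. Qed.

Lemma compact_eitv a b (K : set R) : eitv a b !=set0 -> compact K -> K `<=` eitv a b ->
  exists s t, [/\ eitv a b s, eitv a b t, s <= t & K `<=` `]s, t[].
Proof.
move=> [x0 Dx0] cK KD.
have [->|/set0P K0] := eqVneq K set0.
  by exists x0, x0; split => // x.
have cid : {within K, continuous (@idfun R)} by apply: continuous_subspaceT => x; exact: cvg_id.
have [m /set_mem Km mK] := compact_EVT_max K0 cK cid.
have [n /set_mem Kn nK] := compact_EVT_min K0 cK cid.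
have [_ [t [_ Dt /andP[_ mt]]]] := eitv_ex (KD _ Km).
have [s [_ [Ds _ /andP[sn _]]]] := eitv_ex (KD _ Kn).
exists s, t; split => //.
  apply/ltW/(lt_trans sn)/(le_lt_trans _ mt)/mK; exact/mem_set.
move=> z Kz; rewrite /= in_itv/=; apply/andP; split.
  by apply: (lt_le_trans sn); apply: nK; exact/mem_set.
by apply: (le_lt_trans _ mt); apply: mK; exact/mem_set.
Qed.

Definition loc_integr (D : set R) g := forall s t, D s -> D t -> integr `[s, t] g.

Lemma primitive_loc (D : set R) F f : primitive D F f -> loc_integr D f.
Proof.
move=> pF s t Ds Dt; have [st|ts] := leP s t; first exact: (pF s t Ds Dt st).1.
by rewrite set_itv_ge; [exact: integrable_set0|rewrite bnd_simp -ltNge].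
Qed.

Lemma integr_contM (s t : R) f g : continuous f -> integr `[s, t] g ->
  integr `[s, t] (fun x => f x * g x).
Proof.
move=> cf ig.
have [st|ts] := leP s t; last first.
  by rewrite set_itv_ge; [exact: integrable_set0|rewrite bnd_simp -ltNge].
have [M HM] : exists M : R, forall x, x \in `[s, t] -> `|f x| <= M.
  have cn : {within `[s, t], continuous (fun x => `|f x|)}.
    apply: continuous_subspaceT => x; apply: cvg_norm; exact: cf.
  by have [c _ H] := EVT_max st cn; exists `|f c|.
apply: (@le_integr _ _ _ (fun x => M * `|g x|)) => //.
- apply: measurable_funM; last exact: integr_meas.
  by apply: measurable_funTS; exact: continuous_measurable_fun.
- by move=> x xst; rewrite normrM ler_wpM2r// HM.
- by apply: integrZl => //; exact: integr_norm.
Qed.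

Lemma Rintegral_support (D : set R) (s t : R) h : `[s, t] `<=` D ->
  (forall x, x \notin `[s, t] -> h x = 0) ->
  \int[mu]_(x in D) h x = \int[mu]_(x in `[s, t]) h x.
Proof.
move=> stD h0; rewrite Rintegral_mkcond [RHS]Rintegral_mkcond.
apply: eq_Rintegral => x _; rewrite !patchE.
case: ifPn => [_|xD]; case: ifPn => // xst.
- by rewrite h0//; apply/negP => H; move/negP: xst; apply; exact/mem_set.
- by move/negP: xD; case; apply/mem_set/stD; exact/set_mem.
Qed.

Lemma integr_support (D : set R) (s t : R) h : measurable D -> `[s, t] `<=` D ->
  (forall x, x \notin `[s, t] -> h x = 0) -> integr `[s, t] h -> integr D h.
Proof.
move=> mD stD h0 ih; apply: (@integrS _ setT) => //.
have : integr setT (h \_ `[s, t]) by rewrite -restrict_EFin -integrable_mkcond.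
apply: eq_integr => // x _; rewrite patchE; case: ifPn => // xst.
by rewrite h0//; apply/negP => H; move/negP: xst; apply; exact/mem_set.
Qed.

Lemma test_fun_is_derive (D : set R) phi : test_fun D phi ->
  (forall t : R, is_derive t 1 phi (derive1 phi t)) /\ continuous (derive1 phi).
Proof.
move=> [dphi _]; split=> t.
  by apply: DeriveDef; [exact: (dphi 0%N t)|rewrite derive1E].
apply: differentiable_continuous; apply/derivable1_diffP; exact: (dphi 1%N t).
Qed.

Lemma test_fun_continuous (D : set R) phi : test_fun D phi -> continuous phi.
Proof.
move=> [dphi _] t.
apply: differentiable_continuous; apply/derivable1_diffP; exact: (dphi 0%N t).
Qed.

Lemma test_fun_support a b phi : eitv a b !=set0 -> test_fun (eitv a b) phi ->
  exists s t, [/\ eitv a b s, eitv a b t, s <= t &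
    forall x, x \notin `]s, t[ -> phi x = 0 /\ derive1 phi x = 0].
Proof.
move=> D0 [_ [K [cK KD phi0]]].
have [s [t [Ds Dt st Kst]]] := compact_eitv D0 cK KD.
exists s, t; split => // x xst.
have nK : ~ K x by move=> /Kst H; move/negP: xst; apply.
split; first exact: phi0.
rewrite derive1E (@near_eq_derive _ _ _ _ (cst 0)); first exact: derive_cst.
have : nbhs x (~` K).
  apply: open_nbhs_nbhs; split => //; apply: closed_openC.
  by apply: compact_closed => //; exact: Rhausdorff.
by apply: filterS => z /phi0.
Qed.

Lemma test_fun_integrM a b phi g : eitv a b !=set0 -> test_fun (eitv a b) phi ->
  loc_integr (eitv a b) g ->
  integr (eitv a b) (fun x => phi x * g x) /\
  integr (eitv a b) (fun x => derive1 phi x * g x).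
Proof.
move=> D0 tphi lg; have [s [t [Ds Dt st H]]] := test_fun_support D0 tphi.
have mD := measurable_eitv a b.
have [_ cp] := test_fun_is_derive tphi.
have H' x : x \notin `[s, t] -> phi x = 0 /\ derive1 phi x = 0.
  by move=> xst; apply: H; apply: contra xst; exact: subset_itv_oo_cc.
split; apply: (integr_support _ (eitv_itv Ds Dt)) => //.
- by move=> x /H'[-> _]; rewrite mul0r.
- by apply: integr_contM; [exact: test_fun_continuous tphi|exact: lg].
- by move=> x /H'[_ ->]; rewrite mul0r.
- by apply: integr_contM => //; exact: lg.
Qed.

Lemma test_fun_by_parts a b phi Y y : eitv a b !=set0 -> test_fun (eitv a b) phi ->
  primitive (eitv a b) Y y ->
  \int[mu]_(x in eitv a b) (phi x * y x) = - \int[mu]_(x in eitv a b) (derive1 phi x * Y x).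
Proof.
move=> D0 tphi pY.
have [s [t [Ds Dt st H]]] := test_fun_support D0 tphi.
have mD := measurable_eitv a b.
have [dphi cp] := test_fun_is_derive tphi.
have [iy _] := test_fun_integrM D0 tphi (primitive_loc pY).
have lY : loc_integr (eitv a b) Y.
  move=> p q Dp Dq; apply: continuous_compact_integrable; first exact: segment_compact.
  apply: continuous_in_subspaceT => x /set_mem xpq; apply: (primitive_continuous pY).
  exact: (eitv_itv Dp Dq).
have [_ iY] := test_fun_integrM D0 tphi lY.
apply/eqP; rewrite -subr_eq0 opprK -RintegralD//; apply/eqP.
have H' x : x \notin `[s, t] -> phi x = 0 /\ derive1 phi x = 0.
  by move=> xst; apply: H; apply: contra xst; exact: subset_itv_oo_cc.
rewrite (Rintegral_support (eitv_itv Ds Dt)); last first.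
  by move=> x /H'[-> ->]; rewrite !mul0r addr0.
have pphi := continuous_primitive (D := eitv a b) dphi cp.
have := (primitiveM (@is_interval_eitv _ a b) pphi pY Ds Dt st).2.
(* [phi] vanishes off the open interval []s, t[], hence at both ends, and the boundary terms of the
   product rule for [phi * Y] drop out. *)
have -> : phi s = 0 by apply: (proj1 (H s _)); rewrite in_itv/= ltxx.
have -> : phi t = 0 by apply: (proj1 (H t _)); rewrite in_itv/= ltxx andbF.
rewrite !mul0r subr0 => ->.
by apply: eq_Rintegral => x _; rewrite addrC.
Qed.

Lemma bump_mass_gt0 n (p q : R) : p < q -> 0 < \int[mu]_(x in `[p, q]) bump n p q x.
Proof.
move=> pq; rewrite lt_neqAle Rintegral_ge0 ?andbT; last by move=> x _; exact: bump_ge0.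
apply/eqP => /esym I0.
have ib : integr `[p, q] (bump n p q).
  by apply: continuous_integr; apply: smooth_continuous; exact: smooth_bump.
have E : (\int[mu]_(x in `[p, q]) `|(EFin \o bump n p q) x| = 0)%E.
  under eq_integral => x _ do rewrite gee0_abs ?lee_fin ?bump_ge0//.
  by rewrite -[LHS]fineK; [congr EFin; exact: I0|exact: integrable_fin_num].
have mb := measurable_int _ ib.
have ae : {ae mu, forall x, x \in `[p, q] -> bump n p q x = 0}.
  have /(ae_eq_integral_abs mu (measurable_itv _) mb) := E.
  by apply: ae_imp => x /= H /H[].
have oU : open (`]p, q[%classic : set R) by exact: interval_open.
have [|x xpq] := negligible_open_nonempty oU ae.
- by exists ((p + q) / 2); rewrite /= in_itv/= midf_lt//= midf_lt.
- move=> /(_ (subset_itv_oo_cc xpq)) b0.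
  by have := bump_gt0 n xpq; rewrite b0 ltxx.
Qed.

Lemma cvg_Rintegral_bump (s t p q : R) k : s <= p -> q <= t -> p <= q ->
  integr `[s, t] k ->
  \int[mu]_(x in `[s, t]) (bump n p q x * k x) @[n --> \oo] -->
  \int[mu]_(x in `[p, q]) k x.
Proof.
move=> sp qt pq ik.
have mk := integr_meas ik.
have -> : \int[mu]_(x in `[p, q]) k x = \int[mu]_(x in `[s, t]) (k \_ `]p, q[) x.
  rewrite -Rintegral_mkcondr setIidr; last first.
    by move=> x; rewrite /= !in_itv/= => /andP[px xq]; rewrite (le_trans sp (ltW px)) (le_trans (ltW xq)).
  have ik' : integr `[p, q] k.
    by apply: integrableS ik => // x; rewrite /= !in_itv/= => /andP[px xq]; rewrite (le_trans sp) ?(le_trans xq).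
  rewrite -Rintegral_itv_obnd_cbnd; last by apply: integrableS ik' => //; exact: subset_itv_oc_cc.
  by rewrite -Rintegral_itv_bndo_bndc//; apply: integrableS ik' => //; exact: subset_itv_oo_cc.
apply: (@Rintegral_dct _ _ _ _ (fun x => `|k x|)) => //.
- move=> n; apply: measurable_funM => //; apply: measurable_funTS.
  by apply: continuous_measurable_fun; apply: smooth_continuous; exact: smooth_bump.
- apply/(measurable_restrict _ _ _) => //.
  by apply: measurable_funS mk => //; exact: subIsetl.
- apply: nearW => x _; rewrite patchE; case: ifPn => [/set_mem xpq|xpq].
    rewrite -[X in _ --> X]mul1r; apply: cvgM; last exact: cvg_cst.
    exact: cvg_bump.
  rewrite (_ : (fun n => _) = cst 0); first exact: cvg_cst.
  apply/funext => n; rewrite bump_out ?mul0r//.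
  by apply/negP => H; move/negP: xpq; apply; exact/mem_set.
- exact: integr_norm.
- move=> n x _; rewrite normrM ger0_norm ?bump_ge0// ler_piMl//.
  exact: bump_le1.
Qed.

End Primitives.

(** * The du Bois-Reymond lemma *)

Section DuBoisReymond.
Context {R : realType}.
Implicit Types (f g F G y : R -> R) (a b : \bar R).

(** The vanishing integral is what makes the primitive from [-oo] return to 0 to the right of the
    support, so that it has compact support in the interval. *)
Lemma antiderivative_test_fun a b s t g : eitv a b s -> eitv a b t -> s <= t ->
  smooth g -> (forall x, x \notin `[s, t] -> g x = 0) ->
  \int[mu]_(x in `[s, t]) g x = 0 ->
  exists2 phi, test_fun (eitv a b) phi & forall x, derive1 phi x = g x.
Proof.
move=> Ds Dt st sg g0 Ig0.
have cg := smooth_continuous sg.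
have iT : integr setT g.
  apply: (integr_support _ _ g0) => //; exact: continuous_integr.
pose phi x := \int[mu]_(z in `]-oo, x]) g z.
have dphi (x : R) : is_derive x 1 phi (g x).
  have [|||] := @continuous_FTC1 R g -oo%O x (x + 1) _ _ _ (cg x).
  - by rewrite ltrDl.
  - exact: integrableS iT.
  - by rewrite ltNyr.
  by rewrite -/phi derive1E => dp gE; exact: DeriveDef dp gE.
exists phi; last by move=> x; rewrite derive1E; case: (dphi x).
split.
  apply: smooth_derivable1n; case=> [//|n]; exists g; split => //; exact: sg.
exists [set` `[s, t]]; split.
- exact: segment_compact.
- exact: eitv_itv.
- move=> x; rewrite /= in_itv/= => /negP; rewrite negb_and -!ltNge => /orP[xs|tx].
    rewrite /phi /Rintegral (eq_integral (cst 0%E)); last first.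
      move=> z /set_mem; rewrite /= in_itv/= => zx; rewrite g0// in_itv/=.
      by rewrite leNgt (le_lt_trans zx xs).
    by rewrite integral0.
  have xT : `[s, t] `<=` `]-oo, x].
    by move=> z; rewrite /= !in_itv/= => /andP[_ zt]; rewrite (le_trans zt (ltW tx)).
  by rewrite /phi (Rintegral_support xT g0).
Qed.

(** Fix one bump [th0]. Every other bump, after subtraction of the multiple of [th0] with the same
    integral, has mean zero and hence is the derivative of a test function. So [k] integrates
    against every bump like the constant [c], and letting the bumps sharpen replaces them by
    indicators of intervals. *)
Lemma duBoisReymond0 a b k : eitv a b !=set0 -> loc_integr (eitv a b) k ->
  (forall phi, test_fun (eitv a b) phi ->
     \int[mu]_(x in eitv a b) (derive1 phi x * k x) = 0) ->
  exists c, {ae mu, forall x, eitv a b x -> k x = c}.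
Proof.
move=> [x0 Dx0] lk Hk.
have [p0 [q0 [Dp0 Dq0 /andP[px0 xq0]]]] := eitv_ex Dx0.
have pq0 : p0 < q0 by exact: lt_trans xq0.
pose th0 := bump 0 p0 q0.
pose m0 := \int[mu]_(x in `[p0, q0]) th0 x.
have m0_gt0 : 0 < m0 by exact: bump_mass_gt0.
pose c := (\int[mu]_(x in `[p0, q0]) (th0 x * k x)) / m0.
exists c.
have bump0 n (p q s t : R) x : s <= p -> q <= t -> x \notin `[s, t] -> bump n p q x = 0.
  move=> sp qt xst; apply: bump_out; apply: contra xst.
  by rewrite !in_itv/= => /andP[px xq]; rewrite (le_trans sp (ltW px)) (le_trans (ltW xq) qt).
have main p q : eitv a b p -> eitv a b q -> p < q ->
    \int[mu]_(x in `[p, q]) k x = (q - p) * c.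
  move=> Dp Dq pq.
  (* A common interval that contains the supports of [th0] and of the bumps over []p, q[]. *)
  pose s := Num.min p0 p; pose t := Num.max q0 q.
  have sp0 : s <= p0 by rewrite ge_min lexx.
  have sp : s <= p by rewrite ge_min lexx orbT.
  have tq0 : q0 <= t by rewrite le_max lexx.
  have tq : q <= t by rewrite le_max lexx orbT.
  have st : s <= t by rewrite (le_trans sp)// (le_trans (ltW pq)).
  have Ds : eitv a b s by rewrite /s; case: leP.
  have Dt : eitv a b t by rewrite /t; case: leP.
  have ik : integr `[s, t] k by exact: lk.
  (* The ratio of the masses of the two bumps; [r n * th0] is the multiple to be subtracted. *)
  pose r n := (\int[mu]_(x in `[s, t]) (bump n p q x * 1)) / m0.
  have cb n p' q' : continuous (bump n p' q' : R -> R).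
    by apply: smooth_continuous; exact: smooth_bump.
  have E0 h : \int[mu]_(x in `[s, t]) (th0 x * h x) = \int[mu]_(x in `[p0, q0]) (th0 x * h x).
    apply: Rintegral_support.
      by apply: subset_itvScc; rewrite bnd_simp.
    by move=> x xpq; rewrite /th0 (bump0 _ _ _ p0 q0) ?mul0r.
  have En n : \int[mu]_(x in `[s, t]) (bump n p q x * k x) = r n * (c * m0).
    pose g x := bump n p q x - r n * th0 x.
    have sg : smooth g.
      move=> m; rewrite (_ : g = fun x => bump n p q x + (- r n) * th0 x).
        apply: derivable_uptoD; first exact: smooth_bump.
        apply: derivable_uptoM; first exact: derivable_upto_cst.
        exact: smooth_bump.
      by apply/funext => x; rewrite /g mulNr.
    have g0 x : x \notin `[s, t] -> g x = 0.
      by move=> xst; rewrite /g /th0 (bump0 _ _ _ s t)// (bump0 _ _ _ s t)// mulr0 subr0.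
    have Ig0 : \int[mu]_(x in `[s, t]) g x = 0.
      rewrite RintegralB//; [|exact: continuous_integr|]; last first.
        by apply: integrZl => //; apply: continuous_integr; exact: cb.
      rewrite RintegralZl//; last by apply: continuous_integr; exact: cb.
      have -> : \int[mu]_(x in `[s, t]) th0 x = m0.
        transitivity (\int[mu]_(x in `[s, t]) (th0 x * 1)).
          by apply: eq_Rintegral => x _; rewrite mulr1.
        by rewrite (E0 (fun=> 1)); apply: eq_Rintegral => x _; rewrite mulr1.
      rewrite /r divfK ?gt_eqF//.
      apply/eqP; rewrite subr_eq0; apply/eqP.
      by apply: eq_Rintegral => x _; rewrite mulr1.
    have [phi tphi dphi] := antiderivative_test_fun Ds Dt st sg g0 Ig0.
    have := Hk _ tphi; rewrite (Rintegral_support (eitv_itv Ds Dt)); last first.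
      by move=> x /g0 gx; rewrite dphi gx mul0r.
    under eq_Rintegral => x _ do rewrite dphi /g mulrBl -(mulrA (r n)).
    have ib n' p' q' : integr `[s, t] (fun x => bump n' p' q' x * k x).
      by apply: integr_contM.
    rewrite RintegralB//; last by apply: integrZl => //; exact: ib.
    rewrite RintegralZl//; last exact: ib.
    rewrite E0 => /eqP; rewrite subr_eq0 => /eqP ->.
    by rewrite /c divfK// gt_eqF.
  have L1 := cvg_Rintegral_bump sp tq (ltW pq) ik.
  have i1 : integr `[s, t] (fun=> 1) by apply: continuous_integr => x; exact: cvg_cst.
  have L2 := cvg_Rintegral_bump sp tq (ltW pq) i1.
  have L3 : r n * (c * m0) @[n --> \oo] --> (\int[mu]_(x in `[p, q]) 1) / m0 * (c * m0).
    by apply: cvgM; [apply: cvgM; [exact: L2|exact: cvg_cst]|exact: cvg_cst].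
  have {}L1 : r n * (c * m0) @[n --> \oo] --> \int[mu]_(x in `[p, q]) k x.
    by move: L1; under eq_fun do rewrite En.
  rewrite (cvg_unique (@Rhausdorff R) L1 L3).
  rewrite Rintegral_cst//= lebesgue_measure_itv/= lte_fin pq/= mul1r.
  by field; rewrite gt_eqF.
suff : {ae mu, forall x, eitv a b x -> k x - c = 0}.
  by apply: ae_imp => x H /H /eqP; rewrite subr_eq0 => /eqP.
apply: ae_eq0_of_Rintegral => s t Ds Dt st.
have ic : integr `[s, t] (fun=> c) by apply: continuous_integr => x; exact: cvg_cst.
have ik := lk s t Ds Dt.
split; first exact: integrB.
rewrite RintegralB//.
move: st; rewrite le_eqVlt => /predU1P[->|st].
  by rewrite set_itv1 !Rintegral_set1 subrr.
rewrite main// Rintegral_cst//= lebesgue_measure_itv/= lte_fin st/= mulrC subrr//.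
Qed.

Lemma loc_integr_primitive a b y x0 : eitv a b x0 -> loc_integr (eitv a b) y ->
  exists Y, primitive (eitv a b) Y y.
Proof.
move=> Dx0 ly.
exists (fun t => if x0 <= t then \int[mu]_(x in `[x0, t]) y x else - \int[mu]_(x in `[t, x0]) y x).
move=> s t Ds Dt st; split; first exact: ly.
have split3 p q r : eitv a b p -> eitv a b r -> p <= q -> q <= r ->
    \int[mu]_(x in `[p, r]) y x = \int[mu]_(x in `[p, q]) y x + \int[mu]_(x in `[q, r]) y x.
  move=> Dp Dr pq qr; have i := ly p r Dp Dr.
  have := @Rintegral_itvB _ y (BLeft p) (BRight r) q i.
  rewrite !bnd_simp => /(_ pq qr) /(canRL (subrK _)) ->.
  rewrite addrC; congr (_ + _); rewrite Rintegral_itv_obnd_cbnd//.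
  by apply: integrableS i => //; apply: subset_itvr; rewrite bnd_simp.
case: (leP x0 s) => [x0s|sx0]; case: (leP x0 t) => [x0t|tx0].
- by rewrite (split3 x0 s t)//; ring.
- by move: (le_lt_trans (le_trans x0s st) tx0); rewrite ltxx.
- by rewrite (split3 s x0 t)//; [ring|exact: ltW].
- by rewrite (split3 s t x0)//; [ring|exact: ltW].
Qed.

(** Integration by parts shows that [f] minus any primitive of [y] is orthogonal to all derivatives
    of test functions, hence constant almost everywhere. *)
Lemma duBoisReymond a b f y : eitv a b !=set0 -> loc_integr (eitv a b) f ->
  loc_integr (eitv a b) y ->
  (forall phi, test_fun (eitv a b) phi ->
     \int[mu]_(x in eitv a b) (phi x * y x) = - \int[mu]_(x in eitv a b) (derive1 phi x * f x)) ->
  exists2 F, primitive (eitv a b) F y & {ae mu, forall x, eitv a b x -> f x = F x}.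
Proof.
move=> D0 lf ly H; have [x0 Dx0] := D0.
have [Y pY] := loc_integr_primitive Dx0 ly.
have lY : loc_integr (eitv a b) Y.
  move=> p q Dp Dq; apply: continuous_compact_integrable; first exact: segment_compact.
  apply: continuous_in_subspaceT => x /set_mem xpq; apply: (primitive_continuous pY).
  exact: (eitv_itv Dp Dq).
have [||c Hc] := @duBoisReymond0 a b (fun x => f x - Y x) D0.
- by move=> s t Ds Dt; apply: integrB => //; [exact: lf|exact: lY].
- move=> phi tphi; under eq_Rintegral do rewrite mulrBr.
  have mD := measurable_eitv a b.
  rewrite RintegralB//; [|exact: (test_fun_integrM D0 tphi lf).2|exact: (test_fun_integrM D0 tphi lY).2].
  have := test_fun_by_parts D0 tphi pY; rewrite (H _ tphi) => /oppr_inj ->.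
  by rewrite subrr.
exists (fun x => Y x + c).
  by move=> s t Ds Dt st; have [i e] := pY s t Ds Dt st; split => //; rewrite -e; ring.
by apply: ae_imp Hc => x Hx /Hx <-; rewrite addrC subrK.
Qed.

End DuBoisReymond.

(** * Approximation in L^2 by Steklov averages *)

Section Steklov.
Context {R : realType}.
Implicit Types (f g h F G y : R -> R) (a b : \bar R).

(** Lebesgue measure is determined by its values on half-open intervals, and a shift preserves their
    lengths. *)
Lemma lebesgue_measure_shift (c : R) (A : set R) : measurable A ->
  pushforward mu ((fun x : R => x + c) : _ -> measurableTypeR R) A = mu A.
Proof.
move=> mA; apply/esym/lebesgue_measure_unique => //=.
  by apply: (@continuous_measurable_fun R) => x; apply: cvgD; [exact: cvg_id|exact: cvg_cst].
move=> _ _ [[p q]] _ <-; rewrite /pushforward.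
have -> : (fun x : R => x + c) @^-1` [set` `]p, q]] = [set` `]p - c, q - c]].
  by apply/seteqP; split => x /=; rewrite !in_itv/= ltrBlDr lerBrDr.
rewrite !lebesgue_measure_itv/= !lte_fin ltrD2r.
by case: ifP => // _; rewrite -!EFinB; congr EFin; ring.
Qed.

Lemma Rintegral_shift h (c p q : R) : integr setT h ->
  integr `[p, q] (fun x => h (x + c)) /\
  \int[mu]_(x in `[p, q]) h (x + c) = \int[mu]_(x in `[p + c, q + c]) h x.
Proof.
move=> ih.
pose T : measurableTypeR R -> measurableTypeR R := fun x : R => x + c.
have mT : measurable_fun setT T.
  by apply: (@continuous_measurable_fun R) => x; apply: cvgD; [exact: cvg_id|exact: cvg_cst].
have mh : measurable_fun setT (EFin \o h) by exact: measurable_int ih.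
have E : [set` `[p, q]] = T @^-1` `[p + c, q + c].
  by apply/seteqP; split => x /=; rewrite !in_itv/= !lerD2r.
have I : integr `[p, q] (fun x => h (x + c)).
  apply/integrableP; split.
    by apply: measurable_funTS; exact: (measurableT_comp mh mT).
  rewrite E -(@ge0_integral_pushforward _ _ _ _ _ T mT mu `[p + c, q + c]%classic (fun x => `|(EFin \o h) x|)%E)//=; last first.
    by apply: measurable_funTS; exact: (measurableT_comp (@abse_measurable _ _) mh).
  rewrite (eq_measure_integral mu)/=; last first.
    by move=> A mA _; exact: lebesgue_measure_shift.
  by case/integrableP : (integrS measurableT (measurable_itv `[p + c, q + c]) (@subsetT _ _) ih).
split => //; rewrite /Rintegral; congr fine.
have I' : mu.-integrable (T @^-1` `[p + c, q + c]) ((EFin \o h) \o T) by rewrite -E.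
rewrite E -(integral_pushforward mT mh I')//.
by apply: eq_measure_integral => A mA _; exact: lebesgue_measure_shift.
Qed.

(** The average is taken to the right of [x], so that a support spreads only to the left, by [e];
    this leaves the right bound of the support in place. *)
Definition steklov h (e x : R) : R := e^-1 * \int[mu]_(z in `[x, x + e]) h z.

Lemma integr_cst (c p q : R) : integr `[p, q] (fun=> c).
Proof. by apply: continuous_integr => x; exact: cvg_cst. Qed.

Lemma primitiveZ (D : set R) c F f : primitive D F f ->
  primitive D (fun x => c * F x) (fun x => c * f x).
Proof.
move=> pF s t Ds Dt st; have [i e] := pF s t Ds Dt st.
split; first exact: integrZl.
by rewrite RintegralZl// -e mulrBr.
Qed.

Lemma primitiveD (D : set R) F f G g : primitive D F f -> primitive D G g ->
  primitive D (fun x => F x + G x) (fun x => f x + g x).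
Proof.
move=> pF pG s t Ds Dt st; have [i e] := pF s t Ds Dt st; have [i' e'] := pG s t Ds Dt st.
split; first exact: integrD.
by rewrite RintegralD// -e -e'; ring.
Qed.

Lemma primitiveS (D E : set R) F f : E `<=` D -> primitive D F f -> primitive E F f.
Proof. by move=> ED pF s t /ED Ds /ED Dt; exact: pF. Qed.

Lemma integr_primitive h : integr setT h ->
  primitive setT (fun x => \int[mu]_(z in `]-oo, x]) h z) h.
Proof.
move=> ih s t _ _ st; have i : integr `[s, t] h by exact: integrableS ih.
split => //.
have iy : integr `]-oo, t] h by exact: integrableS ih.
have := @Rintegral_itvB _ h -oo%O (BRight t) s iy.
rewrite !bnd_simp => /(_ isT st) ->.
by rewrite Rintegral_itv_obnd_cbnd//; apply: integrableS i => //; exact: subset_itv_oc_cc.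
Qed.

Lemma steklovE h e x : 0 <= e -> integr setT h ->
  steklov h e x = e^-1 * (\int[mu]_(z in `]-oo, x + e]) h z - \int[mu]_(z in `]-oo, x]) h z).
Proof.
move=> e0 ih; rewrite /steklov.
have xe : x <= x + e by rewrite lerDl.
by rewrite -(integr_primitive ih (I : setT x) (I : setT (x + e)) xe).2.
Qed.

Lemma primitive_steklov h e : 0 <= e -> integr setT h ->
  primitive setT (steklov h e) (fun x => e^-1 * (h (x + e) - h x)).
Proof.
move=> e0 ih; have pP := integr_primitive ih.
rewrite (_ : steklov h e = fun x => e^-1 * (\int[mu]_(z in `]-oo, x + e]) h z +
    (-1) * \int[mu]_(z in `]-oo, x]) h z)); last first.
  by apply/funext => x; rewrite steklovE// mulN1r.
rewrite (_ : (fun x => e^-1 * (h (x + e) - h x)) =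
    (fun x => e^-1 * (h (x + e) + (-1) * h x))); last first.
  by apply/funext => x; rewrite mulN1r.
apply: primitiveZ; apply: primitiveD; last exact: primitiveZ.
move=> s t _ _ st; have [i ->] := Rintegral_shift e s t ih; split => //.
apply: (pP (s + e) (t + e) _ _ _).2 => //.
by rewrite lerD2r.
Qed.

Lemma steklov_out h e s t x : 0 <= e -> (forall x, x \notin `[s, t] -> h x = 0) ->
  x \notin `[s - e, t] -> steklov h e x = 0.
Proof.
move=> e0 h0; rewrite in_itv/= negb_and -!ltNge => xst.
rewrite /steklov; set I := Rintegral _ _ _.
suff -> : I = 0 by rewrite mulr0.
transitivity (\int[mu]_(z in `[x, x + e]) (cst 0 z : R)).
  apply: eq_Rintegral => z /set_mem; rewrite /= in_itv/= => /andP[xz zx].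
  rewrite h0// in_itv/=; apply/negP => /andP[sz zt].
  by case/orP: xst => H; lra.
by rewrite Rintegral_cst// mul0r.
Qed.

Lemma steklov_le h e M x : 0 < e -> integr setT h -> (forall x, `|h x| <= M) ->
  `|steklov h e x| <= M.
Proof.
move=> e0 ih hM; rewrite /steklov normrM gtr0_norm ?invr_gt0//.
rewrite ler_pdivrMl// mulrC.
have i : integr `[x, x + e] h by exact: integrableS ih.
apply: (le_trans (le_normr_Rintegral _ i)) => //.
apply: (@le_trans _ _ (\int[mu]_(z in `[x, x + e]) M)).
  by apply: le_Rintegral => //; [exact: integr_norm|exact: integr_cst].
rewrite Rintegral_cst//= lebesgue_measure_itv/= lte_fin ltrDl e0/=.
by rewrite (addrC x) addrK.
Qed.

(** Lebesgue's differentiation theorem, read along the sequence [d / n.+1] of increments; the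
    exceptional null set does not depend on [d]. *)
Lemma steklov_cvg h : integr setT h ->
  {ae mu, forall x, forall d : R, 0 < d -> steklov h (d / n.+1%:R) x @[n --> \oo] --> h x}.
Proof.
move=> ih.
have lh : locally_integrable setT h by apply: open_integrable_locally => //; exact: openT.
have iy (y : R) : integr `]-oo, y] h by apply: integrableS ih.
have := FTC1Ny iy lh; apply: ae_imp => x [dF FE] d d0.
pose F (y : R) := \int[mu]_(z in `]-oo, y]) h z.
have c : h0^-1 *: (F (h0 *: 1 + x) - F x) @[h0 --> (0 : R)^'] --> h x.
  rewrite -FE derive1E; exact: dF.
have c0 : d / n.+1%:R @[n --> \oo] --> (0 : R).
  rewrite -(mulr0 d); apply: cvgM; [exact: cvg_cst|exact: cvg_harmonic].
have d1 n : d / n.+1%:R != 0 by rewrite gt_eqF// divr_gt0.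
have := (cvgr_dnbhsP _ _ _).1 c (fun n => d / n.+1%:R) (conj d1 c0).
rewrite (_ : (fun n => _) = (fun n => steklov h (d / n.+1%:R) x))//.
apply/funext => n; rewrite steklovE//; last by rewrite divr_ge0// ltW.
by rewrite [_ *: 1]mulr1 [_ + x]addrC.
Qed.

(** [eps] bounds the square of the distance, which accounts for the factors 2 in
    [l2_close_trans]. *)
Definition l2_close (D : set R) (u v : R -> R) (eps : R) :=
  integr D (fun x => (u x - v x) ^+ 2) /\ \int[mu]_(x in D) (u x - v x) ^+ 2 <= eps.

Lemma l2_close_trans (D : set R) (u v w : R -> R) (e1 e2 : R) : measurable D ->
  measurable_fun D u -> measurable_fun D v -> measurable_fun D w ->
  l2_close D u v e1 -> l2_close D v w e2 -> l2_close D u w (2 * e1 + 2 * e2).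
Proof.
move=> mD mu_ mv mw [i1 h1] [i2 h2].
have le x : (u x - w x) ^+ 2 <= 2 * (u x - v x) ^+ 2 + 2 * (v x - w x) ^+ 2.
  have := sqr_ge0 (u x - v x - (v x - w x)); nra.
have i : integr D (fun x => 2 * (u x - v x) ^+ 2 + 2 * (v x - w x) ^+ 2).
  by apply: integrD => //; exact: integrZl.
have i' : integr D (fun x => (u x - w x) ^+ 2).
  apply: (le_integr mD _ _ i).
    by apply: measurable_funX; exact: measurable_funB.
  by move=> x _; rewrite ger0_norm ?sqr_ge0.
split => //; apply: (@le_trans _ _ (\int[mu]_(x in D) (2 * (u x - v x) ^+ 2 + 2 * (v x - w x) ^+ 2))).
  by apply: le_Rintegral => // x _; exact: le.
rewrite RintegralD//; [|exact: integrZl|exact: integrZl].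
rewrite !RintegralZl//; lra.
Qed.

Lemma l2_close_dct (D : set R) (u_ : nat -> R -> R) (u g : R -> R) (eps : R) : measurable D ->
  (forall n, measurable_fun D (u_ n)) -> measurable_fun D u ->
  {ae mu, forall x, D x -> u_ n x @[n --> \oo] --> u x} ->
  integr D g -> (forall n x, D x -> (u_ n x - u x) ^+ 2 <= g x) -> 0 < eps ->
  exists n, l2_close D (u_ n) u eps.
Proof.
move=> mD mu_ mu0 cu ig ug e0.
have mu2 n : measurable_fun D (fun x => (u_ n x - u x) ^+ 2).
  by apply: measurable_funX; exact: measurable_funB.
have : \int[mu]_(x in D) (u_ n x - u x) ^+ 2 @[n --> \oo] --> \int[mu]_(x in D) (cst 0 x : R).
  apply: (@Rintegral_dct _ _ _ _ g) => //.
    apply: ae_imp cu => x cu Dx.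
    rewrite [X in _ --> X](_ : _ = (u x - u x) * (u x - u x)); last by rewrite subrr mul0r.
    under eq_fun do rewrite expr2.
    by apply: cvgM; apply: cvgB; [exact: cu|exact: cvg_cst|exact: cu|exact: cvg_cst].
  by move=> n x Dx; rewrite ger0_norm ?sqr_ge0 ?ug.
rewrite (_ : \int[mu]_(x in D) (cst 0 x : R) = 0); last by rewrite Rintegral_cst// mul0r.
move=> /cvgr0Pnorm_le /(_ _ e0) [N _ /(_ N (leqnn N))] /= le.
exists N; split; last by apply: le_trans (ler_norm _) le.
by apply: (le_integr mD (mu2 N) _ ig) => x Dx; rewrite ger0_norm ?sqr_ge0 ?ug.
Qed.

(** The primitive of [h ^+ 2] has limits at both ends of the interval. Choosing [s] and [t] where it
    is within [eps / 2] of them leaves at most [eps] outside [[s, t]]. *)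
Lemma l2_tail a b h eps : eitv a b !=set0 -> measurable_fun (eitv a b) h ->
  integr (eitv a b) (fun x => h x ^+ 2) -> 0 < eps ->
  exists s t, [/\ eitv a b s, eitv a b t, s <= t &
    l2_close (eitv a b) (h \_ `[s, t]) h eps].
Proof.
move=> [x0 Dx0] mh ih e0.
have mD := measurable_eitv a b.
pose k x := h x ^+ 2.
have lk : loc_integr (eitv a b) k.
  by move=> p q Dp Dq; apply: integrableS ih => //; exact: eitv_itv.
have [K pK] := loc_integr_primitive Dx0 lk.
have e2 : 0 < eps / 2 by rewrite divr_gt0.
have cr := primitive_cvg_right Dx0 pK ih; have cl := primitive_cvg_left Dx0 pK ih.
set r := (X in _ --> X) in cr; set l := (X in _ --> X) in cl.
have [t [Dt xt] tr] : exists2 t, eitv a b t /\ x0 < t & `|r - K t| < eps / 2.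
  have /cvgrPdist_lt/(_ _ e2) H := cr.
  by have [t [? ?]] := filter_ex (filterI (near_end_right Dx0) H); exists t.
have [s [Ds sx] sl] : exists2 s, eitv a b s /\ s < x0 & `|l - K s| < eps / 2.
  have /cvgrPdist_lt/(_ _ e2) H := cl.
  by have [s [? ?]] := filter_ex (filterI (near_end_left Dx0) H); exists s.
have st : s <= t by rewrite ltW// (lt_trans sx).
exists s, t; split => //.
have E x : ((h \_ `[s, t]) x - h x) ^+ 2 = k x - (k \_ `[s, t]) x.
  by rewrite !patchE /k; case: ifPn => _; rewrite ?subrr ?expr0n/= ?sub0r ?sqrrN ?subr0.
have i1 : integr (eitv a b) (k \_ `[s, t]).
  apply: (@integrS _ setT) => //.
  by rewrite -restrict_EFin -integrable_mkcond//; exact: lk.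
split; first by apply: eq_integr (integrB mD ih i1) => // x _; rewrite E.
under eq_Rintegral do rewrite E.
rewrite RintegralB// -Rintegral_mkcondr setIidr; last exact: eitv_itv.
rewrite -(pK s t Ds Dt st).2 (primitive_total (ex_intro _ _ Dx0) pK ih cl cr).
move: tr sl; rewrite !ltr_norml => /andP[_ H1] /andP[H2 _].
by rewrite -/l -/r; lra.
Qed.

Lemma measurable_trunc (D : set R) h (n : R) : measurable D -> measurable_fun D h ->
  measurable_fun D (fun x => if `|h x| <= n then h x else 0).
Proof.
move=> mD mh; apply: measurable_fun_if => //.
- apply: (measurable_fun_ler (f := fun x => `|h x|)) => //.
  exact: measurableT_comp.
- by apply: measurable_funS mh => //; exact: subIsetl.
Qed.

Lemma l2_trunc (D : set R) h eps : measurable D -> measurable_fun D h ->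
  integr D (fun x => h x ^+ 2) -> 0 < eps ->
  exists n : nat, l2_close D (h \_ [set x | `|h x| <= n%:R]) h eps.
Proof.
move=> mD mh ih e0.
apply: (l2_close_dct (u_ := fun n => h \_ [set x | `|h x| <= n%:R]) mD _ mh _ ih _ e0).
- move=> n.
  rewrite (_ : _ \_ _ = fun x => if `|h x| <= n%:R then h x else 0); last first.
    by apply/funext => x; rewrite patchE; congr (if _ then _ else _); apply/idP/idP; rewrite inE.
  exact: measurable_trunc.
- apply: nearW => x Dx; apply: (@cvg_near_cst _ R).
  near=> n; rewrite patchE ifT// inE/=.
  by near: n; apply: nbhs_infty_ger.
- move=> n x _; rewrite patchE; case: ifP => _.
    by rewrite subrr expr0n/= sqr_ge0.
  by rewrite sub0r sqrrN.
Unshelve. all: by end_near. Qed.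

(** Boundedness and compact support of [h] provide constant majorants on [[s', t]], both for the
    convergence of the averages and for the difference quotient [f]. The widths are at most
    [s - s'], so that the averages stay supported inside the interval. *)
Lemma l2_steklov a b s t h (M : R) eps : eitv a b s -> eitv a b t -> s <= t ->
  measurable_fun setT h -> (forall x, `|h x| <= M) -> (forall x, x \notin `[s, t] -> h x = 0) ->
  0 < eps -> exists F f s', [/\ eitv a b s', s' <= s, primitive (eitv a b) F f,
    measurable_fun setT f & integr (eitv a b) (fun x => f x ^+ 2)] /\
    [/\ forall x, x \notin `[s', t] -> F x = 0 /\ f x = 0,
      measurable_fun setT F & l2_close (eitv a b) F h eps].
Proof.
move=> Ds Dt st mh hM h0 e0.
have mD := measurable_eitv a b.
have M0 : 0 <= M by exact: le_trans (normr_ge0 _) (hM s).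
have ih : integr setT h.
  apply: (integr_support (s := s) (t := t)) => //.
  by apply: (le_integr _ _ (fun x _ => hM x)) => //; [exact: measurable_funTS|exact: integr_cst].
have [s' [_ [Ds' _ /andP[s's _]]]] := eitv_ex Ds.
pose d := s - s'; have d0 : 0 < d by rewrite subr_gt0.
pose e n : R := d / n.+1%:R.
have en0 n : 0 < e n by rewrite divr_gt0.
have end_ n : e n <= d by rewrite ler_pdivrMr//; apply: ler_peMr; [exact: ltW|rewrite ler1n].
have out n x : x \notin `[s', t] -> x \notin `[s - e n, t].
  apply: contra; rewrite !in_itv/= => /andP[sx ->]; rewrite andbT.
  by have := end_ n; rewrite /d; lra.
have pF n := primitive_steklov (ltW (en0 n)) ih.
have mF n : measurable_fun setT (steklov h (e n)).
  apply: continuous_measurable_fun => x.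
  apply: (@primitive_continuous _ -oo%E +oo%E _ _ x (primitiveS (@subsetT _ _) (pF n))).
  by rewrite /eitv/= ltNyr ltry.
have iM (c : R) : integr (eitv a b) (fun x => (cst c \_ `[s', t]) x).
  apply: (@integrS _ setT) => //.
  by rewrite -restrict_EFin -integrable_mkcond//; exact: integr_cst.
have [|||| n cn] := l2_close_dct (D := eitv a b) (u_ := fun n => steklov h (e n)) (u := h)
    (g := cst ((2 * M) ^+ 2) \_ `[s', t]) mD _ _ _ (iM _) _ e0.
- by move=> n; exact: measurable_funTS.
- exact: measurable_funTS.
- by apply: ae_imp (steklov_cvg ih) => x H _; exact: H.
(* Neither [h] nor its averages exceed [M] in absolute value, so their difference is at most
   [2 * M]; outside [[s', t]] both vanish. *)
- move=> n x _; rewrite patchE; case: ifPn => xst.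
    rewrite -real_normK ?num_real// lerXn2r ?nnegrE ?mulr_ge0//.
    apply: (le_trans (ler_normB _ _)).
    have := steklov_le x (en0 n) ih hM; have := hM x; lra.
  have {}xst : x \notin `[s', t] by apply/negP => H; move/negP: xst; apply; exact/mem_set.
  rewrite (steklov_out (ltW (en0 n)) h0) ?out// h0 ?subrr ?expr0n//.
  apply: contra xst; rewrite !in_itv/= => /andP[sx ->]; rewrite andbT.
  by rewrite (le_trans _ sx)// ltW.
exists (steklov h (e n)), (fun x => (e n)^-1 * (h (x + e n) - h x)), s'.
have f0 x : x \notin `[s', t] -> (e n)^-1 * (h (x + e n) - h x) = 0.
  move=> /(out n); rewrite in_itv/= negb_and -!ltNge => H.
  have En := en0 n.
  have h1 : h (x + e n) = 0.
    by rewrite h0// in_itv/= negb_and -!ltNge; apply/orP; case/orP: H => H; [left|right]; lra.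
  have h2 : h x = 0.
    by rewrite h0// in_itv/= negb_and -!ltNge; apply/orP; case/orP: H => H; [left|right]; lra.
  by rewrite h1 h2 subrr mulr0.
have mf : measurable_fun setT (fun x : R => (e n)^-1 * (h (x + e n) - h x)).
  apply: measurable_funM => //; apply: measurable_funB => //.
  apply: (measurableT_comp mh).
  by apply: continuous_measurable_fun => x; apply: cvgD; [exact: cvg_id|exact: cvg_cst].
split; split => //; first exact: ltW.
- exact: primitiveS (pF n).
- apply: (le_integr mD _ _ (iM (((e n)^-1 * (2 * M)) ^+ 2))).
    by apply: measurable_funTS; exact: measurable_funX.
  move=> x _; rewrite patchE; case: ifPn => xst.
    have ei : 0 <= (e n)^-1 by rewrite invr_ge0 ltW.
    rewrite normrX lerXn2r ?nnegrE ?mulr_ge0//.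
    rewrite normrM ger0_norm//; apply: ler_wpM2l => //.
    apply: (le_trans (ler_normB _ _)).
    have := hM x; have := hM (x + e n); lra.
  rewrite f0 ?expr0n ?normr0//.
  by apply/negP => H; move/negP: xst; apply; exact/mem_set.
- move=> x xst; split; last exact: f0.
  exact: (steklov_out (ltW (en0 n)) h0 (out n x xst)).
Qed.

Lemma l2_approx a b h eps : eitv a b !=set0 -> measurable_fun (eitv a b) h ->
  integr (eitv a b) (fun x => h x ^+ 2) -> 0 < eps ->
  exists F f s t, [/\ eitv a b s, eitv a b t, primitive (eitv a b) F f,
    measurable_fun setT f & integr (eitv a b) (fun x => f x ^+ 2)] /\
    [/\ forall x, x \notin `[s, t] -> F x = 0 /\ f x = 0,
      measurable_fun setT F & l2_close (eitv a b) F h eps].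
Proof.
move=> D0 mh ih e0; have mD := measurable_eitv a b.
(* Truncation and cutting off cost [eps / 16] each, averaging [eps / 4]. Two uses of
   [l2_close_trans] give [2 * (eps / 4) + 2 * (2 * (eps / 16) + 2 * (eps / 16)) = eps]. *)
have e8 : 0 < eps / 16 by rewrite divr_gt0.
have e4 : 0 < eps / 4 by rewrite divr_gt0.
have [n cn] := l2_trunc mD mh ih e8.
set h1 := h \_ _ in cn.
have h1E x : h1 x = if `|h x| <= n%:R then h x else 0.
  by rewrite /h1 patchE; congr (if _ then _ else _); apply/idP/idP; rewrite inE.
have mh1 : measurable_fun (eitv a b) h1.
  rewrite (_ : h1 = fun x => if `|h x| <= n%:R then h x else 0); last exact/funext.
  exact: measurable_trunc.
have ih1 : integr (eitv a b) (fun x => h1 x ^+ 2).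
  apply: (le_integr mD _ _ ih); first exact: measurable_funX.
  by move=> x _; rewrite ger0_norm ?sqr_ge0// h1E; case: ifP => // _; rewrite expr0n/= sqr_ge0.
have [s [t [Ds Dt st ct]]] := l2_tail D0 mh1 ih1 e8.
have mh2 : measurable_fun setT (h1 \_ `[s, t]).
  apply/(measurable_restrictT _ _).1 => //.
  by apply: measurable_funS mh1 => //; exact: eitv_itv.
have [F [f [s' [[Ds' s's pF mf if2] [out mF cF]]]]] := l2_steklov (M := n%:R) (h := h1 \_ `[s, t]) Ds Dt st mh2
  (ltac:(move=> x; rewrite patchE; case: ifP => _; rewrite ?normr0// h1E; case: ifP => //; rewrite normr0//))
  (ltac:(move=> x xst; rewrite patchE ifF//; apply/negP => /set_mem H; move/negP: xst; exact)) e4.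
exists F, f, s', t; split; split => //.
have mF' : measurable_fun (eitv a b) F by exact: measurable_funTS.
have mh2' : measurable_fun (eitv a b) (h1 \_ `[s, t]) by exact: measurable_funTS.
have := l2_close_trans mD mF' mh2' mh cF (l2_close_trans mD mh2' mh1 mh ct cn).
by rewrite (_ : 2 * _ + 2 * _ = eps); last by field.
Qed.

End Steklov.

(** * Functions with square integrable derivative *)

Section SquareIntegrable.
Context {R : realType}.
Implicit Types (u v : R -> R) (D : set R).

Definition sqint D u := measurable_fun D u /\ integr D (fun x => u x ^+ 2).

Lemma sqintM D u v : measurable D -> sqint D u -> sqint D v ->
  integr D (fun x => u x * v x).
Proof.
move=> mD [mu_ iu] [mv iv].
apply: (le_integr mD _ _ (integrD mD iu iv)); first exact: measurable_funM.
move=> x _; rewrite normrM -(real_normK (num_real (u x))) -(real_normK (num_real (v x))).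
have := sqr_ge0 (`|u x| - `|v x|); have := normr_ge0 (u x); have := normr_ge0 (v x); nra.
Qed.

Lemma sqintD D u v : measurable D -> sqint D u -> sqint D v ->
  sqint D (fun x => u x + v x).
Proof.
move=> mD su sv; have iuv := sqintM mD su sv; move: su sv => [mu_ iu] [mv iv].
split; first exact: measurable_funD.
by apply: eq_integr (integrD mD (integrD mD iu iv) (integrZl 2 mD iuv)) => // x _; ring.
Qed.

Lemma sqintZ D (c : R) u : measurable D -> sqint D u -> sqint D (fun x => c * u x).
Proof.
move=> mD [mu_ iu]; split; first exact: measurable_funM.
by apply: eq_integr (integrZl (c ^+ 2) mD iu) => // x _; ring.
Qed.

Lemma sqint_integr_bounded D u : measurable D -> (mu D < +oo)%E -> sqint D u -> integr D u.
Proof.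
move=> mD foo [mu_ iu].
have i1 : integr D (fun=> 1).
  apply: measurable_bounded_integrable => //.
  by exists 1; split; [exact: num_real|move=> z cz t _ /=; rewrite normr1 ltW].
apply: (le_integr mD mu_ _ (integrD mD i1 iu)) => x _.
rewrite -(real_normK (num_real (u x))).
have := sqr_ge0 (`|u x| - 1); have := normr_ge0 (u x); nra.
Qed.

Lemma sqint_loc a b u : sqint (eitv a b) u -> loc_integr (eitv a b) u.
Proof.
move=> [mu_ iu] s t Ds Dt; apply: sqint_integr_bounded => //.
  by rewrite /= lebesgue_measure_itv/=; case: ifP => //= _; rewrite ltry.
split; first by apply: measurable_funS mu_ => //; [exact: measurable_eitv|exact: eitv_itv].
by apply: integrS iu => //; [exact: measurable_eitv|exact: eitv_itv].
Qed.

Lemma eq_Rintegral_ae D u v : measurable D -> measurable_fun D u -> measurable_fun D v ->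
  {ae mu, forall x, D x -> u x = v x} -> \int[mu]_(x in D) u x = \int[mu]_(x in D) v x.
Proof.
move=> mD mu_ mv uv; rewrite /Rintegral; congr fine.
apply: ae_eq_integral => //; try exact/measurable_EFinP.
by apply: ae_imp uv => x /= H /H ->.
Qed.

Lemma eq_integr_ae D u v : measurable D -> measurable_fun D v ->
  {ae mu, forall x, D x -> u x = v x} -> integr D u -> integr D v.
Proof.
move=> mD mv uv /integrableP[mu_ fin]; apply/integrableP; split; first exact/measurable_EFinP.
suff <- : (\int[mu]_(x in D) `|(EFin \o u) x| = \int[mu]_(x in D) `|(EFin \o v) x|)%E by [].
apply: ge0_ae_eq_integral => //.
- by apply: measurableT_comp.
- by apply: measurableT_comp => //; exact/measurable_EFinP.
- by apply: ae_imp uv => x /= H /H ->.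
Qed.

Lemma eq_sqint_ae D u v : measurable D -> measurable_fun D v ->
  {ae mu, forall x, D x -> u x = v x} -> sqint D u -> sqint D v.
Proof.
move=> mD mv uv [_ iu]; split => //.
apply: eq_integr_ae iu => //; first exact: measurable_funX.
by apply: ae_imp uv => x H /H ->.
Qed.

(** Membership in the Sobolev space [H^1] of the interval. The derivative is carried along as data,
    being determined only almost everywhere. *)
Definition h1pair a b u u' :=
  [/\ primitive (eitv a b) u u', sqint (eitv a b) u & sqint (eitv a b) u'].

Lemma h1pairM a b u u' v v' : h1pair a b u u' -> h1pair a b v v' ->
  let k x := u' x * v x + u x * v' x in
  [/\ primitive (eitv a b) (fun x => u x * v x) k,
      integr (eitv a b) (fun x => u x * v x) & integr (eitv a b) k].
Proof.
move=> [pu su su'] [pv sv sv']; have mD := measurable_eitv a b.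
split; [by apply: primitiveM => //; exact: is_interval_eitv|exact: sqintM|].
by apply: integrD => //; exact: sqintM.
Qed.

(** This is [primitive_bound] for [u ^+ 2], whose derivative [2 * u * u'] is dominated by
    [u ^+ 2 + u' ^+ 2]. *)
Lemma h1pair_bound a b u u' x y d s : h1pair a b u u' ->
  0 < d -> eitv a b x -> eitv a b y -> d <= y - x -> eitv a b s ->
  u s ^+ 2 <= (2 / d + 1) * (\int[mu]_(t in eitv a b) u t ^+ 2 +
                             \int[mu]_(t in eitv a b) u' t ^+ 2).
Proof.
move=> hu d0 Dx Dy dxy Ds; have [pu [mu_ iu] [mu' iu']] := hu.
have mD := measurable_eitv a b.
have [pk iK ik] := h1pairM hu hu.
have := primitive_bound pk iK ik d0 Dx Dy dxy Ds.
rewrite -expr2 ger0_norm ?sqr_ge0// => /le_trans; apply.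
under eq_Rintegral do rewrite -expr2 ger0_norm ?sqr_ge0//.
set I := \int[mu]_(t in eitv a b) u t ^+ 2.
set J := \int[mu]_(t in eitv a b) u' t ^+ 2.
have J0 : 0 <= J by apply: Rintegral_ge0 => t _; exact: sqr_ge0.
have I0 : 0 <= I by apply: Rintegral_ge0 => t _; exact: sqr_ge0.
have d2 : 0 <= 2 / d by rewrite divr_ge0// ltW.
have : \int[mu]_(t in eitv a b) `|u' t * u t + u t * u' t| <= I + J.
  rewrite -RintegralD//; apply: le_Rintegral => //; [exact: integr_norm|exact: integrD|].
  move=> t _; rewrite ler_norml; apply/andP; split.
    have := sqr_ge0 (u t + u' t); nra.
  have := sqr_ge0 (u t - u' t); nra.
nra.
Qed.

(** Square integrability of [u'] gives integrability only on sets of finite measure; the part of the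
    interval between the finite end [a] and an interior point is one. *)
Lemma h1pair_cvg_left (a : R) b u u' : eitv a%:E b !=set0 -> h1pair a%:E b u u' ->
  exists l : R, u x @[x --> a^'+] --> l.
Proof.
move=> [s Ds] [pu su su'].
have [p [_ [Dp _ /andP[ps _]]]] := eitv_ex Ds.
have sub : eitv a%:E s%:E `<=` eitv a%:E b.
  move=> x /andP[ax xs]; rewrite /eitv/= ax/=; case/andP: Ds => _.
  exact: lt_trans.
have Dp' : eitv a%:E s%:E p.
  by apply/andP; split; [case/andP: Dp|rewrite lte_fin].
have iu' : integr (eitv a%:E s%:E) u'.
  apply: sqint_integr_bounded; first exact: measurable_eitv.
    rewrite (_ : eitv _ _ = [set` `]a, s[]); last first.
      by apply/seteqP; split => x /=; rewrite /eitv/= in_itv/= !lte_fin.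
    by rewrite lebesgue_measure_itv/=; case: ifP => //= _; rewrite ltry.
  case: su' => m i; split; first by apply: measurable_funS m => //; exact: measurable_eitv.
  by apply: integrS i => //; exact: measurable_eitv.
by eexists; exact: (primitive_cvg_left Dp' (primitiveS sub pu) iu').
Qed.

Lemma h1pair_cvg_right a (b : R) u u' : eitv a b%:E !=set0 -> h1pair a b%:E u u' ->
  exists l : R, u x @[x --> b^'-] --> l.
Proof.
move=> [s Ds] [pu su su'].
have [_ [p [_ Dp /andP[_ sp]]]] := eitv_ex Ds.
have sub : eitv s%:E b%:E `<=` eitv a b%:E.
  move=> x /andP[ax xs]; rewrite /eitv/= xs andbT; case/andP: Ds => h _.
  exact: lt_trans ax.
have Dp' : eitv s%:E b%:E p.
  by apply/andP; split; [rewrite lte_fin|case/andP: Dp].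
have iu' : integr (eitv s%:E b%:E) u'.
  apply: sqint_integr_bounded; first exact: measurable_eitv.
    rewrite (_ : eitv _ _ = [set` `]s, b[]); last first.
      by apply/seteqP; split => x /=; rewrite /eitv/= in_itv/= !lte_fin.
    by rewrite lebesgue_measure_itv/=; case: ifP => //= _; rewrite ltry.
  case: su' => m i; split; first by apply: measurable_funS m => //; exact: measurable_eitv.
  by apply: integrS i => //; exact: measurable_eitv.
by eexists; exact: (primitive_cvg_right Dp' (primitiveS sub pu) iu').
Qed.

End SquareIntegrable.

(** * Complex-valued functions, reduced to real and imaginary parts *)

Section ComplexFunctions.
Context {R : realType}.
Local Notation C := R[i].
Local Notation re := (@complex.Re R).
Local Notation im := (@complex.Im R).
Implicit Types (x y c : C) (D : set R) (a b : \bar R) (F f G g K k : R -> C).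

Lemma complex_ext x y : re x = re y -> im x = im y -> x = y.
Proof. by case: x y => [? ?] [? ?] /= -> ->. Qed.

Lemma reD x y : re (x + y) = re x + re y. Proof. by case: x y => [? ?] []. Qed.
Lemma imD x y : im (x + y) = im x + im y. Proof. by case: x y => [? ?] []. Qed.
Lemma reN x : re (- x) = - re x. Proof. by case: x. Qed.
Lemma imN x : im (- x) = - im x. Proof. by case: x. Qed.
Lemma reM x y : re (x * y) = re x * re y - im x * im y. Proof. by case: x y => [? ?] []. Qed.
Lemma imM x y : im (x * y) = re x * im y + im x * re y. Proof. by case: x y => [? ?] []. Qed.
Lemma re_conj x : re (Num.conj x) = re x. Proof. by case: x. Qed.
Lemma im_conj x : im (Num.conj x) = - im x. Proof. by case: x. Qed.
Lemma re_sum I (s : seq I) (h : I -> C) : re (\sum_(i <- s) h i) = \sum_(i <- s) re (h i).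
Proof. by apply: big_morph => //; exact: reD. Qed.

Definition reimE := (reD, imD, reN, imN, reM, imM, re_conj, im_conj).

Definition cintegr D f := integr D (re \o f) /\ integr D (im \o f).
Definition csqint D f := sqint D (re \o f) /\ sqint D (im \o f).
Definition cprimitive D F f :=
  primitive D (re \o F) (re \o f) /\ primitive D (im \o F) (im \o f).
Definition cloc_integr D f := loc_integr D (re \o f) /\ loc_integr D (im \o f).

Lemma cintegrD D f g : measurable D -> cintegr D f -> cintegr D g ->
  cintegr D (fun t => f t + g t).
Proof.
move=> mD [f1 f2] [g1 g2]; split.
  by apply: eq_integr (integrD mD f1 g1) => // t _ /=; rewrite reD.
by apply: eq_integr (integrD mD f2 g2) => // t _ /=; rewrite imD.
Qed.

Lemma cintegrZ D c f : measurable D -> cintegr D f -> cintegr D (fun t => c * f t).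
Proof.
move=> mD [f1 f2]; split.
  by apply: eq_integr (integrB mD (integrZl (re c) mD f1) (integrZl (im c) mD f2)) => // t _ /=;
    rewrite reM.
by apply: eq_integr (integrD mD (integrZl (re c) mD f2) (integrZl (im c) mD f1)) => // t _ /=;
    rewrite imM.
Qed.

Lemma cintegralD D f g : measurable D -> cintegr D f -> cintegr D g ->
  cintegral D (fun t => f t + g t) = cintegral D f + cintegral D g.
Proof.
move=> mD [f1 f2] [g1 g2]; apply: complex_ext; rewrite ?reD ?imD /=.
  by rewrite -RintegralD//; apply: eq_Rintegral => t _; rewrite reD.
by rewrite -RintegralD//; apply: eq_Rintegral => t _; rewrite imD.
Qed.

Lemma cintegralZ D c f : measurable D -> cintegr D f ->
  cintegral D (fun t => c * f t) = c * cintegral D f.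
Proof.
move=> mD [f1 f2]; apply: complex_ext; rewrite ?reM ?imM /=.
  rewrite -!RintegralZl// -RintegralB//; [|exact: integrZl|exact: integrZl].
  by apply: eq_Rintegral => t _; rewrite reM.
rewrite -!RintegralZl// -RintegralD//; [|exact: integrZl|exact: integrZl].
by apply: eq_Rintegral => t _; rewrite imM.
Qed.

Lemma cintegral_conj D f : measurable D -> cintegr D f ->
  cintegral D (fun t => Num.conj (f t)) = Num.conj (cintegral D f).
Proof.
move=> mD [f1 f2]; apply: complex_ext; rewrite ?re_conj ?im_conj /=.
  by apply: eq_Rintegral => t _; rewrite re_conj.
rewrite -[RHS]mulN1r -RintegralZl//; apply: eq_Rintegral => t _.
by rewrite im_conj mulN1r.
Qed.

Lemma eq_cintegral_ae D f g : measurable D -> cmeasurable D f -> cmeasurable D g ->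
  {ae mu, forall t, D t -> f t = g t} -> cintegral D f = cintegral D g.
Proof.
move=> mD [f1 f2] [g1 g2] fg; apply: complex_ext => /=; apply: eq_Rintegral_ae => //.
  by apply: ae_imp fg => t H /H ->.
by apply: ae_imp fg => t H /H ->.
Qed.

Lemma csqint_meas D f : csqint D f -> cmeasurable D f.
Proof. by move=> [[? _] [? _]]. Qed.

Lemma eq_csqint_ae D f g : measurable D -> cmeasurable D g ->
  {ae mu, forall t, D t -> f t = g t} -> csqint D f -> csqint D g.
Proof.
move=> mD [g1 g2] fg [s1 s2]; split; [apply: eq_sqint_ae s1|apply: eq_sqint_ae s2] => //.
  by apply: ae_imp fg => t H /H /= ->.
by apply: ae_imp fg => t H /H /= ->.
Qed.

Lemma csqintD D f g : measurable D -> csqint D f -> csqint D g ->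
  csqint D (fun t => f t + g t).
Proof.
move=> mD [f1 f2] [g1 g2]; split.
  rewrite (_ : _ \o _ = (fun t => re (f t) + re (g t))); first exact: sqintD.
  by apply/funext => t /=; rewrite reD.
rewrite (_ : _ \o _ = (fun t => im (f t) + im (g t))); first exact: sqintD.
by apply/funext => t /=; rewrite imD.
Qed.

Lemma csqintZ D c f : measurable D -> csqint D f -> csqint D (fun t => c * f t).
Proof.
move=> mD [f1 f2]; split.
  rewrite (_ : _ \o _ = (fun t => re c * re (f t) + (- im c) * im (f t))).
    by apply: sqintD => //; exact: sqintZ.
  by apply/funext => t /=; rewrite reM mulNr.
rewrite (_ : _ \o _ = (fun t => re c * im (f t) + im c * re (f t))).
  by apply: sqintD => //; exact: sqintZ.
by apply/funext => t /=; rewrite imM.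
Qed.

Lemma csqint0 D : csqint D (fun=> 0).
Proof.
suff : sqint D (fun=> 0 : R) by [].
split; first exact: measurable_cst.
rewrite (_ : _ \o _ = cst 0%E); first exact: integrable0.
by apply/funext => t /=; rewrite expr0n.
Qed.

Lemma csqint_sum D I (s : seq I) (h : I -> R -> C) : measurable D ->
  (forall i, csqint D (h i)) -> csqint D (fun t => \sum_(i <- s) h i t).
Proof.
move=> mD hs; elim: s => [|i s IH].
  by under eq_fun do rewrite big_nil; exact: csqint0.
by under eq_fun do rewrite big_cons; exact: csqintD.
Qed.

Lemma csqintM D f g : measurable D -> csqint D f -> csqint D g ->
  cintegr D (fun t => Num.conj (f t) * g t).
Proof.
move=> mD [f1 f2] [g1 g2]; split.
  apply: eq_integr (integrD mD (sqintM mD f1 g1) (sqintM mD f2 g2)) => // t _ /=.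
  by rewrite !reimE mulNr opprK.
apply: eq_integr (integrB mD (sqintM mD f1 g2) (sqintM mD f2 g1)) => // t _ /=.
by rewrite !reimE mulNr.
Qed.

Lemma primitive_cst D (r : R) : primitive D (fun=> r) (fun=> 0).
Proof.
move=> s t _ _ _; split; first exact: integr_cst.
by rewrite Rintegral_cst// mul0r subrr.
Qed.

Lemma cprimitiveD D F f G g : cprimitive D F f -> cprimitive D G g ->
  cprimitive D (fun t => F t + G t) (fun t => f t + g t).
Proof.
move=> [F1 F2] [G1 G2]; split.
  rewrite (_ : _ \o _ = fun t => re (F t) + re (G t)); last by apply/funext => t /=; rewrite reD.
  rewrite (_ : _ \o _ = fun t => re (f t) + re (g t)); last by apply/funext => t /=; rewrite reD.
  exact: primitiveD.
rewrite (_ : _ \o _ = fun t => im (F t) + im (G t)); last by apply/funext => t /=; rewrite imD.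
rewrite (_ : _ \o _ = fun t => im (f t) + im (g t)); last by apply/funext => t /=; rewrite imD.
exact: primitiveD.
Qed.

Lemma cprimitiveZ D c F f : cprimitive D F f ->
  cprimitive D (fun t => c * F t) (fun t => c * f t).
Proof.
move=> [F1 F2]; split.
  rewrite (_ : _ \o _ = fun t => re c * re (F t) + (- im c) * im (F t)); last first.
    by apply/funext => t /=; rewrite reM mulNr.
  rewrite (_ : _ \o _ = fun t => re c * re (f t) + (- im c) * im (f t)); last first.
    by apply/funext => t /=; rewrite reM mulNr.
  by apply: primitiveD; exact: primitiveZ.
rewrite (_ : _ \o _ = fun t => re c * im (F t) + im c * re (F t)); last first.
  by apply/funext => t /=; rewrite imM.
rewrite (_ : _ \o _ = fun t => re c * im (f t) + im c * re (f t)); last first.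
  by apply/funext => t /=; rewrite imM.
by apply: primitiveD; exact: primitiveZ.
Qed.

Lemma cprimitive_sum D I (s : seq I) (H h : I -> R -> C) :
  (forall i, cprimitive D (H i) (h i)) ->
  cprimitive D (fun t => \sum_(i <- s) H i t) (fun t => \sum_(i <- s) h i t).
Proof.
move=> hs; elim: s => [|i s IH].
  under eq_fun do rewrite big_nil; under [X in cprimitive _ _ X]eq_fun do rewrite big_nil.
  by split; exact: primitive_cst.
under eq_fun do rewrite big_cons; under [X in cprimitive _ _ X]eq_fun do rewrite big_cons.
exact: cprimitiveD.
Qed.

(* the functions to which the fundamental theorem of calculus applies up to
   the ends of the interval *)
Definition w11pair a b K k :=
  [/\ cprimitive (eitv a b) K k, cintegr (eitv a b) K & cintegr (eitv a b) k].

Definition ch1pair a b F f :=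
  [/\ cprimitive (eitv a b) F f, csqint (eitv a b) F & csqint (eitv a b) f].

Lemma w11pairD a b K k K' k' : w11pair a b K k -> w11pair a b K' k' ->
  w11pair a b (fun t => K t + K' t) (fun t => k t + k' t).
Proof.
move=> [p1 i1 j1] [p2 i2 j2]; have mD := measurable_eitv a b.
by split; [exact: cprimitiveD|exact: cintegrD|exact: cintegrD].
Qed.

Lemma w11pairZ a b c K k : w11pair a b K k ->
  w11pair a b (fun t => c * K t) (fun t => c * k t).
Proof.
move=> [p1 i1 j1]; have mD := measurable_eitv a b.
by split; [exact: cprimitiveZ|exact: cintegrZ|exact: cintegrZ].
Qed.

Lemma w11pair_sum a b I (s : seq I) (H h : I -> R -> C) :
  (forall i, w11pair a b (H i) (h i)) ->
  w11pair a b (fun t => \sum_(i <- s) H i t) (fun t => \sum_(i <- s) h i t).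
Proof.
move=> hs; elim: s => [|i s IH].
  under eq_fun do rewrite big_nil; under [X in w11pair _ _ _ X]eq_fun do rewrite big_nil.
  split; first by split; exact: primitive_cst.
    by split; exact: integrable0.
  by split; exact: integrable0.
under eq_fun do rewrite big_cons; under [X in w11pair _ _ _ X]eq_fun do rewrite big_cons.
exact: w11pairD.
Qed.

Lemma ch1pairM a b F f G g : ch1pair a b F f -> ch1pair a b G g ->
  w11pair a b (fun t => Num.conj (F t) * G t)
    (fun t => Num.conj (f t) * G t + Num.conj (F t) * g t).
Proof.
move=> [[pF1 pF2] [sF1 sF2] [sf1 sf2]] [[pG1 pG2] [sG1 sG2] [sg1 sg2]].
have mD := measurable_eitv a b.
have hF1 : h1pair a b (re \o F) (re \o f) by split.
have hF2 : h1pair a b (im \o F) (im \o f) by split.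
have hG1 : h1pair a b (re \o G) (re \o g) by split.
have hG2 : h1pair a b (im \o G) (im \o g) by split.
have [p11 _ _] := h1pairM hF1 hG1; have [p22 _ _] := h1pairM hF2 hG2.
have [p12 _ _] := h1pairM hF1 hG2; have [p21 _ _] := h1pairM hF2 hG1.
split; first split.
- rewrite (_ : _ \o _ = fun t => re (F t) * re (G t) + im (F t) * im (G t)); last first.
    by apply/funext => t /=; rewrite !reimE mulNr opprK.
  rewrite (_ : _ \o _ = fun t => (re (f t) * re (G t) + re (F t) * re (g t)) +
      (im (f t) * im (G t) + im (F t) * im (g t))); last first.
    by apply/funext => t /=; rewrite !reimE; ring.
  exact: primitiveD.
- rewrite (_ : _ \o _ = fun t => re (F t) * im (G t) + (-1) * (im (F t) * re (G t))); last first.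
    by apply/funext => t /=; rewrite !reimE; ring.
  rewrite (_ : _ \o _ = fun t => (re (f t) * im (G t) + re (F t) * im (g t)) +
      (-1) * (im (f t) * re (G t) + im (F t) * re (g t))); last first.
    by apply/funext => t /=; rewrite !reimE; ring.
  by apply: primitiveD => //; exact: primitiveZ.
- exact: csqintM.
- by apply: cintegrD => //; exact: csqintM.
Qed.

Definition ccvg (A : set_system R) f c :=
  (re (f t) @[t --> A] --> re c) /\ (im (f t) @[t --> A] --> im c).

Section Limits.
Variables (A : set_system R) (FA : ProperFilter A).

Lemma ccvg_cst c : ccvg A (fun=> c) c.
Proof. by split; exact: cvg_cst. Qed.

Lemma ccvgD f g x y : ccvg A f x -> ccvg A g y -> ccvg A (fun t => f t + g t) (x + y).
Proof.
move=> [f1 f2] [g1 g2]; split.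
  by under eq_fun do rewrite reD; rewrite reD; exact: cvgD.
by under eq_fun do rewrite imD; rewrite imD; exact: cvgD.
Qed.

Lemma ccvgM f g x y : ccvg A f x -> ccvg A g y -> ccvg A (fun t => f t * g t) (x * y).
Proof.
move=> [f1 f2] [g1 g2]; split.
  by under eq_fun do rewrite reM; rewrite reM; apply: cvgB; exact: cvgM.
by under eq_fun do rewrite imM; rewrite imM; apply: cvgD; exact: cvgM.
Qed.

Lemma ccvg_conj f x : ccvg A f x -> ccvg A (fun t => Num.conj (f t)) (Num.conj x).
Proof.
move=> [f1 f2]; split.
  by under eq_fun do rewrite re_conj; rewrite re_conj.
by under eq_fun do rewrite im_conj; rewrite im_conj; exact: cvgN.
Qed.

Lemma ccvg_sum I (s : seq I) (h : I -> R -> C) (l : I -> C) :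
  (forall i, ccvg A (h i) (l i)) -> ccvg A (fun t => \sum_(i <- s) h i t) (\sum_(i <- s) l i).
Proof.
move=> hl; elim: s => [|i s IH].
  by under eq_fun do rewrite big_nil; rewrite big_nil; exact: ccvg_cst.
by under eq_fun do rewrite big_cons; rewrite big_cons; exact: ccvgD.
Qed.

Lemma ccvg_unique f x y : ccvg A f x -> ccvg A f y -> x = y.
Proof.
move=> [f1 f2] [g1 g2]; apply: complex_ext.
  exact: cvg_unique f1 g1.
exact: cvg_unique f2 g2.
Qed.

End Limits.

(* At an infinite end, only 0 can be the limit of an integrable function. *)
Definition left_value a (f : R -> C) c :=
  if a is r%:E then ccvg r^'+ f c else c = 0.
Definition right_value b (f : R -> C) c :=
  if b is r%:E then ccvg r^'- f c else c = 0.

(** Integrability of [k] makes [K] converge at both ends. At an infinite end integrability of [K]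
    itself forces the limit 0, the value prescribed there by [left_value] and [right_value]. *)
Lemma w11pair_total a b K k l r : eitv a b !=set0 -> w11pair a b K k ->
  left_value a K l -> right_value b K r -> cintegral (eitv a b) k = r - l.
Proof.
move=> [s Ds] [[p1 p2] [i1 i2] [j1 j2]] vl vr.
have [sa sb] := andP Ds.
have clr (u u' : R -> R) : primitive (eitv a b) u u' -> integr (eitv a b) u ->
    integr (eitv a b) u' -> (a = -oo%E -> u x @[x --> end_left a] --> (0 : R)) /\
    (b = +oo%E -> u x @[x --> end_right b] --> (0 : R)).
  move=> p i j; split => ab; subst.
    have c := primitive_cvg_left Ds p j.
    by rewrite -[X in _ --> X](integr_cvg_left_eq0 (lt_trans sa sb) i c).
  have c := primitive_cvg_right Ds p j.
  by rewrite -[X in _ --> X](integr_cvg_right_eq0 (lt_trans sa sb) i c).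
have ccl : ccvg (end_left a) K l.
  move: vl; case: a {sb} p1 p2 i1 i2 j1 j2 Ds sa clr => [a| |] p1 p2 i1 i2 j1 j2 Ds sa clr //.
  by move=> ->; split; [apply: (clr _ _ p1 i1 j1).1|apply: (clr _ _ p2 i2 j2).1].
have ccr : ccvg (end_right b) K r.
  move: vr; case: b {sa} p1 p2 i1 i2 j1 j2 Ds sb clr => [b| |] p1 p2 i1 i2 j1 j2 Ds sb clr //.
  by move=> ->; split; [apply: (clr _ _ p1 i1 j1).2|apply: (clr _ _ p2 i2 j2).2].
have D0 : eitv a b !=set0 by exists s.
apply: complex_ext; rewrite ?reD ?imD ?reN ?imN /=.
  exact: (primitive_total D0 p1 j1 ccl.1 ccr.1).
exact: (primitive_total D0 p2 j2 ccl.2 ccr.2).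
Qed.

End ComplexFunctions.

(** * Vector-valued functions: trace estimate and Green's identity on an interval *)

Section VectorFunctions.
Context {R : realType}.
Local Notation C := R[i].
Local Notation re := (@complex.Re R).
Local Notation im := (@complex.Im R).
Implicit Types (D : set R) (a b : \bar R).

Section Fixed.
Variable d : nat.
Implicit Types (F f G g : R -> 'cV[C]_d) (v w : 'cV[C]_d) (M : 'M[C]_d).

Definition vsqint D f := forall k, csqint D (fun t => f t k 0).
Definition vprimitive D F f := forall k, cprimitive D (fun t => F t k 0) (fun t => f t k 0).
Definition vh1pair a b F f := forall k, ch1pair a b (fun t => F t k 0) (fun t => f t k 0).
Definition vleft a F v := forall k, left_value a (fun t => F t k 0) (v k 0).
Definition vright b F v := forall k, right_value b (fun t => F t k 0) (v k 0).

Definition vnorm2 v : R := \sum_k (re (v k 0) ^+ 2 + im (v k 0) ^+ 2).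

Lemma vnorm2_ge0 v : 0 <= vnorm2 v.
Proof. by apply: sumr_ge0 => k _; rewrite addr_ge0 ?sqr_ge0. Qed.

Lemma vnorm2E v : (v^t* *m v) 0 0 = (vnorm2 v)%:C.
Proof.
rewrite mxE /vnorm2 rmorph_sum /=; apply: eq_bigr => k _.
rewrite !mxE; apply: complex_ext; rewrite !reimE /=; ring.
Qed.

Lemma hformE M v w :
  hform M v w = \sum_i \sum_j M i j * (Num.conj (v i 0) * w j 0).
Proof.
rewrite /hform mxE; under eq_bigr do rewrite mxE mulr_suml.
rewrite exchange_big; apply: eq_bigr => i _; apply: eq_bigr => j _.
by rewrite !mxE; ring.
Qed.

Lemma hform_conj M v w : Num.conj (hform M v w) = hform (M^t*) w v.
Proof.
rewrite !hformE rmorph_sum /= exchange_big; apply: eq_bigr => i _.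
rewrite rmorph_sum; apply: eq_bigr => j _.
by rewrite !mxE !rmorphM /= conjCK; ring.
Qed.

(** In coordinates the form is a finite combination of products [Num.conj (F t i 0) * G t j 0].
    These are integrable together with their derivatives, even on unbounded intervals, so the
    fundamental theorem holds up to the ends. *)
Lemma vh1pair_green a b M F f G g vl wl vr wr : eitv a b !=set0 ->
  vh1pair a b F f -> vh1pair a b G g ->
  vleft a F vl -> vright b F vr -> vleft a G wl -> vright b G wr ->
  cintegral (eitv a b) (fun t => hform M (f t) (G t) + hform M (F t) (g t)) =
  hform M vr wr - hform M vl wl.
Proof.
move=> D0 hF hG Fl Fr Gl Gr.
pose K t := \sum_i \sum_j M i j * (Num.conj (F t i 0) * G t j 0).
pose k t := \sum_i \sum_j M i j * (Num.conj (f t i 0) * G t j 0 + Num.conj (F t i 0) * g t j 0).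
have hK : w11pair a b K k.
  apply: w11pair_sum => i; apply: w11pair_sum => j; apply: w11pairZ.
  exact: ch1pairM.
rewrite (_ : (fun t => hform M (f t) (G t) + hform M (F t) (g t)) = k); last first.
  apply/funext => t; rewrite !hformE -big_split; apply: eq_bigr => i _ /=.
  by rewrite -big_split; apply: eq_bigr => j _ /=; ring.
apply: (w11pair_total D0 hK); rewrite hformE.
- move: Fl Gl {hF hG hK D0}; case: a => [r| |] Fl Gl /=.
  + apply: ccvg_sum => i; apply: ccvg_sum => j; apply: ccvgM; first exact: ccvg_cst.
    by apply: ccvgM; [apply: ccvg_conj; exact: Fl|exact: Gl].
  + by apply: big1 => i _; apply: big1 => j _; rewrite (Gl j) !mulr0.
  + by apply: big1 => i _; apply: big1 => j _; rewrite (Gl j) !mulr0.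
- move: Fr Gr {hF hG hK D0}; case: b => [r| |] Fr Gr /=.
  + apply: ccvg_sum => i; apply: ccvg_sum => j; apply: ccvgM; first exact: ccvg_cst.
    by apply: ccvgM; [apply: ccvg_conj; exact: Fr|exact: Gr].
  + by apply: big1 => i _; apply: big1 => j _; rewrite (Gr j) !mulr0.
  + by apply: big1 => i _; apply: big1 => j _; rewrite (Gr j) !mulr0.
Qed.

Lemma Rintegral_sum D I (s : seq I) (h : I -> R -> R) : measurable D ->
  (forall i, integr D (h i)) -> integr D (fun t => \sum_(i <- s) h i t) /\
  \int[mu]_(t in D) (\sum_(i <- s) h i t) = \sum_(i <- s) \int[mu]_(t in D) h i t.
Proof.
move=> mD ih; elim: s => [|i s [IH1 IH2]].
  rewrite big_nil; split.
    by under eq_fun do rewrite big_nil; exact: integrable0.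
  by under eq_Rintegral do rewrite big_nil; rewrite Rintegral_cst// mul0r.
rewrite big_cons; split.
  by under eq_fun do rewrite big_cons; exact: integrD.
by under eq_Rintegral do rewrite big_cons; rewrite RintegralD// IH2.
Qed.

Lemma vsqint_norm D f : measurable D -> vsqint D f ->
  integr D (fun t => vnorm2 (f t)) /\
  \int[mu]_(t in D) vnorm2 (f t) =
  \sum_k (\int[mu]_(t in D) re (f t k 0) ^+ 2 + \int[mu]_(t in D) im (f t k 0) ^+ 2).
Proof.
move=> mD sf; have [|i e] := @Rintegral_sum D _ (index_enum 'I_d)
  (fun k t => re (f t k 0) ^+ 2 + im (f t k 0) ^+ 2) mD.
  by move=> k; have [[_ ?] [_ ?]] := sf k; exact: integrD.
split => //; rewrite /vnorm2 e; apply: eq_bigr => k _.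
by have [[_ ?] [_ ?]] := sf k; rewrite RintegralD.
Qed.

Lemma vh1pair_sqint a b F f : vh1pair a b F f ->
  vsqint (eitv a b) F /\ vsqint (eitv a b) f.
Proof. by move=> h; split=> k; case: (h k). Qed.

Lemma vh1pair_vnorm2_bound a b F f x y (e : R) : vh1pair a b F f ->
  0 < e -> eitv a b x -> eitv a b y -> e <= y - x ->
  forall s, eitv a b s -> vnorm2 (F s) <=
  (2 / e + 1) * (\int[mu]_(t in eitv a b) vnorm2 (F t) + \int[mu]_(t in eitv a b) vnorm2 (f t)).
Proof.
move=> h e0 Dx Dy exy s Ds; have mD := measurable_eitv a b.
have [sF sf] := vh1pair_sqint h.
rewrite (vsqint_norm mD sF).2 (vsqint_norm mD sf).2 -big_split mulr_sumr /=.
apply: ler_sum => k _; have [[p1 p2] [s1 s2] [t1 t2]] := h k.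
have := h1pair_bound (And3 p1 s1 t1) e0 Dx Dy exy Ds.
have := h1pair_bound (And3 p2 s2 t2) e0 Dx Dy exy Ds.
by rewrite /=; lra.
Qed.

Lemma cvg_sum_seq (T : Type) (A : set_system T) (FA : Filter A) I (s : seq I)
    (h : I -> T -> R) (l : I -> R) :
  (forall i, h i t @[t --> A] --> l i) ->
  \sum_(i <- s) h i t @[t --> A] --> \sum_(i <- s) l i.
Proof.
move=> hl; elim: s => [|i s IH].
  by under eq_fun do rewrite big_nil; rewrite big_nil; exact: cvg_cst.
by under eq_fun do rewrite big_cons; rewrite big_cons; exact: cvgD.
Qed.

Lemma cvg_vnorm2 (A : set_system R) (FA : ProperFilter A) F v :
  cvg_cV A F v -> vnorm2 (F t) @[t --> A] --> vnorm2 v.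
Proof.
move=> c; apply: cvg_sum_seq => k /=; have [c1 c2] := c k.
by apply: cvgD; rewrite !expr2; under eq_fun do rewrite expr2; exact: cvgM.
Qed.

(** The pointwise bound in the interior is a closed condition and passes to the limit at a finite
    end; at an infinite end the value is 0. The constant depends on the interval only through the
    lower bound [e] on its length. *)
Lemma vh1pair_trace a b F f x y (e : R) : vh1pair a b F f ->
  0 < e -> eitv a b x -> eitv a b y -> e <= y - x ->
  forall v, (vleft a F v \/ vright b F v) -> vnorm2 v <=
  (2 / e + 1) * (\int[mu]_(t in eitv a b) vnorm2 (F t) + \int[mu]_(t in eitv a b) vnorm2 (f t)).
Proof.
move=> h e0 Dx Dy exy v; have B := vh1pair_vnorm2_bound h e0 Dx Dy exy.
set c := (X in _ <= X).
have c0 : 0 <= c by apply: le_trans (B x Dx); exact: vnorm2_ge0.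
have v0 : (forall k, v k 0 = 0) -> vnorm2 v <= c.
  by move=> v0; rewrite /vnorm2 big1// => k _; rewrite v0 /= expr0n addr0.
have key A : ProperFilter A -> cvg_cV A F v -> (\forall t \near A, eitv a b t) -> vnorm2 v <= c.
  move=> FA cv nA; have := cvg_vnorm2 FA cv => cn.
  apply: (closed_cvg (fun z : R => z <= c)) cn; first exact: closed_le.
  by apply: filterS nA => t; exact: B.
case=> [vl|vr].
  move: (near_end_left Dx) vl; case: a {B h Dx Dy} @c c0 v0 key => [r| |] c c0 v0 key nD vl.
  - by apply: (key r^'+) => //; apply: filterS nD => t [].
  - exact: v0.
  - exact: v0.
move: (near_end_right Dx) vr; case: b {B h Dx Dy} @c c0 v0 key => [r| |] c c0 v0 key nD vl.
- by apply: (key r^'-) => //; apply: filterS nD => t [].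
- exact: v0.
- exact: v0.
Qed.

Lemma vh1pair_left a b F f : eitv a b !=set0 -> vh1pair a b F f -> exists v, vleft a F v.
Proof.
move=> D0 h; case: a D0 h => [r| |] D0 h; last 2 first.
- by exists 0 => k /=; rewrite mxE.
- by exists 0 => k /=; rewrite mxE.
have ex k : exists c : C, left_value r%:E (fun t => F t k 0) c.
  have [[p1 p2] [s1 s2] [t1 t2]] := h k.
  have [l1 c1] := h1pair_cvg_left D0 (And3 p1 s1 t1).
  have [l2 c2] := h1pair_cvg_left D0 (And3 p2 s2 t2).
  by exists (l1 +i* l2); split.
have [l Hl] := choice ex; exists (\col_k l k) => k; rewrite mxE; exact: Hl.
Qed.

Lemma vh1pair_right a b F f : eitv a b !=set0 -> vh1pair a b F f -> exists v, vright b F v.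
Proof.
move=> D0 h; case: b D0 h => [r| |] D0 h; last 2 first.
- by exists 0 => k /=; rewrite mxE.
- by exists 0 => k /=; rewrite mxE.
have ex k : exists c : C, right_value r%:E (fun t => F t k 0) c.
  have [[p1 p2] [s1 s2] [t1 t2]] := h k.
  have [l1 c1] := h1pair_cvg_right D0 (And3 p1 s1 t1).
  have [l2 c2] := h1pair_cvg_right D0 (And3 p2 s2 t2).
  by exists (l1 +i* l2); split.
have [l Hl] := choice ex; exists (\col_k l k) => k; rewrite mxE; exact: Hl.
Qed.

Lemma vprimitive_continuous a b F f t : vprimitive (eitv a b) F f -> eitv a b t ->
  cvg_cV (nbhs t) F (F t).
Proof.
move=> p Dt k; have [p1 p2] := p k.
by split; [exact: (primitive_continuous p1 Dt)|exact: (primitive_continuous p2 Dt)].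
Qed.

End Fixed.

Lemma vsqintM n d D (A : 'M[C]_(n, d)) f : measurable D -> vsqint D f ->
  vsqint D (fun t => A *m f t).
Proof.
move=> mD sf k; under eq_fun do rewrite mxE.
by apply: csqint_sum => // j; exact: csqintZ.
Qed.

Lemma vsqintD d D (f g : R -> 'cV[C]_d) : measurable D -> vsqint D f -> vsqint D g ->
  vsqint D (fun t => f t + g t).
Proof. by move=> mD sf sg k; under eq_fun do rewrite mxE; exact: csqintD. Qed.

Lemma vsqintZ d D (c : C) (f : R -> 'cV[C]_d) : measurable D -> vsqint D f ->
  vsqint D (fun t => c *: f t).
Proof. by move=> mD sf k; under eq_fun do rewrite mxE; exact: csqintZ. Qed.

Lemma vprimitiveM n d D (A : 'M[C]_(n, d)) F f : vprimitive D F f ->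
  vprimitive D (fun t => A *m F t) (fun t => A *m f t).
Proof.
move=> p k; under eq_fun do rewrite mxE; under [X in cprimitive _ _ X]eq_fun do rewrite mxE.
by apply: cprimitive_sum => // j; exact: cprimitiveZ.
Qed.

Lemma cvg_cVM n d (A : set_system R) (FA : ProperFilter A) (M : 'M[C]_(n, d)) F v :
  cvg_cV A F v -> cvg_cV A (fun t => M *m F t) (M *m v).
Proof.
move=> c k; have : ccvg A (fun t => \sum_j M k j * F t j 0) (\sum_j M k j * v j 0).
  by apply: ccvg_sum => j; apply: ccvgM; [exact: ccvg_cst|exact: c].
by move=> [c1 c2]; rewrite mxE; split; under eq_fun do rewrite mxE.
Qed.

Lemma mxmeasurableM n d D (A : 'M[C]_(n, d)) (f : R -> 'cV[C]_d) :
  mxmeasurable D f -> mxmeasurable D (fun t => A *m f t).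
Proof.
by move=> mf; apply: mxmeasurable_mul => // i j; exact: cmeasurable_cst.
Qed.

End VectorFunctions.

(** * Distributional derivatives and their absolutely continuous representatives *)

Section Distributions.
Context {R : realType} {d : nat}.
Local Notation C := R[i].
Local Notation re := (@complex.Re R).
Local Notation im := (@complex.Im R).
Implicit Types (D : set R) (a b : \bar R) (f y F G g : R -> 'cV[C]_d).

Lemma re_vintegral D (phi : R -> R) y k :
  re (vintegral D (fun t => (phi t)%:C *: y t) k 0) =
  \int[mu]_(t in D) (phi t * re (y t k 0)).
Proof.
rewrite mxE /=; apply: eq_Rintegral => t _.
by rewrite mxE reM /= mul0r subr0.
Qed.

Lemma im_vintegral D (phi : R -> R) y k :
  im (vintegral D (fun t => (phi t)%:C *: y t) k 0) =
  \int[mu]_(t in D) (phi t * im (y t k 0)).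
Proof.
rewrite mxE /=; apply: eq_Rintegral => t _.
by rewrite mxE imM /= mul0r addr0.
Qed.

Lemma is_distrP (P1 P0 : 'M[C]_d) D f y : is_distr P1 P0 D f y <->
  forall phi, test_fun D phi -> forall k,
    (\int[mu]_(t in D) (phi t * re (y t k 0)) =
      (- \int[mu]_(t in D) (derive1 phi t * re ((P1 *m f t) k 0))) +
      \int[mu]_(t in D) (phi t * re ((P0 *m f t) k 0))) /\
    (\int[mu]_(t in D) (phi t * im (y t k 0)) =
      (- \int[mu]_(t in D) (derive1 phi t * im ((P1 *m f t) k 0))) +
      \int[mu]_(t in D) (phi t * im ((P0 *m f t) k 0))).
Proof.
split=> H phi tphi.
  move=> k; have := congr1 (fun A : 'cV[C]_d => A k 0) (H phi tphi).
  rewrite [X in _ = X]mxE [X in _ = X + _]mxE => E; split.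
    by rewrite -3!re_vintegral E reD reN.
  by rewrite -3!im_vintegral E imD imN.
apply/matrixP => k j; rewrite ord1 [RHS]mxE [X in _ = X + _]mxE; apply: complex_ext.
  rewrite [RHS]reD [X in _ = X + _]reN; apply: (etrans (re_vintegral D phi y k)).
  apply: (etrans (H phi tphi k).1); congr (- _ + _); apply/esym.
    exact: (re_vintegral D (derive1 phi) (fun t => P1 *m f t) k).
  exact: (re_vintegral D phi (fun t => P0 *m f t) k).
rewrite [RHS]imD [X in _ = X + _]imN; apply: (etrans (im_vintegral D phi y k)).
apply: (etrans (H phi tphi k).2); congr (- _ + _); apply/esym.
  exact: (im_vintegral D (derive1 phi) (fun t => P1 *m f t) k).
exact: (im_vintegral D phi (fun t => P0 *m f t) k).
Qed.

Lemma test_fun_measurable D phi : test_fun D phi ->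
  measurable_fun setT phi /\ measurable_fun setT (derive1 phi).
Proof.
move=> tp; split; apply: continuous_measurable_fun.
  exact: test_fun_continuous tp.
exact: (test_fun_is_derive tp).2.
Qed.

Lemma vsqint_meas D f : vsqint D f -> mxmeasurable D f.
Proof. by move=> sf i j; rewrite (ord1 j); exact: csqint_meas. Qed.

(** Elements of [L2H] are accessible only through representatives chosen by the quotient, so the
    distributional equation must be transferable between functions that agree almost everywhere. *)
Lemma eq_is_distr (P1 P0 : 'M[C]_d) D f y f' y' : measurable D ->
  mxmeasurable D f -> mxmeasurable D f' -> mxmeasurable D y -> mxmeasurable D y' ->
  {ae mu, forall t, D t -> f t = f' t} -> {ae mu, forall t, D t -> y t = y' t} ->
  is_distr P1 P0 D f y -> is_distr P1 P0 D f' y'.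
Proof.
move=> mD mf mf' my my' ff yy /is_distrP H; apply/is_distrP => phi tphi k.
have [mp mdp] := test_fun_measurable tphi.
have [H1 H2] := H phi tphi k.
have E (psi : R -> R) (u u' : R -> 'cV[C]_d) : measurable_fun setT psi ->
    mxmeasurable D u -> mxmeasurable D u' -> {ae mu, forall t, D t -> u t = u' t} ->
    \int[mu]_(t in D) (psi t * re (u t k 0)) = \int[mu]_(t in D) (psi t * re (u' t k 0)) /\
    \int[mu]_(t in D) (psi t * im (u t k 0)) = \int[mu]_(t in D) (psi t * im (u' t k 0)).
  move=> mpsi mu_ mu' uu; have mpsi' : measurable_fun D psi by exact: measurable_funTS.
  split; apply: eq_Rintegral_ae => //.
  - by apply: measurable_funM => //; exact: (mu_ k 0).1.
  - by apply: measurable_funM => //; exact: (mu' k 0).1.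
  - by apply: ae_imp uu => t U /U ->.
  - by apply: measurable_funM => //; exact: (mu_ k 0).2.
  - by apply: measurable_funM => //; exact: (mu' k 0).2.
  - by apply: ae_imp uu => t U /U ->.
have PE (P : 'M[C]_d) : {ae mu, forall t, D t -> P *m f t = P *m f' t}.
  by apply: ae_imp ff => t U /U ->.
have [<- <-] := E phi y y' mp my my' yy.
have [<- <-] := E (derive1 phi) _ _ mdp (mxmeasurableM P1 mf) (mxmeasurableM P1 mf') (PE P1).
by have [<- <-] := E phi _ _ mp (mxmeasurableM P0 mf) (mxmeasurableM P0 mf') (PE P0).
Qed.

Definition vloc_integr D f := forall k, cloc_integr D (fun t => f t k 0).

Lemma vsqint_loc a b f : vsqint (eitv a b) f -> vloc_integr (eitv a b) f.
Proof. by move=> sf k; have [s1 s2] := sf k; split; exact: sqint_loc. Qed.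

Lemma is_distr_primitive (P1 P0 : 'M[C]_d) a b F f' : eitv a b !=set0 ->
  vsqint (eitv a b) F -> vprimitive (eitv a b) F f' ->
  is_distr P1 P0 (eitv a b) F (fun t => P1 *m f' t + P0 *m F t).
Proof.
move=> D0 sF pF; have mD := measurable_eitv a b.
apply/is_distrP => phi tphi k.
have [q1 q2] := vprimitiveM P1 pF k.
have [l1 l2] := vsqint_loc (vsqintM P0 mD sF) k.
have i0 := fun u lu => (test_fun_integrM D0 tphi (g := u) lu).1.
split.
  rewrite -(test_fun_by_parts D0 tphi q1) -RintegralD//; last 2 first.
  - by apply: i0; exact: primitive_loc q1.
  - exact: i0.
  by apply: eq_Rintegral => t _; rewrite -mulrDr mxE reD.
rewrite -(test_fun_by_parts D0 tphi q2) -RintegralD//; last 2 first.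
- by apply: i0; exact: primitive_loc q2.
- exact: i0.
by apply: eq_Rintegral => t _; rewrite -mulrDr mxE imD.
Qed.

(** Bringing [P0 *m f] to the other side leaves [P1 *m f] with distributional derivative [g]. The du
    Bois-Reymond lemma applies to the real and imaginary part of each coordinate, and the inverse of
    [P1] turns the result into a statement on [f]. *)
Lemma primitive_of_is_distr (P1 P0 : 'M[C]_d) a b f y : P1 \in unitmx -> eitv a b !=set0 ->
  vsqint (eitv a b) f -> vsqint (eitv a b) y -> is_distr P1 P0 (eitv a b) f y ->
  exists F f', [/\ vh1pair a b F f', {ae mu, forall t, eitv a b t -> f t = F t} &
    forall t, y t = P1 *m f' t + P0 *m f t].
Proof.
move=> uP1 D0 sf sy /is_distrP H; have mD := measurable_eitv a b.
pose g t := y t - P0 *m f t.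
have sP0 := vsqintM P0 mD sf; have sP1 := vsqintM P1 mD sf.
have sg : vsqint (eitv a b) g.
  rewrite (_ : g = fun t => y t + (-1) *: (P0 *m f t)); last first.
    by apply/funext => t; rewrite scaleN1r.
  by apply: vsqintD => //; exact: vsqintZ.
have ly := vsqint_loc sy; have lP0 := vsqint_loc sP0; have lP1 := vsqint_loc sP1.
have lg := vsqint_loc sg.
have key k : exists U : (R -> R) * (R -> R),
  [/\ primitive (eitv a b) U.1 (fun t => re (g t k 0)),
      primitive (eitv a b) U.2 (fun t => im (g t k 0)) &
      {ae mu, forall t, eitv a b t -> re ((P1 *m f t) k 0) = U.1 t /\
        im ((P1 *m f t) k 0) = U.2 t}].
  have [|U1 p1 e1] := @duBoisReymond _ a b (fun t => re ((P1 *m f t) k 0)) (fun t => re (g t k 0)) D0 (lP1 k).1 (lg k).1.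
    move=> phi tphi; have [H1 _] := H phi tphi k.
    have i0 := fun u lu => (test_fun_integrM D0 tphi (g := u) lu).1.
    under eq_Rintegral do rewrite mxE [in X in re (_ + X)]mxE reD reN mulrBr.
    rewrite RintegralB//; [|exact: (i0 _ (ly k).1)|exact: (i0 _ (lP0 k).1)].
    by rewrite H1 addrK.
  have [|U2 p2 e2] := @duBoisReymond _ a b (fun t => im ((P1 *m f t) k 0)) (fun t => im (g t k 0)) D0 (lP1 k).2 (lg k).2.
    move=> phi tphi; have [_ H2] := H phi tphi k.
    have i0 := fun u lu => (test_fun_integrM D0 tphi (g := u) lu).1.
    under eq_Rintegral do rewrite mxE [in X in im (_ + X)]mxE imD imN mulrBr.
    rewrite RintegralB//; [|exact: (i0 _ (ly k).2)|exact: (i0 _ (lP0 k).2)].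
    by rewrite H2 addrK.
  by exists (U1, U2); split => //; apply: ae_imp2 e1 e2 => t E1 E2 Dt; split; [exact: E1|exact: E2].
have [U HU] := choice key.
pose PF t : 'cV[C]_d := \col_k ((U k).1 t +i* (U k).2 t).
have pPF : vprimitive (eitv a b) PF g.
  move=> k; have [p1 p2 _] := HU k; split.
    by rewrite (_ : _ \o _ = (U k).1)//; apply/funext => t /=; rewrite mxE.
  by rewrite (_ : _ \o _ = (U k).2)//; apply/funext => t /=; rewrite mxE.
pose F t := invmx P1 *m PF t; pose f' t := invmx P1 *m g t.
have pF : vprimitive (eitv a b) F f' by exact: vprimitiveM.
have fF : {ae mu, forall t, eitv a b t -> f t = F t}.
  have A : {ae mu, forall t, forall k, eitv a b t -> re ((P1 *m f t) k 0) = (U k).1 t /\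
        im ((P1 *m f t) k 0) = (U k).2 t}.
    (* The coordinates are indexed by natural numbers in order to intersect the sets of full
       measure; indices [n >= d] satisfy the claim vacuously. *)
    have := @ae_foralln _ _ R mu (fun n t => forall k : 'I_d, n = k -> eitv a b t -> re ((P1 *m f t) k 0) = (U k).1 t /\
        im ((P1 *m f t) k 0) = (U k).2 t).
    move=> /(_ _)/wrap[]; last first.
      by apply: ae_imp => t A k; exact: (A k k).
    move=> n; case: (ltnP n d) => nd; last first.
      by apply: nearW => t k nk; move: nd; rewrite nk leqNgt ltn_ord.
    have [_ _] := HU (Ordinal nd); apply: ae_imp => t A k nk.
    by rewrite (_ : k = Ordinal nd)//; exact: val_inj.
  apply: ae_imp A => t A Dt; rewrite /F.
  rewrite (_ : PF t = P1 *m f t) ?mulKmx//.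
  apply/matrixP => k j; rewrite ord1 mxE.
  by have [E1 E2] := A k Dt; apply: complex_ext => /=.
(* [F] is continuous on the interval, hence measurable, as needed to transfer square integrability
   from [f], which equals it only almost everywhere. *)
have mF : mxmeasurable (eitv a b) F.
  move=> k j; rewrite ord1; have [p1 p2] := pF k.
  split; apply: (subspace_continuous_measurable_fun mD).
    apply: continuous_in_subspaceT => t /set_mem Dt; exact: (primitive_continuous p1 Dt).
  apply: continuous_in_subspaceT => t /set_mem Dt; exact: (primitive_continuous p2 Dt).
exists F, f'; split => //.
- move=> k; split; [exact: pF| |exact: (vsqintM (invmx P1) mD sg k)].
  have fFk : {ae mu, forall t, eitv a b t -> f t k 0 = F t k 0}.
    by apply: ae_imp fF => t E /E ->.
  exact: (eq_csqint_ae mD (mF k 0) fFk (sf k)).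
- by move=> t; rewrite /f' mulKVmx// /g subrK.
Qed.

End Distributions.

(** * Unconditional sums *)

Section Sums.
Context {R : realType} (I : choiceType).
Implicit Types (f g p q : I -> R).

Definition rsummable f : Prop := (\esum_(i in [set: I]) `|f i|%:E < +oo)%E.

Definition psum f : R := fine (\esum_(i in [set: I]) (f i)%:E).

Lemma le_rsummable f g : (forall i, `|f i| <= g i) -> rsummable g -> rsummable f.
Proof.
move=> fg; apply: le_lt_trans; apply: le_esum => i _; rewrite lee_fin.
exact: le_trans (ler_norm _).
Qed.

Lemma rsummableD f g : rsummable f -> rsummable g -> rsummable (fun i => f i + g i).
Proof.
move=> sf sg; rewrite /rsummable.
apply: (@le_lt_trans _ _ (\esum_(i in [set: I]) (`|f i|%:E + `|g i|%:E))%E).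
  by apply: le_esum => i _; rewrite -EFinD lee_fin ler_normD.
by rewrite esumD// lte_add_pinfty.
Qed.

Lemma rsummableZ (c : R) f : rsummable f -> rsummable (fun i => c * f i).
Proof.
move=> sf; rewrite /rsummable; under eq_esum do rewrite normrM EFinM.
by apply: esumZ_lty => // i; rewrite lee_fin.
Qed.

Lemma rsummableN f : rsummable f -> rsummable (fun i => - f i).
Proof. by move=> sf; rewrite /rsummable; under eq_esum do rewrite normrN. Qed.

Lemma rsummable_pos f : rsummable f -> rsummable (fun i => Num.max (f i) 0).
Proof.
move=> sf; apply: (le_rsummable (g := fun i => `|f i|)).
  move=> i; rewrite ger0_norm ?le_max ?lexx ?orbT// ge_max ler_norm/=; exact: normr_ge0.
by rewrite /rsummable; under eq_esum do rewrite normr_id.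
Qed.

Lemma rsummableE f : (forall i, 0 <= f i) ->
  rsummable f = (\esum_(i in [set: I]) (f i)%:E < +oo)%E :> Prop.
Proof.
by move=> f0; rewrite /rsummable; congr (is_true (_ < _)%E); apply: eq_esum => i _; rewrite ger0_norm.
Qed.

Lemma psum_fin f : (forall i, 0 <= f i) -> rsummable f ->
  (\esum_(i in [set: I]) (f i)%:E \is a fin_num)%E.
Proof.
move=> f0; rewrite rsummableE// => sf; rewrite ge0_fin_numE//.
by apply: esum_ge0 => i _; rewrite lee_fin.
Qed.

Lemma psumD f g : (forall i, 0 <= f i) -> (forall i, 0 <= g i) ->
  rsummable f -> rsummable g -> psum (fun i => f i + g i) = psum f + psum g.
Proof.
move=> f0 g0 sf sg; rewrite /psum -fineD; [|exact: psum_fin|exact: psum_fin].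
by under eq_esum do rewrite EFinD; rewrite esumD// => i _; rewrite lee_fin.
Qed.

Lemma psum_ge0 f : (forall i, 0 <= f i) -> 0 <= psum f.
Proof. by move=> f0; rewrite fine_ge0// esum_ge0// => i _; rewrite lee_fin. Qed.

Lemma le_psum f g : (forall i, 0 <= f i) -> rsummable g -> (forall i, f i <= g i) ->
  psum f <= psum g.
Proof.
move=> f0 sg fg; have g0 i : 0 <= g i by exact: le_trans (fg i).
have sf : rsummable f by apply: le_rsummable sg => i; rewrite ger0_norm.
apply: fine_le; [exact: psum_fin|exact: psum_fin|].
by apply: le_esum => i _; rewrite lee_fin.
Qed.

(** Only the inequality for a positive factor is proved on finite partial sums; the reverse one is
    the same inequality for [c^-1] and the family [c * f]. *)
Lemma psumZ (c : R) f : 0 <= c -> (forall i, 0 <= f i) -> rsummable f ->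
  psum (fun i => c * f i) = c * psum f.
Proof.
have le (k : R) g : 0 < k -> (forall i, 0 <= g i) -> rsummable g ->
    psum (fun i => k * g i) <= k * psum g.
  move=> k0 g0 sg; have kg0 i : 0 <= k * g i by rewrite mulr_ge0// ltW.
  rewrite -lee_fin EFinM /psum !fineK; [|exact: psum_fin|by apply: psum_fin => //; exact: rsummableZ].
  apply: ge_ereal_sup => _ [X [Xfin _] <-].
  under eq_fsbigr do rewrite EFinM.
  rewrite -ge0_mule_fsumr//.
  apply: lee_wpmul2l; first by rewrite lee_fin ltW.
  by apply: ereal_sup_ubound; exists X.
rewrite le_eqVlt => /predU1P[<-|c0] f0 sf.
  rewrite mul0r /psum esum1// => i _; first by rewrite mul0r.
apply/eqP; rewrite eq_le le//=.
have ci0 : 0 < c^-1 by rewrite invr_gt0.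
rewrite -ler_pdivlMl//.
have := le c^-1 (fun i => c * f i) ci0 (fun i => mulr_ge0 (ltW c0) (f0 i)) (rsummableZ c sf).
by rewrite (_ : (fun i => c^-1 * (c * f i)) = f)//; apply/funext => i; rewrite mulKf// gt_eqF.
Qed.

(** Frees [rsum] from the canonical positive and negative parts: any decomposition into nonnegative
    summable families computes it. Linearity then reduces to [psum], since decompositions can be
    added while positive parts cannot. *)
Lemma rsum_psum f p q : (forall i, 0 <= p i) -> (forall i, 0 <= q i) ->
  rsummable p -> rsummable q -> (forall i, f i = p i - q i) -> rsum f = psum p - psum q.
Proof.
move=> p0 q0 sp sq E.
have sf : rsummable f.
  apply: (le_rsummable (g := fun i => p i + q i)); last exact: rsummableD.
  by move=> i; rewrite E (le_trans (ler_normB _ _))// !ger0_norm.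
have sfp := rsummable_pos sf; have sfn := rsummable_pos (rsummableN sf).
have P (u : I -> R) i : 0 <= Num.max (u i) 0 by rewrite le_max lexx orbT.
rewrite /rsum -/(psum (fun i => Num.max (f i) 0)) -/(psum (fun i => Num.max (- f i) 0)).
(* Written with sums only, the claim concerns nonnegative families, and the two sides agree term by
   term. *)
suff : psum (fun i => Num.max (f i) 0) + psum q = psum (fun i => Num.max (- f i) 0) + psum p.
  by move=> H; apply/eqP; rewrite subr_eq addrAC eq_sym subr_eq H addrC.
rewrite -!psumD//; last exact: (P (fun i => - f i)).
congr fine; apply: eq_esum => i _; congr EFin.
by rewrite E; case: (leP (p i - q i) 0); case: (leP (- (p i - q i)) 0); lra.
Qed.

Lemma rsum_ge0E f : (forall i, 0 <= f i) -> rsummable f -> rsum f = psum f.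
Proof.
move=> f0 sf; have s0 : rsummable (fun=> 0 : R).
  by rewrite /rsummable esum1 ?ltry// => i _; rewrite normr0.
rewrite (@rsum_psum f f (fun=> 0))//; last by move=> i; rewrite subr0.
by rewrite [psum (fun=> 0)](_ : _ = 0) ?subr0// /psum esum1.
Qed.

Let pos f i := Num.max (f i) 0.
Let neg f i := Num.max (- f i) 0.

Let pn f i : f i = pos f i - neg f i.
Proof. by rewrite /pos /neg; case: (leP (f i) 0); case: (leP (- f i) 0); lra. Qed.

Let pos0 f i : 0 <= pos f i. Proof. by rewrite le_max lexx orbT. Qed.
Let neg0 f i : 0 <= neg f i. Proof. by rewrite le_max lexx orbT. Qed.
Let spos f : rsummable f -> rsummable (pos f). Proof. exact: rsummable_pos. Qed.
Let sneg f : rsummable f -> rsummable (neg f).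
Proof. by move=> /rsummableN/rsummable_pos. Qed.

Lemma rsumD f g : rsummable f -> rsummable g ->
  rsum (fun i => f i + g i) = rsum f + rsum g.
Proof.
move=> sf sg.
rewrite (@rsum_psum _ (fun i => pos f i + pos g i) (fun i => neg f i + neg g i)).
- rewrite !psumD//; [|exact: sneg|exact: sneg|exact: spos|exact: spos].
  rewrite (@rsum_psum f (pos f) (neg f))//; [|exact: spos|exact: sneg].
  rewrite (@rsum_psum g (pos g) (neg g))//; [|exact: spos|exact: sneg].
  ring.
- by move=> i; rewrite addr_ge0.
- by move=> i; rewrite addr_ge0.
- by apply: rsummableD; exact: spos.
- by apply: rsummableD; exact: sneg.
- by move=> i; rewrite [f i]pn [g i]pn; ring.
Qed.

Lemma rsumN f : rsummable f -> rsum (fun i => - f i) = - rsum f.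
Proof.
move=> sf; rewrite (@rsum_psum _ (neg f) (pos f))//; [|exact: sneg|exact: spos|by move=> i; rewrite [f i]pn opprB].
by rewrite (@rsum_psum f (pos f) (neg f))//; [ring|exact: spos|exact: sneg].
Qed.

Lemma rsumZ (c : R) f : rsummable f -> rsum (fun i => c * f i) = c * rsum f.
Proof.
wlog c0 : c / 0 <= c => [H|] sf.
  have [/H|c0] := leP 0 c; first exact.
  transitivity (rsum (fun i => - ((- c) * f i))).
    by congr rsum; apply/funext => i; rewrite mulNr opprK.
  rewrite rsumN; last exact: rsummableZ.
  by rewrite H// ?oppr_ge0 ?ltW// mulNr opprK.
rewrite (@rsum_psum _ (fun i => c * pos f i) (fun i => c * neg f i)).
- rewrite !psumZ//; [|exact: sneg|exact: spos].
  by rewrite -mulrBr -(@rsum_psum f)//; [exact: spos|exact: sneg].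
- by move=> i; rewrite mulr_ge0.
- by move=> i; rewrite mulr_ge0.
- by apply: rsummableZ; exact: spos.
- by apply: rsummableZ; exact: sneg.
- by move=> i; rewrite [f i]pn mulrBr.
Qed.

End Sums.

Section SumReindex.
Context {R : realType} (I : choiceType) (P : pred I).

(** Links sums over [edgeL G] or [edgeR G], which are subtypes, with sums over all edges padded by
    0. *)
Lemma esum_sub (g : I -> \bar R) :
  (\esum_(j in [set: {i | P i}]) g (val j) = \esum_(i in [set: I]) (if P i then g i else 0))%E.
Proof.
rewrite -(esum_image setT (val : {i | P i} -> I) g); last first.
  by move=> x y _ _; exact: val_inj.
rewrite [LHS]esum_mkcond; apply: eq_esum => i _.
congr (if _ then _ else _); apply/idP/idP => [/set_mem[[j Pj] _ <-]//|Pi].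
by apply/mem_set; exists (exist _ i Pi).
Qed.

Lemma rsum_sub (f : I -> R) :
  rsum (fun j : {i | P i} => f (val j)) = rsum (fun i => if P i then f i else 0).
Proof.
rewrite /rsum; congr (fine _ - fine _).
  rewrite (esum_sub (fun i => (Num.max (f i) 0)%:E)); apply: eq_esum => i _.
  by case: (P i) => //; rewrite maxxx.
rewrite (esum_sub (fun i => (Num.max (- f i) 0)%:E)); apply: eq_esum => i _.
by case: (P i) => //; rewrite oppr0 maxxx.
Qed.

Lemma rsummable_sub (f : I -> R) :
  rsummable (fun j : {i | P i} => f (val j)) = rsummable (fun i => if P i then f i else 0).
Proof.
rewrite /rsummable (esum_sub (fun i => `|f i|%:E)); congr (is_true (_ < _)%E).
by apply: eq_esum => i _; case: (P i); rewrite ?normr0.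
Qed.

End SumReindex.

Section ComplexSums.
Context {R : realType} (I : choiceType).
Local Notation C := R[i].
Local Notation re := (@complex.Re R).
Local Notation im := (@complex.Im R).
Implicit Types (f g : I -> C) (c : C).

Definition csummable f := rsummable (fun i => re (f i)) /\ rsummable (fun i => im (f i)).

Lemma csummableD f g : csummable f -> csummable g -> csummable (fun i => f i + g i).
Proof.
move=> [f1 f2] [g1 g2]; split.
  by under eq_fun do rewrite reD; exact: rsummableD.
by under eq_fun do rewrite imD; exact: rsummableD.
Qed.

Lemma csummableZ c f : csummable f -> csummable (fun i => c * f i).
Proof.
move=> [f1 f2]; split.
  under eq_fun do rewrite reM; apply: rsummableD; first exact: rsummableZ.
  by apply: rsummableN; exact: rsummableZ.
by under eq_fun do rewrite imM; apply: rsummableD; exact: rsummableZ.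
Qed.

Lemma csumD f g : csummable f -> csummable g ->
  csum (fun i => f i + g i) = csum f + csum g.
Proof.
move=> [f1 f2] [g1 g2]; apply: complex_ext; rewrite ?reD ?imD /=.
  by under eq_fun do rewrite reD; rewrite rsumD.
by under eq_fun do rewrite imD; rewrite rsumD.
Qed.

Lemma csumZ c f : csummable f -> csum (fun i => c * f i) = c * csum f.
Proof.
move=> [f1 f2]; apply: complex_ext; rewrite ?reM ?imM /=.
  under eq_fun do rewrite reM.
  rewrite rsumD; [|exact: rsummableZ|by apply: rsummableN; exact: rsummableZ].
  by rewrite rsumN ?rsumZ//; exact: rsummableZ.
under eq_fun do rewrite imM.
by rewrite rsumD ?rsumZ//; exact: rsummableZ.
Qed.

Lemma csum_conj f : csummable f -> csum (fun i => Num.conj (f i)) = Num.conj (csum f).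
Proof.
move=> [f1 f2]; apply: complex_ext; rewrite ?re_conj ?im_conj /=.
  by under eq_fun do rewrite re_conj.
by under eq_fun do rewrite im_conj; rewrite rsumN.
Qed.

End ComplexSums.

Section ComplexSumReindex.
Context {R : realType} (I : choiceType).
Local Notation C := R[i].
Local Notation re := (@complex.Re R).
Local Notation im := (@complex.Im R).
Implicit Types (f g : I -> C).

Lemma csum_sub (P : pred I) f :
  csum (fun j : {i | P i} => f (val j)) = csum (fun i => if P i then f i else 0).
Proof.
apply: complex_ext => /=.
  rewrite (rsum_sub P (fun i => re (f i))); congr rsum; apply/funext => i.
  by case: (P i).
rewrite (rsum_sub P (fun i => im (f i))); congr rsum; apply/funext => i.
by case: (P i).
Qed.

Lemma csummable_sub (P : pred I) f :
  csummable (fun i => if P i then f i else 0) <-> csummable (fun j : {i | P i} => f (val j)).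
Proof.
rewrite /csummable (rsummable_sub P (fun i => re (f i))) (rsummable_sub P (fun i => im (f i))).
have -> : (fun i => re (if P i then f i else 0)) = (fun i => if P i then re (f i) else 0).
  by apply/funext => i; case: (P i).
have -> // : (fun i => im (if P i then f i else 0)) = (fun i => if P i then im (f i) else 0).
by apply/funext => i; case: (P i).
Qed.

End ComplexSumReindex.

(** * Hilbert spaces *)

Section PreInnerProduct.
Context {R : realType}.
Local Notation C := R[i].
Local Notation re := (@complex.Re R).
Local Notation im := (@complex.Im R).

(** A form that may be degenerate, so that the continuity arguments below cover [ip_L2H], whose
    nonnegativity is what gets established, as well as the two boundary spaces. *)
Definition pre_inner_product (U : lmodType C) (ip : U -> U -> C) : Prop :=
  [/\ sesqui ip, forall x y, ip y x = Num.conj (ip x y) & forall x, 0 <= ip x x].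

Variables (U : lmodType C) (ip : U -> U -> C) (hip : pre_inner_product ip).
Implicit Types (x y z : U).

Lemma ip_lin c x y z : ip z (c *: x + y) = c * ip z x + ip z y.
Proof. by case: hip => [[_ H] _ _]; exact: H. Qed.

Lemma ip_antilin c x y z : ip (c *: x + y) z = Num.conj c * ip x z + ip y z.
Proof. by case: hip => [[H _] _ _]; exact: H. Qed.

Lemma ipDr x y z : ip z (x + y) = ip z x + ip z y.
Proof. by have := ip_lin 1 x y z; rewrite scale1r mul1r. Qed.

Lemma ipDl x y z : ip (x + y) z = ip x z + ip y z.
Proof. by have := ip_antilin 1 x y z; rewrite scale1r rmorph1 mul1r. Qed.

Lemma ip0r z : ip z 0 = 0.
Proof. by apply: (addrI (ip z 0)); rewrite -ipDr !addr0. Qed.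

Lemma ip0l z : ip 0 z = 0.
Proof. by apply: (addrI (ip 0 z)); rewrite -ipDl !addr0. Qed.

Lemma ipZr c x z : ip z (c *: x) = c * ip z x.
Proof. by have := ip_lin c x 0 z; rewrite addr0 ip0r addr0. Qed.

Lemma ipZl c x z : ip (c *: x) z = Num.conj c * ip x z.
Proof. by have := ip_antilin c x 0 z; rewrite addr0 ip0l addr0. Qed.

Lemma ipNr x z : ip z (- x) = - ip z x.
Proof. by rewrite -scaleN1r ipZr mulN1r. Qed.

Lemma ipNl x z : ip (- x) z = - ip x z.
Proof. by rewrite -scaleN1r ipZl rmorphN1 mulN1r. Qed.

Lemma ip_conj x y : ip y x = Num.conj (ip x y).
Proof. by case: hip. Qed.

Lemma re_ip_ge0 x : 0 <= re (ip x x).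
Proof. by case: hip => _ _ /(_ x); rewrite lecE => /andP[]. Qed.

Lemma im_ip x : im (ip x x) = 0.
Proof. by case: hip => _ _ /(_ x); rewrite lecE => /andP[/eqP]. Qed.

Lemma hnorm_ge0 x : 0 <= hnorm ip x. Proof. exact: sqrtr_ge0. Qed.

Lemma hnorm_sqr x : hnorm ip x ^+ 2 = re (ip x x).
Proof. by rewrite sqr_sqrtr// re_ip_ge0. Qed.

Lemma hnorm_lt x (e : R) : 0 < e -> (hnorm ip x < e) = (re (ip x x) < e ^+ 2).
Proof. by move=> e0; rewrite -hnorm_sqr ltr_pXn2r// nnegrE ?hnorm_ge0// ltW. Qed.

Lemma re_ip_add_scale (t : R) x y :
  re (ip (t%:C *: x + y) (t%:C *: x + y)) =
  t ^+ 2 * re (ip x x) + 2 * t * re (ip x y) + re (ip y y).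
Proof.
rewrite ip_lin !ip_antilin (ip_conj x y) !reimE /= im_ip; ring.
Qed.

(** Continuity of [ip x] at 0 in place of the Cauchy-Schwarz inequality. Nonnegativity at
    [t *: x + y] and at [- t *: x + y] bounds [2 * t * |re (ip x y)|] by
    [t ^+ 2 * re (ip x x) + re (ip y y)]. The choice of [t] makes [t * re (ip x x) <= e], and the
    radius makes the last term at most [e * t]. *)
Lemma re_ip_small x (e : R) : 0 < e ->
  exists2 s : R, 0 < s & forall y, hnorm ip y < s -> `|re (ip x y)| <= e.
Proof.
move=> e0; pose t := e / (re (ip x x) + 1).
have q0 := re_ip_ge0 x.
have t0 : 0 < t by rewrite divr_gt0// ltr_wpDl.
exists (Num.sqrt (e * t)); first by rewrite sqrtr_gt0 mulr_gt0.
have et : 0 < e * t by rewrite mulr_gt0.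
move=> y; rewrite hnorm_lt ?sqrtr_gt0//; rewrite sqr_sqrtr; last exact: ltW.
move=> /ltW qy.
have tx : t * re (ip x x) <= e.
  by rewrite /t mulrAC ler_pdivrMr ?ltr_wpDl// ler_pM2l// lerDl.
have H1 : 0 <= t ^+ 2 * re (ip x x) + 2 * t * re (ip x y) + re (ip y y).
  by rewrite -re_ip_add_scale re_ip_ge0.
have H2 : 0 <= t ^+ 2 * re (ip x x) - 2 * t * re (ip x y) + re (ip y y).
  by rewrite (_ : _ + _ = re (ip ((- t)%:C *: x + y) ((- t)%:C *: x + y)));
    [exact: re_ip_ge0|rewrite re_ip_add_scale; ring].
have tt : t * (t * re (ip x x)) <= t * e by rewrite ler_pM2l.
have t2 : 0 < 2 * t by rewrite mulr_gt0.
rewrite ler_norml; apply/andP; split.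
  by rewrite -subr_ge0 -(pmulr_rge0 _ t2); nra.
by rewrite -subr_ge0 -(pmulr_rge0 _ t2); nra.
Qed.

Lemma hcvg_re_ip_eq a b (u v : nat -> U) x y :
  (forall n, ip a (u n) = ip b (v n)) -> hcvg ip u x -> hcvg ip v y ->
  re (ip a x) = re (ip b y).
Proof.
move=> E cu cv; apply/eqP; rewrite -subr_eq0 -normr_le0.
apply/ler_addgt0Pr => e e0; rewrite add0r.
have e2 : 0 < e / 2 by rewrite divr_gt0.
have [s s0 Hs] := re_ip_small a e2; have [r r0 Hr] := re_ip_small b e2.
move/cvgr0Pnorm_lt : cu => /(_ _ s0) cu; move/cvgr0Pnorm_lt : cv => /(_ _ r0) cv.
have [n [un vn]] := filter_ex (filterI cu cv).
rewrite ger0_norm ?hnorm_ge0// in un; rewrite ger0_norm ?hnorm_ge0// in vn.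
have {}Hs := Hs _ un; have {}Hr := Hr _ vn.
have -> : re (ip a x) - re (ip b y) = - re (ip a (u n - x)) + re (ip b (v n - y)).
  by rewrite !ipDr !ipNr (E n) !reimE; ring.
by apply: (le_trans (ler_normD _ _)); rewrite normrN; lra.
Qed.

Lemma hcvg_ip_eq a b (u v : nat -> U) x y :
  (forall n, ip a (u n) = ip b (v n)) -> hcvg ip u x -> hcvg ip v y ->
  ip a x = ip b y.
Proof.
move=> E cu cv; apply: complex_ext; first exact: hcvg_re_ip_eq E cu cv.
(* By conjugate linearity in the first argument, the real part of [ip ('i *: a) x] is the imaginary
   part of [ip a x]. *)
have Ei n : ip ('i *: a) (u n) = ip ('i *: b) (v n) by rewrite !ipZl E.
have := hcvg_re_ip_eq Ei cu cv.
by rewrite !ipZl !reimE /= !mul0r !sub0r !mulN1r !opprK.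
Qed.

End PreInnerProduct.

Section DirectSums.
Context {R : realType}.
Local Notation C := R[i].
Local Notation re := (@complex.Re R).

Lemma inner_product_pre (U : lmodType C) (ip : U -> U -> C) :
  inner_product ip -> pre_inner_product ip.
Proof.
move=> [s c p]; split => // x; have [->|/p/ltW//] := eqVneq x 0.
have [_ /(_ 1 0 0 0)] := s; rewrite scaler0 addr0 mul1r => H.
rewrite (_ : ip 0 0 = 0)//; apply: (addrI (ip 0 0)).
by rewrite -H addr0.
Qed.

Lemma sesqui_sum (U W : lmodType C) (ipU : U -> U -> C) (ipW : W -> W -> C) :
  sesqui ipU -> sesqui ipW -> sesqui (ip_sum ipU ipW).
Proof.
move=> [u1 u2] [w1 w2]; split => c x y z; rewrite /ip_sum /=.
  by rewrite u1 w1; ring.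
by rewrite u2 w2; ring.
Qed.

Lemma hilbert_sum (U W : lmodType C) (ipU : U -> U -> C) (ipW : W -> W -> C) :
  hilbert ipU -> hilbert ipW -> hilbert (ip_sum ipU ipW).
Proof.
move=> [pU cU] [pW cW].
have hU := inner_product_pre pU; have hW := inner_product_pre pW.
have [sU jU dU] := pU; have [sW jW dW] := pW.
split.
  split; first exact: sesqui_sum.
    by move=> x y; rewrite /ip_sum rmorphD /= jU jW.
  move=> [x y] xy0; rewrite /ip_sum /=.
  have [x0|x0] := eqVneq x 0.
    rewrite x0 (ip0r hU) add0r; apply: dW; apply: contra_neq xy0 => ->.
    by rewrite x0.
  apply: ltr_pwDl; [exact: dU|by case: hW].
move=> u cu.
have leU x : hnorm ipU x.1 <= hnorm (ip_sum ipU ipW) x.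
  by rewrite ler_sqrt ?reD ?lerDl ?addr_ge0 ?re_ip_ge0.
have leW x : hnorm ipW x.2 <= hnorm (ip_sum ipU ipW) x.
  by rewrite ler_sqrt ?reD ?lerDr ?addr_ge0 ?re_ip_ge0.
have [|lU cvU] := cU (fun n => (u n).1).
  move=> e e0; have [N HN] := cu e e0; exists N => m n Nm Nn.
  exact: le_lt_trans (leU (u m - u n)) (HN _ _ Nm Nn).
have [|lW cvW] := cW (fun n => (u n).2).
  move=> e e0; have [N HN] := cu e e0; exists N => m n Nm Nn.
  exact: le_lt_trans (leW (u m - u n)) (HN _ _ Nm Nn).
exists (lU, lW); apply/cvgr0Pnorm_le => e e0.
have e2 : 0 < e / 2 by rewrite divr_gt0.
move/cvgr0Pnorm_lt : cvU => /(_ _ e2) cvU; move/cvgr0Pnorm_lt : cvW => /(_ _ e2) cvW.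
apply: filterS (filterI cvU cvW) => n [].
rewrite !ger0_norm ?sqrtr_ge0// !hnorm_lt// => a b.
rewrite -(ger0_norm (ltW e0)) -sqrtr_sqr ler_sqrt ?sqr_ge0// reD /=; nra.
Qed.

End DirectSums.

Section Hermitian.
Context {R : realType} (d : nat).
Local Notation C := R[i].
Local Notation re := (@complex.Re R).
Local Notation im := (@complex.Im R).
Implicit Types (M : 'M[C]_d) (u v : 'cV[C]_d).

(** Nonnegativity of the form at [u + v] and at [- u + v] bounds the real part of the mixed term;
    replacing [u] by ['i *: u] gives the imaginary part. *)
Lemma hform_bound M u v : M^t* = M -> (forall w, 0 <= hform M w w) ->
  `|re (hform M u v)| <= re (hform M u u) + re (hform M v v) /\
  `|im (hform M u v)| <= re (hform M u u) + re (hform M v v).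
Proof.
move=> hM M0.
have key (a b c : R) : 0 <= 1 ^+ 2 * a + 2 * 1 * b + c ->
    0 <= (- 1) ^+ 2 * a + 2 * (- 1) * b + c -> 0 <= a -> 0 <= c -> `|b| <= a + c.
  by move=> *; rewrite ler_norml; apply/andP; split; lra.
have re_le w z : `|re (hform M w z)| <= re (hform M w w) + re (hform M z z).
  have E (t : R) : re (hform M (t%:C *: w + z) (t%:C *: w + z)) =
      t ^+ 2 * re (hform M w w) + 2 * t * re (hform M w z) + re (hform M z z).
    have imw : im (hform M w w) = 0 by have := M0 w; rewrite lecE => /andP[/eqP].
    rewrite hformDl !hformDr !hformZr !hformZl (_ : hform M z w = Num.conj (hform M w z)); last first.
      by rewrite hform_conj hM.
    by move: (hform M w w) imw (hform M w z) (hform M z z) => a ia b c; rewrite !reimE /= ia; ring.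
  have H1 : 0 <= re (hform M (1%:C *: w + z) (1%:C *: w + z)) by exact: Re_hform_ge0.
  have H2 : 0 <= re (hform M ((- 1)%:C *: w + z) ((- 1)%:C *: w + z)) by exact: Re_hform_ge0.
  rewrite E in H1; rewrite E in H2.
  exact: key H1 H2 (Re_hform_ge0 w M0) (Re_hform_ge0 z M0).
split; first exact: re_le.
have := re_le ('i *: u) v.
rewrite !hformZl !hformZr; move: (hform M u u) (hform M u v) (hform M v v) => a b c.
by rewrite !reimE /= !(mul0r, mul1r, mulN1r, sub0r, add0r, opprK, addr0, mulr0, subr0).
Qed.

End Hermitian.

(** * Completeness of the spaces of boundary values *)

Section L2Hilbert.
Context {R : realType} (I : countType) (n : nat) (w : 'I_n -> {posnum R}).
Local Notation C := R[i].
Local Notation re := (@complex.Re R).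
Local Notation im := (@complex.Im R).
Implicit Types (f g h : l2 I w) (u v : 'cV[C]_n).

Definition wnorm2 v : R := re (hform (posdiag w) v v).

Lemma posdiag_herm : (posdiag w)^t* = posdiag w :> 'M[C]_n.
Proof.
apply/matrixP => i j; rewrite !mxE eq_sym; case: eqP => [->|_]; rewrite ?mulr1n ?mulr0n ?rmorph0//.
by apply: complex_ext; rewrite ?re_conj ?im_conj /= ?oppr0.
Qed.

Lemma wnorm2E v : wnorm2 v = \sum_k (w k)%:num * (re (v k 0) ^+ 2 + im (v k 0) ^+ 2).
Proof.
rewrite /wnorm2 /hform /posdiag mul_mx_diag mxE re_sum; apply: eq_bigr => k _.
rewrite !mxE !reimE /=; ring.
Qed.

Lemma wnorm2_ge0 v : 0 <= wnorm2 v.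
Proof. by apply: Re_hform_ge0 => z; exact: hform_posdiag_ge0. Qed.

Lemma l2_rsummable f : rsummable (fun i => wnorm2 (val f i)).
Proof.
rewrite rsummableE; last by move=> i; exact: wnorm2_ge0.
by have := valP f => /asboolP.
Qed.

Lemma l2_csummable f g : csummable (fun i => hform (posdiag w) (val f i) (val g i)).
Proof.
have S := rsummableD (l2_rsummable f) (l2_rsummable g).
have B i := hform_bound (val f i) (val g i) posdiag_herm (hform_posdiag_ge0 w).
split; apply: (le_rsummable _ S) => i; first exact: (B i).1.
exact: (B i).2.
Qed.

Lemma re_ip_l2 f : re (ip_l2 f f) = psum (fun i => wnorm2 (val f i)).
Proof.
rewrite /= -/(rsum (fun i => wnorm2 (val f i))) rsum_ge0E//; last exact: l2_rsummable.
by move=> i; exact: wnorm2_ge0.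
Qed.

Lemma inner_product_l2 : inner_product (@ip_l2 R I n w).
Proof.
have E c f g i : val (c *: f + g) i = c *: val f i + val g i by rewrite linearP.
split.
- split => c f g h; rewrite /ip_l2.
    under [in LHS]eq_fun do rewrite E hformDl hformZl.
    by rewrite csumD ?csumZ//; [exact: l2_csummable|apply: csummableZ; exact: l2_csummable|exact: l2_csummable].
  under [in LHS]eq_fun do rewrite E hformDr hformZr.
  by rewrite csumD ?csumZ//; [exact: l2_csummable|apply: csummableZ; exact: l2_csummable|exact: l2_csummable].
- move=> f g; rewrite /ip_l2 -csum_conj; last exact: l2_csummable.
  by congr csum; apply/funext => i; rewrite hform_conj posdiag_herm.
- move=> f f0; rewrite ltcE /=; apply/andP; split.
    rewrite (_ : (fun i => _) = (fun=> 0)); last first.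
      by apply/funext => i; have := hform_posdiag_ge0 w (val f i); rewrite lecE => /andP[/eqP].
    by rewrite rsum_ge0E// ?/psum ?esum1// /rsummable esum1 ?ltry// => i _; rewrite normr0.
  rewrite rsum_ge0E; [|by move=> i; exact: wnorm2_ge0|exact: l2_rsummable].
  have [i fi] : exists i, val f i != 0.
    apply: contrapT => H; move/eqP: f0; apply; apply: val_inj; apply/funext => i.
    by apply/eqP/negPn/negP => fi; apply: H; exists i.
  have [k vk] : exists k, val f i k 0 != 0.
    apply: contrapT => H; move/eqP: fi; apply; apply/matrixP => k j; rewrite ord1 mxE.
    by apply/eqP/negPn/negP => fi; apply: H; exists k.
  have p0 : 0 < wnorm2 (val f i).
    rewrite wnorm2E (bigD1 k)//=; apply: ltr_pwDl; last first.
      by apply: sumr_ge0 => j _; rewrite mulr_ge0// addr_ge0 ?sqr_ge0.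
    rewrite mulr_gt0// lt_neqAle addr_ge0 ?sqr_ge0// andbT eq_sym.
    apply: contra vk; rewrite paddr_eq0 ?sqr_ge0// !sqrf_eq0 => /andP[/eqP r0 /eqP i0].
    by apply/eqP/complex_ext.
  apply: (lt_le_trans p0); rewrite -lee_fin fineK; last first.
    by apply: psum_fin; [move=> j; exact: wnorm2_ge0|exact: l2_rsummable].
  by apply: esum_ge; exists [set i] => //; rewrite fsbig_set1.
Qed.

Lemma wnorm2_coord v k : (w k)%:num * (re (v k 0) ^+ 2 + im (v k 0) ^+ 2) <= wnorm2 v.
Proof.
rewrite wnorm2E (bigD1 k)//= lerDl; apply: sumr_ge0 => j _.
by rewrite mulr_ge0// addr_ge0 ?sqr_ge0.
Qed.

Lemma le_wnorm2_psum f i : wnorm2 (val f i) <= psum (fun i => wnorm2 (val f i)).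
Proof.
rewrite -lee_fin fineK; last first.
  by apply: psum_fin; [move=> j; exact: wnorm2_ge0|exact: l2_rsummable].
by apply: esum_ge; exists [set i] => //; rewrite fsbig_set1.
Qed.

Lemma real_cauchy_cvg (u : nat -> R) :
  (forall e : R, 0 < e -> exists N : nat, forall m p, (N <= m)%N -> (N <= p)%N -> `|u m - u p| < e) ->
  exists l : R, u @ \oo --> l.
Proof.
move=> H; have : cauchy (u @ \oo).
  apply/cauchy_ballP => e e0; have [N HN] := H e e0.
  exists ([set u n | n in [set n | (N <= n)%N]], [set u n | n in [set n | (N <= n)%N]]).
    by split; exists N => // m /= Nm; exists m.
  by move=> [_ _] /= [[m Nm <-] [p Np <-]]; exact: HN.
by move=> /cauchy_cvg/cvg_ex.
Qed.

(** Each coordinate of a Cauchy sequence converges. The Cauchy bound on finite partial sums survives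
    this coordinatewise limit, and the supremum over finite sets then controls the distance to the
    limit family. *)
Lemma hilbert_l2 : hilbert (@ip_l2 R I n w).
Proof.
split; first exact: inner_product_l2.
have hip := inner_product_pre inner_product_l2.
move=> u cu.
have sub m p i : val (u m - u p) i = val (u m) i - val (u p) i by rewrite linearB.
have nE f : hnorm (@ip_l2 R I n w) f ^+ 2 = psum (fun i => wnorm2 (val f i)).
  by rewrite hnorm_sqr// re_ip_l2.
have coord i k e : 0 < e -> exists N, forall m p, (N <= m)%N -> (N <= p)%N ->
    re (val (u m) i k 0 - val (u p) i k 0) ^+ 2 + im (val (u m) i k 0 - val (u p) i k 0) ^+ 2 < e ^+ 2.
  (* The weight [w k] of the coordinate is compensated: [e' ^+ 2] equals [e ^+ 2] times the
     weight. *)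
  move=> e0; pose e' := e * Num.sqrt (w k)%:num.
  have e'0 : 0 < e' by rewrite mulr_gt0// sqrtr_gt0.
  have [N HN] := cu e' e'0; exists N => m p Nm Np; have := HN m p Nm Np.
  rewrite hnorm_lt// re_ip_l2 => H.
  have := le_lt_trans (le_wnorm2_psum (u m - u p) i) H.
  rewrite sub => /(le_lt_trans (wnorm2_coord _ k)).
  rewrite /e' exprMn sqr_sqrtr// mulrC ltr_pM2r//.
  by rewrite !mxE.
have cre i k : exists l : R, re (val (u n) i k 0) @[n --> \oo] --> l.
  apply: real_cauchy_cvg => e e0; have [N HN] := coord i k e e0; exists N => m p Nm Np.
  rewrite -(ltr_pXn2r (n := 2))// ?nnegrE ?ltW// real_normK ?num_real//.
  apply: le_lt_trans (HN m p Nm Np); rewrite reD reN lerDl; exact: sqr_ge0.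
have cim i k : exists l : R, im (val (u n) i k 0) @[n --> \oo] --> l.
  apply: real_cauchy_cvg => e e0; have [N HN] := coord i k e e0; exists N => m p Nm Np.
  rewrite -(ltr_pXn2r (n := 2))// ?nnegrE ?ltW// real_normK ?num_real//.
  apply: le_lt_trans (HN m p Nm Np); rewrite imD imN lerDr; exact: sqr_ge0.
have [lr Hlr] := choice (fun ik : I * 'I_n => cre ik.1 ik.2).
have [li Hli] := choice (fun ik : I * 'I_n => cim ik.1 ik.2).
pose l i : 'cV[C]_n := \col_k (lr (i, k) +i* li (i, k)).
have cw m i : wnorm2 (val (u m) i - val (u p) i) @[p --> \oo] --> wnorm2 (val (u m) i - l i).
  rewrite wnorm2E; under eq_fun do rewrite wnorm2E.
  apply: cvg_sum_seq => k; apply: cvgM; first exact: cvg_cst.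
  have c1 : re ((val (u m) i - val (u p) i) k 0) @[p --> \oo] --> re ((val (u m) i - l i) k 0).
    under eq_fun do rewrite !mxE reD reN.
    rewrite !mxE reD reN /=; apply: cvgB; first exact: cvg_cst.
    exact: (Hlr (i, k)).
  have c2 : im ((val (u m) i - val (u p) i) k 0) @[p --> \oo] --> im ((val (u m) i - l i) k 0).
    under eq_fun do rewrite !mxE imD imN.
    rewrite !mxE imD imN /=; apply: cvgB; first exact: cvg_cst.
    exact: (Hli (i, k)).
  by rewrite !expr2; under eq_fun do rewrite !expr2; apply: cvgD; exact: cvgM.
have key e : 0 < e -> exists N, forall m, (N <= m)%N ->
    (\esum_(i in [set: I]) (wnorm2 (val (u m) i - l i))%:E <= (e ^+ 2)%:E)%E.
  move=> e0; have [N HN] := cu e e0; exists N => m Nm.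
  apply: ge_ereal_sup => _ [X [Xfin _] <-].
  rewrite fsbig_finite//= sumEFin lee_fin.
  have cs : \sum_(i <- finmap.enum_fset (fset_set X)) wnorm2 (val (u m) i - val (u p) i) @[p --> \oo] -->
            \sum_(i <- finmap.enum_fset (fset_set X)) wnorm2 (val (u m) i - l i).
    by apply: cvg_sum_seq => i; exact: cw.
  apply: (closed_cvg (fun z : R => z <= e ^+ 2)) cs; first exact: closed_le.
  exists N => // p /= Np; have := HN m p Nm Np; rewrite hnorm_lt// re_ip_l2 => /ltW H.
  apply: le_trans H; rewrite -lee_fin fineK; last first.
    by apply: psum_fin; [move=> j; exact: wnorm2_ge0|exact: l2_rsummable].
  apply: esum_ge; exists X; first by split.
  by rewrite fsbig_finite//= sumEFin lee_fin; under eq_bigr do rewrite -sub.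
(* The limit is square summable because it is [u m] minus the difference [u m - l], and both lie in
   the space. *)
have diff_in m : (\esum_(i in [set: I]) (wnorm2 (val (u m) i - l i))%:E < +oo)%E ->
    l \in sq_summable (I := I) w.
  move=> fin.
  have d_in : (fun i => val (u m) i - l i) \in sq_summable (I := I) w by apply/asboolP.
  have := rpredB (valP (u m)) d_in.
  by rewrite (_ : val (u m) - _ = l)//; apply/funext => i; rewrite [LHS]/= opprB addrCA subrr addr0.
have [N0 HN0] := key 1 ltr01.
have l_in := diff_in N0 (le_lt_trans (HN0 N0 (leqnn N0)) (ltry _)).
exists (exist _ l l_in); apply/cvgr0Pnorm_le => e e0.
have [N HN] := key e e0; exists N => // m /= Nm.
rewrite ger0_norm ?hnorm_ge0// -(ler_pXn2r (n := 2))// ?nnegrE ?hnorm_ge0 ?(ltW e0)// nE.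
rewrite -lee_fin fineK; last first.
  by apply: psum_fin; [move=> j; exact: wnorm2_ge0|exact: l2_rsummable].
apply: le_trans (HN m Nm); apply: le_esum => i _.
by rewrite linearB.
Qed.

End L2Hilbert.

(** * The space of square integrable functions on the graph *)

Section MatrixBounds.
Context {R : realType} (d : nat).
Local Notation C := R[i].
Local Notation re := (@complex.Re R).
Local Notation im := (@complex.Im R).
Implicit Types (A : 'M[C]_d) (z w : 'cV[C]_d) (m M : R).

(** The middle clause is an inequality in [C] and therefore also says that the quadratic form is
    real, which lets the bounds be stated for real parts. *)
Definition bounded_hermitian m M A :=
  [/\ A^t* = A, forall z, 0 <= hform A z z &
      forall z, m * vnorm2 z <= re (hform A z z) <= M * vnorm2 z].

Lemma vnorm2_eq0 z : vnorm2 z <= 0 -> z = 0.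
Proof.
move=> z0; apply/matrixP => k j; rewrite ord1 mxE.
have : vnorm2 z == 0 by rewrite eq_le z0 vnorm2_ge0.
rewrite /vnorm2 psumr_eq0; last by move=> i _; rewrite addr_ge0 ?sqr_ge0.
move=> /allP /(_ k (mem_index_enum k)) /=; rewrite paddr_eq0 ?sqr_ge0//.
by rewrite !sqrf_eq0 => /andP[/eqP ? /eqP ?]; exact: complex_ext.
Qed.

Lemma hform_mulmxr A z w : hform A z w = hform 1%:M z (A *m w).
Proof. by rewrite /hform mulmx1 mulmxA. Qed.

Lemma hform1E z w : hform 1%:M z w = \sum_k Num.conj (z k 0) * w k 0 :> C.
Proof. by rewrite /hform mulmx1 mxE; apply: eq_bigr => k _; rewrite !mxE. Qed.

Lemma hform1_norm z : re (hform 1%:M z z) = vnorm2 z.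
Proof.
by rewrite hform1E re_sum; apply: eq_bigr => k _; rewrite !reimE; ring.
Qed.

Lemma re_hform1_le (r : R) z w : 0 < r ->
  2 * re (hform 1%:M z w) <= r * vnorm2 z + r^-1 * vnorm2 w.
Proof.
move=> r0; rewrite hform1E re_sum !mulr_sumr -big_split; apply: ler_sum => k _ /=.
rewrite !reimE; set a := re (z k 0); set b := im (z k 0); set c := re (w k 0); set e := im (w k 0).
have h (x y : R) : 2 * (x * y) <= r * x ^+ 2 + r^-1 * y ^+ 2.
  have : 0 <= r^-1 * (r * x - y) ^+ 2 by rewrite mulr_ge0 ?sqr_ge0// invr_ge0 ltW.
  rewrite (_ : r^-1 * (r * x - y) ^+ 2 = r * x ^+ 2 + r^-1 * y ^+ 2 - 2 * (x * y)); first lra.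
  by field; rewrite gt_eqF.
have := h a c; have := h b e; lra.
Qed.

Section Bounded.
Variables (m M : R) (A : 'M[C]_d) (m0 : 0 < m) (hA : bounded_hermitian m M A).

Lemma bounded_hermitian_unit : A \in unitmx.
Proof.
have [hA1 _ hA2] := hA.
rewrite -row_free_unit -kermx_eq0; apply/eqP/row_matrixP => i; rewrite row0.
set v := row i _; have vA : v *m A = 0 by rewrite /v -row_mul mulmx_ker row0.
pose z : 'cV[C]_d := v^t*.
have zt : z^t* = v by rewrite /z; apply/matrixP => p q; rewrite !mxE conjCK.
have := (andP (hA2 z)).1; rewrite /hform zt vA mul0mx mxE /= => h.
have z0 : z = 0 by apply: vnorm2_eq0; rewrite -(pmulr_rle0 _ m0).
by rewrite -zt z0; apply/matrixP => p q; rewrite !mxE rmorph0.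
Qed.

(** The operator inequality [A^2 <= M A]. It follows from nonnegativity of the form at [A z - M z]:
    the cross terms contribute [- 2 * M * |A z|^2], and the upper bound controls the form at [A z]
    by [M * |A z|^2]. When [A z] is nonzero, the two bounds at [A z] force [M > 0]. *)
Lemma vnorm2_mulmx_le z : vnorm2 (A *m z) <= M * re (hform A z z).
Proof.
have [hA1 hA0 hA2] := hA.
have [z0|z0] := eqVneq (A *m z) 0.
  rewrite z0 (_ : vnorm2 _ = 0); last by rewrite /vnorm2 big1// => k _; rewrite mxE /= expr0n addr0.
  by rewrite hform_mulmxr z0 (_ : hform _ _ _ = 0) ?mulr0//; rewrite /hform mulmx0 mxE.
have n0 : 0 < vnorm2 (A *m z).
  rewrite ltNge; apply/negP => /vnorm2_eq0 h; by rewrite h eqxx in z0.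
have M0 : 0 < M.
  have /andP[h1 h2] := hA2 (A *m z).
  by rewrite -(pmulr_lgt0 _ n0); apply: lt_le_trans h2; apply: lt_le_trans h1; exact: mulr_gt0.
have E : re (hform A z (A *m z)) = vnorm2 (A *m z).
  by rewrite /hform -{1}hA1 -hform1_norm /hform mulmx1 trmx_mul map_mxM.
have E' : re (hform A (A *m z) z) = vnorm2 (A *m z).
  by rewrite -E -{1}hA1 -hform_conj re_conj.
have := Re_hform_ge0 ((- M)%:C *: z + A *m z) hA0.
have /andP[_ h2] := hA2 (A *m z).
have im0 : im (hform A z z) = 0 by have := hA0 z; rewrite lecE => /andP[/eqP].
rewrite hformDl !hformDr !hformZr !hformZl.
move: (hform A z z) im0 (hform A z (A *m z)) E (hform A (A *m z) z) E'
  (hform A (A *m z) (A *m z)) h2 => a ia b E c E' e h2.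
move: (vnorm2 (A *m z)) n0 E E' h2 => n n0 E E' h2; rewrite !reimE /= E E' ia => h.
by rewrite -(ler_pM2l M0); nra.
Qed.

(** For [w = invmx A *m z] the form is [re <w, z>]. Doubled, it is at most
    [m * |w|^2 + m^-1 * |z|^2], and the lower bound on [A] absorbs the first term into the form
    itself. *)
Lemma re_hform_inv_le z : re (hform A (invmx A *m z) (invmx A *m z)) <= m^-1 * vnorm2 z.
Proof.
have [hA1 hA0 hA2] := hA.
have uA := bounded_hermitian_unit.
set w := invmx A *m z; have Aw : A *m w = z by rewrite /w mulKVmx.
have /andP[h1 _] := hA2 w.
have := re_hform1_le w z m0; move: h1; rewrite hform_mulmxr Aw; lra.
Qed.

End Bounded.

End MatrixBounds.

Section MeasurableInverse.
Context {R : realType}.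
Local Notation C := R[i].
Local Notation re := (@complex.Re R).
Local Notation im := (@complex.Im R).
Implicit Types (D : set R) (f : R -> C).

Lemma cmeasurable_inv D f : measurable D -> cmeasurable D f -> cmeasurable D (fun t => (f t)^-1).
Proof.
move=> mD [f1 f2].
have mq : measurable_fun D (fun t => (re (f t) ^+ 2 + im (f t) ^+ 2)^-1).
  rewrite (_ : (fun t => _) = (fun t => (re (f t) ^+ 2 + im (f t) ^+ 2) `^ (-1))); last first.
    by apply/funext => t; rewrite powR_inv1// addr_ge0 ?sqr_ge0.
  apply: (measurableT_comp (measurable_powR (-1))).
  by apply: measurable_funD; exact: measurable_funX.
split.
  rewrite (_ : (fun t => _) = (fun t => re (f t) * (re (f t) ^+ 2 + im (f t) ^+ 2)^-1)).
    exact: measurable_funM.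
  by apply/funext => t; case: (f t).
rewrite (_ : (fun t => _) = (fun t => - (im (f t) * (re (f t) ^+ 2 + im (f t) ^+ 2)^-1))).
  by apply: measurableT_comp => //; exact: measurable_funM.
by apply/funext => t; case: (f t).
Qed.

Lemma cmeasurable_prod D (I : Type) (s : seq I) (F : I -> R -> C) :
  (forall i, cmeasurable D (F i)) ->
  cmeasurable D (fun t => \prod_(i <- s) F i t).
Proof.
move=> mF; elim: s => [|i s IH].
  by under eq_fun do rewrite big_nil; exact: cmeasurable_cst.
by under eq_fun do rewrite big_cons; exact: cmeasurableM.
Qed.

Lemma cmeasurable_det D n (A : R -> 'M[C]_n) : mxmeasurable D A ->
  cmeasurable D (fun t => \det (A t)).
Proof.
move=> mA; rewrite /determinant; apply: cmeasurable_sum => s.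
apply: cmeasurableM; first exact: cmeasurable_cst.
by apply: cmeasurable_prod => i; exact: mA.
Qed.

(** Cramer's formula is a polynomial expression in the entries divided by the determinant, hence
    measurable on all of [D], whether or not the matrix is invertible at each point. *)
Lemma mxmeasurable_inv D n (A : R -> 'M[C]_n) : measurable D -> mxmeasurable D A ->
  mxmeasurable D (fun t => (\det (A t))^-1 *: \adj (A t)).
Proof.
move=> mD mA i j; under eq_fun do rewrite !mxE.
apply: cmeasurableM; first by apply: cmeasurable_inv => //; exact: cmeasurable_det.
rewrite /cofactor; apply: cmeasurableM; first exact: cmeasurable_cst.
apply: cmeasurable_det => p q; under eq_fun do rewrite !mxE; exact: mA.
Qed.

End MeasurableInverse.

Section AlmostEverywhere.
Context {R : realType}.
Implicit Types (D : set R) (f g : R -> R).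

(** The maximum of [f] and [g] lies above [f] everywhere and equals [g] almost everywhere. *)
Lemma le_Rintegral_ae D f g : measurable D -> integr D f -> integr D g ->
  {ae mu, forall t, D t -> f t <= g t} -> \int[mu]_(t in D) f t <= \int[mu]_(t in D) g t.
Proof.
move=> mD iF iG fg.
pose h t := Num.max (f t) (g t).
have mh : measurable_fun D h by apply: measurable_maxr; exact: integr_meas.
have ih : integr D h.
  apply: (eq_integr_ae mD mh _ iG).
  by apply: ae_imp fg => t H /H H'; rewrite /h max_r.
rewrite (eq_Rintegral_ae mD (integr_meas iG) mh); last first.
  by apply: ae_imp fg => t H /H H'; rewrite /h max_r.
by apply: le_Rintegral => // t _; rewrite /h le_max lexx.
Qed.

Lemma le_integr_ae D f g : measurable D -> measurable_fun D f ->
  {ae mu, forall t, D t -> `|f t| <= g t} -> integr D g -> integr D f.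
Proof.
move=> mD mf fg ig.
pose h t := Num.max (`|f t|) (g t).
have mh : measurable_fun D h.
  by apply: measurable_maxr; [exact: measurableT_comp|exact: integr_meas].
have ih : integr D h.
  apply: (eq_integr_ae mD mh _ ig).
  by apply: ae_imp fg => t H /H H'; rewrite /h max_r.
by apply: (le_integr mD mf _ ih) => t _; rewrite /h le_max lexx.
Qed.

Lemma vsqint_of_norm d D (f : R -> 'cV[R[i]]_d) g : measurable D -> mxmeasurable D f ->
  integr D g -> {ae mu, forall t, D t -> vnorm2 (f t) <= g t} -> vsqint D f.
Proof.
move=> mD mf ig fg k; have [m1 m2] := mf k 0.
have le (v : 'cV[R[i]]_d) : complex.Re (v k 0) ^+ 2 <= vnorm2 v /\ complex.Im (v k 0) ^+ 2 <= vnorm2 v.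
  rewrite /vnorm2 (bigD1 k)//=; set s := (X in _ + X).
  have s0 : 0 <= s by apply: sumr_ge0 => j _; rewrite addr_ge0 ?sqr_ge0.
  have := sqr_ge0 (complex.Re (v k 0)); have := sqr_ge0 (complex.Im (v k 0)); lra.
split; split => //; apply: (le_integr_ae mD _ _ ig); try exact: measurable_funX.
  by apply: ae_imp fg => t H /H H'; rewrite ger0_norm ?sqr_ge0// (le_trans (le (f t)).1).
by apply: ae_imp fg => t H /H H'; rewrite ger0_norm ?sqr_ge0// (le_trans (le (f t)).2).
Qed.

Lemma mxmeasurable_vnorm2 d D (f : R -> 'cV[R[i]]_d) : mxmeasurable D f ->
  measurable_fun D (fun t => vnorm2 (f t)).
Proof.
move=> mf; rewrite /vnorm2; apply: measurable_sum => k.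
by apply: measurable_funD; apply: measurable_funX; have [] := mf k 0.
Qed.

End AlmostEverywhere.

(** * Representatives, energies and the scalar product of [L2H] *)

Section L2HTheory.
Context {R : realType} {G : metric_graph R} {d : nat}.
Local Notation C := R[i].
Local Notation re := (@complex.Re R).
Local Notation im := (@complex.Im R).
Variables (H : hamiltonian G d) (hH : uniformly_pos_bounded H).
Implicit Types (e : edge G) (x y : L2H hH).
Local Open Scope quotient_scope.

Lemma uniformly_bounded_hermitian : exists m M : R, [/\ 0 < m, 0 < M &
  forall e, {ae mu, forall t, edge_int e t -> bounded_hermitian m M (H e t)}].
Proof.
have [m [M [m0 mM HM]]] := hH; exists m, M; split => // [|e].
  exact: lt_le_trans mM.
have h0 := hform_ge0 hH e.
have h3 := ae_imp2 (fun t a b => conj a b) h0 (HM e).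
apply: ae_imp2 h3 (ham_hermitian H e) => t [a b] c It; split; [exact: c|exact: a|] => z.
move: (b It z) => /andP[]; rewrite !vnorm2E !lecE => /andP[_ h1] /andP[_ h2].
by move: h1 h2; rewrite !reM /= !mul0r !subr0 => -> ->.
Qed.

Definition edge_energy (x : edge G -> R -> 'cV[C]_d) e : R :=
  \int[mu]_(t in edge_int e) re (hform (H e t) (x e t) (x e t)).

Lemma re_hform_measurable (x : edge G -> R -> 'cV[C]_d) e :
  mxmeasurable (edge_int e) (x e) ->
  measurable_fun (edge_int e) (fun t => re (hform (H e t) (x e t) (x e t))).
Proof.
move=> mx; apply/measurable_EFinP; apply: measurable_hform => //; exact: ham_measurable.
Qed.

(** The form is nonnegative only almost everywhere; passing to absolute values gives access to the
    results on nonnegative integrands. *)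
Lemma edge_integral_ge0 (x : edge G -> R -> 'cV[C]_d) e :
  mxmeasurable (edge_int e) (x e) ->
  (\int[mu]_(t in edge_int e) (re (hform (H e t) (x e t) (x e t)))%:E =
   \int[mu]_(t in edge_int e) `|re (hform (H e t) (x e t) (x e t))|%:E)%E.
Proof.
move=> mx; apply: ae_eq_integral.
- exact: measurable_edge_int.
- by apply/measurable_EFinP; exact: re_hform_measurable.
- by apply/measurable_EFinP; apply: measurableT_comp => //; exact: re_hform_measurable.
apply: ae_imp (hform_ge0 hH e) => t + It => /(_ It) Ht.
by rewrite ger0_norm// Re_hform_ge0.
Qed.

Lemma sq_integrableP (x : edge G -> R -> 'cV[C]_d) :
  (x \in sq_integrable hH) <-> [/\ forall e, mxmeasurable (edge_int e) (x e),
    forall e, integr (edge_int e) (fun t => re (hform (H e t) (x e t) (x e t))) &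
    rsummable (edge_energy x)].
Proof.
split.
  move=> /asboolP[mx ex].
  have i0 e : (0 <= \int[mu]_(t in edge_int e) (re (hform (H e t) (x e t) (x e t)))%:E)%E.
    by rewrite edge_integral_ge0//; apply: integral_ge0 => t _; rewrite lee_fin.
  have fin e : (\int[mu]_(t in edge_int e) (re (hform (H e t) (x e t) (x e t)))%:E < +oo)%E.
    apply: le_lt_trans ex; rewrite /energy; apply: esum_ge; exists [set e] => //.
    by rewrite fsbig_set1.
  have iE e : integr (edge_int e) (fun t => re (hform (H e t) (x e t) (x e t))).
    apply/integrableP; split; first by apply/measurable_EFinP; exact: re_hform_measurable.
    by have := fin e; rewrite edge_integral_ge0.
  split => //; rewrite rsummableE.
    apply: le_lt_trans ex; rewrite /energy; apply: le_esum => e _.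
    by rewrite /edge_energy /Rintegral fineK//; apply: integrable_fin_num => //; exact: measurable_edge_int.
  by move=> e; rewrite /edge_energy /Rintegral fine_ge0.
move=> [mx ix sx]; apply/asboolP; split => //.
move: sx; rewrite /rsummable; apply: le_lt_trans; rewrite /energy; apply: le_esum => e _.
have -> : (\int[mu]_(t in edge_int e) (re (hform (H e t) (x e t) (x e t)))%:E)%E = (edge_energy x e)%:E.
  by rewrite /edge_energy /Rintegral fineK//; apply: integrable_fin_num => //; exact: measurable_edge_int.
by rewrite lee_fin ler_norm.
Qed.

Lemma rep_sq_integrable x : rep x \in sq_integrable hH.
Proof. exact: (valP (repr x)). Qed.

Lemma rep_measurable x e : mxmeasurable (edge_int e) (rep x e).
Proof. by have /sq_integrableP[] := rep_sq_integrable x. Qed.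

Lemma Hrep_measurable x e : mxmeasurable (edge_int e) (Hrep x e).
Proof.
apply: mxmeasurable_mul; [exact: ham_measurable|exact: rep_measurable].
Qed.

Lemma rep_energy x e :
  integr (edge_int e) (fun t => re (hform (H e t) (rep x e t) (rep x e t))).
Proof. by have /sq_integrableP[] := rep_sq_integrable x. Qed.

Lemma rep_rsummable x : rsummable (edge_energy (rep x)).
Proof. by have /sq_integrableP[] := rep_sq_integrable x. Qed.

(** The lower bound on [H] controls [x] by its energy, and [A^2 <= M A] controls [H x]. One
    constant, the maximum of [m^-1] and [M], serves all edges, so summability over the edges is
    inherited from the energies. *)
Lemma rep_norms : exists2 K : R, 0 < K & forall x e,
  [/\ vsqint (edge_int e) (rep x e), vsqint (edge_int e) (Hrep x e),
      \int[mu]_(t in edge_int e) vnorm2 (rep x e t) <= K * edge_energy (rep x) e &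
      \int[mu]_(t in edge_int e) vnorm2 (Hrep x e t) <= K * edge_energy (rep x) e].
Proof.
have [m [M [m0 M0 hmM]]] := uniformly_bounded_hermitian.
pose K := Num.max m^-1 M; exists K; first by rewrite lt_max M0 orbT.
move=> x e; have mD := measurable_edge_int e.
have iK := integrZl K mD (rep_energy x e).
have ge0 (z : 'cV[C]_d) t : bounded_hermitian m M (H e t) -> 0 <= re (hform (H e t) z z).
  by move=> [_ h _]; exact: Re_hform_ge0.
have b1 : {ae mu, forall t, edge_int e t ->
    vnorm2 (rep x e t) <= K * re (hform (H e t) (rep x e t) (rep x e t))}.
  apply: ae_imp (hmM e) => t h /h ht; have [_ _ /(_ (rep x e t))/andP[h1 _]] := ht.
  apply: (@le_trans _ _ (m^-1 * re (hform (H e t) (rep x e t) (rep x e t)))).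
    by rewrite ler_pdivlMl.
  by rewrite ler_wpM2r ?ge0// le_max lexx.
have b2 : {ae mu, forall t, edge_int e t ->
    vnorm2 (Hrep x e t) <= K * re (hform (H e t) (rep x e t) (rep x e t))}.
  apply: ae_imp (hmM e) => t h /h ht.
  apply: (le_trans (vnorm2_mulmx_le m0 ht (rep x e t))) => //.
  by rewrite ler_wpM2r ?ge0// le_max lexx orbT.
have s1 := vsqint_of_norm mD (rep_measurable x e) iK b1.
have s2 := vsqint_of_norm mD (Hrep_measurable x e) iK b2.
split => //.
  rewrite -RintegralZl//; last exact: rep_energy.
  by apply: le_Rintegral_ae => //; exact: (vsqint_norm mD s1).1.
rewrite -RintegralZl//; last exact: rep_energy.
by apply: le_Rintegral_ae => //; exact: (vsqint_norm mD s2).1.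
Qed.

Lemma rep_vsqint x e : vsqint (edge_int e) (rep x e).
Proof. by have [K _ /(_ x e)[]] := rep_norms. Qed.

Lemma Hrep_vsqint x e : vsqint (edge_int e) (Hrep x e).
Proof. by have [K _ /(_ x e)[]] := rep_norms. Qed.

Lemma edge_energy_ge0 x e : 0 <= edge_energy (rep x) e.
Proof.
rewrite /edge_energy /Rintegral edge_integral_ge0; last exact: rep_measurable.
by rewrite fine_ge0// integral_ge0// => t _; rewrite lee_fin.
Qed.

Lemma rep_vnorm2_rsummable x :
  rsummable (fun e => \int[mu]_(t in edge_int e) vnorm2 (rep x e t)).
Proof.
have [K _ HK] := rep_norms.
apply: le_rsummable (rsummableZ K (rep_rsummable x)) => e.
rewrite ger0_norm; first by have [_ _ ? _] := HK x e.
by apply: Rintegral_ge0 => t _; exact: vnorm2_ge0.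
Qed.

Lemma Hrep_vnorm2_rsummable x :
  rsummable (fun e => \int[mu]_(t in edge_int e) vnorm2 (Hrep x e t)).
Proof.
have [K _ HK] := rep_norms.
apply: le_rsummable (rsummableZ K (rep_rsummable x)) => e.
rewrite ger0_norm; first by have [_ _ _ ?] := HK x e.
by apply: Rintegral_ge0 => t _; exact: vnorm2_ge0.
Qed.

Lemma rep_pi (x0 : sq_fun hH) e :
  {ae mu, forall t, edge_int e t -> rep (\pi_(L2H hH) x0) e t = val x0 e t}.
Proof.
have : repr (\pi_(L2H hH) x0) - x0 \in @ae_null R G d H hH.
  by rewrite Quotient.idealrBE reprK.
move=> /asboolP /(_ e); apply: ae_imp => t h It.
by have := h It; rewrite linearB /= => /eqP; rewrite subr_eq0 => /eqP.
Qed.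

Lemma L2H_eq x y : (forall e, {ae mu, forall t, edge_int e t -> rep x e t = rep y e t}) -> x = y.
Proof.
move=> h; rewrite -[x]reprK -[y]reprK; apply/eqP; rewrite -Quotient.idealrBE.
apply/asboolP => e; apply: ae_imp (h e) => t E It.
by rewrite linearB /=; apply/eqP; rewrite subr_eq0; apply/eqP; exact: E.
Qed.

Lemma rep_lin c x y e :
  {ae mu, forall t, edge_int e t -> rep (c *: x + y) e t = c *: rep x e t + rep y e t}.
Proof.
have -> : c *: x + y = \pi_(L2H hH) (c *: repr x + repr y).
  by rewrite -L2H_addE -pi_scale !reprK.
apply: ae_imp (rep_pi (c *: repr x + repr y) e) => t h It.
by rewrite h// linearP.
Qed.

Lemma Hrep_lin c x y e :
  {ae mu, forall t, edge_int e t -> Hrep (c *: x + y) e t = c *: Hrep x e t + Hrep y e t}.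
Proof.
by apply: ae_imp (rep_lin c x y e) => t h /h h'; rewrite /Hrep h' mulmxDr scalemxAr.
Qed.

Lemma exists_rep (f : edge G -> R -> 'cV[C]_d) :
  (forall e, vsqint (edge_int e) (f e)) ->
  rsummable (fun e => \int[mu]_(t in edge_int e) vnorm2 (f e t)) ->
  exists x, forall e, {ae mu, forall t, edge_int e t -> rep x e t = f e t}.
Proof.
move=> sf Sf.
have [m [M [m0 M0 hmM]]] := uniformly_bounded_hermitian.
have mf e : mxmeasurable (edge_int e) (f e) by exact: vsqint_meas.
have b e : {ae mu, forall t, edge_int e t ->
    0 <= re (hform (H e t) (f e t) (f e t)) <= M * vnorm2 (f e t)}.
  apply: ae_imp (hmM e) => t h /h [_ h0 /(_ (f e t))/andP[_ ->]]; rewrite andbT.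
  exact: Re_hform_ge0.
have iE e : integr (edge_int e) (fun t => re (hform (H e t) (f e t) (f e t))).
  apply: (le_integr_ae (measurable_edge_int e) _ _ (integrZl M (measurable_edge_int e) (vsqint_norm (measurable_edge_int e) (sf e)).1)).
    exact: re_hform_measurable.
  by apply: ae_imp (b e) => t h /h /andP[h0 h1]; rewrite ger0_norm.
have fin : f \in sq_integrable hH.
  apply/sq_integrableP; split => //.
  apply: le_rsummable (rsummableZ M Sf) => e.
  rewrite -RintegralZl//; [|exact: measurable_edge_int|exact: (vsqint_norm (measurable_edge_int e) (sf e)).1].
  rewrite ger0_norm; last first.
    rewrite /edge_energy /Rintegral edge_integral_ge0//.
    by rewrite fine_ge0// integral_ge0// => t _; rewrite lee_fin.
  apply: le_Rintegral_ae; [exact: measurable_edge_int|exact: iE| |].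
    by apply: integrZl; [exact: measurable_edge_int|exact: (vsqint_norm (measurable_edge_int e) (sf e)).1].
  by apply: ae_imp (b e) => t h /h /andP[].
exists (\pi_(L2H hH) (exist _ f fin)) => e.
exact: (rep_pi (exist _ f fin) e).
Qed.

(** Take [x] to be the inverse of [H] applied to [f], written by Cramer's formula so that it is
    measurable on the whole edge. It agrees with the inverse matrix wherever [H] obeys its
    bounds. *)
Lemma exists_Hrep (f : edge G -> R -> 'cV[C]_d) :
  (forall e, vsqint (edge_int e) (f e)) ->
  rsummable (fun e => \int[mu]_(t in edge_int e) vnorm2 (f e t)) ->
  exists x, forall e, {ae mu, forall t, edge_int e t -> Hrep x e t = f e t}.
Proof.
move=> sf Sf.
have [m [M [m0 M0 hmM]]] := uniformly_bounded_hermitian.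
pose g e t := ((\det (H e t))^-1 *: \adj (H e t)) *m f e t.
have mf e : mxmeasurable (edge_int e) (f e) by exact: vsqint_meas.
have mg e : mxmeasurable (edge_int e) (g e).
  apply: mxmeasurable_mul; last exact: mf.
  by apply: mxmeasurable_inv; [exact: measurable_edge_int|exact: ham_measurable].
have gE e : {ae mu, forall t, edge_int e t ->
    (* One factor [m^-1] comes from the bound on the form of [H] at the inverse image, the other
       from the lower bound that compares this form with the Euclidean norm. *)
    H e t *m g e t = f e t /\ vnorm2 (g e t) <= m^-1 * (m^-1 * vnorm2 (f e t))}.
  apply: ae_imp (hmM e) => t h /h ht.
  have uH := bounded_hermitian_unit m0 ht.
  have gi : g e t = invmx (H e t) *m f e t.
    rewrite /g; congr (_ *m _).
    by have := uH; rewrite /invmx => ->.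
  split; first by rewrite gi mulKVmx.
  have := re_hform_inv_le m0 ht (f e t); rewrite -gi => h1.
  have [_ _ /(_ (g e t))/andP[h2 _]] := ht.
  by rewrite ler_pdivlMl//; exact: le_trans h1.
have iM e : integr (edge_int e) (fun t => m^-1 * (m^-1 * vnorm2 (f e t))).
  by do 2 (apply: integrZl; first exact: measurable_edge_int); exact: (vsqint_norm (measurable_edge_int e) (sf e)).1.
have gle e : {ae mu, forall t, edge_int e t -> vnorm2 (g e t) <= m^-1 * (m^-1 * vnorm2 (f e t))}.
  by apply: ae_imp (gE e) => t h /h [].
have sg e : vsqint (edge_int e) (g e) by exact: (vsqint_of_norm (measurable_edge_int e) (mg e) (iM e) (gle e)).
have [|x Hx] := exists_rep sg.
  apply: le_rsummable (rsummableZ m^-1 (rsummableZ m^-1 Sf)) => e.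
  rewrite ger0_norm; last by apply: Rintegral_ge0 => t _; exact: vnorm2_ge0.
  rewrite -!RintegralZl//; try exact: measurable_edge_int; try exact: (vsqint_norm (measurable_edge_int e) (sf e)).1.
    by apply: le_Rintegral_ae; [exact: measurable_edge_int|exact: (vsqint_norm (measurable_edge_int e) (sg e)).1|exact: iM|exact: gle].
  by apply: integrZl; [exact: measurable_edge_int|exact: (vsqint_norm (measurable_edge_int e) (sf e)).1].
exists x => e; apply: ae_imp2 (Hx e) (gE e) => t h1 h2 It.
by rewrite /Hrep h1// (h2 It).1.
Qed.

Lemma cintegr_hform x y e :
  cintegr (edge_int e) (fun t => hform (H e t) (rep x e t) (rep y e t)).
Proof.
have S : forall k, cintegr (edge_int e) (fun t => Num.conj (rep x e t k 0) * Hrep y e t k 0).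
  by move=> k; apply: csqintM; [exact: measurable_edge_int|exact: rep_vsqint|exact: Hrep_vsqint].
under eq_fun do rewrite hform_mulmxr hform1E.
elim: (index_enum _) => [|k s IH].
  by under eq_fun do rewrite big_nil; split; exact: integrable0.
by under eq_fun do rewrite big_cons; apply: cintegrD; [exact: measurable_edge_int|exact: S|exact: IH].
Qed.

(** By [hform_bound] the integral over an edge is dominated by the sum of the energies of [x] and
    [y] on it, and energies are summable. *)
Lemma ip_csummable x y :
  csummable (fun e => cintegral (edge_int e) (fun t => hform (H e t) (rep x e t) (rep y e t))).
Proof.
have [m [M [m0 M0 hmM]]] := uniformly_bounded_hermitian.
have S := rsummableD (rep_rsummable x) (rep_rsummable y).
have B e : {ae mu, forall t, edge_int e t ->
  `|re (hform (H e t) (rep x e t) (rep y e t))| <= re (hform (H e t) (rep x e t) (rep x e t)) + re (hform (H e t) (rep y e t) (rep y e t)) /\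
  `|im (hform (H e t) (rep x e t) (rep y e t))| <= re (hform (H e t) (rep x e t) (rep x e t)) + re (hform (H e t) (rep y e t) (rep y e t))}.
  by apply: ae_imp (hmM e) => t h /h [h1 h2 _]; exact: hform_bound.
have [c1 c2] : (forall e, integr (edge_int e) (fun t => re (hform (H e t) (rep x e t) (rep y e t)))) /\
  (forall e, integr (edge_int e) (fun t => im (hform (H e t) (rep x e t) (rep y e t)))).
  by split=> e; have [] := cintegr_hform x y e.
have key e (u : R -> R) : integr (edge_int e) u ->
    {ae mu, forall t, edge_int e t -> `|u t| <= re (hform (H e t) (rep x e t) (rep x e t)) + re (hform (H e t) (rep y e t) (rep y e t))} ->
    `|\int[mu]_(t in edge_int e) u t| <= edge_energy (rep x) e + edge_energy (rep y) e.
  move=> iu ub; apply: le_trans; first by apply: le_normr_Rintegral => //; exact: measurable_edge_int.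
  have ix := rep_energy x e; have iy := rep_energy y e.
  rewrite /edge_energy -RintegralD//; last exact: measurable_edge_int.
  apply: le_Rintegral_ae => //; [exact: measurable_edge_int|exact: integr_norm|].
  by apply: integrD => //; exact: measurable_edge_int.
split; apply: (le_rsummable _ S) => e; apply: key => //.
  by apply: ae_imp (B e) => t h /h [].
by apply: ae_imp (B e) => t h /h [].
Qed.

Lemma cmeasurable_hform x y e :
  cmeasurable (edge_int e) (fun t => hform (H e t) (rep x e t) (rep y e t)).
Proof.
by have [i1 i2] := cintegr_hform x y e; split; [exact: integr_meas i1|exact: integr_meas i2].
Qed.

Lemma re_ip_energy x : re (ip_L2H x x) = psum (edge_energy (rep x)).
Proof.
rewrite /= -/(edge_energy (rep x)) rsum_ge0E//; first exact: edge_energy_ge0.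
exact: rep_rsummable.
Qed.

Lemma ip_L2H_pre : pre_inner_product (@ip_L2H R G d H hH).
Proof.
have [m [M [m0 M0 hmM]]] := uniformly_bounded_hermitian.
split.
- split => c x y z; rewrite /ip_L2H.
    rewrite -csumZ; last exact: ip_csummable.
    rewrite -csumD; [|by apply: csummableZ; exact: ip_csummable|exact: ip_csummable].
    congr csum; apply/funext => e.
    rewrite -cintegralZ; [|exact: measurable_edge_int|exact: cintegr_hform].
    rewrite -cintegralD; [|exact: measurable_edge_int|by apply: cintegrZ; [exact: measurable_edge_int|exact: cintegr_hform]|exact: cintegr_hform].
    apply: eq_cintegral_ae; [exact: measurable_edge_int|exact: cmeasurable_hform| |].
      apply: cmeasurableD; last exact: cmeasurable_hform.
      by apply: cmeasurableM; [exact: cmeasurable_cst|exact: cmeasurable_hform].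
    by apply: ae_imp (rep_lin c x y e) => t h /h ->; rewrite hformDl hformZl.
  rewrite -csumZ; last exact: ip_csummable.
  rewrite -csumD; [|by apply: csummableZ; exact: ip_csummable|exact: ip_csummable].
  congr csum; apply/funext => e.
  rewrite -cintegralZ; [|exact: measurable_edge_int|exact: cintegr_hform].
  rewrite -cintegralD; [|exact: measurable_edge_int|by apply: cintegrZ; [exact: measurable_edge_int|exact: cintegr_hform]|exact: cintegr_hform].
  apply: eq_cintegral_ae; [exact: measurable_edge_int|exact: cmeasurable_hform| |].
    apply: cmeasurableD; last exact: cmeasurable_hform.
    by apply: cmeasurableM; [exact: cmeasurable_cst|exact: cmeasurable_hform].
  by apply: ae_imp (rep_lin c x y e) => t h /h ->; rewrite hformDr hformZr.
- move=> x y; rewrite /ip_L2H -csum_conj; last exact: ip_csummable.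
  congr csum; apply/funext => e.
  rewrite -cintegral_conj; [|exact: measurable_edge_int|exact: cintegr_hform].
  apply: eq_cintegral_ae; [exact: measurable_edge_int|exact: cmeasurable_hform| |].
    by apply: cmeasurable_conj; exact: cmeasurable_hform.
  by apply: ae_imp (hmM e) => t h /h [h1 _ _]; rewrite hform_conj h1.
- move=> x; rewrite lecE re_ip_energy psum_ge0 ?andbT; last exact: edge_energy_ge0.
  apply/eqP => /=; rewrite [X in rsum X](_ : _ = fun=> 0).
    by rewrite rsum_ge0E// ?/psum ?esum1// /rsummable esum1 ?ltry// => i _; rewrite normr0.
  apply/funext => e; rewrite (eq_Rintegral_ae (v := fun=> 0) (measurable_edge_int e)).
  + by rewrite Rintegral_cst ?mul0r//; exact: measurable_edge_int.
  + exact: (cmeasurable_hform x x e).2.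
  + exact: measurable_cst.
  + apply: ae_imp (hmM e) => t h /h [_ /(_ (rep x e t)) + _].
    by rewrite lecE => /andP[/eqP].
Qed.

End L2HTheory.

(** * Boundary values and Green's identity *)

Section VectorNorm.
Context {R : realType}.
Local Notation C := R[i].
Local Notation re := (@complex.Re R).
Local Notation im := (@complex.Im R).

Lemma vnorm2D_le d (u v : 'cV[C]_d) : vnorm2 (u + v) <= 2 * vnorm2 u + 2 * vnorm2 v.
Proof.
rewrite /vnorm2 !mulr_sumr -big_split; apply: ler_sum => k _ /=.
rewrite mxE reD imD.
have := sqr_ge0 (re (u k 0) - re (v k 0)); have := sqr_ge0 (im (u k 0) - im (v k 0)); lra.
Qed.

Lemma vnorm2_0 d : vnorm2 (0 : 'cV[C]_d) = 0.
Proof. by rewrite /vnorm2 big1// => k _; rewrite mxE /= expr0n addr0. Qed.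

Lemma vnorm2Z d (c : C) (v : 'cV[C]_d) : vnorm2 (c *: v) = (re c ^+ 2 + im c ^+ 2) * vnorm2 v.
Proof.
rewrite /vnorm2 mulr_sumr; apply: eq_bigr => k _.
by rewrite mxE !reimE; ring.
Qed.

Lemma vnorm2N d (v : 'cV[C]_d) : vnorm2 (- v) = vnorm2 v.
Proof. by rewrite -scaleN1r vnorm2Z /= oppr0 expr0n addr0 sqrrN expr1n mul1r. Qed.

Lemma vnorm2_coord d (v : 'cV[C]_d) k : re (v k 0) ^+ 2 + im (v k 0) ^+ 2 <= vnorm2 v.
Proof.
rewrite /vnorm2 (bigD1 k)//= lerDl; apply: sumr_ge0 => j _.
by rewrite addr_ge0 ?sqr_ge0.
Qed.

Lemma vnorm2_mx_bound n d (A : 'M[C]_(n, d)) :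
  exists2 K : R, 0 <= K & forall v : 'cV[C]_d, vnorm2 (A *m v) <= K * vnorm2 v.
Proof.
suff H (s : seq 'I_d) : exists2 K : R, 0 <= K & forall v : 'cV[C]_d,
    vnorm2 (\sum_(j <- s) v j 0 *: col j A) <= K * vnorm2 v.
  have [K K0 HK] := H (index_enum 'I_d); exists K => // v.
  rewrite (_ : A *m v = \sum_j v j 0 *: col j A)//.
  apply/matrixP => i k; rewrite ord1 mxE summxE; apply: eq_bigr => j _.
  by rewrite !mxE mulrC.
elim: s => [|j s [K K0 IH]].
  by exists 0 => // v; rewrite big_nil vnorm2_0 mul0r.
exists (2 * vnorm2 (col j A) + 2 * K).
  by rewrite addr_ge0 ?mulr_ge0 ?vnorm2_ge0.
move=> v; rewrite big_cons; apply: (le_trans (vnorm2D_le _ _)).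
have h1 := IH v; have h2 := vnorm2_coord v j; have h3 := vnorm2_ge0 (col j A).
have h4 : (re (v j 0) ^+ 2 + im (v j 0) ^+ 2) * vnorm2 (col j A) <= vnorm2 v * vnorm2 (col j A).
  exact: ler_wpM2r.
rewrite vnorm2Z; lra.
Qed.

Lemma wnorm2_bound n (w : 'I_n -> {posnum R}) :
  exists2 K : R, 0 <= K & forall v : 'cV[C]_n, wnorm2 w v <= K * vnorm2 v.
Proof.
exists (\sum_k (w k)%:num); first by apply: sumr_ge0.
move=> v; rewrite wnorm2E mulr_suml; apply: ler_sum => k _.
by rewrite ler_pM2l// vnorm2_coord.
Qed.

Lemma vnorm2_usubmx n m (v : 'cV[C]_(n + m)) : vnorm2 (usubmx v) <= vnorm2 v.
Proof.
rewrite [leRHS]/vnorm2 big_split_ord /= -[X in X <= _]addr0; apply: lerD.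
  by apply: ler_sum => k _; rewrite !mxE.
by apply: sumr_ge0 => k _; rewrite addr_ge0 ?sqr_ge0.
Qed.

Lemma vnorm2_dsubmx n m (v : 'cV[C]_(n + m)) : vnorm2 (dsubmx v) <= vnorm2 v.
Proof.
rewrite [leRHS]/vnorm2 big_split_ord /= -[X in X <= _]add0r; apply: lerD.
  by apply: sumr_ge0 => k _; rewrite addr_ge0 ?sqr_ge0.
by apply: ler_sum => k _; rewrite !mxE.
Qed.

Lemma vnorm2_col_mx n m (u : 'cV[C]_n) (v : 'cV[C]_m) :
  vnorm2 (col_mx u v) = vnorm2 u + vnorm2 v.
Proof.
rewrite {1}/vnorm2 big_split_ord /=; congr (_ + _); apply: eq_bigr => k _.
  by rewrite col_mxEu.
by rewrite col_mxEd.
Qed.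

Lemma vnorm2_le_wnorm2 n (w : 'I_n -> {posnum R}) :
  exists2 K : R, 0 <= K & forall v : 'cV[C]_n, vnorm2 v <= K * wnorm2 w v.
Proof.
exists (\sum_k ((w k)%:num)^-1); first by apply: sumr_ge0.
move=> v; rewrite /vnorm2 mulr_suml; apply: ler_sum => k _.
by rewrite ler_pdivlMl// wnorm2_coord.
Qed.

End VectorNorm.

Section BoundaryValues.
Context {R : realType} (d : nat).
Local Notation C := R[i].
Local Notation re := (@complex.Re R).
Local Notation im := (@complex.Im R).
Implicit Types (D : set R) (A : set_system R) (F f : R -> 'cV[C]_d) (v : 'cV[C]_d).

Lemma cvg_cV_unique A (FA : ProperFilter A) F v v' :
  cvg_cV A F v -> cvg_cV A F v' -> v = v'.
Proof.
move=> c c'; apply/matrixP => k j; rewrite ord1.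
exact: (ccvg_unique FA (c k) (c' k)).
Qed.

Lemma cvg_cVD A (FA : ProperFilter A) F f v v' :
  cvg_cV A F v -> cvg_cV A f v' -> cvg_cV A (fun t => F t + f t) (v + v').
Proof.
move=> c c' k; have [c1 c2] := ccvgD FA (c k) (c' k).
by rewrite mxE; split; under eq_fun do rewrite mxE.
Qed.

Lemma cvg_cVZ A (FA : ProperFilter A) (c : C) F v :
  cvg_cV A F v -> cvg_cV A (fun t => c *: F t) (c *: v).
Proof.
move=> h k; have [c1 c2] := ccvgM FA (ccvg_cst FA c) (h k).
by rewrite mxE; split; under eq_fun do rewrite mxE.
Qed.

Lemma eq_cvg_cV A (FA : ProperFilter A) F f v :
  (\forall t \near A, F t = f t) -> cvg_cV A F v -> cvg_cV A f v.
Proof.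
move=> E c k; have [c1 c2] := c k.
by split; [apply: cvg_trans c1|apply: cvg_trans c2]; apply: near_eq_cvg;
  apply: filterS E => t ->.
Qed.

Lemma continuous_ae_eq_cV D F f : open D ->
  (forall t, D t -> cvg_cV (nbhs t) F (F t)) -> (forall t, D t -> cvg_cV (nbhs t) f (f t)) ->
  {ae mu, forall t, D t -> F t = f t} -> forall t, D t -> F t = f t.
Proof.
move=> oD cF cf Ff t Dt; apply/matrixP => k j; rewrite ord1; apply: complex_ext.
  apply: (@continuous_ae_eq _ D (fun t => re (F t k 0)) (fun t => re (f t k 0))) => //.
  - by move=> x Dx; exact: (cF x Dx k).1.
  - by move=> x Dx; exact: (cf x Dx k).1.
  - by apply: ae_imp Ff => x h /h ->.
apply: (@continuous_ae_eq _ D (fun t => im (F t k 0)) (fun t => im (f t k 0))) => //.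
- by move=> x Dx; exact: (cF x Dx k).2.
- by move=> x Dx; exact: (cf x Dx k).2.
- by apply: ae_imp Ff => x h /h ->.
Qed.

(** [boundary_value] quantifies over continuous representatives. Any two of them agree everywhere on
    the open set [D], so the limit can be computed with the representative [F] at hand. *)
Lemma boundary_valueP D A (FA : ProperFilter A) F f v : open D ->
  (\forall t \near A, D t) -> (forall t, D t -> cvg_cV (nbhs t) F (F t)) ->
  {ae mu, forall t, D t -> f t = F t} -> boundary_value D A f v <-> cvg_cV A F v.
Proof.
move=> oD nD cF fF; split; last first.
  by move=> cv; exists F; split => //; apply: ae_imp fF => t h /h ->.
move=> [h [hf ch cv]].
apply: eq_cvg_cV cv; apply: filterS nD => t Dt.
apply: (continuous_ae_eq_cV oD ch cF _ Dt).
by apply: ae_imp2 hf fF => x h1 h2 Dx; rewrite h1// h2.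
Qed.

Lemma boundary_value_unique D A (FA : ProperFilter A) f v v' : open D ->
  (\forall t \near A, D t) -> boundary_value D A f v -> boundary_value D A f v' -> v = v'.
Proof.
move=> oD nD [h [hf ch cv]] [h' [hf' ch' cv']].
apply: (cvg_cV_unique FA cv); apply: eq_cvg_cV cv'.
apply: filterS nD => t Dt; apply: (continuous_ae_eq_cV oD ch' ch _ Dt).
by apply: ae_imp2 hf hf' => x h1 h2 Dx; rewrite h1// h2.
Qed.

Lemma boundary_value_lin D A (FA : ProperFilter A) c f f' g v v' :
  {ae mu, forall t, D t -> g t = c *: f t + f' t} ->
  boundary_value D A f v -> boundary_value D A f' v' -> boundary_value D A g (c *: v + v').
Proof.
move=> E [h [hf ch cv]] [h' [hf' ch' cv']].
exists (fun t => c *: h t + h' t); split.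
- have E' := ae_imp2 (fun t a b => conj a b) hf hf'.
  by apply: ae_imp2 E E' => t h1 [h2 h3] Dt; rewrite h1// h2// h3.
- by move=> t Dt; apply: cvg_cVD; [apply: cvg_cVZ; exact: ch|exact: ch'].
- by apply: cvg_cVD => //; exact: cvg_cVZ.
Qed.

Lemma boundary_valueM n D A (FA : ProperFilter A) (M : 'M[C]_(n, d)) f v :
  boundary_value D A f v -> boundary_value D A (fun t => M *m f t) (M *m v).
Proof.
move=> [h [hf ch cv]]; exists (fun t => M *m h t); split.
- by apply: ae_imp hf => t E /E ->.
- by move=> t Dt; apply: cvg_cVM; exact: ch.
- exact: cvg_cVM.
Qed.

End BoundaryValues.

Global Instance at_left_end_proper (R : realType) (G : metric_graph R) (e : edge G) :
  ProperFilter (at_left_end e).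
Proof. by rewrite /at_left_end; typeclasses eauto. Qed.

Global Instance at_right_end_proper (R : realType) (G : metric_graph R) (e : edge G) :
  ProperFilter (at_right_end e).
Proof. by rewrite /at_right_end; typeclasses eauto. Qed.

(** * The maximal operator: traces and Green's identity on an edge *)

Section MaximalOperator.
Context {R : realType} {G : metric_graph R} {d : nat}.
Local Notation C := R[i].
Local Notation re := (@complex.Re R).
Local Notation im := (@complex.Im R).
Variables (H : hamiltonian G d) (hH : uniformly_pos_bounded H) (P1 P0 : 'M[C]_d).
Implicit Types (e : edge G) (x y : L2H hH) (p q : L2H hH * L2H hH).
Hypothesis inf_diam : (0 < ereal_inf [set diam (edge_int e) | e in [set: edge G]])%E.

(** The diameter is a supremum of distances, so a number strictly below the infimum of the diameters
    is exceeded by the distance of two points of each edge. In this form the lower bound enters both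
    the trace estimate and the cutoffs. *)
Lemma edge_length : exists2 delta : R, 0 < delta & forall e,
  exists s t, [/\ edge_int e s, edge_int e t & delta <= t - s].
Proof.
have [delta d0 Hd] : exists2 delta : R, 0 < delta & forall e, (delta%:E < diam (edge_int e))%E.
  have := inf_diam; set I := ereal_inf _ => I0.
  have [r r0 rI] : exists2 r : R, 0 < r & (r%:E < I)%E.
    case: I I0 => [r| |] //.
      by rewrite lte_fin => r0; exists (r / 2); rewrite ?divr_gt0// lte_fin; lra.
    by exists 1 => //; rewrite ltry.
  by exists r => // e; apply: (lt_le_trans rI); apply: ereal_inf_lbound; exists e.
exists delta => // e; have := Hd e; rewrite /diam => /ereal_sup_gt[_ [s Ds [t Dt <-]]].
rewrite lte_fin => /ltW st.
have [h|h] := leP t s.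
  by exists t, s; split => //; move: st; rewrite ger0_norm// subr_ge0.
by exists s, t; split => //; move: st; rewrite distrC ger0_norm// subr_ge0 ltW.
Qed.

Lemma edge_int_neq0 e : edge_int e !=set0.
Proof. by have [delta _ /(_ e)[s [_ [? _ _]]]] := edge_length; exists s. Qed.

Lemma open_edge_int e : open (edge_int e).
Proof. exact: open_eitv. Qed.

Lemma near_at_left_end e : (-oo < left_end e)%E -> \forall t \near at_left_end e, edge_int e t.
Proof.
move=> el; have [s Ds] := edge_int_neq0 e.
have := near_end_left (Ds : eitv (left_end e) (right_end e) s).
rewrite /at_left_end; case E : (left_end e) el Ds => [r| |] // el Ds.
  by apply: filterS => t [+ _]; rewrite /eitv -E.
by move=> _; case/andP : Ds; rewrite E ltNge leey.
Qed.

Lemma near_at_right_end e : (right_end e < +oo)%E -> \forall t \near at_right_end e, edge_int e t.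
Proof.
move=> el; have [s Ds] := edge_int_neq0 e.
have := near_end_right (Ds : eitv (left_end e) (right_end e) s).
rewrite /at_right_end; case E : (right_end e) el Ds => [r| |] // el Ds.
  by apply: filterS => t [+ _]; rewrite /eitv -E.
by move=> _; case/andP : Ds => _; rewrite E ltNge leNye.
Qed.

Lemma vleft_finite e (F : R -> 'cV[C]_d) v : (-oo < left_end e)%E ->
  vleft (left_end e) F v <-> cvg_cV (at_left_end e) F v.
Proof.
move=> el; have [s Ds] := edge_int_neq0 e; move: Ds => /andP[sl _].
by rewrite /at_left_end; case: (left_end e) el sl.
Qed.

Lemma vright_finite e (F : R -> 'cV[C]_d) v : (right_end e < +oo)%E ->
  vright (right_end e) F v <-> cvg_cV (at_right_end e) F v.
Proof.
move=> el; have [s Ds] := edge_int_neq0 e; move: Ds => /andP[_ sl].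
by rewrite /at_right_end; case: (right_end e) el sl.
Qed.

Lemma vleft_infinite e (F : R -> 'cV[C]_d) v : ~~ (-oo < left_end e)%E ->
  vleft (left_end e) F v -> v = 0.
Proof.
case: (left_end e) => [r| |]; rewrite ?ltNyr ?ltNyy//= => _ h.
by apply/matrixP => k j; rewrite ord1 mxE; exact: h.
Qed.

Lemma vright_infinite e (F : R -> 'cV[C]_d) v : ~~ (right_end e < +oo)%E ->
  vright (right_end e) F v -> v = 0.
Proof.
case: (right_end e) => [r| |]; rewrite ?ltry//= => _ h.
by apply/matrixP => k j; rewrite ord1 mxE; exact: h.
Qed.

Definition maximal_op : set (L2H hH * L2H hH) :=
  [set p | forall e, is_distr P1 P0 (edge_int e) (Hrep p.1 e) (rep p.2 e)].

Hypothesis P1_unit : P1 \in unitmx.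

(* the absolutely continuous representatives [F] of [H x] on the edges, their
   derivatives [f] and their boundary values [vl] and [vr] *)
Definition regular_rep p (F f : edge G -> R -> 'cV[C]_d) (vl vr : edge G -> 'cV[C]_d) :=
  forall e, [/\ vh1pair (left_end e) (right_end e) (F e) (f e),
    {ae mu, forall t, edge_int e t -> Hrep p.1 e t = F e t},
    forall t, rep p.2 e t = P1 *m f e t + P0 *m Hrep p.1 e t,
    vleft (left_end e) (F e) (vl e) & vright (right_end e) (F e) (vr e)].

Lemma exists_regular_rep p : maximal_op p -> exists F f vl vr, regular_rep p F f vl vr.
Proof.
move=> mp.
have key e : exists z : (R -> 'cV[C]_d) * (R -> 'cV[C]_d) * 'cV[C]_d * 'cV[C]_d,
    [/\ vh1pair (left_end e) (right_end e) z.1.1.1 z.1.1.2,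
    {ae mu, forall t, edge_int e t -> Hrep p.1 e t = z.1.1.1 t},
    forall t, rep p.2 e t = P1 *m z.1.1.2 t + P0 *m Hrep p.1 e t,
    vleft (left_end e) z.1.1.1 z.1.2 & vright (right_end e) z.1.1.1 z.2].
  have D0 : eitv (left_end e) (right_end e) !=set0 by exact: edge_int_neq0.
  have [F [f [h1 h2 h3]]] := primitive_of_is_distr P1_unit D0 (Hrep_vsqint p.1 e)
    (rep_vsqint p.2 e) (mp e).
  have [vl hl] := vh1pair_left D0 h1; have [vr hr] := vh1pair_right D0 h1.
  by exists (F, f, vl, vr).
have [z Hz] := choice key.
by exists (fun e => (z e).1.1.1), (fun e => (z e).1.1.2), (fun e => (z e).1.2), (fun e => (z e).2).
Qed.

Section RegularRep.
Variables (p : L2H hH * L2H hH) (F f : edge G -> R -> 'cV[C]_d) (vl vr : edge G -> 'cV[C]_d).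
Hypothesis rp : regular_rep p F f vl vr.

Lemma regular_rep_left n (S : 'M[C]_(n, d)) e v : (-oo < left_end e)%E ->
  boundary_value (edge_int e) (at_left_end e) (fun t => S *m Hrep p.1 e t) v <-> v = S *m vl e.
Proof.
move=> el; have [h1 h2 _ hl _] := rp e.
have cl := (vleft_finite (F e) (vl e) el).1 hl.
have pF : vprimitive (edge_int e) (F e) (f e) by move=> k; case: (h1 k).
have fE : {ae mu, forall t, edge_int e t -> S *m Hrep p.1 e t = S *m F e t}.
  by apply: ae_imp h2 => t E /E ->.
have cF : forall t, edge_int e t -> cvg_cV (nbhs t) (fun t => S *m F e t) (S *m F e t).
  by move=> t Dt; apply: cvg_cVM; exact: (vprimitive_continuous pF Dt).
rewrite (@boundary_valueP R n (edge_int e) (at_left_end e) _ _ _ v (@open_edge_int e) (near_at_left_end el) cF fE).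
split => [h|->]; last exact: cvg_cVM.
by apply: (cvg_cV_unique _ h); exact: cvg_cVM.
Qed.

Lemma regular_rep_right n (S : 'M[C]_(n, d)) e v : (right_end e < +oo)%E ->
  boundary_value (edge_int e) (at_right_end e) (fun t => S *m Hrep p.1 e t) v <-> v = S *m vr e.
Proof.
move=> el; have [h1 h2 _ _ hr] := rp e.
have cl := (vright_finite (F e) (vr e) el).1 hr.
have pF : vprimitive (edge_int e) (F e) (f e) by move=> k; case: (h1 k).
have fE : {ae mu, forall t, edge_int e t -> S *m Hrep p.1 e t = S *m F e t}.
  by apply: ae_imp h2 => t E /E ->.
have cF : forall t, edge_int e t -> cvg_cV (nbhs t) (fun t => S *m F e t) (S *m F e t).
  by move=> t Dt; apply: cvg_cVM; exact: (vprimitive_continuous pF Dt).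
rewrite (@boundary_valueP R n (edge_int e) (at_right_end e) _ _ _ v (@open_edge_int e) (near_at_right_end el) cF fE).
split => [h|->]; last exact: cvg_cVM.
by apply: (cvg_cV_unique _ h); exact: cvg_cVM.
Qed.

(** The trace estimate needs the norm of the derivative [f], which is recovered from the equation as
    the inverse of [P1] applied to [p.2 - P0 H p.1]. With [delta] uniform, the bounds on the edges
    are a fixed combination of summable norms. *)
Lemma regular_rep_trace_rsummable :
  rsummable (fun e => vnorm2 (vl e)) /\ rsummable (fun e => vnorm2 (vr e)).
Proof.
have [delta d0 Hd] := edge_length.
have [K1 K10 HK1] := vnorm2_mx_bound (invmx P1); have [K0 K00 HK0] := vnorm2_mx_bound P0.
pose b e := \int[mu]_(t in edge_int e) vnorm2 (Hrep p.1 e t) +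
  K1 * (2 * \int[mu]_(t in edge_int e) vnorm2 (rep p.2 e t) +
        2 * (K0 * \int[mu]_(t in edge_int e) vnorm2 (Hrep p.1 e t))).
have sb : rsummable (fun e => (2 / delta + 1) * b e).
  apply: rsummableZ; apply: rsummableD; first exact: Hrep_vnorm2_rsummable.
  apply: rsummableZ; apply: rsummableD; first by apply: rsummableZ; exact: rep_vnorm2_rsummable.
  by do 2 apply: rsummableZ; exact: Hrep_vnorm2_rsummable.
suff le e v : vleft (left_end e) (F e) v \/ vright (right_end e) (F e) v ->
    vnorm2 v <= (2 / delta + 1) * b e.
  split; apply: le_rsummable sb => e; rewrite ger0_norm ?vnorm2_ge0//; apply: le.
    by left; have [_ _ _ hl _] := rp e.
  by right; have [_ _ _ _ hr] := rp e.
move=> hv; have [h1 h2 h3 _ _] := rp e; have [s [t [Ds Dt st]]] := Hd e.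
apply: (le_trans (vh1pair_trace h1 d0 Ds Dt st hv)).
apply: ler_wpM2l; first by rewrite addr_ge0// divr_ge0// ltW.
have mD := measurable_edge_int e.
have [sF sf] : vsqint (edge_int e) (F e) /\ vsqint (edge_int e) (f e) := vh1pair_sqint h1.
have [iH _] := vsqint_norm mD (Hrep_vsqint p.1 e).
have [iy _] := vsqint_norm mD (rep_vsqint p.2 e).
apply: lerD.
  have mF := mxmeasurable_vnorm2 (vsqint_meas sF).
  have mH := mxmeasurable_vnorm2 (vsqint_meas (Hrep_vsqint p.1 e)).
  rewrite -(eq_Rintegral_ae mD mF mH); first exact: lexx.
  by apply: ae_imp h2 => z E /E ->.
have i1 := integrZl 2 mD iy; have i2 := integrZl K0 mD iH; have i3 := integrZl 2 mD i2.
have i4 := integrD mD i1 i3.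
rewrite -!RintegralZl// -RintegralD// -RintegralZl//; apply: le_Rintegral => //.
- exact: (vsqint_norm mD sf).1.
- exact: integrZl.
move=> z _.
have -> : f e z = invmx P1 *m (rep p.2 e z + - (P0 *m Hrep p.1 e z)) by rewrite h3 addrK mulKmx.
apply: (le_trans (HK1 _)); apply: ler_wpM2l => //.
apply: (le_trans (vnorm2D_le _ _)); rewrite vnorm2N lerD2l.
by apply: ler_wpM2l => //; exact: HK0.
Qed.

End RegularRep.

Hypothesis P0_skew : P0^t* = - P0.
Hypothesis P1_herm : P1^t* = P1.

(** Since [H] is Hermitian, the weighted products become unweighted ones of [H x] with the image
    under the operator. The terms with [P1] then form a total derivative and those with [P0]
    cancel. *)
Lemma green_edge p q F f vl vr F' f' vl' vr' e :
  regular_rep p F f vl vr -> regular_rep q F' f' vl' vr' ->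
  cintegral (edge_int e) (fun t => hform (H e t) (rep p.1 e t) (rep q.2 e t)) +
  cintegral (edge_int e) (fun t => hform (H e t) (rep p.2 e t) (rep q.1 e t)) =
  hform P1 (vr e) (vr' e) - hform P1 (vl e) (vl' e).
Proof.
move=> rp rq; have [h1 h2 h3 hl hr] := rp e; have [g1 g2 g3 gl gr] := rq e.
have mD := measurable_edge_int e; have D0 : eitv (left_end e) (right_end e) !=set0 by exact: edge_int_neq0.
rewrite -(vh1pair_green P1 D0 h1 g1 hl hr gl gr) -cintegralD//; [|exact: cintegr_hform|exact: cintegr_hform].
have mP : cmeasurable (edge_int e) (fun t => hform P1 (f e t) (F' e t) + hform P1 (F e t) (f' e t)).
  have m1 (u v : R -> 'cV[C]_d) : vsqint (edge_int e) u -> vsqint (edge_int e) v ->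
      cmeasurable (edge_int e) (fun t => hform P1 (u t) (v t)).
    move=> su sv; under eq_fun do rewrite hformE.
    apply: cmeasurable_sum => i; apply: cmeasurable_sum => j.
    apply: cmeasurableM; first exact: cmeasurable_cst.
    by apply: cmeasurableM; [apply: cmeasurable_conj; exact: csqint_meas|exact: csqint_meas].
  have [s1 s2] := vh1pair_sqint h1; have [t1 t2] := vh1pair_sqint g1.
  by apply: cmeasurableD; exact: m1.
apply: (eq_cintegral_ae mD) => //.
  by apply: cmeasurableD; exact: cmeasurable_hform.
have [m [M [m0 M0 hmM]]] := uniformly_bounded_hermitian hH.
have h := ae_imp2 (fun t a b => conj a b) h2 g2.
apply: ae_imp2 h (hmM e) => t [a b] c Dt.
have [hh _ _] := c Dt.
have E (u v : 'cV[C]_d) : hform (H e t) u v = hform 1%:M (H e t *m u) v.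
  by rewrite /hform mulmx1 trmx_mul map_mxM /= hh.
rewrite (E (rep p.1 e t)) (hform_mulmxr (H e t)) -/(Hrep p.1 e t) -/(Hrep q.1 e t).
rewrite h3 g3 (a Dt) (b Dt).
rewrite hformDr hformDl -!hform_mulmxr.
have E1 (A : 'M[C]_d) (u v : 'cV[C]_d) : hform 1%:M (A *m u) v = hform (A^t*) u v.
  by rewrite /hform mulmx1 trmx_mul map_mxM.
rewrite !E1 P1_herm P0_skew.
(* Skew symmetry: moving [P0] to the other factor changes its sign, so its two contributions
   annihilate each other. *)
have -> : hform (- P0) (F e t) (F' e t) = - hform P0 (F e t) (F' e t).
  by rewrite /hform mulmxN mulNmx mxE.
by ring.
Qed.

End MaximalOperator.

(** * Boundary values in the diagonalising coordinates *)

Section BoundaryForm.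
Context {R : realType} {G : metric_graph R} {np nm : nat}.
Local Notation C := R[i].
Local Notation re := (@complex.Re R).
Local Notation im := (@complex.Im R).
Local Notation d := (np + nm)%N.
Variables (H : hamiltonian G d) (hH : uniformly_pos_bounded H) (P1 P0 S : 'M[C]_d).
Variables (lam : 'I_np -> {posnum R}) (theta : 'I_nm -> {posnum R}).
Hypothesis inf_diam : (0 < ereal_inf [set diam (edge_int e) | e in [set: edge G]])%E.
Hypothesis P1_unit : P1 \in unitmx.
Local Notation X := (L2H hH).
Local Notation B := (G1 G lam theta * G2 G lam theta)%type.
Local Notation ipX := (@ip_L2H R G d H hH).
Local Notation maxop := (@maximal_op R G d H hH P1 P0).
Implicit Types (e : edge G) (p q : X * X) (g h : B).

Lemma l2_eq (I : countType) n (w : 'I_n -> {posnum R}) (f g : l2 I w) :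
  (forall i, val f i = val g i) -> f = g.
Proof. by move=> E; apply: val_inj; apply/funext. Qed.

Lemma boundary_values_unique (x : X) g h :
  boundary_values S x g -> boundary_values S x h -> g = h.
Proof.
move=> [gl gr] [hl hr].
have L (j : edgeL G) : val g.1.1 j = val h.1.1 j /\ val g.2.1 j = val h.2.1 j.
  have [v [bv -> ->]] := gl j; have [w [bw -> ->]] := hl j.
  by rewrite (boundary_value_unique _ (@open_edge_int R G (val j))
    (near_at_left_end inf_diam (valP j)) bv bw).
have Q (j : edgeR G) : val g.1.2 j = val h.1.2 j /\ val g.2.2 j = val h.2.2 j.
  have [v [bv -> ->]] := gr j; have [w [bw -> ->]] := hr j.
  by rewrite (boundary_value_unique _ (@open_edge_int R G (val j))
    (near_at_right_end inf_diam (valP j)) bv bw).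
case: g h L Q {gl gr hl hr} => [[g1 g2] [g3 g4]] [[h1 h2] [h3 h4]] /= L Q.
congr ((_, _), (_, _)); apply: l2_eq => j.
- exact: (L j).1.
- exact: (Q j).1.
- exact: (L j).2.
- exact: (Q j).2.
Qed.

Lemma boundary_values_lin c (x y : X) g h :
  boundary_values S x g -> boundary_values S y h -> boundary_values S (c *: x + y) (c *: g + h).
Proof.
move=> [gl gr] [hl hr].
have SE e : {ae mu, forall t, edge_int e t ->
    S *m Hrep (c *: x + y) e t = c *: (S *m Hrep x e t) + S *m Hrep y e t}.
  by apply: ae_imp (Hrep_lin c x y e) => t E /E ->; rewrite mulmxDr -scalemxAr.
split=> j.
  have [v [bv v1 v2]] := gl j; have [w [bw w1 w2]] := hl j.
  exists (c *: v + w); split.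
  - exact: boundary_value_lin (SE (val j)) bv bw.
  - by rewrite [RHS]linearP /= -v1 -w1.
  - by rewrite [RHS]linearP /= -v2 -w2.
have [v [bv v1 v2]] := gr j; have [w [bw w1 w2]] := hr j.
exists (c *: v + w); split.
- exact: boundary_value_lin (SE (val j)) bv bw.
- by rewrite [RHS]linearP /= -v1 -w1.
- by rewrite [RHS]linearP /= -v2 -w2.
Qed.

Lemma exists_l2 (I : countType) n (w : 'I_n -> {posnum R}) (f : I -> 'cV[C]_n) (b : I -> R) :
  (forall i, vnorm2 (f i) <= b i) -> rsummable b -> exists g : l2 I w, forall i, val g i = f i.
Proof.
move=> fb sb; have [K K0 HK] := wnorm2_bound w.
have fin : f \in sq_summable (I := I) w.
  apply/asboolP.
  have : rsummable (fun i => wnorm2 w (f i)).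
    apply: le_rsummable (rsummableZ K sb) => i; rewrite ger0_norm ?wnorm2_ge0//.
    by apply: (le_trans (HK _)); exact: ler_wpM2l.
  by rewrite rsummableE// => i; exact: wnorm2_ge0.
by exists (exist _ f fin).
Qed.

Section OneElement.
Variables (p : X * X) (F f : edge G -> R -> 'cV[C]_d) (vl vr : edge G -> 'cV[C]_d).
Hypothesis rp : regular_rep P1 P0 p F f vl vr.

Lemma boundary_valuesP g : boundary_values S p.1 g <->
  (forall j : edgeL G, val g.1.1 j = usubmx (S *m vl (val j)) /\
                       val g.2.1 j = dsubmx (S *m vl (val j))) /\
  (forall j : edgeR G, val g.1.2 j = dsubmx (S *m vr (val j)) /\
                       val g.2.2 j = usubmx (S *m vr (val j))).
Proof.
split=> [[gl gr]|[gl gr]]; split=> j.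
- by have [v [/(regular_rep_left inf_diam rp _ _ (valP j)) -> -> ->]] := gl j.
- by have [v [/(regular_rep_right inf_diam rp _ _ (valP j)) -> -> ->]] := gr j.
- exists (S *m vl (val j)); split; [|exact: (gl j).1|exact: (gl j).2].
  by apply/(regular_rep_left inf_diam rp _ _ (valP j)).
- exists (S *m vr (val j)); split; [|exact: (gr j).1|exact: (gr j).2].
  by apply/(regular_rep_right inf_diam rp _ _ (valP j)).
Qed.

Lemma exists_boundary_values : exists g, boundary_values S p.1 g.
Proof.
have [sl sr] := regular_rep_trace_rsummable inf_diam P1_unit rp.
have [K K0 HK] := vnorm2_mx_bound S.
have SL : rsummable (fun j : edgeL G => K * vnorm2 (vl (val j))).
  apply: rsummableZ.
  rewrite (rsummable_sub (fun e => (-oo < left_end e)%E) (fun e => vnorm2 (vl e))).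
  by apply: le_rsummable sl => e; case: ifP => _; rewrite ?normr0 ?ger0_norm ?vnorm2_ge0.
have SR : rsummable (fun j : edgeR G => K * vnorm2 (vr (val j))).
  apply: rsummableZ.
  rewrite (rsummable_sub (fun e => (right_end e < +oo)%E) (fun e => vnorm2 (vr e))).
  by apply: le_rsummable sr => e; case: ifP => _; rewrite ?normr0 ?ger0_norm ?vnorm2_ge0.
have [g1 E1] := exists_l2 lam (f := fun j : edgeL G => usubmx (S *m vl (val j)))
  (fun j => le_trans (vnorm2_usubmx _) (HK _)) SL.
have [g2 E2] := exists_l2 theta (f := fun j : edgeR G => dsubmx (S *m vr (val j)))
  (fun j => le_trans (vnorm2_dsubmx _) (HK _)) SR.
have [g3 E3] := exists_l2 theta (f := fun j : edgeL G => dsubmx (S *m vl (val j)))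
  (fun j => le_trans (vnorm2_dsubmx _) (HK _)) SL.
have [g4 E4] := exists_l2 lam (f := fun j : edgeR G => usubmx (S *m vr (val j)))
  (fun j => le_trans (vnorm2_usubmx _) (HK _)) SR.
by exists ((g1, g2), (g3, g4)); apply/boundary_valuesP; split=> j; split; rewrite ?E1 ?E2 ?E3 ?E4.
Qed.

End OneElement.

Lemma maximal_boundary_values p : maxop p -> exists g, boundary_values S p.1 g.
Proof.
by move=> /(exists_regular_rep inf_diam P1_unit)[F [f [vl [vr rp]]]];
  exact: exists_boundary_values rp.
Qed.

Hypothesis P0_skew : P0^t* = - P0.
Hypothesis P1_herm : P1^t* = P1.
Hypothesis P1_diag : P1 = S^t* *m block_mx (posdiag lam) 0 0 (- posdiag theta) *m S.

Lemma hform_P1 (u v : 'cV[C]_d) : hform P1 u v =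
  hform (posdiag lam) (usubmx (S *m u)) (usubmx (S *m v)) -
  hform (posdiag theta) (dsubmx (S *m u)) (dsubmx (S *m v)).
Proof.
set D := block_mx (posdiag lam) 0 0 (- posdiag theta).
have -> : hform P1 u v = hform D (S *m u) (S *m v).
  by rewrite P1_diag -/D /hform trmx_mul map_mxM /= !mulmxA.
move: (S *m u) (S *m v) => a b.
rewrite /hform -[a in LHS]vsubmxK -[b in LHS]vsubmxK /D.
rewrite tr_col_mx map_row_mx mul_row_block !mulmx0 addr0 add0r mul_row_col mxE.
by rewrite mulmxN mulNmx [X in _ + X]mxE.
Qed.

(** The sum over the edges is the form of [P1] at the right ends minus that at the left ends. In the
    diagonalising coordinates [g.1] collects the positive part at left ends and the negative part at
    right ends, so every term carries the sign opposite to [omega_form]. *)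
Lemma maximal_green p q g h : maxop p -> maxop q ->
  boundary_values S p.1 g -> boundary_values S q.1 h ->
  ipX p.1 q.2 + ipX p.2 q.1 = - omega_form (ip_G1 G lam theta) (ip_G2 G lam theta) g h.
Proof.
move=> mp mq.
have [F [f [vl [vr rp]]]] := exists_regular_rep inf_diam P1_unit mp.
have [F' [f' [vl' [vr' rq]]]] := exists_regular_rep inf_diam P1_unit mq.
move=> /(boundary_valuesP rp)[gl gr] /(boundary_valuesP rq)[hl hr].
pose l e := hform P1 (vl e) (vl' e); pose r e := hform P1 (vr e) (vr' e).
(* Boundary values at infinite ends are 0, so sums over all edges coincide with sums over [edgeL G]
   and [edgeR G]. *)
have lE e : l e = if (-oo < left_end e)%E then l e else 0.
  case: ifPn => // ne; have [_ _ _ z _] := rp e.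
  by rewrite /l (vleft_infinite ne z) hformE big1// => i _; rewrite big1// => j _; rewrite mxE rmorph0 mul0r mulr0.
have rE e : r e = if (right_end e < +oo)%E then r e else 0.
  case: ifPn => // ne; have [_ _ _ _ z] := rp e.
  by rewrite /r (vright_infinite ne z) hformE big1// => i _; rewrite big1// => j _; rewrite mxE rmorph0 mul0r mulr0.
have s11 := l2_csummable g.1.1 h.1.1; have s12 := l2_csummable g.1.2 h.1.2.
have s21 := l2_csummable g.2.1 h.2.1; have s22 := l2_csummable g.2.2 h.2.2.
have lj (j : edgeL G) : l (val j) = hform (posdiag lam) (val g.1.1 j) (val h.1.1 j) +
    (-1) * hform (posdiag theta) (val g.2.1 j) (val h.2.1 j).
  by rewrite mulN1r (gl j).1 (gl j).2 (hl j).1 (hl j).2 -hform_P1.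
have rj (j : edgeR G) : r (val j) = hform (posdiag lam) (val g.2.2 j) (val h.2.2 j) +
    (-1) * hform (posdiag theta) (val g.1.2 j) (val h.1.2 j).
  by rewrite mulN1r (gr j).1 (gr j).2 (hr j).1 (hr j).2 -hform_P1.
have sl' : csummable (fun j : edgeL G => l (val j)).
  by under eq_fun do rewrite lj; apply: csummableD => //; exact: csummableZ.
have sr' : csummable (fun j : edgeR G => r (val j)).
  by under eq_fun do rewrite rj; apply: csummableD => //; exact: csummableZ.
have sl : csummable l.
  rewrite (_ : l = fun e => if (-oo < left_end e)%E then l e else 0); last exact/funext.
  by apply/(csummable_sub (fun e => (-oo < left_end e)%E) l).
have sr : csummable r.
  rewrite (_ : r = fun e => if (right_end e < +oo)%E then r e else 0); last exact/funext.
  by apply/(csummable_sub (fun e => (right_end e < +oo)%E) r).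
have cl : csum l = ip_l2 g.1.1 h.1.1 - ip_l2 g.2.1 h.2.1.
  rewrite (_ : l = fun e => if (-oo < left_end e)%E then l e else 0); last exact/funext.
  rewrite -(csum_sub (fun e => (-oo < left_end e)%E) l).
  transitivity (csum (fun j : edgeL G => l (val j))) => //; rewrite (funext lj).
  by rewrite csumD//; [rewrite csumZ// mulN1r|exact: csummableZ].
have cr : csum r = ip_l2 g.2.2 h.2.2 - ip_l2 g.1.2 h.1.2.
  rewrite (_ : r = fun e => if (right_end e < +oo)%E then r e else 0); last exact/funext.
  rewrite -(csum_sub (fun e => (right_end e < +oo)%E) r).
  transitivity (csum (fun j : edgeR G => r (val j))) => //; rewrite (funext rj).
  by rewrite csumD//; [rewrite csumZ// mulN1r|exact: csummableZ].
transitivity (csum (fun e => r e + (-1) * l e)).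
  rewrite /ip_L2H -csumD; [|exact: ip_csummable|exact: ip_csummable].
  congr csum; apply/funext => e.
  by rewrite (green_edge inf_diam P0_skew P1_herm e rp rq) mulN1r.
rewrite csumD//; last exact: csummableZ.
rewrite csumZ// cl cr /omega_form /ip_G1 /ip_G2 /ip_sum; ring.
Qed.

End BoundaryForm.

(** * Prescribing boundary values *)

Section Cutoff.
Context {R : realType}.
Implicit Types (k c x : R) (a b : \bar R).

(** The squared positive part is continuously differentiable, and that suffices for
    [continuous_primitive]. *)
Definition pospart_sqr x : R := Num.max x 0 ^+ 2.

Lemma is_derive_pospart_sqr x : is_derive x (1 : R) pospart_sqr (2 * Num.max x 0).
Proof.
have [x0|x0|->] := ltgtP x 0.
- rewrite mulr0; apply: (near_eq_is_derive (f := cst 0)).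
  near=> y; rewrite /pospart_sqr (max_idPr _) ?expr0n//.
  by apply: ltW; near: y; exact: lt_nbhsl.
- have d : is_derive x (1 : R) (fun y => y ^+ 2 : R) (2 * x).
    by apply: is_derive_eq; rewrite /GRing.scale/= ?expr1; ring.
  apply: near_eq_is_derive d.
  near=> y; rewrite /pospart_sqr (max_idPl _)//.
  by apply: ltW; near: y; exact: lt_nbhsr.
- rewrite mulr0; apply: (@is_derive0_sqr_bound _ _ 1) => h.
  rewrite /pospart_sqr maxxx expr0n subr0 mul1r ger0_norm ?sqr_ge0//.
  by have [h0|h0] := leP h 0; rewrite ?expr0n ?sqr_ge0.
Unshelve. all: by end_near. Qed.

(** A descent from 1 at the end [c] to 0 at distance [delta] inside the interval, obtained with
    [k = - delta^-1] at a left end and [k = delta^-1] at a right end. [cut'] is its derivative. *)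
Definition cut k c x : R := pospart_sqr (k * (x - c) + 1).
Definition cut' k c x : R := 2 * Num.max (k * (x - c) + 1) 0 * k.

Lemma is_derive_cut k c x : is_derive x (1 : R) (cut k c) (cut' k c x).
Proof.
rewrite /cut /cut'; apply: (@is_derive1_comp _ pospart_sqr (fun x => k * (x - c) + 1)).
  exact: is_derive_pospart_sqr.
by apply: is_derive_eq; rewrite addr0 subr0; exact: mulr1.
Qed.

Lemma continuous_cut k c : continuous (cut k c).
Proof.
move=> x; apply: differentiable_continuous; apply/derivable1_diffP.
by have [] := is_derive_cut k c x.
Qed.

Lemma continuous_cut' k c : continuous (cut' k c).
Proof.
move=> x; rewrite /cut'; apply: cvgM; last exact: cvg_cst.
apply: cvgM; first exact: cvg_cst.
apply: (@continuous_max _ _ (fun x => k * (x - c) + 1) (fun=> 0)); last exact: cvg_cst.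
by apply: cvgD; [apply: cvgM; [exact: cvg_cst|apply: cvgB; [exact: cvg_id|exact: cvg_cst]]|exact: cvg_cst].
Qed.

Lemma primitive_cut (D : set R) k c : primitive D (cut k c) (cut' k c).
Proof. exact: continuous_primitive (is_derive_cut k c) (@continuous_cut' k c). Qed.

Lemma sqint_support (D : set R) u (p q K : R) : measurable D -> continuous u -> p <= q ->
  (forall x, D x -> `|u x| <= K) -> (forall x, D x -> x \notin `[p, q] -> u x = 0) ->
  sqint D u /\ \int[mu]_(x in D) u x ^+ 2 <= K ^+ 2 * (q - p).
Proof.
move=> mD cu pq uK u0.
have mu_ : measurable_fun D u.
  by apply: measurable_funTS; exact: continuous_measurable_fun.
pose w : R -> R := (cst (K ^+ 2)) \_ `[p, q].
have iw : integr D w.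
  apply: (@integrS _ setT) => //.
  by rewrite /w -restrict_EFin -integrable_mkcond//; exact: integr_cst.
have uw x : D x -> u x ^+ 2 <= w x.
  move=> Dx; rewrite /w patchE mem_setE; have [xpq|xpq] := boolP (x \in `[p, q]).
    by rewrite -real_normK ?num_real// ler_sqr ?nnegrE ?uK// (le_trans _ (uK x Dx)).
  by rewrite u0// expr0n.
have iu : integr D (fun x => u x ^+ 2).
  apply: (@le_integr _ _ _ w) => //; first exact: measurable_funX.
  by move=> x Dx; rewrite ger0_norm ?sqr_ge0// uw.
split => //.
apply: (@le_trans _ _ (\int[mu]_(x in D) w x)); first exact: le_Rintegral.
rewrite /w -Rintegral_mkcondr Rintegral_cst; last exact: measurableI.
apply: ler_wpM2l; first exact: sqr_ge0.
have mpq : mu `[p, q] = (q - p)%:E.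
  by rewrite lebesgue_measure_itv/= lte_fin; case: ltgtP pq => // -> _; rewrite subrr.
rewrite -lee_fin -mpq fineK.
  by apply: le_measure => //; rewrite inE//; exact: measurableI.
rewrite ge0_fin_numE//; apply: (@le_lt_trans _ _ (mu `[p, q])); last by rewrite mpq ltry.
by apply: le_measure => //; rewrite inE//; exact: measurableI.
Qed.

(* [cut k c] lies between 0 and 1 and [`|cut' k c| <= 2 / delta], and both live
   on an interval of length [delta]. *)
Lemma cut_sqint (D : set R) k c (delta p q : R) : measurable D -> 0 < delta ->
  `|k| = delta^-1 -> q - p = delta ->
  (forall x, D x -> k * (x - c) <= 0) ->
  (forall x, D x -> x \notin `[p, q] -> k * (x - c) + 1 <= 0) ->
  [/\ sqint D (cut k c), sqint D (cut' k c),
    \int[mu]_(x in D) cut k c x ^+ 2 <= delta + 4 / delta &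
    \int[mu]_(x in D) cut' k c x ^+ 2 <= delta + 4 / delta].
Proof.
move=> mD d0 kd pqd neg out.
have pq : p <= q by rewrite -subr_ge0 pqd ltW.
have m0 x : 0 <= Num.max (k * (x - c) + 1) 0 by rewrite le_max lexx orbT.
have m1 x : D x -> Num.max (k * (x - c) + 1) 0 <= 1.
  by move=> Dx; rewrite ge_max ler01 andbT gerDr neg.
have [s1 i1] : sqint D (cut k c) /\ \int[mu]_(x in D) cut k c x ^+ 2 <= 1 ^+ 2 * (q - p).
  apply: sqint_support => //; first exact: continuous_cut.
    by move=> x Dx; rewrite /cut /pospart_sqr ger0_norm ?sqr_ge0// expr_le1// m1.
  by move=> x Dx xpq; rewrite /cut /pospart_sqr (max_idPr (out _ Dx xpq)) expr0n.
have [s2 i2] : sqint D (cut' k c) /\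
    \int[mu]_(x in D) cut' k c x ^+ 2 <= (2 / delta) ^+ 2 * (q - p).
  apply: sqint_support => //; first exact: continuous_cut'.
    move=> x Dx; rewrite /cut' normrM kd ler_wpM2r ?invr_ge0 ?(ltW d0)//.
    rewrite ger0_norm ?mulr_ge0// -[leRHS]mulr1; apply: ler_wpM2l => //; exact: m1.
  by move=> x Dx xpq; rewrite /cut' (max_idPr (out _ Dx xpq)) mulr0 mul0r.
(* The squared norm of [cut] is at most [delta] and that of [cut'] at most [4 / delta]; their sum
   serves as a common bound. *)
have e : (2 / delta) ^+ 2 * delta = 4 / delta by field; rewrite gt_eqF.
rewrite pqd ?e in i1 i2; split => //.
  by apply: (le_trans i1); rewrite expr1n mul1r lerDl divr_ge0// ltW.
by apply: (le_trans i2); rewrite lerDr ltW.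
Qed.

Definition cutoff a b (K l r : R) chi chi' := [/\ primitive (eitv a b) chi chi',
  (sqint (eitv a b) chi /\ \int[mu]_(x in eitv a b) chi x ^+ 2 <= K),
  (sqint (eitv a b) chi' /\ \int[mu]_(x in eitv a b) chi' x ^+ 2 <= K),
  (forall y, a = y%:E -> chi x @[x --> y^'+] --> l) &
  (forall y, b = y%:E -> chi x @[x --> y^'-] --> r)].

Lemma cut_center k c : cut k c c = 1.
Proof. by rewrite /cut /pospart_sqr subrr mulr0 add0r (max_idPl _)// expr1n. Qed.

Lemma cutoff_left a b (delta s t : R) : (-oo < a)%E -> 0 < delta -> eitv a b s -> eitv a b t ->
  delta <= t - s -> exists chi chi', cutoff a b (delta + 4 / delta) 1 0 chi chi'.
Proof.
move=> aoo d0 Ds Dt st.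
case: a aoo Ds Dt => [y _ Ds Dt|_ /andP[]//|]; last by rewrite ltxx.
have D x : eitv y%:E b x -> y < x by case/andP; rewrite lte_fin.
have iv0 : 0 <= delta^-1 by rewrite invr_ge0 ltW.
have [||||s1 s2 i1 i2] :=
    @cut_sqint (eitv y%:E b) (- delta^-1) y delta y (y + delta) (measurable_eitv _ _) d0.
- by rewrite normrN ger0_norm.
- by rewrite addrC addKr.
- by move=> x Dx; rewrite mulNr oppr_le0 mulr_ge0// subr_ge0 ltW// D.
- move=> x Dx; rewrite in_itv/= (ltW (D x Dx))/= -ltNge => h.
  rewrite mulNr addrC subr_le0 ler_pdivlMl// mulr1 lerBrDl; exact: ltW.
exists (cut (- delta^-1) y), (cut' (- delta^-1) y); split => //.
- exact: primitive_cut.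
- move=> z [<-]; apply: cvg_at_right_filter; rewrite -[X in _ --> X](cut_center (- delta^-1) y).
  exact: continuous_cut.
(* The opposite end is farther than [delta] from [y], because [s] and [t] lie strictly between them
   at distance at least [delta]. So the cutoff has already reached 0 there. *)
- move=> z bz; apply: cvg_at_left_filter.
  rewrite (_ : 0 = cut (- delta^-1) y z); first exact: continuous_cut.
  rewrite /cut /pospart_sqr (max_idPr _) ?expr0n//.
  rewrite mulNr addrC subr_le0 ler_pdivlMl// mulr1.
  have tz : t < z by case/andP : Dt => _; rewrite bz lte_fin.
  have := D s Ds; lra.
Qed.

Lemma cutoff_right a b (delta s t : R) : (b < +oo)%E -> 0 < delta -> eitv a b s -> eitv a b t ->
  delta <= t - s -> exists chi chi', cutoff a b (delta + 4 / delta) 0 1 chi chi'.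
Proof.
move=> boo d0 Ds Dt st.
case: b boo Ds Dt => [y _ Ds Dt| |_ /andP[_]//]; last by rewrite ltxx.
have D x : eitv a y%:E x -> x < y by case/andP => _; rewrite lte_fin.
have iv0 : 0 <= delta^-1 by rewrite invr_ge0 ltW.
have [||||s1 s2 i1 i2] :=
    @cut_sqint (eitv a y%:E) delta^-1 y delta (y - delta) y (measurable_eitv _ _) d0.
- by rewrite ger0_norm.
- by rewrite opprB addrC subrK.
- by move=> x Dx; rewrite mulr_ge0_le0// subr_le0 ltW// D.
- move=> x Dx; rewrite in_itv/= (ltW (D x Dx))/= andbT -ltNge => h.
  rewrite -lerBrDr sub0r ler_pdivrMl// mulrN1; lra.
exists (cut delta^-1 y), (cut' delta^-1 y); split => //.
- exact: primitive_cut.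
- move=> z az; apply: cvg_at_right_filter.
  rewrite (_ : 0 = cut delta^-1 y z); first exact: continuous_cut.
  rewrite /cut /pospart_sqr (max_idPr _) ?expr0n//.
  rewrite -lerBrDr sub0r ler_pdivrMl// mulrN1.
  have zs : z < s by case/andP : Ds; rewrite az lte_fin.
  have := D t Dt; lra.
- move=> z [<-]; apply: cvg_at_left_filter; rewrite -[X in _ --> X](cut_center delta^-1 y).
  exact: continuous_cut.
Qed.

End Cutoff.

(** * Extension of prescribed end values to an interval *)

Section Lift.
Context {R : realType} (d : nat).
Local Notation C := R[i].
Local Notation re := (@complex.Re R).
Local Notation im := (@complex.Im R).
Implicit Types (a b : \bar R) (v w : 'cV[C]_d) (F f : R -> 'cV[C]_d).

Definition end_lift a b (B : R) v w F f :=
  [/\ (vsqint (eitv a b) F /\ \int[mu]_(t in eitv a b) vnorm2 (F t) <= B),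
      (vsqint (eitv a b) f /\ \int[mu]_(t in eitv a b) vnorm2 (f t) <= B),
      vprimitive (eitv a b) F f, vleft a F v & vright b F w].

Lemma re_scale (u : R -> R) v k : re \o (fun t => ((u t)%:C *: v) k 0) = fun t => re (v k 0) * u t.
Proof. by apply/funext => t; rewrite /= mxE reimE /= mul0r subr0 mulrC. Qed.

Lemma im_scale (u : R -> R) v k : im \o (fun t => ((u t)%:C *: v) k 0) = fun t => im (v k 0) * u t.
Proof. by apply/funext => t; rewrite /= mxE reimE /= mul0r addr0 mulrC. Qed.

Lemma vsqint_scale (D : set R) u v (B : R) : measurable D ->
  sqint D u /\ \int[mu]_(x in D) u x ^+ 2 <= B ->
  vsqint D (fun t => (u t)%:C *: v) /\
  \int[mu]_(t in D) vnorm2 ((u t)%:C *: v) <= vnorm2 v * B.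
Proof.
move=> mD [su uB]; split.
  by move=> k; rewrite /csqint re_scale im_scale; split; exact: sqintZ.
under eq_Rintegral do rewrite vnorm2Z /= expr0n addr0 mulrC.
by rewrite RintegralZl//; [apply: ler_wpM2l => //; exact: vnorm2_ge0|case: su].
Qed.

(** The Booleans [l] and [r] select the end at which the vector [v] is attained, so that left and
    right cutoffs are treated together. *)
Lemma lift_cutoff a b (K : R) (l r : bool) v chi chi' : eitv a b !=set0 -> cutoff a b K l%:R r%:R chi chi' ->
  end_lift a b (vnorm2 v * K) (if a is y%:E then l%:R *: v else 0) (if b is y%:E then r%:R *: v else 0)
    (fun t => (chi t)%:C *: v) (fun t => (chi' t)%:C *: v).
Proof.
move=> D0 [p1 s1 s2 cl cr]; have mD := measurable_eitv a b.
have lim (A : set_system R) (FA : ProperFilter A) (j : bool) k : chi x @[x --> A] --> (j%:R : R) ->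
    ccvg A (fun t => ((chi t)%:C *: v) k 0) ((j%:R *: v) k 0).
  move=> c; have -> : (j%:R *: v) k 0 = (re (v k 0) * j%:R) +i* (im (v k 0) * j%:R).
    by rewrite mxE; apply: complex_ext; rewrite reimE /=; case: j {c} => /=; rewrite ?(mul0r, mulr0, mul1r, mulr1, addr0, subr0).
  split; rewrite ?(re_scale, im_scale).
    rewrite -[X in X @ _]/(re \o (fun t => ((chi t)%:C *: v) k 0)) re_scale.
    by apply: cvgM => //; exact: cvg_cst.
  rewrite -[X in X @ _]/(im \o (fun t => ((chi t)%:C *: v) k 0)) im_scale.
  by apply: cvgM => //; exact: cvg_cst.
split.
- exact: vsqint_scale.
- exact: vsqint_scale.
- by move=> k; rewrite /cprimitive !re_scale !im_scale; split; exact: primitiveZ.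
- case: a {D0 p1 s1 s2 mD} cl => [y| |] cl k; [|by rewrite /= mxE..].
  exact: lim (cl y erefl).
- case: b {D0 p1 s1 s2 mD} cr => [y| |] cr k; [|by rewrite /= mxE..].
  exact: lim (cr y erefl).
Qed.

Lemma liftD a b (B B' : R) v w F f v' w' F' f' : end_lift a b B v w F f -> end_lift a b B' v' w' F' f' ->
  end_lift a b (2 * (B + B')) (v + v') (w + w') (fun t => F t + F' t) (fun t => f t + f' t).
Proof.
move=> [[sF bF] [sf bf] pF lF rF] [[sF' bF'] [sf' bf'] pF' lF' rF'].
have mD := measurable_eitv a b.
have key h h' : vsqint (eitv a b) h -> vsqint (eitv a b) h' ->
    \int[mu]_(t in eitv a b) vnorm2 (h t) <= B -> \int[mu]_(t in eitv a b) vnorm2 (h' t) <= B' ->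
    vsqint (eitv a b) (fun t => h t + h' t) /\
    \int[mu]_(t in eitv a b) vnorm2 (h t + h' t) <= 2 * (B + B').
  move=> sh sh' bh bh'; have shh := vsqintD mD sh sh'; split => //.
  have i1 := (vsqint_norm mD sh).1; have i2 := (vsqint_norm mD sh').1.
  have i3 := integrZl 2 mD i1; have i4 := integrZl 2 mD i2.
  apply: (@le_trans _ _ (\int[mu]_(t in eitv a b) (2 * vnorm2 (h t) + 2 * vnorm2 (h' t)))).
    apply: le_Rintegral => //; [exact: (vsqint_norm mD shh).1|exact: integrD|].
    by move=> t _; exact: vnorm2D_le.
  by rewrite RintegralD// !RintegralZl// -mulrDr ler_pM2l// lerD.
split.
- exact: key.
- exact: key.
- move=> k; rewrite (_ : (fun t => (F t + F' t) k 0) = fun t => F t k 0 + F' t k 0).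
    rewrite (_ : (fun t => (f t + f' t) k 0) = fun t => f t k 0 + f' t k 0); first exact: cprimitiveD.
    by apply/funext => t; rewrite mxE.
  by apply/funext => t; rewrite mxE.
- case: a lF lF' {sF sf pF bF bf sF' sf' pF' bF' bf' mD key} => [y| |] lF lF' k; rewrite /= mxE.
  + rewrite (_ : (fun t => (F t + F' t) k 0) = fun t => F t k 0 + F' t k 0); first exact: ccvgD (lF k) (lF' k).
    by apply/funext => t; rewrite mxE.
  + by rewrite (lF k) (lF' k) addr0.
  + by rewrite (lF k) (lF' k) addr0.
- case: b rF rF' {sF sf pF bF bf sF' sf' pF' bF' bf' mD key} => [y| |] rF rF' k; rewrite /= mxE.
  + rewrite (_ : (fun t => (F t + F' t) k 0) = fun t => F t k 0 + F' t k 0); first exact: ccvgD (rF k) (rF' k).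
    by apply/funext => t; rewrite mxE.
  + by rewrite (rF k) (rF' k) addr0.
  + by rewrite (rF k) (rF' k) addr0.
Qed.

Lemma lift0 a b (B : R) : eitv a b !=set0 -> 0 <= B ->
  end_lift a b B 0 0 (fun=> 0) (fun=> 0).
Proof.
move=> D0 B0; have mD := measurable_eitv a b.
have s0 : sqint (eitv a b) (fun=> 0 : R).
  by split; [exact: measurable_cst|under eq_fun do rewrite expr0n; exact: integrable0].
have z k : (fun t : R => (0 : 'cV[C]_d) k 0) = fun=> 0 by apply/funext => t; rewrite mxE.
have sv : vsqint (eitv a b) (fun=> 0 : 'cV[C]_d) /\
    \int[mu]_(t in eitv a b) vnorm2 (0 : 'cV[C]_d) <= B.
  split; first by move=> k; rewrite z; split.
  by under eq_Rintegral do rewrite vnorm2_0; rewrite Rintegral_cst// mul0r.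
split => //.
- by move=> k; rewrite z; split; exact: primitive_cst.
- by case: a {D0 mD s0 sv} => [y| |] k; rewrite ?z /= mxE//; exact: ccvg_cst.
- by case: b {D0 mD s0 sv} => [y| |] k; rewrite ?z /= mxE//; exact: ccvg_cst.
Qed.

(** A lift of [v] vanishing at the right end is added to a lift of [w] vanishing at the left end.
    The constant is chosen before the interval and depends on [delta] alone, so the lifts on all
    edges can be summed. Its factor 2 comes from [liftD]. *)
Lemma exists_lift (delta : R) : 0 < delta -> exists2 K, 0 <= K & forall a b s t v w,
  eitv a b s -> eitv a b t -> delta <= t - s ->
  (~~ (-oo < a)%E -> v = 0) -> (~~ (b < +oo)%E -> w = 0) ->
  exists F f, end_lift a b (K * (vnorm2 v + vnorm2 w)) v w F f.
Proof.
move=> d0; exists (2 * (delta + 4 / delta)); first by rewrite mulr_ge0// addr_ge0 ?divr_ge0// ltW.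
move=> a b s t v w Ds Dt st av bw.
have D0 : eitv a b !=set0 by exists s.
have K0 : 0 <= delta + 4 / delta by rewrite addr_ge0 ?divr_ge0// ltW.
have [F [f l1]] : exists F f, end_lift a b (vnorm2 v * (delta + 4 / delta)) v 0 F f.
  have [aoo|aoo] := boolP (-oo < a)%E; last first.
    by rewrite av//; exists (fun=> 0), (fun=> 0); apply: lift0; rewrite ?mulr_ge0 ?vnorm2_ge0.
  have [chi [chi' H]] := cutoff_left aoo d0 Ds Dt st.
  have := lift_cutoff (l := true) (r := false) v D0 H.
  rewrite scale0r scale1r (_ : (if b is _%:E then 0 else 0) = 0); last by case: (b).
  move=> h; exists (fun t => (chi t)%:C *: v), (fun t => (chi' t)%:C *: v).
  by case: a aoo h Ds {H Dt D0 av} => [y _ //|_ _ /andP[]//|]; rewrite ltxx.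
have [F' [f' l2]] : exists F f, end_lift a b (vnorm2 w * (delta + 4 / delta)) 0 w F f.
  have [boo|boo] := boolP (b < +oo)%E; last first.
    by rewrite bw//; exists (fun=> 0), (fun=> 0); apply: lift0; rewrite ?mulr_ge0 ?vnorm2_ge0.
  have [chi [chi' H]] := cutoff_right boo d0 Ds Dt st.
  have := lift_cutoff (l := false) (r := true) w D0 H.
  rewrite scale0r scale1r (_ : (if a is _%:E then 0 else 0) = 0); last by case: (a).
  move=> h; exists (fun t => (chi t)%:C *: w), (fun t => (chi' t)%:C *: w).
  by case: b boo h Ds {H Dt D0 bw l1} => [y _ //||_ _ /andP[_]//]; rewrite ltxx.
exists (fun t => F t + F' t), (fun t => f t + f' t).
have := liftD l1 l2; rewrite addr0 add0r -mulrDl mulrCA mulrC -mulrA [X in _ * X]mulrC.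
by rewrite mulrA.
Qed.

End Lift.

Section Realization.
Context {R : realType} {G : metric_graph R} {d : nat}.
Local Notation C := R[i].
Variables (H : hamiltonian G d) (hH : uniformly_pos_bounded H) (P1 P0 : 'M[C]_d).
Implicit Types (e : edge G) (x y : L2H hH) (p q : L2H hH * L2H hH).
Hypothesis inf_diam : (0 < ereal_inf [set diam (edge_int e) | e in [set: edge G]])%E.
Local Notation maxop := (@maximal_op R G d H hH P1 P0).

(** The means of producing elements of the maximal operator: it realises prescribed square
    integrable [H^1] functions [F] on the edges as [H x], provided that their norms and those of
    their derivatives are summable. *)
Lemma exists_maximal (F f : edge G -> R -> 'cV[C]_d) :
  (forall e, [/\ vsqint (edge_int e) (F e), vsqint (edge_int e) (f e) &
    vprimitive (edge_int e) (F e) (f e)]) ->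
  rsummable (fun e => \int[mu]_(t in edge_int e) vnorm2 (F e t)) ->
  rsummable (fun e => \int[mu]_(t in edge_int e) vnorm2 (f e t)) ->
  exists2 q, maxop q & forall e,
    {ae mu, forall t, edge_int e t -> Hrep q.1 e t = F e t} /\
    {ae mu, forall t, edge_int e t -> rep q.2 e t = P1 *m f e t + P0 *m F e t}.
Proof.
move=> hFf SF Sf.
have sF e : vsqint (edge_int e) (F e) by case: (hFf e).
have sf e : vsqint (edge_int e) (f e) by case: (hFf e).
have pF e : vprimitive (edge_int e) (F e) (f e) by case: (hFf e).
have sg e : vsqint (edge_int e) (fun t => P1 *m f e t + P0 *m F e t).
  by apply: vsqintD; [exact: measurable_edge_int|apply: vsqintM => //; exact: measurable_edge_int|apply: vsqintM => //; exact: measurable_edge_int].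
have [x xF] := exists_Hrep hH sF SF.
have [K1 K10 HK1] := vnorm2_mx_bound P1; have [K0 K00 HK0] := vnorm2_mx_bound P0.
have [|y yg] := exists_rep hH sg.
  apply: le_rsummable (rsummableD (rsummableZ (2 * K1) Sf) (rsummableZ (2 * K0) SF)) => e.
  have mD := measurable_edge_int e.
  rewrite ger0_norm; last by apply: Rintegral_ge0 => t _; exact: vnorm2_ge0.
  have i1 := integrZl (2 * K1) mD (vsqint_norm mD (sf e)).1.
  have i2 := integrZl (2 * K0) mD (vsqint_norm mD (sF e)).1.
  have [j1 _] := vsqint_norm mD (sf e); have [j2 _] := vsqint_norm mD (sF e).
  rewrite -!RintegralZl// -RintegralD//; apply: le_Rintegral => //.
  - exact: (vsqint_norm mD (sg e)).1.
  - exact: integrD.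
  move=> t _; apply: (le_trans (vnorm2D_le _ _)); rewrite -!mulrA.
  by apply: lerD; apply: ler_wpM2l.
exists (x, y); last by move=> e; split; [exact: xF|exact: yg].
move=> e; have mD := measurable_edge_int e.
have D0 : eitv (left_end e) (right_end e) !=set0 by exact: edge_int_neq0.
apply: (eq_is_distr mD _ _ _ _ _ _ (is_distr_primitive P1 P0 D0 (sF e) (pF e))).
- exact: vsqint_meas.
- exact: Hrep_measurable.
- exact: vsqint_meas.
- exact: rep_measurable.
- by apply: ae_imp (xF e) => t E /E.
- by apply: ae_imp (yg e) => t E /E.
Qed.

Section Values.
Variables (x : L2H hH) (e : edge G) (F f : R -> 'cV[C]_d).
Hypothesis xF : {ae mu, forall t, edge_int e t -> Hrep x e t = F t}.
Hypothesis pF : vprimitive (edge_int e) F f.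

Lemma boundary_value_left v : (-oo < left_end e)%E -> vleft (left_end e) F v ->
  boundary_value (edge_int e) (at_left_end e) (Hrep x e) v.
Proof.
move=> el lF; exists F; split.
- by apply: ae_imp xF => t E /E.
- by move=> t Dt; exact: (vprimitive_continuous pF Dt).
- by apply/vleft_finite.
Qed.

Lemma boundary_value_right v : (right_end e < +oo)%E -> vright (right_end e) F v ->
  boundary_value (edge_int e) (at_right_end e) (Hrep x e) v.
Proof.
move=> el lF; exists F; split.
- by apply: ae_imp xF => t E /E.
- by move=> t Dt; exact: (vprimitive_continuous pF Dt).
- by apply/vright_finite.
Qed.

End Values.

End Realization.

Section Surjectivity.
Context {R : realType} {G : metric_graph R} {np nm : nat}.
Local Notation C := R[i].
Local Notation d := (np + nm)%N.
Variables (H : hamiltonian G d) (hH : uniformly_pos_bounded H) (P1 P0 S : 'M[C]_d).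
Variables (lam : 'I_np -> {posnum R}) (theta : 'I_nm -> {posnum R}).
Hypothesis inf_diam : (0 < ereal_inf [set diam (edge_int e) | e in [set: edge G]])%E.
Hypothesis S_unitary : S \is unitarymx.
Local Notation B := (G1 G lam theta * G2 G lam theta)%type.
Local Notation maxop := (@maximal_op R G d H hH P1 P0).

Definition extend0 (P : pred (edge G)) (f : {e | P e} -> 'cV[C]_d) (e : edge G) : 'cV[C]_d :=
  if insub e is Some j then f j else 0.

Lemma extend0_val (P : pred (edge G)) (f : {e | P e} -> 'cV[C]_d) j : extend0 f (val j) = f j.
Proof. by rewrite /extend0 valK. Qed.

Lemma extend0_out (P : pred (edge G)) (f : {e | P e} -> 'cV[C]_d) e : ~~ P e -> extend0 f e = 0.
Proof. by move=> Pe; rewrite /extend0 insubN. Qed.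

Lemma extend0_rsummable (P : pred (edge G)) (f : {e | P e} -> 'cV[C]_d) :
  rsummable (fun j => vnorm2 (f j)) -> rsummable (fun e => vnorm2 (extend0 f e)).
Proof.
under eq_fun do rewrite -extend0_val.
rewrite (rsummable_sub P (fun e => vnorm2 (extend0 f e))); apply: le_rsummable => e.
case: ifPn => Pe; first by rewrite ger0_norm ?vnorm2_ge0.
by rewrite extend0_out// vnorm2_0 normr0.
Qed.

Lemma l2_vnorm2_rsummable (I : countType) n (w : 'I_n -> {posnum R}) (g : l2 I w) :
  rsummable (fun i => vnorm2 (val g i)).
Proof.
have [K K0 HK] := vnorm2_le_wnorm2 w.
apply: le_rsummable (rsummableZ K (l2_rsummable g)) => i.
by rewrite ger0_norm ?vnorm2_ge0//; exact: HK.
Qed.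

(** The adjoint of [S] converts the prescribed coordinates into values of [H x] at the ends,
    extended by 0 to infinite ends. Since the norms of the lifts are bounded uniformly by those of
    the end values, square summable data give an element of the space. *)
Lemma boundary_values_surj (g : B) : exists2 q, maxop q & boundary_values S q.1 g.
Proof.
have SS u : S *m (S^t* *m u) = u by rewrite mulmxA; move/unitarymxP : S_unitary => ->; rewrite mul1mx.
have [K0 K00 HK0] := vnorm2_mx_bound (S^t*).
pose fl (j : edgeL G) : 'cV[C]_d := S^t* *m col_mx (val g.1.1 j) (val g.2.1 j).
(* At a right end the components change places: the upper block belongs to the second boundary space
   and the lower block to the first. *)
pose fr (j : edgeR G) : 'cV[C]_d := S^t* *m col_mx (val g.2.2 j) (val g.1.2 j).
have sl : rsummable (fun e => vnorm2 (extend0 fl e)).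
  apply: extend0_rsummable.
  apply: le_rsummable (rsummableZ K0 (rsummableD (l2_vnorm2_rsummable g.1.1) (l2_vnorm2_rsummable g.2.1))) => j.
  by rewrite ger0_norm ?vnorm2_ge0// (le_trans (HK0 _))// vnorm2_col_mx.
have sr : rsummable (fun e => vnorm2 (extend0 fr e)).
  apply: extend0_rsummable.
  apply: le_rsummable (rsummableZ K0 (rsummableD (l2_vnorm2_rsummable g.2.2) (l2_vnorm2_rsummable g.1.2))) => j.
  by rewrite ger0_norm ?vnorm2_ge0// (le_trans (HK0 _))// vnorm2_col_mx.
have [delta d0 Hd] := edge_length inf_diam.
have [K Kge HK] := @exists_lift R d _ d0.
have /choice[z Hz] : forall e, exists z : (R -> 'cV[C]_d) * (R -> 'cV[C]_d),
    end_lift (left_end e) (right_end e) (K * (vnorm2 (extend0 fl e) + vnorm2 (extend0 fr e)))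
    (extend0 fl e) (extend0 fr e) z.1 z.2.
  move=> e; have [s [t [Ds Dt st]]] := Hd e.
  have [F [f l]] := HK (left_end e) (right_end e) s t (extend0 fl e) (extend0 fr e) Ds Dt st
    (fun h => extend0_out fl h) (fun h => extend0_out fr h).
  by exists (F, f).
have [|||q mq Hq] := @exists_maximal R G d H hH P1 P0 inf_diam (fun e => (z e).1) (fun e => (z e).2).
- by move=> e; case: (Hz e) => [[? _] [? _] ? _ _].
- apply: le_rsummable (rsummableZ K (rsummableD sl sr)) => e.
  rewrite ger0_norm; last by apply: Rintegral_ge0 => t _; exact: vnorm2_ge0.
  by case: (Hz e) => [[_ ?] _ _ _ _].
- apply: le_rsummable (rsummableZ K (rsummableD sl sr)) => e.
  rewrite ger0_norm; last by apply: Rintegral_ge0 => t _; exact: vnorm2_ge0.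
  by case: (Hz e) => [_ [_ ?] _ _ _].
exists q => //; split=> j.
- have [_ _ pF lF _] := Hz (val j); have [xF _] := Hq (val j).
  exists (col_mx (val g.1.1 j) (val g.2.1 j)); rewrite col_mxKu col_mxKd; split => //.
  rewrite -[X in boundary_value _ _ _ X]SS; apply: boundary_valueM.
  rewrite -/(fl j) -extend0_val.
  exact: (boundary_value_left inf_diam xF pF (valP j) lF).
- have [_ _ pF _ rF] := Hz (val j); have [xF _] := Hq (val j).
  exists (col_mx (val g.2.2 j) (val g.1.2 j)); rewrite col_mxKu col_mxKd; split => //.
  rewrite -[X in boundary_value _ _ _ X]SS; apply: boundary_valueM.
  rewrite -/(fr j) -extend0_val.
  exact: (boundary_value_right inf_diam xF pF (valP j) rF).
Qed.

End Surjectivity.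

(** * The adjoint *)

Section CompactSupport.
Context {R : realType} {d : nat}.
Local Notation C := R[i].
Implicit Types (a b : \bar R) (F : R -> 'cV[C]_d).

Lemma compact_support_ends a b F (s t : R) : eitv a b s -> eitv a b t ->
  (forall x, x \notin `[s, t] -> F x = 0) -> vleft a F 0 /\ vright b F 0.
Proof.
move=> Ds Dt F0.
have cc (A : set_system R) (FA : ProperFilter A) : (\forall x \near A, 0 = F x) -> cvg_cV A F 0.
  by move=> E; apply: (eq_cvg_cV FA E) => k; split; exact: cvg_cst.
split.
  case: a Ds Dt => [y| |] Ds Dt; [|by move=> k; rewrite /= mxE..].
  apply: (cc y^'+); have N : \forall x \near y^'+, eitv y%:E b x /\ x < s := near_end_left Ds.
  by apply: filterS N => x [_ xs]; rewrite F0// in_itv/= negb_and -ltNge xs.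
case: b Ds Dt => [y| |] Ds Dt; [|by move=> k; rewrite /= mxE..].
apply: (cc y^'-); have N : \forall x \near y^'-, eitv a y%:E x /\ t < x := near_end_right Dt.
by apply: filterS N => x [_ xs]; rewrite F0// in_itv/= negb_and -!ltNge xs orbT.
Qed.

End CompactSupport.

Section SingleTerm.
Context {R : realType} {I : choiceType}.
Local Notation C := R[i].

Lemma esum_single (k : I -> R) i : (forall j, j != i -> k j = 0) -> (forall j, 0 <= k j) ->
  (\esum_(j in [set: I]) (k j)%:E)%E = (k i)%:E.
Proof.
move=> k0 kge; rewrite -(@esum_set1 _ _ i (fun j => (k j)%:E)); last by rewrite lee_fin.
rewrite [RHS]esum_mkcond; apply: eq_esum => j _.
by case: ifPn => // ji; rewrite k0//; apply: contra ji => /eqP ->; rewrite inE.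
Qed.

Lemma rsummable_single (k : I -> R) i : (forall j, j != i -> k j = 0) -> rsummable k.
Proof.
move=> k0; rewrite /rsummable (@esum_single (fun j => `|k j|) i) ?ltry//.
by move=> j /k0 ->; rewrite normr0.
Qed.

Lemma csum_single (f : I -> C) i : (forall j, j != i -> f j = 0) -> csum f = f i.
Proof.
move=> f0.
have key (h : I -> R) : (forall j, j != i -> h j = 0) -> rsum h = h i.
  move=> h0.
  rewrite /rsum (@esum_single (fun j => Num.max (h j) 0) i); last 2 first.
  - by move=> j ji; rewrite h0// maxxx.
  - by move=> j; rewrite le_max lexx orbT.
  rewrite (@esum_single (fun j => Num.max (- h j) 0) i); last 2 first.
  - by move=> j ji; rewrite h0// oppr0 maxxx.
  - by move=> j; rewrite le_max lexx orbT.
  rewrite /=; have [p|p] := leP 0 (h i).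
    by rewrite (max_idPr _) ?oppr_le0// subr0.
  by rewrite (max_idPl _) ?oppr_ge0 ?(ltW p)// sub0r opprK.
by apply: complex_ext; rewrite /= key// => j /f0 ->.
Qed.

End SingleTerm.

Section TestFunctions.
Context {R : realType}.
Implicit Types (a b : \bar R) (phi : R -> R).

Lemma test_fun_sqint a b phi : eitv a b !=set0 -> test_fun (eitv a b) phi ->
  sqint (eitv a b) phi /\ sqint (eitv a b) (derive1 phi).
Proof.
move=> D0 tphi; have [s [t [Ds Dt st H]]] := test_fun_support D0 tphi.
have [dp cp] := test_fun_is_derive tphi; have cphi := test_fun_continuous tphi.
have H' x : x \notin `[s, t] -> phi x = 0 /\ derive1 phi x = 0.
  by move=> xst; apply: H; apply: contra xst; exact: subset_itv_oo_cc.
have key u : continuous u -> (forall x, x \notin `[s, t] -> u x = 0) -> sqint (eitv a b) u.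
  move=> cu u0; split.
    by apply: measurable_funTS; exact: continuous_measurable_fun.
  apply: (integr_support _ (eitv_itv Ds Dt)); first exact: measurable_eitv.
    by move=> x /u0 ->; rewrite expr0n.
  by apply: (@continuous_integr _ (fun x => u x * u x)) => x; apply: cvgM; exact: cu.
by split; apply: key => // x /H'[].
Qed.

End TestFunctions.

(** * The adjoint as minus the maximal operator *)

Section AdjointMaximal.
Context {R : realType} {G : metric_graph R} {d : nat}.
Local Notation C := R[i].
Local Notation re := (@complex.Re R).
Local Notation im := (@complex.Im R).
Variables (H : hamiltonian G d) (hH : uniformly_pos_bounded H) (P1 P0 : 'M[C]_d).
Implicit Types (e : edge G) (p q : L2H hH * L2H hH).
Hypothesis inf_diam : (0 < ereal_inf [set diam (edge_int e) | e in [set: edge G]])%E.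
Hypothesis P0_skew : P0^t* = - P0.
Hypothesis P1_herm : P1^t* = P1.
Local Notation maxop := (@maximal_op R G d H hH P1 P0).
Local Notation ipX := (@ip_L2H R G d H hH).

Lemma exists_port_ham_op (F f : edge G -> R -> 'cV[C]_d) :
  (forall e, [/\ vsqint (edge_int e) (F e), vsqint (edge_int e) (f e) &
    vprimitive (edge_int e) (F e) (f e)]) ->
  (forall e, exists s t, [/\ edge_int e s, edge_int e t & forall x, x \notin `[s, t] -> F e x = 0]) ->
  rsummable (fun e => \int[mu]_(t in edge_int e) vnorm2 (F e t)) ->
  rsummable (fun e => \int[mu]_(t in edge_int e) vnorm2 (f e t)) ->
  exists2 q : L2H hH * L2H hH, port_ham_op P1 P0 q & forall e,
    {ae mu, forall t, edge_int e t -> Hrep q.1 e t = F e t} /\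
    {ae mu, forall t, edge_int e t -> rep q.2 e t = P1 *m f e t + P0 *m F e t}.
Proof.
move=> hFf supp SF Sf; have [q mq Hq] := exists_maximal hH P1 P0 inf_diam hFf SF Sf.
exists q => //; split => // e el.
  have [_ _ pF] := hFf e; have [s [t [Ds Dt F0]]] := supp e.
  exact: (boundary_value_left inf_diam (Hq e).1 pF el (compact_support_ends Ds Dt F0).1).
have [_ _ pF] := hFf e; have [s [t [Ds Dt F0]]] := supp e.
exact: (boundary_value_right inf_diam (Hq e).1 pF el (compact_support_ends Ds Dt F0).2).
Qed.

Lemma rep0 e : {ae mu, forall t, edge_int e t -> rep (0 : L2H hH) e t = 0}.
Proof.
by apply: ae_imp (rep_lin (-1) (0 : L2H hH) 0 e) => t h /h; rewrite scaler0 addr0 scaleN1r addNr.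
Qed.

Lemma repN (x : L2H hH) e : {ae mu, forall t, edge_int e t -> rep (- x) e t = - rep x e t}.
Proof.
apply: ae_imp2 (rep_lin (-1) x 0 e) (rep0 e) => t h1 h2 Dt.
by move: (h1 Dt); rewrite h2// !addr0 !scaleN1r.
Qed.

(** The test vector [delta_mx k 0] extracts the coordinate [k] once [P1] and [P0] have been moved to
    the other factor; skew symmetry of [P0] accounts for the sign of [b]. *)
Lemma hform1_test (a b : R) k y :
  hform 1%:M (P1 *m (a%:C *: delta_mx k 0) + P0 *m (b%:C *: delta_mx k 0)) y =
  a%:C * (P1 *m y) k 0 + (- b)%:C * (P0 *m y) k 0.
Proof.
have key (M : 'M[C]_d) (c : R) : hform 1%:M (M *m (c%:C *: delta_mx k 0)) y = c%:C * (M^t* *m y) k 0.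
  rewrite -scalemxAr hformZl (_ : Num.conj c%:C = c%:C); last by apply: complex_ext; rewrite !reimE /= ?oppr0.
  congr (_ * _); rewrite /hform mulmx1 trmx_mul map_mxM -mulmxA mxE (bigD1 k)//= big1 ?addr0.
    by rewrite !mxE !eqxx /= rmorph1 mul1r.
  by move=> j /negPf jk; rewrite !mxE jk /= rmorph0 mul0r.
rewrite hformDl !key P1_herm P0_skew mulNmx [(- (_ *m _)) _ _]mxE mulrN -mulNr.
by congr (_ + _ * _); apply: complex_ext; rewrite !reimE /= ?oppr0.
Qed.

(** The relation of the adjoint is tested with the element [q] of the operator for which [H q.1] is
    [phi] times a unit vector on the edge [e] and 0 on all others. Its compact support gives the
    boundary conditions, and both scalar products reduce to one edge. *)
Lemma adjoint_weak p e phi k : adjoint ipX (port_ham_op P1 P0) p ->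
  test_fun (edge_int e) phi ->
  cintegral (edge_int e) (fun t => (derive1 phi t)%:C * (P1 *m Hrep p.1 e t) k 0 +
    (- phi t)%:C * (P0 *m Hrep p.1 e t) k 0) =
  cintegral (edge_int e) (fun t => (phi t)%:C * rep p.2 e t k 0).
Proof.
move=> Ap tphi.
have D0 e' : eitv (left_end e') (right_end e') !=set0 by exact: edge_int_neq0.
have [s [t [Ds Dt st supp]]] := test_fun_support (D0 e) tphi.
have [sphi sphi'] := test_fun_sqint (D0 e) tphi.
have [dphi cphi'] := test_fun_is_derive tphi.
pose z : 'cV[C]_d := delta_mx k 0.
pose F e' x : 'cV[C]_d := if e' == e then (phi x)%:C *: z else 0.
pose f e' x : 'cV[C]_d := if e' == e then (derive1 phi x)%:C *: z else 0.
have vs0 e' : vsqint (edge_int e') (fun=> 0 : 'cV[C]_d).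
  by have [[]] := lift0 d (D0 e') (lexx (0 : R)).
have [||||q Aq Hq] := @exists_port_ham_op F f.
- move=> e'; rewrite /F /f; case: eqVneq => [->|_].
    split.
    + by have [] := vsqint_scale (B := \int[mu]_(x in edge_int e) phi x ^+ 2) z (measurable_edge_int e) (conj sphi (lexx _)).
    + by have [] := vsqint_scale (B := \int[mu]_(x in edge_int e) derive1 phi x ^+ 2) z (measurable_edge_int e) (conj sphi' (lexx _)).
    + move=> j; rewrite /cprimitive !re_scale !im_scale.
      by split; apply: primitiveZ; exact: continuous_primitive.
  split; [exact: vs0|exact: vs0|].
  by case: (lift0 d (D0 e') (lexx (0 : R)) : end_lift _ _ _ (0 : 'cV[C]_d) _ _ _).
- move=> e'; rewrite /F; case: eqVneq => [->|_].
    exists s, t; split => // x xst.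
    have nx : x \notin `]s, t[ by apply: contra xst; exact: subset_itv_oo_cc.
    by rewrite (supp x nx).1 scale0r.
  by have [x Dx] := D0 e'; exists x, x.
- apply: (@rsummable_single _ _ _ e) => e' /negPf ne; rewrite /F ne.
  by under eq_Rintegral do rewrite vnorm2_0; rewrite Rintegral_cst ?mul0r//; exact: measurable_edge_int.
- apply: (@rsummable_single _ _ _ e) => e' /negPf ne; rewrite /f ne.
  by under eq_Rintegral do rewrite vnorm2_0; rewrite Rintegral_cst ?mul0r//; exact: measurable_edge_int.
have cm (u : R -> R) : continuous u -> cmeasurable (edge_int e) (fun t => (u t)%:C).
  by move=> cu; split; [apply: measurable_funTS; exact: continuous_measurable_fun|exact: measurable_cst].
have cphi := test_fun_continuous tphi.
have mc (M : 'M[C]_d) : mxmeasurable (edge_int e) (fun=> M).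
  by move=> i j; exact: cmeasurable_cst.
have e2 : ipX q.2 p.1 = cintegral (edge_int e) (fun t => hform (H e t) (rep q.2 e t) (rep p.1 e t)).
  apply: (@csum_single _ _ (fun e => cintegral (edge_int e) (fun t => hform (H e t) (rep q.2 e t) (rep p.1 e t))) e).
  move=> e' ne; rewrite (_ : 0 = cintegral (edge_int e') (fun=> 0)); last first.
    by apply: complex_ext; rewrite /= Rintegral_cst ?mul0r//; exact: measurable_edge_int.
  apply: eq_cintegral_ae; [exact: measurable_edge_int|exact: cmeasurable_hform|exact: cmeasurable_cst|].
  apply: ae_imp (Hq e').2 => x h Dx; rewrite h// /F /f (negPf ne) !mulmx0 addr0.
  by rewrite hformE big1// => i _; rewrite big1// => j _; rewrite mxE rmorph0 mul0r mulr0.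
have e1 : ipX q.1 p.2 = cintegral (edge_int e) (fun t => hform (H e t) (rep q.1 e t) (rep p.2 e t)).
  apply: (@csum_single _ _ (fun e => cintegral (edge_int e) (fun t => hform (H e t) (rep q.1 e t) (rep p.2 e t))) e).
  move=> e' ne; rewrite (_ : 0 = cintegral (edge_int e') (fun=> 0)); last first.
    by apply: complex_ext; rewrite /= Rintegral_cst ?mul0r//; exact: measurable_edge_int.
  apply: eq_cintegral_ae; [exact: measurable_edge_int|exact: cmeasurable_hform|exact: cmeasurable_cst|].
  apply: ae_imp2 (ham_hermitian H e') (Hq e').1 => x hE h Dx.
  rewrite -[LHS]conjCK hform_conj hE// hform_mulmxr -/(Hrep q.1 e' x) h// /F (negPf ne).
  by rewrite hformE big1 ?rmorph0// => i _; rewrite big1// => j _; rewrite [X in _ * (_ * X)]mxE !mulr0.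
have e3 : cintegral (edge_int e) (fun t => hform (H e t) (rep q.2 e t) (rep p.1 e t)) =
    cintegral (edge_int e) (fun t => (derive1 phi t)%:C * (P1 *m Hrep p.1 e t) k 0 +
    (- phi t)%:C * (P0 *m Hrep p.1 e t) k 0).
  apply: eq_cintegral_ae; [exact: measurable_edge_int|exact: cmeasurable_hform| |].
    apply: cmeasurableD; apply: cmeasurableM.
    - exact: cm.
    - by apply: (mxmeasurable_mul (mc P1)); exact: Hrep_measurable.
    - by apply: cm => x; apply: cvgN; exact: cphi.
    - by apply: (mxmeasurable_mul (mc P0)); exact: Hrep_measurable.
  apply: ae_imp (Hq e).2 => x h Dx.
  by rewrite h// hform_mulmxr -/(Hrep p.1 e x) /F /f eqxx hform1_test.
rewrite -e3 -e2 (Ap q Aq) e1; apply: eq_cintegral_ae; [exact: measurable_edge_int|exact: cmeasurable_hform| |].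
  apply: cmeasurableM; first exact: cm.
  exact: rep_measurable.
apply: ae_imp2 (ham_hermitian H e) (Hq e).1 => x hE h Dx.
(* Conjugating the form twice lets the Hermitian matrix [H e x] act on the first argument, where
   [H q.1] is known explicitly. *)
rewrite -[LHS]conjCK hform_conj hE// hform_mulmxr -/(Hrep q.1 e x) h// /F eqxx.
rewrite hform1E (bigD1 k)//= big1 ?addr0.
  rewrite rmorphM /= conjCK mulrC; congr (_ * _); rewrite !mxE !eqxx mulr1.
  by apply: complex_ext; rewrite !reimE /= ?oppr0.
by move=> j /negPf jk; rewrite !mxE jk /= !mulr0.
Qed.

(** [adjoint_weak] is the distributional equation up to sign, but as an equation of combined
    integrals. The terms are split only after each is seen to be integrable, [phi] and its
    derivative being compactly supported. *)
Lemma adjoint_maximal p : adjoint ipX (port_ham_op P1 P0) p -> maxop (p.1, - p.2).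
Proof.
move=> Ap e; have mD := measurable_edge_int e.
have D0 : eitv (left_end e) (right_end e) !=set0 by exact: edge_int_neq0.
have mc (M : 'M[C]_d) : mxmeasurable (edge_int e) (fun=> M).
  by move=> i j; exact: cmeasurable_cst.
have sM (M : 'M[C]_d) : vsqint (edge_int e) (fun t => M *m Hrep p.1 e t).
  by apply: vsqintM => //; exact: Hrep_vsqint.
have sN : vsqint (edge_int e) (fun t => - rep p.2 e t).
  rewrite (_ : (fun t => _) = fun t => (- 1%:M : 'M[C]_d) *m rep p.2 e t).
    by apply: vsqintM => //; exact: rep_vsqint.
  by apply/funext => t; rewrite mulNmx mul1mx.
apply: (@eq_is_distr _ _ P1 P0 (edge_int e) (Hrep p.1 e) (fun t => - rep p.2 e t)) => //.
- exact: Hrep_measurable.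
- exact: Hrep_measurable.
- exact: vsqint_meas.
- exact: rep_measurable.
- by apply: ae_imp (rep0 e).
- by apply: ae_imp (repN p.2 e) => t h /h.
apply/is_distrP => phi tphi k.
have loc (g : R -> 'cV[C]_d) : vsqint (edge_int e) g ->
  loc_integr (eitv (left_end e) (right_end e)) (fun t => re (g t k 0)) /\
  loc_integr (eitv (left_end e) (right_end e)) (fun t => im (g t k 0)).
  by move=> sg; case: (vsqint_loc sg k).
have [r1 i1] := loc _ (sM P1); have [r0 i0] := loc _ (sM P0).
have [r2 i2] := loc _ (rep_vsqint p.2 e).
have I g := test_fun_integrM (g := g) D0 tphi.
have W := adjoint_weak k Ap tphi.
pose D := eitv (left_end e) (right_end e).
have split_int (u v w : R -> R) : loc_integr D u -> loc_integr D v -> loc_integr D w ->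
    \int[mu]_(t in D) (derive1 phi t * u t - phi t * v t) = \int[mu]_(t in D) (phi t * w t) ->
    \int[mu]_(t in D) (phi t * - w t) =
    (- \int[mu]_(t in D) (derive1 phi t * u t)) + \int[mu]_(t in D) (phi t * v t).
  move=> lu lv lw; have [_ iu] := I _ lu; have [iv _] := I _ lv; have [iw _] := I _ lw.
  rewrite RintegralB// => E.
  transitivity (- \int[mu]_(t in D) (phi t * w t)); last by rewrite -E opprB addrC.
  rewrite -mulN1r -RintegralZl//; apply: eq_Rintegral => t _; ring.
split.
- transitivity (\int[mu]_(t in D) (phi t * - re (rep p.2 e t k 0))).
    by apply: eq_Rintegral => t _; rewrite mxE reN.
  apply: split_int => //; have := congr1 re W; rewrite /= => W'.
  transitivity (\int[mu]_(t in D) re ((derive1 phi t)%:C * (P1 *m Hrep p.1 e t) k 0 +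
    (- phi t)%:C * (P0 *m Hrep p.1 e t) k 0)).
    by apply: eq_Rintegral => t _; rewrite !reimE /= !mul0r !subr0 mulNr.
  by apply: (etrans W'); apply: eq_Rintegral => t _; rewrite !reimE /= mul0r subr0.
- transitivity (\int[mu]_(t in D) (phi t * - im (rep p.2 e t k 0))).
    by apply: eq_Rintegral => t _; rewrite mxE imN.
  apply: split_int => //; have := congr1 im W; rewrite /= => W'.
  transitivity (\int[mu]_(t in D) im ((derive1 phi t)%:C * (P1 *m Hrep p.1 e t) k 0 +
    (- phi t)%:C * (P0 *m Hrep p.1 e t) k 0)).
    by apply: eq_Rintegral => t _; rewrite !reimE /= !mul0r !addr0 mulNr.
  by apply: (etrans W'); apply: eq_Rintegral => t _; rewrite !reimE /= mul0r addr0.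
Qed.

End AdjointMaximal.

(** * Density of the domain *)

Section FiniteSupport.
Context {R : realType} {I : choiceType}.
Implicit Types (f : I -> R) (X : set I).

Lemma rsummable_finite X f : finite_set X -> rsummable (fun i => if i \in X then f i else 0).
Proof.
move=> fX; rewrite /rsummable.
have -> : (\esum_(i in [set: I]) `|if i \in X then f i else 0|%:E = \esum_(i in X) `|f i|%:E)%E.
  by rewrite [RHS]esum_mkcond; apply: eq_esum => i _; case: ifP; rewrite ?normr0.
by rewrite esum_fset//; rewrite fsumEFin// ltry.
Qed.

Lemma rsummable_tail f (eps : R) : (forall i, 0 <= f i) -> rsummable f -> 0 < eps ->
  exists2 X, finite_set X & psum (fun i => if i \in X then 0 else f i) <= eps.
Proof.
move=> f0 sf e0; have fin := psum_fin f0 sf.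
have : ((psum f - eps)%:E < \esum_(i in [set: I]) (f i)%:E)%E.
  by rewrite -[ltRHS]fineK// lte_fin -/(psum f) ltrBlDr ltrDl.
move=> /ereal_sup_gt[_ [X [fX _] <-]] lt; exists X => //.
have p0 i : 0 <= (if i \in X then f i else 0) by case: ifP.
have q0 i : 0 <= (if i \in X then 0 else f i) by case: ifP.
have sp := @rsummable_finite X f fX.
have sq : rsummable (fun i => if i \in X then 0 else f i).
  by apply: le_rsummable sf => i; case: ifP => _; rewrite ?normr0// ger0_norm.
have E : psum f = psum (fun i => if i \in X then f i else 0) + psum (fun i => if i \in X then 0 else f i).
  by rewrite -psumD//; congr psum; apply/funext => i; case: ifP; rewrite ?addr0 ?add0r.
suff : psum f - eps < psum (fun i => if i \in X then f i else 0) by rewrite E; lra.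
rewrite -lte_fin (lt_le_trans lt)// /psum fineK ?psum_fin//.
rewrite -esum_fset//; last by move=> i _; rewrite lee_fin.
by rewrite esum_mkcond; apply: le_esum => i _; case: ifP.
Qed.

(** Supplies the same admissible error [c] for every edge of a finite set so that the errors add up
    to at most [eps]. *)
Lemma small_weight X (eps : R) : finite_set X -> 0 < eps ->
  exists2 c : R, 0 < c & psum (fun i => if i \in X then c else 0) <= eps.
Proof.
move=> fX e0; set N := psum (fun i => if i \in X then 1 else 0 : R).
have i0 i : 0 <= (if i \in X then 1 else 0 : R) by case: ifP.
have N0 : 0 <= N by apply: psum_ge0.
exists (eps / (N + 1)); first by rewrite divr_gt0// ltr_wpDl.
rewrite (_ : (fun i => _) = fun i => eps / (N + 1) * (if i \in X then 1 else 0)); last first.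
  by apply/funext => i; case: ifP; rewrite ?mulr1 ?mulr0.
rewrite psumZ//; last exact: rsummable_finite.
  by rewrite -/N mulrAC ler_pdivrMr ?ltr_wpDl// ler_pM2l// lerDl.
by rewrite divr_ge0 ?addr_ge0// ltW.
Qed.

End FiniteSupport.

Section VectorApproximation.
Context {R : realType} {d : nat}.
Local Notation C := R[i].
Local Notation re := (@complex.Re R).
Local Notation im := (@complex.Im R).
Implicit Types (a b : \bar R).

Lemma eitv_finite_bounds a b (I : finType) (g : I -> R) : eitv a b !=set0 -> (forall i, eitv a b (g i)) ->
  (exists2 s, eitv a b s & forall i, s <= g i) /\ (exists2 s, eitv a b s & forall i, g i <= s).
Proof.
move=> [x Dx] gD.
have mm (u v : R) : eitv a b u -> eitv a b v -> eitv a b (Num.min u v) /\ eitv a b (Num.max u v).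
  by move=> Du Dv; have [uv|uv] := leP u v.
have L (l : seq I) : (exists2 s, eitv a b s & forall i, i \in l -> s <= g i) /\
    (exists2 s, eitv a b s & forall i, i \in l -> g i <= s).
  elim: l => [|i l [[s Ds Hs] [t Dt Ht]]]; first by split; exists x.
  split; [exists (Num.min (g i) s); first exact: (mm _ _ (gD i) Ds).1|
          exists (Num.max (g i) t); first exact: (mm _ _ (gD i) Dt).2].
    by move=> j; rewrite inE => /predU1P[->|/Hs h]; rewrite ge_min ?lexx ?h ?orbT.
  by move=> j; rewrite inE => /predU1P[->|/Ht h]; rewrite le_max ?lexx ?h ?orbT.
have [[s Ds Hs] [t Dt Ht]] := L (enum I).
split; [exists s => // i; apply: Hs|exists t => // i; apply: Ht]; exact: mem_enum.
Qed.

Lemma vl2_approx a b (h : R -> 'cV[C]_d) (eps : R) : eitv a b !=set0 -> vsqint (eitv a b) h -> 0 < eps ->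
  exists F f s t, [/\ vsqint (eitv a b) F, vsqint (eitv a b) f & vprimitive (eitv a b) F f] /\
    [/\ eitv a b s, eitv a b t, (forall x, x \notin `[s, t] -> F x = 0) &
      \int[mu]_(x in eitv a b) vnorm2 (F x - h x) <= eps].
Proof.
move=> D0 sh e0; have mD := measurable_eitv a b.
(* A vector has [2 * d] real components, each approximated up to [eps']; the summand 1 keeps the
   denominator positive for [d = 0]. *)
pose eps' := eps / (d%:R * 2 + 1).
have N0 : 0 < d%:R * 2 + 1 :> R by rewrite ltr_wpDl// mulr_ge0.
have e'0 : 0 < eps' by rewrite divr_gt0.
have key (u : R -> R) : sqint (eitv a b) u -> exists z : (R -> R) * (R -> R) * R * R,
   [/\ sqint (eitv a b) z.1.1.1, sqint (eitv a b) z.1.1.2 & primitive (eitv a b) z.1.1.1 z.1.1.2] /\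
   [/\ eitv a b z.1.2, eitv a b z.2, (forall x, x \notin `[z.1.2, z.2] -> z.1.1.1 x = 0) &
   sqint (eitv a b) (fun x => z.1.1.1 x - u x) /\ \int[mu]_(x in eitv a b) (z.1.1.1 x - u x) ^+ 2 <= eps'].
  move=> [mu_ iu]; have [F [f [s [t [[Ds Dt pF mf If] [supp mF [iF leF]]]]]]] := l2_approx D0 mu_ iu e'0.
  have mF' : measurable_fun (eitv a b) F by exact: measurable_funTS.
  have sd : sqint (eitv a b) (fun x => F x - u x) by split => //; exact: measurable_funB.
  exists (F, f, s, t) => /=; split; split => //.
  - rewrite (_ : F = fun x => (F x - u x) + u x); first exact: sqintD.
    by apply/funext => x; rewrite subrK.
  - by split => //; exact: measurable_funTS.
  - by move=> x /supp[].
have /choice[zr Hr] : forall k, exists z, _ := fun k => key _ (sh k).1.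
have /choice[zi Hi] : forall k, exists z, _ := fun k => key _ (sh k).2.
pose F x : 'cV[C]_d := \col_k ((zr k).1.1.1 x +i* (zi k).1.1.1 x).
pose f x : 'cV[C]_d := \col_k ((zr k).1.1.2 x +i* (zi k).1.1.2 x).
have reF k : re \o (fun t => F t k 0) = (zr k).1.1.1 by apply/funext => t /=; rewrite mxE.
have imF k : im \o (fun t => F t k 0) = (zi k).1.1.1 by apply/funext => t /=; rewrite mxE.
have ref k : re \o (fun t => f t k 0) = (zr k).1.1.2 by apply/funext => t /=; rewrite mxE.
have imf k : im \o (fun t => f t k 0) = (zi k).1.1.2 by apply/funext => t /=; rewrite mxE.
have zr1 k : eitv a b (zr k).1.2 by case: (Hr k) => _ [].
have zr2 k : eitv a b (zr k).2 by case: (Hr k) => _ [].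
have zi1 k : eitv a b (zi k).1.2 by case: (Hi k) => _ [].
have zi2 k : eitv a b (zi k).2 by case: (Hi k) => _ [].
have [[s1 Ds1 Hs1] _] := eitv_finite_bounds (g := fun k => (zr k).1.2) D0 zr1.
have [[s2 Ds2 Hs2] _] := eitv_finite_bounds (g := fun k => (zi k).1.2) D0 zi1.
have [_ [t1 Dt1 Ht1]] := eitv_finite_bounds (g := fun k => (zr k).2) D0 zr2.
have [_ [t2 Dt2 Ht2]] := eitv_finite_bounds (g := fun k => (zi k).2) D0 zi2.
exists F, f, (Num.min s1 s2), (Num.max t1 t2); split; split.
- by move=> k; rewrite /csqint reF imF; split; [case: (Hr k) => [[]]|case: (Hi k) => [[]]].
- by move=> k; rewrite /csqint ref imf; split; [case: (Hr k) => [[]]|case: (Hi k) => [[]]].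
- by move=> k; rewrite /cprimitive reF imF ref imf; split; [case: (Hr k) => [[]]|case: (Hi k) => [[]]].
- by have [] := leP s1 s2.
- by have [] := leP t1 t2.
- move=> x xst; apply/matrixP => k j; rewrite ord1 !mxE.
  have out (s t : R) : Num.min s1 s2 <= s -> t <= Num.max t1 t2 -> x \notin `[s, t].
    move=> ss tt; apply: contra xst; rewrite !in_itv/= => /andP[sx xt].
    by rewrite (le_trans ss)//= (le_trans xt).
  have [_ [_ _ r0 _]] := Hr k; have [_ [_ _ i0 _]] := Hi k.
  rewrite r0; last by apply: out; [rewrite ge_min Hs1|rewrite le_max Ht1].
  by rewrite i0//; apply: out; [rewrite ge_min Hs2 orbT|rewrite le_max Ht2 orbT].
have reD' k : re \o (fun t => (F t - h t) k 0) = fun x => (zr k).1.1.1 x - re (h x k 0).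
  by apply/funext => t /=; rewrite !mxE !reimE.
have imD' k : im \o (fun t => (F t - h t) k 0) = fun x => (zi k).1.1.1 x - im (h x k 0).
  by apply/funext => t /=; rewrite !mxE !reimE.
have sD : vsqint (eitv a b) (fun x => F x - h x).
  move=> k; rewrite /csqint reD' imD'; split.
    by have [_ [_ _ _ []]] := Hr k.
  by have [_ [_ _ _ []]] := Hi k.
rewrite (vsqint_norm mD sD).2.
apply: (@le_trans _ _ (\sum_(k < d) (eps' + eps'))).
  apply: ler_sum => k _; apply: lerD.
    have [_ [_ _ _ [_ le]]] := Hr k; apply: le_trans le; rewrite le_eqVlt; apply/orP; left; apply/eqP.
    by apply: eq_Rintegral => t _; rewrite -[X in X ^+ 2]/((re \o (fun t => (F t - h t) k 0)) t) reD'.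
  have [_ [_ _ _ [_ le]]] := Hi k; apply: le_trans le; rewrite le_eqVlt; apply/orP; left; apply/eqP.
  by apply: eq_Rintegral => t _; rewrite -[X in X ^+ 2]/((im \o (fun t => (F t - h t) k 0)) t) imD'.
rewrite sumr_const card_ord -mulr_natl.
have -> : d%:R * (eps' + eps') = eps * (d%:R * 2 / (d%:R * 2 + 1)).
  by rewrite /eps'; field; rewrite gt_eqF.
by rewrite ler_piMr ?(ltW e0)// ler_pdivrMr// mul1r lerDl.
Qed.

End VectorApproximation.

(** * Approximation by elements with compact support on finitely many edges *)

Section Density.
Context {R : realType} {G : metric_graph R} {d : nat}.
Local Notation C := R[i].
Local Notation re := (@complex.Re R).
Variables (H : hamiltonian G d) (hH : uniformly_pos_bounded H) (P1 P0 : 'M[C]_d).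
Hypothesis inf_diam : (0 < ereal_inf [set diam (edge_int e) | e in [set: edge G]])%E.
Local Notation ipX := (@ip_L2H R G d H hH).

Lemma edge_energy_le_Hrep : exists2 K : R, 0 < K & forall (x : L2H hH) (e : edge G),
  edge_energy H (rep x) e <= K * \int[mu]_(t in edge_int e) vnorm2 (Hrep x e t).
Proof.
have [m [M [m0 M0 hmM]]] := uniformly_bounded_hermitian hH.
exists m^-1; first by rewrite invr_gt0.
move=> x e; have mD := measurable_edge_int e.
have iH := (vsqint_norm mD (Hrep_vsqint x e)).1.
rewrite -RintegralZl//; apply: le_Rintegral_ae => //; [exact: rep_energy|exact: integrZl|].
apply: ae_imp (hmM e) => t h Dt; have h' := h Dt.
have -> : rep x e t = invmx (H e t) *m Hrep x e t.
  by rewrite mulKmx//; exact: bounded_hermitian_unit m0 h'.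
exact: re_hform_inv_le m0 h' _.
Qed.

(** Outside a finite set [X] of edges that carries all but [eta] of the norm of [H x], the
    approximant is 0; on [X] it is obtained from [vl2_approx] for [H x]. The bound of the energy by
    the norm of [H x] transfers the estimate to [x]. Finiteness of [X] makes the derivatives
    summable, although they are not controlled by [eta]. *)
Lemma port_ham_op_dense : densely_defined ipX (port_ham_op P1 P0).
Proof.
move=> x eps eps0; have hip := ip_L2H_pre hH.
have [K K0 HK] := edge_energy_le_Hrep.
pose b e := \int[mu]_(t in edge_int e) vnorm2 (Hrep x e t).
have b0 e : 0 <= b e by apply: Rintegral_ge0 => t _; exact: vnorm2_ge0.
have sb : rsummable b := Hrep_vnorm2_rsummable x.
(* The tail and the approximation errors contribute [eta] each, so the squared distance is at most
   [2 * K * eta = eps ^+ 2 / 2]. *)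
pose eta := eps ^+ 2 / (4 * K).
have eta0 : 0 < eta by rewrite divr_gt0 ?exprn_gt0 ?mulr_gt0.
have [X fX tX] := rsummable_tail b0 sb eta0.
have [c c0 wX] := small_weight fX eta0.
have D0 (e : edge G) : eitv (left_end e) (right_end e) !=set0 by exact: edge_int_neq0.
have /choice[z Hz] : forall e, exists z : (R -> 'cV[C]_d) * (R -> 'cV[C]_d) * R * R,
  [/\ vsqint (edge_int e) z.1.1.1, vsqint (edge_int e) z.1.1.2 & vprimitive (edge_int e) z.1.1.1 z.1.1.2] /\
    [/\ edge_int e z.1.2, edge_int e z.2, (forall x, x \notin `[z.1.2, z.2] -> z.1.1.1 x = 0) &
      \int[mu]_(t in edge_int e) vnorm2 (z.1.1.1 t - Hrep x e t) <= c].
  move=> e; have [F [f [s [t h]]]] := vl2_approx (D0 e) (Hrep_vsqint x e) c0.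
  by exists (F, f, s, t).
pose F e t : 'cV[C]_d := if e \in X then (z e).1.1.1 t else 0.
pose f e t : 'cV[C]_d := if e \in X then (z e).1.1.2 t else 0.
have zz (e : edge G) : [/\ vsqint (edge_int e) (fun=> 0 : 'cV[C]_d), vsqint (edge_int e) (fun=> 0 : 'cV[C]_d) &
    vprimitive (edge_int e) (fun=> 0 : 'cV[C]_d) (fun=> 0)].
  by have [[s1 _] _ p _ _] := lift0 d (D0 e) (lexx (0 : R)).
have S0 (u : edge G -> R -> 'cV[C]_d) : (forall e, e \notin X -> u e = fun=> 0) ->
    rsummable (fun e => \int[mu]_(t in edge_int e) vnorm2 (u e t)).
  move=> u0; have := @rsummable_finite R _ X (fun e => \int[mu]_(t in edge_int e) vnorm2 (u e t)) fX.
  congr rsummable; apply/funext => e; case: ifPn => // /u0 ->.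
  by under eq_Rintegral do rewrite vnorm2_0; rewrite Rintegral_cst ?mul0r//; exact: measurable_edge_int.
have [||||q Aq Hq] := @exists_port_ham_op R G d H hH P1 P0 inf_diam F f.
- move=> e; rewrite /F /f; case: (e \in X); [exact: (Hz e).1|exact: zz].
- move=> e; rewrite /F; case: (e \in X); last by have [y Dy] := D0 e; exists y, y.
  by have [_ [u v w _]] := Hz e; exists (z e).1.2, (z e).2; split.
- by apply: S0 => e /negPf ne; apply/funext => t; rewrite /F ne.
- by apply: S0 => e /negPf ne; apply/funext => t; rewrite /f ne.
exists q => //; rewrite hnorm_lt// re_ip_energy.
have le (e : edge G) : edge_energy H (rep (q.1 - x)) e <= K *
    ((if e \in X then c else 0) + (if e \in X then 0 else b e)).
  apply: (le_trans (HK _ _)); apply: ler_wpM2l; first exact: ltW.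
  have mD := measurable_edge_int e.
  have sF : vsqint (edge_int e) (F e) by rewrite /F; case: (e \in X); [case: (Hz e) => [[]]|case: (zz e)].
  have sN : vsqint (edge_int e) (fun t => F e t + (-1) *: Hrep x e t).
    by apply: vsqintD => //; apply: vsqintZ => //; exact: Hrep_vsqint.
  have -> : \int[mu]_(t in edge_int e) vnorm2 (Hrep (q.1 - x) e t) =
      \int[mu]_(t in edge_int e) vnorm2 (F e t + (-1) *: Hrep x e t).
    apply: eq_Rintegral_ae => //; [exact: mxmeasurable_vnorm2 (Hrep_measurable _ _)|exact: mxmeasurable_vnorm2 (vsqint_meas sN)|].
    have L := Hrep_lin (-1) x q.1 e; rewrite scaleN1r addrC in L.
    by apply: ae_imp2 L (Hq e).1 => t h1 h2 Dt; rewrite h1// h2// addrC.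
  rewrite /F; case: (e \in X).
    rewrite addr0; have [_ [_ _ _ h]] := Hz e; apply: le_trans h.
    by rewrite le_eqVlt; apply/orP; left; apply/eqP; apply: eq_Rintegral => t _; rewrite scaleN1r.
  rewrite add0r le_eqVlt; apply/orP; left; apply/eqP; apply: eq_Rintegral => t _.
  by rewrite add0r scaleN1r vnorm2N.
have p0 (e : edge G) : 0 <= (if e \in X then c else 0 : R) by case: ifP => // _; exact: ltW.
have q0 (e : edge G) : 0 <= (if e \in X then 0 else b e) by case: ifP.
have sp : rsummable (fun e => if e \in X then c else 0) by exact: (@rsummable_finite _ _ X (fun=> c)).
have sq : rsummable (fun e => if e \in X then 0 else b e).
  by apply: le_rsummable sb => e; case: ifP => _; rewrite ?normr0// ger0_norm.
apply: (@le_lt_trans _ _ (K * (eta + eta))).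
  apply: (le_trans (le_psum _ _ le)).
  - exact: edge_energy_ge0.
  - by apply: rsummableZ; exact: rsummableD.
  rewrite psumZ//; [|exact: ltW|by move=> e; exact: addr_ge0|exact: rsummableD].
  by rewrite psumD// ler_pM2l// lerD.
have -> : K * (eta + eta) = eps ^+ 2 / 2 by rewrite /eta; field; rewrite gt_eqF.
by rewrite ltr_pdivrMr// ltr_pMr ?exprn_gt0// ltr1n.
Qed.

End Density.

(** * The boundary system *)

Section AbstractForms.
Context {R : realType}.
Local Notation C := R[i].
Variables (U : lmodType C) (ip : U -> U -> C) (hip : pre_inner_product ip).

(** Two readings of a limit of Green's identity without boundary term: the relation that puts
    [(x, - y)] into the adjoint, and the vanishing of the left-hand side of Green's identity. *)
Lemma ip_skew_pair a b x y : ip a y = ip (- b) x -> ip b x = ip a (- y) /\ ip a y + ip b x = 0.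
Proof. by move=> E; rewrite (ipNr hip) E (ipNl hip) opprK addNr. Qed.

Lemma sesqui_Omega : sesqui (Omega_form ip).
Proof.
split=> c x y z; rewrite /Omega_form /=.
  by rewrite !(ip_antilin hip); ring.
by rewrite !(ip_lin hip); ring.
Qed.

(** Passing from the adjoint to the maximal operator negates both second components, which cancels
    the sign in [maximal_green]. *)
Lemma Omega_formN p q (z : C) : ip p.1 (- q.2) + ip (- p.2) q.1 = - z -> Omega_form ip p q = z.
Proof. by rewrite (ipNr hip) (ipNl hip) -opprD => /oppr_inj. Qed.

Lemma sesqui_omega (W : lmodType C) (ipW : W -> W -> C) : pre_inner_product ipW ->
  sesqui (omega_form ip ipW).
Proof.
move=> hipW.
split=> c x y z; rewrite /omega_form /=.
  by rewrite (ip_antilin hip) (ip_antilin hipW); ring.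
by rewrite (ip_lin hip) (ip_lin hipW); ring.
Qed.

End AbstractForms.

Section BoundarySystem.
Context {R : realType} {G : metric_graph R} {np nm : nat}.
Local Notation C := R[i].
Local Notation re := (@complex.Re R).
Local Notation im := (@complex.Im R).
Local Notation d := (np + nm)%N.
Variables (H : hamiltonian G d) (hH : uniformly_pos_bounded H) (P1 P0 S : 'M[C]_d).
Variables (lam : 'I_np -> {posnum R}) (theta : 'I_nm -> {posnum R}).
Hypothesis P1_herm : P1^t* = P1.
Hypothesis P1_unit : P1 \in unitmx.
Hypothesis P0_skew : P0^t* = - P0.
Hypothesis S_unitary : S \is unitarymx.
Hypothesis P1_diag : P1 = S^t* *m block_mx (posdiag lam) 0 0 (- posdiag theta) *m S.
Hypothesis inf_diam : (0 < ereal_inf [set diam (edge_int e) | e in [set: edge G]])%E.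
Local Notation X := (L2H hH).
Local Notation B := (G1 G lam theta * G2 G lam theta)%type.
Local Notation ipX := (@ip_L2H R G d H hH).
Local Notation ip1 := (ip_G1 G lam theta).
Local Notation ip2 := (ip_G2 G lam theta).
Local Notation maxop := (@maximal_op R G d H hH P1 P0).
Local Notation A := (@port_ham_op R G d H hH P1 P0).
Implicit Types (e : edge G) (p q : X * X) (g h : B).

Let hip : pre_inner_product ipX := ip_L2H_pre hH.

Lemma hilbert_G1 : hilbert ip1.
Proof. exact: hilbert_sum (hilbert_l2 _ _) (hilbert_l2 _ _). Qed.

Lemma hilbert_G2 : hilbert ip2.
Proof. exact: hilbert_sum (hilbert_l2 _ _) (hilbert_l2 _ _). Qed.

Let hip1 : pre_inner_product ip1 := inner_product_pre hilbert_G1.1.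
Let hip2 : pre_inner_product ip2 := inner_product_pre hilbert_G2.1.

Let green p q g h := @maximal_green R G np nm H hH P1 P0 S lam theta inf_diam P1_unit
  P0_skew P1_herm P1_diag p q g h.

(** A unitary [S] is invertible, so the values of [H x] at the finite ends vanish exactly when both
    blocks of the values of [S H x] do. *)
Lemma port_ham_opE p : A p <-> maxop p /\ boundary_values S p.1 (0 : B).
Proof.
have S0 : S *m 0 = 0 :> 'cV[C]_d by rewrite mulmx0.
split=> [[mp bl br]|[mp [bl br]]].
  split => //; split=> j; exists 0.
    split; [|by rewrite [RHS]linear0..].
    by rewrite -S0; apply: boundary_valueM; exact: bl (valP j).
  split; [|by rewrite [RHS]linear0..].
  by rewrite -S0; apply: boundary_valueM; exact: br (valP j).
have SV0 : S^t* *m 0 = 0 :> 'cV[C]_d by rewrite mulmx0.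
have SS : S^t* *m S = 1%:M by apply: mulmx1C; exact/unitarymxP.
have SK (u : R -> 'cV[C]_d) : u = fun t => S^t* *m (S *m u t).
  by apply/funext => t; rewrite mulmxA SS mul1mx.
have v0 (v : 'cV[C]_d) : 0 = usubmx v -> 0 = dsubmx v -> v = 0.
  by move=> u w; rewrite -[v]vsubmxK -u -w col_mx0.
split => // e el.
  have [v [bv u w]] := bl (exist _ e el).
  have vv : v = 0 by exact: v0.
  by rewrite vv in bv; rewrite (SK (Hrep p.1 e)) -SV0; apply: boundary_valueM; exact: bv.
have [v [bv u w]] := br (exist _ e el).
have vv : v = 0 by exact: v0.
by rewrite vv in bv; rewrite (SK (Hrep p.1 e)) -SV0; apply: boundary_valueM; exact: bv.
Qed.

(** From left to right, Green's identity against an element with zero boundary values has no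
    boundary term; the converse is [adjoint_maximal]. *)
Lemma maximal_op_adjoint p : maxop p <-> adjoint ipX A (p.1, - p.2).
Proof.
split=> [mp q /port_ham_opE[mq bq]|].
  have [h bh] := maximal_boundary_values S lam theta inf_diam P1_unit mp.
  have := green mq mp bq bh.
  rewrite /omega_form (ip0l hip1) (ip0l hip2) subrr oppr0 => /eqP.
  by rewrite /= (ipNr hip) addr_eq0 => /eqP ->; rewrite opprK.
by move=> /(adjoint_maximal inf_diam P0_skew P1_herm); rewrite /= opprK; case: p.
Qed.

Lemma adjoint_lin c p q : adjoint ipX A p -> adjoint ipX A q -> adjoint ipX A (c *: p + q).
Proof. by move=> ap aq r Ar; rewrite !(ip_lin hip) (ap r Ar) (aq r Ar). Qed.

(** Read off from the adjoint, where linearity is immediate; the distributional equation would bring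
    in representatives that are linear only almost everywhere. *)
Lemma maximal_op_lin c p q : maxop p -> maxop q -> maxop (c *: p + q).
Proof.
move=> /maximal_op_adjoint ap /maximal_op_adjoint aq; apply/maximal_op_adjoint.
by have := adjoint_lin c ap aq; congr (adjoint ipX A (_, _)); rewrite /= opprD scalerN.
Qed.

(** This is what makes the operator single-valued. The continuous representative of [H 0] vanishes
    identically, so its derivative has zero integral over every subinterval and vanishes almost
    everywhere. *)
Lemma maximal_op_single (w : X) : maxop (0, w) -> w = 0.
Proof.
move=> /(exists_regular_rep inf_diam P1_unit)[F [f [vl [vr rp]]]].
apply: L2H_eq => e; have [h1 h2 h3 _ _] := rp e.
have pF : vprimitive (edge_int e) (F e) (f e) by move=> k; case: (h1 k).
have F0 t : edge_int e t -> F e t = 0.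
  apply: (@continuous_ae_eq_cV R d (edge_int e) (F e) (fun=> 0)).
  - exact: open_edge_int.
  - by move=> u Du; exact: (vprimitive_continuous pF Du).
  - by move=> u Du k; split; exact: cvg_cst.
  - by apply: ae_imp2 h2 (rep0 hH e) => u a b Du; rewrite -a// /Hrep b// mulmx0.
have z (u v : R -> R) : primitive (edge_int e) u v -> (forall t, edge_int e t -> u t = 0) ->
    {ae mu, forall t, edge_int e t -> v t = 0}.
  move=> puv u0; apply: ae_eq0_of_Rintegral => s t Ds Dt st.
  by have [i <-] := puv s t Ds Dt st; rewrite !u0// subrr.
have fk k : {ae mu, forall t, edge_int e t -> f e t k 0 = 0}.
  have [p1 p2] := pF k.
  have Fk t : edge_int e t -> F e t k 0 = 0 by move=> /F0 ->; rewrite mxE.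
  have a1 := z _ _ p1 (fun t Dt => congr1 re (Fk t Dt)).
  have a2 := z _ _ p2 (fun t Dt => congr1 im (Fk t Dt)).
  apply: ae_imp2 a1 a2 => t b1 b2 Dt.
  by apply: complex_ext; [rewrite -[LHS]/((re \o (fun t => f e t k 0)) t) b1|
    rewrite -[LHS]/((im \o (fun t => f e t k 0)) t) b2].
have fE := filter_forall (ae_filter_ringOfSetsType mu) fk.
apply: ae_imp2 fE (ae_imp2 (fun t a b => conj a b) (rep0 hH e) (rep0 hH e)) => t f0 [r0 _] Dt.
rewrite r0// h3 /Hrep r0// !mulmx0 addr0 (_ : f e t = 0) ?mulmx0//.
by apply/matrixP => k j; rewrite ord1 mxE f0.
Qed.

Lemma boundary_values0 : boundary_values S (0 : X) (0 : B).
Proof.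
have m0 : maxop 0.
  by apply/maximal_op_adjoint => q _; rewrite /= oppr0 !(ip0r hip).
have [g bg] := maximal_boundary_values S lam theta inf_diam P1_unit m0.
(* Whatever [g] is, combining it linearly with itself yields boundary values 0 for the element 0. *)
by have := boundary_values_lin (-1) bg bg; rewrite !scaleN1r !addNr.
Qed.

Lemma port_ham_op_linear : linear_operator A.
Proof.
have lin c p q : A p -> A q -> A (c *: p + q).
  move=> /port_ham_opE[mp bp] /port_ham_opE[mq bq]; apply/port_ham_opE.
  split; first exact: maximal_op_lin.
  by have := boundary_values_lin c bp bq; rewrite scaler0 addr0.
split => //.
  apply/port_ham_opE; split; last exact: boundary_values0.
  by apply/maximal_op_adjoint => q _; rewrite /= oppr0 !(ip0r hip).
move=> x y z Axy Axz; have /port_ham_opE[+ _] := lin (-1) _ _ Axz Axy.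
rewrite (_ : _ + _ = (0, y - z)); last first.
  by congr (_, _); rewrite /= scaleN1r ?addNr// addrC.
by move=> /maximal_op_single/eqP; rewrite subr_eq0 => /eqP.
Qed.

(* By Green's identity the boundary values [g] of a limit of elements of [A] are
   annihilated by those of every [q] in the maximal operator; taking [q] with
   boundary values [(g.1, - g.2)] gives [ip1 g.1 g.1 + ip2 g.2 g.2 = 0]. *)
Lemma port_ham_op_closed : closed_operator ipX A.
Proof.
move=> u v x y Auv cu cv.
(* Along the sequence Green's identity with [q] has no boundary term, and [q] being fixed, its
   scalar products pass to the limit. *)
have E q : maxop q -> ipX q.1 y = ipX (- q.2) x.
  move=> mq; apply: (hcvg_ip_eq hip _ cv cu) => n.
  have [h bh] := maximal_boundary_values S lam theta inf_diam P1_unit mq.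
  have /port_ham_opE[mn bn] := Auv n.
  have := green mq mn bh bn.
  rewrite /omega_form (ip0r hip1) (ip0r hip2) subrr oppr0 => /eqP.
  by rewrite (ipNl hip) addr_eq0 => /eqP.
have mxy : maxop (x, y).
  apply/maximal_op_adjoint => p /port_ham_opE[/E e _].
  exact: (@ip_skew_pair R X ipX hip p.1 p.2 x y e).1.
apply/port_ham_opE; split => //.
have [g bg] := maximal_boundary_values S lam theta inf_diam P1_unit mxy.
have [q mq bq] := boundary_values_surj hH P1 P0 inf_diam S_unitary (g.1, - g.2).
have g0 : omega_form ip1 ip2 (g.1, - g.2) g = 0.
  apply/eqP; rewrite -oppr_eq0 -(green mq mxy bq bg); apply/eqP.
  exact: (@ip_skew_pair R X ipX hip q.1 q.2 x y (E q mq)).2.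
rewrite /omega_form /= (ipNl hip2) opprK in g0.
have [[_ _ pos1] _] := hilbert_G1; have [[_ _ pos2] _] := hilbert_G2.
have [[_ _ nn1] [_ _ nn2]] := (hip1, hip2).
move/eqP: g0; rewrite paddr_eq0// => /andP[/eqP z1 /eqP z2].
have g1 : g.1 = 0 by apply/eqP; apply: contraT => /pos1; rewrite z1 ltxx.
have g2 : g.2 = 0 by apply/eqP; apply: contraT => /pos2; rewrite z2 ltxx.
by have -> : 0 = g by rewrite [RHS]surjective_pairing g1 g2.
Qed.

Lemma port_ham_op_skew : skew_symmetric ipX A.
Proof. by move=> x y /port_ham_opE[/maximal_op_adjoint]. Qed.

End BoundarySystem.

(** Well-definedness of the boundary map is expressed by existence and uniqueness of the boundary
    values in the first conjunct; [F] is then any map that selects them on the graph of the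
    adjoint. *)
Theorem lemma6p6 (R : realType) (G : metric_graph R) (np nm : nat)
    (H : hamiltonian G (np + nm)) (P1 P0 S : 'M[R[i]]_(np + nm))
    (lam : 'I_np -> {posnum R}) (theta : 'I_nm -> {posnum R})
    (P1_herm : P1^t* = P1) (P1_unit : P1 \in unitmx) (P0_skew : P0^t* = - P0)
    (S_unitary : S \is unitarymx)
    (P1_diag : P1 =
      S^t* *m block_mx (posdiag lam) 0 0 (- posdiag theta) *m S)
    (inf_diam : (0 < ereal_inf [set diam (edge_int e) | e in [set: edge G]])%E)
    (H_unif : uniformly_pos_bounded H) :
  let ipX := @ip_L2H R G (np + nm) H H_unif in
  let A := @port_ham_op R G (np + nm) H H_unif P1 P0 in
  let ip1 := ip_G1 G lam theta in
  let ip2 := ip_G2 G lam theta in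
  (forall p, adjoint ipX A p ->
    exists! g : G1 G lam theta * G2 G lam theta, boundary_values S p.1 g) /\
  (forall F : L2H H_unif * L2H H_unif -> G1 G lam theta * G2 G lam theta,
    (forall p, adjoint ipX A p -> boundary_values S p.1 (F p)) ->
    boundary_system ipX A (Omega_form ipX) ip1 ip2 F (omega_form ip1 ip2)).
Proof.
move=> ipX A ip1 ip2.
have adj p : adjoint ipX A p -> maximal_op P1 P0 (p.1, - p.2).
  exact: (adjoint_maximal inf_diam P0_skew P1_herm).
have uniq := @boundary_values_unique R G np nm H H_unif S lam theta inf_diam.
split=> [p Ap|F HF].
  have [g bg] := maximal_boundary_values S lam theta inf_diam P1_unit (adj p Ap).
  by exists g; split => // h; exact: uniq bg.
split; [|split].
- split.
  + exact: (port_ham_op_linear H_unif P1_herm P1_unit P0_skew S_unitary P1_diag inf_diam).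
  + exact: (port_ham_op_dense P1 P0 inf_diam).
  + move=> u v x y; exact: (port_ham_op_closed P1_herm P1_unit P0_skew S_unitary P1_diag inf_diam).
  + move=> x y; exact: (port_ham_op_skew P1_herm P1_unit P0_skew S_unitary P1_diag inf_diam).
- have hil1 : hilbert ip1 by exact: hilbert_G1.
  have hil2 : hilbert ip2 by exact: hilbert_G2.
  split; [exact: hil1|exact: hil2|exact: sesqui_Omega (ip_L2H_pre H_unif)|].
  exact: (sesqui_omega (inner_product_pre hil1.1) (inner_product_pre hil2.1)).
split.
- move=> c p q Ap Aq; apply: (uniq (c *: p + q).1).
    by apply: HF; exact: (adjoint_lin c Ap Aq).
  exact: boundary_values_lin (HF p Ap) (HF q Aq).
- move=> g _; have [q mq bq] := boundary_values_surj H_unif P1 P0 inf_diam S_unitary g.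
  have Aq : adjoint ipX A (q.1, - q.2) by exact: (maximal_op_adjoint P1_herm P1_unit P0_skew S_unitary P1_diag inf_diam q).1.
  (* The boundary values depend on the first component alone, so negating the second one moves [q]
     into the adjoint without changing them. *)
  exists (q.1, - q.2) => //; exact: uniq (HF _ Aq) bq.
- move=> p q Ap Aq.
  have := maximal_green inf_diam P1_unit P0_skew P1_herm P1_diag (adj p Ap) (adj q Aq)
    (HF p Ap) (HF q Aq).
  exact: (@Omega_formN R (L2H H_unif) ipX (ip_L2H_pre H_unif) p q (omega_form ip1 ip2 (F p) (F q))).
Qed.
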